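(* Let $\Delta(t) \in \mathbf{Z}[t]$ be a nonzero polynomial that has a nonconstant factor, irreducible in $\mathbf{Q}[t]$, which is neither a constant multiple of a cyclotomic polynomial nor a monomial. There are only finitely many natural numbers $n$ for which there is a freely $n$-periodic knot with Alexander polynomial equal to $\Delta(t)$.
   Context: A knot $K \subset S^3$ is freely $n$-periodic if there is an orientation-preserving diffeomorphism $\phi: S^3 \to S^3$ of order $n$ generating a free action of $\mathbf{Z}/n\mathbf{Z}$ on $S^3$ (no power $\phi^k \neq \mathrm{id}$ has a fixed point), with $\phi(K)=K$ and $\phi$ preserving the orientation of $K$. The Alexander polynomial is understood up to units $\pm t^a$ of $\mathbf{Z}[t,t^{-1}]$. *)

(* Defs.v *)
From HB Require Import structures.
From mathcomp Require Import all_boot all_order all_algebra all_field.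
From mathcomp Require Import all_classical all_reals all_analysis.

Set Implicit Arguments.
Unset Strict Implicit.
Unset Printing Implicit Defensive.

Import Order.TTheory GRing.Theory Num.Theory.
Import numFieldNormedType.Exports.

Local Open Scope classical_set_scope.
Local Open Scope ring_scope.

(* C^oo on an open set U: all iterated directional derivatives exist and are
   Frechet differentiable (hence continuous) at every point of U. *)
Fixpoint ndifferentiable_on (R : realType) (V W : normedModType R) (k : nat)
    (U : set V) (f : V -> W) : Prop :=
  (forall x, U x -> differentiable f x) /\
  if k is k'.+1 then
    forall v : V, ndifferentiable_on k' U (fun x => 'D_v f x)
  else True.

Definition smooth_on (R : realType) (V W : normedModType R)
    (U : set V) (f : V -> W) : Prop :=
  forall k : nat, ndifferentiable_on k U f.

(* The norm `|x| of 'rV[R]_4 is the sup norm; the round sphere needs the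
   Euclidean one. *)
Definition enorm (R : realType) (x : 'rV[R]_4) : R :=
  Num.sqrt (\sum_(i < 4) x ord0 i ^+ 2).

Definition S3 (R : realType) : set 'rV[R]_4 := [set x | enorm x = 1].

Arguments S3 R : clear implicits.

(* Self-maps of S^3 are represented by total maps of R^4 of which only the
   restriction to S^3 matters.  The degree-1 homogeneous extension of f to
   R^4 \ {0} is a product of the smooth positive function |x| with f composed
   with the retraction x |-> x/|x|, a submersion; hence it is smooth if and only
   if f is smooth as a map of manifolds.  At x in S^3 its differential sends x to
   f x and restricts to the differential T_x S^3 -> T_(f x) S^3 of f, so its
   Jacobian determinant has the sign of the latter for the boundary
   orientation. *)
Definition radial_ext (R : realType) (f : 'rV[R]_4 -> 'rV[R]_4) :
    'rV[R]_4 -> 'rV[R]_4 :=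
  fun x => enorm x *: f ((enorm x)^-1 *: x).

Definition smooth_S3_map (R : realType) (f : 'rV[R]_4 -> 'rV[R]_4) : Prop :=
  (forall x, S3 R x -> S3 R (f x)) /\
  smooth_on [set x | x != 0] (radial_ext f).

Definition S3_diffeo (R : realType) (f : 'rV[R]_4 -> 'rV[R]_4) : Prop :=
  smooth_S3_map f /\
  exists g : 'rV[R]_4 -> 'rV[R]_4,
    [/\ smooth_S3_map g,
        forall x, S3 R x -> g (f x) = x
      & forall x, S3 R x -> f (g x) = x].

Definition orientation_preserving (R : realType)
    (f : 'rV[R]_4 -> 'rV[R]_4) : Prop :=
  forall x, S3 R x -> 0 < \det (jacobian (radial_ext f) x).

Definition S3_order (R : realType) (f : 'rV[R]_4 -> 'rV[R]_4) (n : nat) : Prop :=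
  [/\ (0 < n)%N,
      forall x, S3 R x -> iter n f x = x
    & forall k, (0 < k < n)%N -> exists2 x, S3 R x & iter k f x <> x].

Definition free_on_S3 (R : realType) (f : 'rV[R]_4 -> 'rV[R]_4) : Prop :=
  forall k : nat, (exists2 x, S3 R x & iter k f x <> x) ->
    forall x, S3 R x -> iter k f x <> x.

(* A knot is given by a regular parametrization of period 1; the knot as a
   subset of S^3 is [range c]. *)
Definition knot (R : realType) (c : R -> 'rV[R]_4) : Prop :=
  [/\ smooth_on (setT : set R) c,
      forall s, S3 R (c s),
      forall s, derive1 c s != 0
    & forall s t, c s = c t <-> exists z : int, s - t = z%:~R].

Definition freely_periodic (R : realType) (n : nat) (c : R -> 'rV[R]_4) : Prop :=
  exists f : 'rV[R]_4 -> 'rV[R]_4,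
    [/\ S3_diffeo f /\ orientation_preserving f,
        S3_order f n,
        free_on_S3 f,
        f @` range c = range c
      & forall s u, f (c s) = c u ->
          exists2 a : R, 0 < a & 'd (radial_ext f) (c s) (derive1 c s) = a *: derive1 c u].

(* Loops are total maps of which only the restriction to [0, 1] matters. *)
Definition loop (R : realType) (X : set 'rV[R]_4) (x0 : 'rV[R]_4)
    (p : R -> 'rV[R]_4) : Prop :=
  [/\ {within `[0, 1], continuous p},
      forall s : R, s \in `[0, 1] -> X (p s),
      p 0 = x0
    & p 1 = x0].

Definition loop_homotopic (R : realType) (X : set 'rV[R]_4) (x0 : 'rV[R]_4)
    (p q : R -> 'rV[R]_4) : Prop :=
  exists H : R * R -> 'rV[R]_4,
    [/\ {within `[0, 1] `*` `[0, 1], continuous H},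
        forall u : R, u \in `[0, 1] -> loop X x0 (fun s => H (u, s)),
        forall s : R, s \in `[0, 1] -> H (0, s) = p s
      & forall s : R, s \in `[0, 1] -> H (1, s) = q s].

Definition loop_cat (R : realType) (p q : R -> 'rV[R]_4) : R -> 'rV[R]_4 :=
  fun s => if s <= 2^-1 then p (2 * s) else q (2 * s - 1).

Definition loop_rev (R : realType) (p : R -> 'rV[R]_4) : R -> 'rV[R]_4 :=
  fun s => p (1 - s).

(* Words in the free group on x_0, ..., x_(n-1): the letter (i, true) is x_i and
   (i, false) is x_i^-1. *)
Definition word (n : nat) := seq ('I_n * bool).

Inductive pres_eq (n m : nat) (r : 'I_m -> word n) : word n -> word n -> Prop :=
| pres_refl w : pres_eq r w w
| pres_sym v w : pres_eq r v w -> pres_eq r w v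
| pres_trans u v w : pres_eq r u v -> pres_eq r v w -> pres_eq r u w
| pres_cancel u v (i : 'I_n) (b : bool) :
    pres_eq r (u ++ [:: (i, b); (i, ~~ b)] ++ v) (u ++ v)
| pres_rel u v (j : 'I_m) : pres_eq r (u ++ r j ++ v) (u ++ v).

Definition word_loop (R : realType) (n : nat) (x0 : 'rV[R]_4)
    (g : 'I_n -> R -> 'rV[R]_4) (w : word n) : R -> 'rV[R]_4 :=
  foldr (fun (l : 'I_n * bool) p =>
           loop_cat (if l.2 then g l.1 else loop_rev (g l.1)) p)
        (fun=> x0) w.

Definition pi1_presentation (R : realType) (X : set 'rV[R]_4) (x0 : 'rV[R]_4)
    (n m : nat) (g : 'I_n -> R -> 'rV[R]_4) (r : 'I_m -> word n) : Prop :=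
  [/\ forall i, loop X x0 (g i),
      forall p, loop X x0 p ->
        exists w : word n, loop_homotopic X x0 p (word_loop x0 g w)
    & forall v w : word n,
        loop_homotopic X x0 (word_loop x0 g v) (word_loop x0 g w) <->
        pres_eq r v w].

Definition word_degree (n : nat) (a : 'I_n -> int) (w : word n) : int :=
  \sum_(l <- w) (if l.2 then a l.1 else - a l.1).

(* The Laurent ring Z[t, t^-1], inside the fraction field of Z[t]. *)
Definition tvar : {fraction {poly int}} := FracField.tofrac ('X : {poly int}).

Definition laurent (x : {fraction {poly int}}) : Prop :=
  exists (p : {poly int}) (k : nat), x = FracField.tofrac p / tvar ^+ k.

Definition laurent_dvd (x y : {fraction {poly int}}) : Prop :=
  exists2 z, laurent z & y = z * x.

(* This determines d up to the units +- t^a of Z[t, t^-1]. *)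
Definition laurent_gcd (A : set {fraction {poly int}}) (d : {fraction {poly int}}) :
    Prop :=
  [/\ laurent d,
      forall x, A x -> laurent_dvd d x
    & forall e, laurent e -> (forall x, A x -> laurent_dvd e x) ->
        laurent_dvd e d].

(* Image of the Fox derivative d w / d x_j under x_i |-> t^(a i). *)
Fixpoint fox (n : nat) (a : 'I_n -> int) (j : 'I_n) (w : word n) :
    {fraction {poly int}} :=
  match w with
  | [::] => 0
  | (i, true) :: v => (i == j)%:R + tvar ^ a i * fox a j v
  | (i, false) :: v => tvar ^ (- a i) * (fox a j v - (i == j)%:R)
  end.

Definition alexander_matrix (n m : nat) (a : 'I_n -> int) (r : 'I_m -> word n) :
    'M[{fraction {poly int}}]_(m, n) :=
  \matrix_(i, j) fox a j (r i).

(* Fox's definition: the generator, up to units, of the smallest principal ideal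
   containing the first elementary ideal, i.e. the gcd of the minors of order
   (number of generators - 1) of the Alexander matrix of a finite presentation of
   the knot group.  The map [a] must induce a surjection of the knot group onto
   Z; since H_1 of the complement is infinite cyclic, this is the abelianization,
   unique up to sign.  Selections of rows or columns with repetitions only
   contribute zero minors. *)
Definition alexander_polynomial (R : realType) (c : R -> 'rV[R]_4)
    (D : {poly int}) : Prop :=
  exists (x0 : 'rV[R]_4) (n m : nat) (g : 'I_n.+1 -> R -> 'rV[R]_4)
         (r : 'I_m -> word n.+1) (a : 'I_n.+1 -> int),
    [/\ (S3 R `\` range c) x0,
        pi1_presentation (S3 R `\` range c) x0 g r,
        forall j, word_degree a (r j) = 0,
        exists w, word_degree a w = 1
      & laurent_gcd
          [set x | exists (h : 'I_n -> 'I_m) (k : 'I_n -> 'I_n.+1),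
                     x = \det (mxsub h k (alexander_matrix a r))]
          (FracField.tofrac D)].

(* Main.v *)
Require Import Defs.
From HB Require Import structures.
From mathcomp Require Import all_boot all_order all_algebra all_field.
From mathcomp Require Import all_classical all_reals all_analysis.
From mathcomp Require Import ring lra zify.
Import Order.TTheory GRing.Theory Num.Theory.
Import numFieldNormedType.Exports.
Local Open Scope classical_set_scope.
Local Open Scope ring_scope.

(* Let X be the complement of the knot and let phi be the square of the periodic
   map, of order N with n <= 2N.  The quotient of S^3 is never formed: all
   cohomology is Alexander-Spanier cohomology on X, on K and on S^3, and only the
   continuity of the maps is used.

   Duality for K shows that X is connected and that classes in H^1(X; Q) are
   proportional, so the periodic map sends the degree cocycle a to +-a and phi
   preserves it: a(phi x, phi y) = a(x, y) + e(y) - e(x).  The sum of e over an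
   orbit of phi is a constant k.  If a prime p divided both k and N, a power of
   phi of order p would preserve a cocycle modulo p of degree 1 on some loop;
   Smith theory for the free action on S^3 excludes this.  So k and N are coprime.

   Let q be the given factor and lam a root of q.  The cocycles on X twisted by
   lam^a, modulo coboundaries, are cut out by the Fox matrix at t = lam; since a
   matrix of corank h modulo q has minors divisible by q^h, they form a space of
   dimension between 1 and deg D over Q.  It carries T f = lam^e (f o phi), with
   T^N = lam^k; Bezout coefficients turn T into tau with tau^N = lam.  Hence
   q(X^N) has a nonconstant factor of degree at most deg D.

   Such factors have bounded roots and a leading coefficient dividing that of an
   integral multiple of q, so there are finitely many of them; a root nu of one of
   them satisfies q(nu^N) = 0 for finitely many N only, as no root of q is 0 or a
   root of unity. *)

Set Implicit Arguments.
Unset Strict Implicit.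
Unset Printing Implicit Defensive.

(** * Cochains on lists *)

(** Alexander-Spanier cochains are arbitrary functions on lists of nearby points, so they can be
    composed with discontinuous maps: a near-point map onto the knot, a choice of phase in each
    orbit. Tautness, transfer and the equivariant constructions rest on this freedom and need
    neither triangulations nor tubular neighbourhoods. The price is that identities hold only below
    some scale; on the complement no scale is uniform up to the knot, hence the conditions [farK]
    and [nearK].

    The knot group is given by loops while duality concerns cocycles. Holonomy along paths
    translates between them: a homomorphism on words becomes a local cocycle on X, and back. It is
    set up for an arbitrary group because twisted cocycles take values in the affine group of a
    field.

    Coprimality is decisive: T and the powers of lam produce an N-th root of lam to the power gcd(k,
    N), and only gcd 1 reaches lam itself. The factor of q(X^N) is then its common divisor with a
    rational polynomial in tau that annihilates a nontrivial class, of degree bounded by the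
    dimension of the space of classes. *)

Section ListCochains.
Variable F : fieldType.

(* A k-cochain is a function on lists of length k + 1, and dl its coboundary. *)
Fixpoint dl (T : Type) (f : seq T -> F) (s : seq T) : F :=
  if s is x :: s' then f s' - dl (fun t => f (x :: t)) s' else 0.

Lemma dlD (T : Type) (f g : seq T -> F) s :
  dl (fun t => f t + g t) s = dl f s + dl g s.
Proof.
elim: s f g => [|x s IH] f g /=; first by rewrite addr0.
by rewrite IH opprD addrACA.
Qed.

Lemma dlZ (T : Type) (a : F) (f : seq T -> F) s :
  dl (fun t => a * f t) s = a * dl f s.
Proof. by elim: s f => [|x s IH] f /=; rewrite ?mulr0 // IH mulrBr. Qed.

Lemma dlN (T : Type) (f : seq T -> F) s : dl (fun t => - f t) s = - dl f s.
Proof. by elim: s f => [|x s IH] f /=; rewrite ?oppr0 // IH opprB opprK addrC. Qed.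

Lemma dlB (T : Type) (f g : seq T -> F) s :
  dl (fun t => f t - g t) s = dl f s - dl g s.
Proof. by rewrite dlD dlN. Qed.

Lemma dl0 (T : Type) (s : seq T) : dl (fun=> 0) s = 0.
Proof. by elim: s => [//|x s IH] /=; rewrite IH subr0. Qed.

Lemma dl_sum (T I : Type) (r : seq I) (P : pred I) (f : I -> seq T -> F) s :
  dl (fun t => \sum_(i <- r | P i) f i t) s = \sum_(i <- r | P i) dl (f i) s.
Proof.
elim: r => [|i r IH].
  rewrite big_nil (_ : (fun _ => _) = fun=> 0) ?dl0 //.
  by apply/funext => t; rewrite big_nil.
rewrite big_cons -IH; case: (boolP (P i)) => Pi.
  by rewrite -dlD; congr (dl _ s); apply/funext => t; rewrite big_cons Pi.
by congr (dl _ s); apply/funext => t; rewrite big_cons (negbTE Pi).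
Qed.

Lemma dl_dl (T : Type) (f : seq T -> F) s : dl (dl f) s = 0.
Proof.
elim: s f => [//|x s IH] f /=.
by rewrite dlB IH subr0 subrr.
Qed.

Lemma dl_map (T U : Type) (r : T -> U) (f : seq U -> F) s :
  dl (fun t => f (map r t)) s = dl f (map r s).
Proof. by elim: s f => [//|x s IH] f /=; rewrite (IH (fun t => f (r x :: t))). Qed.

Lemma dl_ext (T : eqType) (f g : seq T -> F) s :
  (forall t, {subset t <= s} -> size t = (size s).-1 -> f t = g t) ->
  dl f s = dl g s.
Proof.
elim: s f g => [//|x s IH] f g H /=.
rewrite H; [|by move=> y ys; rewrite inE ys orbT|by []].
congr (_ - _); case: s IH H => [//|y s] IH H; apply: IH => t ts tsz.
apply: H; last by rewrite /= tsz.
by move=> z; rewrite in_cons => /orP[/eqP->|/ts zs]; rewrite in_cons ?eqxx ?zs ?orbT.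
Qed.

Lemma dl_eq0 (T : eqType) (f : seq T -> F) s :
  (forall t, {subset t <= s} -> size t = (size s).-1 -> f t = 0) -> dl f s = 0.
Proof. by move=> H; rewrite (dl_ext H) dl0. Qed.

(** The contracting homotopy of a cone: where [f] is a cocycle on [x :: s], the last term vanishes
    and [f (x :: _)] is a primitive of [f]. *)
Lemma dl_cone (T : Type) (f : seq T -> F) x s :
  dl (fun t => f (x :: t)) s = f s - dl f (x :: s).
Proof. by rewrite /= opprB addrC subrK. Qed.

(** The prism operator of two vertex maps: [f] summed with alternating signs over the lists r x_0,
    ..., r x_i, r' x_i, ..., r' x_n. The maps need not be continuous; only the diameter of these
    lists will matter. *)
Fixpoint prism (T U : Type) (r r' : T -> U) (f : seq U -> F) (s : seq T) : F :=
  if s is x :: s' then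
    f (r x :: r' x :: map r' s') - prism r r' (fun t => f (r x :: t)) s'
  else 0.

Lemma prismD (T U : Type) (r r' : T -> U) (f g : seq U -> F) s :
  prism r r' (fun t => f t + g t) s = prism r r' f s + prism r r' g s.
Proof.
elim: s f g => [|x s IH] f g /=; first by rewrite addr0.
by rewrite IH opprD addrACA.
Qed.

Lemma prismZ (T U : Type) (r r' : T -> U) a (f : seq U -> F) s :
  prism r r' (fun t => a * f t) s = a * prism r r' f s.
Proof. by elim: s f => [|x s IH] f /=; rewrite ?mulr0 // IH mulrBr. Qed.

Lemma prismN (T U : Type) (r r' : T -> U) (f : seq U -> F) s :
  prism r r' (fun t => - f t) s = - prism r r' f s.
Proof. by elim: s f => [|x s IH] f /=; rewrite ?oppr0 // IH opprB opprK addrC. Qed.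

Lemma prism_homotopy (T U : Type) (r r' : T -> U) (f : seq U -> F) s :
  dl (prism r r' f) s + prism r r' (dl f) s = f (map r' s) - f (map r s).
Proof.
elim: s f => [|x s IH] f /=; first by rewrite subrr addr0.
rewrite dlB (dl_map r' (fun t => f (r x :: r' x :: t))).
rewrite [prism _ _ (fun t => _ - _) s]prismD prismN.
have /= := IH (fun t => f (r x :: t)).
set a := dl (prism _ _ _) s; set b := prism _ _ (dl _) s => E.
transitivity (a + b + (f (r' x :: map r' s) - f (r x :: map r' s))); first ring.
by rewrite E; ring.
Qed.

(** The last condition on [t] records that every vertex of [s] survives in each term through one of
    its two images. Support arguments use it: a vertex with both images outside a support kills the
    whole prism. *)
Lemma prism_ext (T U : eqType) (r r' : T -> U) (f g : seq U -> F) s :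
  (forall t, {subset t <= map r s ++ map r' s} -> size t = (size s).+1 ->
    (forall x, x \in s -> r x \in t \/ r' x \in t) -> f t = g t) ->
  prism r r' f s = prism r r' g s.
Proof.
elim: s f g => [//|x s IH] f g H /=; congr (_ - _).
  apply: H => [t|/=|y].
  - rewrite /= !in_cons mem_cat in_cons => /or3P[->//|->|->]; rewrite ?orbT //.
  - by rewrite size_map.
  - rewrite in_cons => /orP[/eqP->|ys]; first by left; rewrite mem_head.
    by right; rewrite !in_cons map_f ?orbT.
apply: IH => t ts tsz tc; apply: H => [y|/=|y].
- rewrite in_cons => /orP[/eqP->|/ts]; first by rewrite /= mem_head.
  by rewrite /= in_cons !mem_cat in_cons => /orP[->|->]; rewrite ?orbT.
- by rewrite tsz.
- rewrite in_cons => /orP[/eqP->|/tc[h|h]]; first by left; rewrite mem_head.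
    by left; rewrite in_cons h orbT.
  by right; rewrite in_cons h orbT.
Qed.

Lemma prism0 (T U : Type) (r r' : T -> U) s : prism r r' (fun=> 0) s = 0.
Proof. by elim: s => [//|x s IH] /=; rewrite IH subr0. Qed.

Lemma prism_eq0 (T U : eqType) (r r' : T -> U) (f : seq U -> F) s :
  (forall t, {subset t <= map r s ++ map r' s} -> size t = (size s).+1 ->
    (forall x, x \in s -> r x \in t \/ r' x \in t) -> f t = 0) ->
  prism r r' f s = 0.
Proof. by move=> H; rewrite (prism_ext H) prism0. Qed.

(** A long homotopy cut into [M] steps, each of which moves points by less than the scale at which
    [f] is a cocycle. *)
Definition psum (T U : Type) (r : nat -> T -> U) (M : nat) (f : seq U -> F) s : F :=
  \sum_(j < M) prism (r j) (r j.+1) f s.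

Lemma psum_nil (T U : Type) (r : nat -> T -> U) M (f : seq U -> F) :
  psum r M f [::] = 0.
Proof. by rewrite /psum big1. Qed.

Lemma psumD (T U : Type) (r : nat -> T -> U) M (f g : seq U -> F) s :
  psum r M (fun t => f t + g t) s = psum r M f s + psum r M g s.
Proof. by rewrite /psum -big_split; apply: eq_bigr => j _; rewrite prismD. Qed.

Lemma psumZ (T U : Type) (r : nat -> T -> U) M a (f : seq U -> F) s :
  psum r M (fun t => a * f t) s = a * psum r M f s.
Proof. by rewrite /psum mulr_sumr; apply: eq_bigr => j _; rewrite prismZ. Qed.

Lemma psum_homotopy (T U : Type) (r : nat -> T -> U) M (f : seq U -> F) s :
  dl (psum r M f) s + psum r M (dl f) s = f (map (r M) s) - f (map (r 0%N) s).
Proof.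
rewrite /psum dl_sum -big_split /=.
under eq_bigr do rewrite prism_homotopy.
by rewrite -(big_mkord xpredT (fun j => f (map (r j.+1) s) - f (map (r j) s)))
  telescope_sumr.
Qed.

Lemma psum_eq0 (T U : eqType) (r : nat -> T -> U) M (f : seq U -> F) s :
  (forall j t, (j < M)%N -> {subset t <= map (r j) s ++ map (r j.+1) s} ->
    size t = (size s).+1 ->
    (forall x, x \in s -> r j x \in t \/ r j.+1 x \in t) -> f t = 0) ->
  psum r M f s = 0.
Proof. by move=> H; rewrite /psum big1 // => j _; apply: prism_eq0 => t; apply: H. Qed.

Definition cup0 (T : Type) (A : T -> F) (f : seq T -> F) (s : seq T) : F :=
  if s is x :: _ then A x * f s else 0.

Definition cup1 (T : Type) (a : T -> T -> F) (f : seq T -> F) (s : seq T) : F :=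
  if s is x :: (y :: _) as t then a x y * f t else 0.

Lemma dl_cup0 (T : Type) (A : T -> F) f x y (s : seq T) :
  dl (cup0 A f) (x :: y :: s) =
  (A y - A x) * f (y :: s) + A x * dl f (x :: y :: s).
Proof. by rewrite [LHS]/= [dl f (_ :: _)]/= !dlZ; ring. Qed.

(** The Leibniz rule. The coboundary of [a] stays written out because it will vanish only on part of
    the lists. *)
Lemma dl_cup1 (T : Type) (a : T -> T -> F) f x y z (s : seq T) :
  dl (cup1 a f) (x :: y :: z :: s) =
  (a x y + a y z - a x z) * f (z :: s) - a x y * dl f (y :: z :: s).
Proof.
rewrite -[LHS]/(cup1 a f (y :: z :: s) -
                dl (fun t => cup1 a f (x :: t)) (y :: z :: s)).
rewrite (_ : (fun t => _) = cup0 (a x) f); last by apply/funext => -[].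
by rewrite dl_cup0 /=; ring.
Qed.

End ListCochains.

(** * Compactly supported cohomology of three-space *)

Section Smallness.
Variables (F : fieldType) (R : realType).

Definition small (T : eqType) (d : T -> T -> R) (e : R) (s : seq T) : Prop :=
  {in s &, forall x y, d x y < e}.

Lemma small_sub (T : eqType) (d : T -> T -> R) e s t :
  {subset t <= s} -> small d e s -> small d e t.
Proof. by move=> ts H x y /ts xs /ts ys; apply: H. Qed.

Lemma small_le (T : eqType) (d : T -> T -> R) e e' s :
  e <= e' -> small d e s -> small d e' s.
Proof. by move=> ee H x y xs ys; apply: lt_le_trans ee; apply: H. Qed.

(** The index [k] is the length of the lists on which [f] is read, one more than the cohomological
    degree: index 2 stands for H^1 and index 4 for H^3. *)
Definition cocycle (T : Type) (P : seq T -> Prop) (k : nat) (f : seq T -> F) :=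
  forall s, size s = k.+1 -> P s -> dl f s = 0.

Definition bounds (T : Type) (P : seq T -> Prop) (k : nat) (f g : seq T -> F) :=
  forall s, size s = k -> P s -> f s = dl g s.

Definition supported (T : eqType) (n : T -> R) (B : R) (f : seq T -> F) :=
  forall s, (exists2 x, x \in s & B < n x) -> f s = 0.

Section Compact.
Variables (T : eqType) (d : T -> T -> R) (n : T -> R).

Definition cs_cocycle k f := exists e B : R,
  [/\ 0 < e, supported n B f & cocycle (small d e) k f].

(** Since [dl g [:: x]] is [g [::]], the complex of lists is augmented. The condition [g [::] = 0]
    removes the augmentation, which no support condition can see because the empty list has no
    vertex. *)
Definition cs_bound k f := exists (e B : R) (g : seq T -> F),
  [/\ 0 < e, supported n B g, g [::] = 0 & bounds (small d e) k f g].

Definition cs_vanish k := forall f, cs_cocycle k f -> cs_bound k f.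

Definition cs_dim1 k := forall f1 f2, cs_cocycle k f1 -> cs_cocycle k f2 ->
  exists m1 m2 : F, (m1 != 0) || (m2 != 0) /\
    cs_bound k (fun s => m1 * f1 s + m2 * f2 s).

Definition cs_nonzero k := exists2 f, cs_cocycle k f & ~ cs_bound k f.

End Compact.

(** * Suspension: compactly supported cohomology of a product with the line *)

Section Suspension.
Variables (Y : eqType) (dY : Y -> Y -> R) (nY : Y -> R).
Hypothesis nY_lip : forall y y', nY y <= nY y' + dY y y'.

Let Z : eqType := (Y * R)%type.
Definition susp_dist (z w : Y * R) : R := Num.max (dY z.1 w.1) `|z.2 - w.2|.
Definition susp_norm (z : Y * R) : R := Num.max (nY z.1) `|z.2|.

Lemma susp_norm_lip z w : susp_norm z <= susp_norm w + susp_dist z w.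
Proof.
rewrite /susp_norm /susp_dist ge_max; apply/andP; split.
  apply: le_trans (nY_lip z.1 w.1) _.
  by apply: lerD; rewrite le_max lexx.
have h : `|z.2| <= `|w.2| + `|z.2 - w.2|.
  by rewrite addrC -{1}(subrK w.2 z.2) ler_normD.
by apply: le_trans h _; apply: lerD; rewrite le_max lexx ?orbT.
Qed.

Lemma small_fst e (s : seq Z) : small susp_dist e s -> small dY e (map fst s).
Proof.
move=> H _ _ /mapP[x xs ->] /mapP[y ys ->].
by have := H _ _ xs ys; rewrite /susp_dist gt_max => /andP[].
Qed.

Lemma small_slice e t (s : seq Y) : 0 < e -> small dY e s ->
  small susp_dist e (map (fun y => (y, t)) s).
Proof.
move=> e0 H _ _ /mapP[x xs ->] /mapP[y ys ->].
by rewrite /susp_dist gt_max/= subrr normr0 e0 andbT; apply: H.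
Qed.

Lemma small_move e eta (r r' : Z -> Z) (s : seq Z) :
  (forall z, (r z).1 = z.1) -> (forall z, (r' z).1 = z.1) ->
  {in s &, forall z w, `|(r z).2 - (r w).2| < eta /\ `|(r z).2 - (r' w).2| < eta
    /\ `|(r' z).2 - (r' w).2| < eta} ->
  eta <= e -> small susp_dist e s -> small susp_dist e (map r s ++ map r' s).
Proof.
move=> r1 r1' H he S z w; rewrite !mem_cat /susp_dist gt_max.
case/orP => /mapP[x xs ->] /orP[] /mapP[y ys ->]; rewrite ?r1 ?r1';
  (have := S _ _ xs ys; rewrite /susp_dist gt_max => /andP[-> _] /=);
  apply: lt_le_trans he; have [h1 [h2 h3]] := H _ _ xs ys => //.
by rewrite distrC; have [_ [h4 _]] := H _ _ ys xs.
Qed.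

Section Step.
Variables (k : nat) (f : seq Z -> F) (e B : R).
Hypothesis e0 : 0 < e.
Hypothesis e1 : e <= 1.
Hypothesis B0 : 0 <= B.
Hypothesis fB : supported susp_norm B f.
Hypothesis fco : cocycle (small susp_dist e) k.+1 f.

(** A list of diameter below 1 with a vertex lower than [-L] lies entirely below [-B], outside the
    support of [f]. *)
Let L := B + 1.
Let eta := e / 4.
Let M := (Num.bound ((B + L) / eta)).+1.

Let eta0 : 0 < eta. Proof. by rewrite /eta divr_gt0. Qed.

Let M_eta : B + L < M%:R * eta.
Proof.
rewrite -ltr_pdivrMr//.
have h0 : 0 <= (B + L) / eta by rewrite divr_ge0 ?(ltW eta0)// /L !addr_ge0.
have h := archi_boundP h0; apply: lt_trans h _.
by rewrite /M ltr_nat.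
Qed.

Definition susp_up (j : nat) (z : Z) : Z := (z.1, z.2 + j%:R * eta).
Definition susp_down (j : nat) (z : Z) : Z := (z.1, Num.max (z.2 - j%:R * eta) (- L)).
(** Integration of [f] along upward rays. The total rise [M * eta] exceeds [B + L], so every point
    above [-L] leaves the support, and on that half-space the result is a primitive of [- f]. *)
Definition susp_prim := psum susp_up M f.
(** Integration along the fibre: rays that start at height [-L], under the support, are whole
    vertical lines as far as [f] is concerned. *)
Definition susp_restr (s : seq Y) : F := susp_prim (map (fun y => (y, - L)) s).

Let up_small j (s : seq Z) : small susp_dist (e / 2) s ->
  small susp_dist e (map (susp_up j) s ++ map (susp_up j.+1) s).
Proof.
move=> S; apply: (@small_move _ e) => //; last first.
  by apply: small_le S; have := e0; lra.
move=> z w zs ws; have := S _ _ zs ws; rewrite /susp_dist gt_max => /andP[_] /= h.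
rewrite !opprD.
have E : j.+1%:R * eta = j%:R * eta + eta by rewrite -addn1 natrD mulrDl mul1r.
rewrite E /eta; set c := j%:R * _; clearbody c.
by move: h; rewrite !ltr_norml => /andP[h1 h2]; have := e0; split; [|split];
  apply/andP; split; lra.
Qed.

Let down_small j (s : seq Z) : small susp_dist (e / 4) s ->
  small susp_dist (e / 2) (map (susp_down j) s ++ map (susp_down j.+1) s).
Proof.
move=> S; apply: (@small_move _ (e / 2)) => //; last first.
  by apply: small_le S; have := e0; lra.
move=> z w zs ws; have := S _ _ zs ws; rewrite /susp_dist gt_max => /andP[_] /= h.
have E : j.+1%:R * eta = j%:R * eta + eta by rewrite -addn1 natrD mulrDl mul1r.
rewrite E /eta; set c := j%:R * _; clearbody c.
move: h; rewrite !ltr_norml => /andP[h1 h2]; have := e0.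
rewrite /Num.max; split; [|split]; apply/andP; split;
  case: ifP => a1; case: ifP => a2; move: a1 a2;
  try move/negbT; try (move=> a1 /negbT; move: a1); rewrite -?leNgt; lra.
Qed.

Let dl_prim s : size s = k.+1 -> small susp_dist (e / 2) s ->
  {in s, forall z : Y * R, - L <= z.2} -> dl susp_prim s = - f s.
Proof.
move=> ssz S sL; have := psum_homotopy susp_up M f s.
rewrite -/susp_prim [psum _ _ (dl f) s]psum_eq0; last first.
  move=> j t _ ts tsz _; apply: fco; first by rewrite tsz ssz.
  apply: (small_sub ts); exact: up_small.
rewrite addr0 => ->.
rewrite [f (map (susp_up M) s)]fB; last first.
  case: s ssz S sL => // z s _ _ sL.
  exists (susp_up M z); first exact: mem_head.
  rewrite /susp_norm lt_max /=; apply/orP; right.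
  by apply: lt_le_trans (ler_norm _); have := sL z (mem_head _ _); have := M_eta; lra.
rewrite add0r; congr (- f _); rewrite -[RHS]map_id; apply: eq_map => -[y t].
by rewrite /susp_up /= mul0r addr0.
Qed.

Let prim_fst s z : z \in s -> B < nY z.1 -> susp_prim s = 0.
Proof.
move=> zs zB; apply: psum_eq0 => j t _ _ _ /(_ _ zs) h; apply: fB.
by case: h => h; [exists (susp_up j z)|exists (susp_up j.+1 z)] => //;
  rewrite /susp_norm lt_max zB.
Qed.

Let prim_snd s z : z \in s -> B < z.2 -> susp_prim s = 0.
Proof.
move=> zs zB; apply: psum_eq0 => j t _ _ _ /(_ _ zs) h; apply: fB.
case: h => h; [exists (susp_up j z)|exists (susp_up j.+1 z)] => //;
  rewrite /susp_norm lt_max /=;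
  (apply/orP; right; apply: (lt_le_trans zB); apply: le_trans (ler_norm _));
  by rewrite lerDl mulr_ge0// ltW.
Qed.

Let bottom (s : seq Z) := {in s, forall z : Y * R, - L <= z.2 < - B}.

Let f_bottom s z : z \in s -> z.2 < - B -> f s = 0.
Proof.
move=> zs zB; apply: fB; exists z => //.
by rewrite /susp_norm lt_max ltr_normr ltrNr zB !orbT.
Qed.

Lemma susp_restr_supported : supported nY B susp_restr.
Proof.
move=> s [y ys yB]; rewrite /susp_restr; apply: (@prim_fst _ (y, - L)) => //.
by apply/mapP; exists y.
Qed.

Lemma susp_restr_cocycle : cocycle (small dY (e / 2)) k susp_restr.
Proof.
move=> s ssz S; rewrite /susp_restr dl_map dl_prim.
- case: s ssz S => // y s _ _; rewrite (@f_bottom _ (y, - L)) ?oppr0 ?mem_head//=.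
  by rewrite /L; lra.
- by rewrite size_map.
- by apply: small_slice => //; rewrite divr_gt0.
- by move=> _ /mapP[y ys ->].
Qed.

(** On the slab between [-L] and [-B] the cochain [f] vanishes, so [susp_prim] is a cocycle there;
    sliding the slab down onto its floor compares it with the pullback of its restriction to the
    floor. *)
Let down_prim s : size s = k -> small susp_dist (e / 4) s -> bottom s ->
  susp_prim s = susp_restr (map fst s) - dl (psum susp_down M susp_prim) s.
Proof.
move=> ssz S sb; have := psum_homotopy susp_down M susp_prim s.
rewrite [psum _ _ (dl _) s]psum_eq0; last first.
  move=> j t _ ts tsz _.
  have tb : bottom t.
    move=> w /ts; rewrite mem_cat => /orP[] /mapP[z zs ->] /=;
      have /andP[h1 h2] := sb _ zs; rewrite le_max lexx orbT gt_max /=;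
      apply/andP; split; try (by rewrite /L; lra); apply: le_lt_trans h2;
      by rewrite gerBl mulr_ge0// ltW.
  rewrite dl_prim ?tsz ?ssz//.
  - case: t tsz tb {ts} => // w t _ tb; have /andP[_ h] := tb w (mem_head _ _).
    by rewrite (@f_bottom _ w) ?oppr0 ?mem_head.
  - apply: (small_sub ts); exact: down_small.
  - by move=> w /tb /andP[].
rewrite addr0 => ->.
rewrite /susp_restr -map_comp.
have -> : map (susp_down M) s = map ((fun y => (y, - L)) \o fst) s.
  apply/eq_in_map => z /sb /andP[h1 h2]; rewrite /susp_down /=; congr pair.
  apply/max_idPr; have := M_eta; have := B0; rewrite /L; lra.
have -> : map (susp_down 0) s = s.
  rewrite -[RHS]map_id; apply/eq_in_map => -[y t] /sb /andP[h1 h2].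
  by rewrite /susp_down /= mul0r subr0; congr pair; apply/max_idPl.
by rewrite opprB addrC subrK.
Qed.

(** A primitive [h] of the fibre integral, combined with the slide of [down_prim], corrects
    [susp_prim] so that it vanishes on the slab. It can then be extended by zero below, which gives
    the compact support that [susp_prim] lacks. *)
Lemma susp_restr_bound : (0 < k)%N -> cs_bound dY nY k susp_restr ->
  cs_bound susp_dist susp_norm k.+1 f.
Proof.
move=> k0 [eh [B' [h [eh0 hB' h0 hb]]]].
(* A list above [-L] with a vertex of norm beyond [B2] is either horizontally outside the supports
   of both [f] and [h], or higher than [L]; heights below [- B2] cannot occur there. *)
pose e' := Num.min eh (e / 4); pose B2 := Num.max B B' + 1 + L.
have e'0 : 0 < e' by rewrite lt_min eh0 /=; have := e0; lra.
have e'4 : e' <= e / 4 by rewrite ge_min lexx orbT.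
have e'1 : e' < 1 by have := e0; have := e1; lra.
pose h' (u : seq Z) :=
  if `[< u <> [::] /\ bottom u >] then h (map fst u) - psum susp_down M susp_prim u else 0.
pose g1 u := - (susp_prim u - dl h' u).
pose good u := [/\ u <> [::], small susp_dist e' u, {in u, forall z : Y * R, - L <= z.2}
  & {in u, forall z : Y * R, susp_norm z <= B2}].
pose g u := if `[< good u >] then g1 u else 0.
have g1_bottom u : size u = k -> small susp_dist e' u -> bottom u -> g1 u = 0.
  move=> uk uS ub; rewrite /g1 (_ : dl h' u = susp_prim u) ?subrr ?oppr0//.
  rewrite down_prim//; last exact: small_le uS.
  rewrite hb ?size_map//; last first.
    by apply: small_fst; apply: small_le uS; rewrite ge_min lexx.
  rewrite -dl_map -dlB; apply: dl_ext => v vu vsz; rewrite /h'; case: asboolP => // hv.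
  case: v vu vsz hv => [|z v] vu vsz hv; first by rewrite /= h0 psum_nil subrr.
  by case: hv; split => // w /vu /ub.
have g1_big u z : size u = k -> small susp_dist e' u -> {in u, forall z : Y * R, - L <= z.2} ->
    z \in u -> B2 < susp_norm z -> g1 u = 0.
  move=> uk uS uL zu; rewrite /susp_norm lt_max => /orP[zB|zB]; rewrite /g1.
    have zall w : w \in u -> Num.max B B' < nY w.1.
      move=> wu; have := uS _ _ zu wu; rewrite /susp_dist gt_max => /andP[+ _].
      have := nY_lip z.1 w.1; move: zB; rewrite /B2 /L; have := B0; have := e'1; lra.
    rewrite (prim_fst zu); last by have := zall _ zu; rewrite gt_max => /andP[].
    rewrite dl_eq0 ?subrr ?oppr0// => v vu vsz; rewrite /h'; case: asboolP => // -[].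
    case: v vu vsz => // w v vu vsz _ _.
    have := zall w (vu w (mem_head _ _)); rewrite gt_max => /andP[wB wB'].
    rewrite hB'; last by exists w.1 => //; apply/mapP; exists w; rewrite ?mem_head.
    rewrite psum_eq0 ?subrr// => j t _ _ _ /(_ w (mem_head _ _)) hw.
    by case: hw => hw; apply: (prim_fst hw).
  have hB : 0 <= Num.max B B' by rewrite le_max B0.
  have {}zB : L + 1 < z.2.
    have := uL _ zu; move: zB; rewrite /B2 ltr_normr => /orP[]; lra.
  rewrite (prim_snd zu); last by move: zB; rewrite /L; lra.
  rewrite dl_eq0 ?subrr ?oppr0// => v vu vsz; rewrite /h'; case: asboolP => // -[].
  case: v vu vsz => // w v vu vsz _ /(_ w (mem_head _ _)) /andP[_ wB].
  have := uS _ _ zu (vu w (mem_head _ _)); rewrite /susp_dist gt_max ltr_norml.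
  move=> /andP[_ /andP[_ h1]]; exfalso; have := lt_trans (ltrB zB wB) h1.
  by rewrite /L; have := B0; have := e'1; lra.
exists e', B2, g; split => //.
- move=> s [z zs zB]; rewrite /g; case: asboolP => // -[_ _ _ /(_ z zs)].
  by rewrite leNgt zB.
- by rewrite /g; case: asboolP => // -[].
move=> s ssz S.
have [sL|/existsNP[z /not_implyP[zs /negP zL]]] :=
  pselect ({in s, forall z : Y * R, - L <= z.2}); last first.
  have sall w : w \in s -> w.2 < - B.
    move=> ws; have := S _ _ ws zs; rewrite /susp_dist gt_max ltr_norml.
    by move=> /andP[_ /andP[_]]; move: zL; rewrite -ltNge /L; have := e'1; lra.
  rewrite (f_bottom zs) ?sall// dl_eq0// => u us usz; rewrite /g; case: asboolP => // -[].
  move=> _ uS uL _; apply: g1_bottom => //; first by rewrite usz ssz.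
  by move=> w wu; rewrite uL// sall// us.
rewrite (_ : dl g s = dl g1 s); last first.
  apply: dl_ext => u us usz; rewrite ssz /= in usz.
  have uS := small_sub us S.
  have uL : {in u, forall z : Y * R, - L <= z.2} by move=> z /us /sL.
  have u0 : u <> [::] by move=> E; move: k0; rewrite -usz E.
  rewrite /g; case: asboolP => // ng.
  have [uB|/existsNP[z /not_implyP[zu /negP]]] :=
    pselect ({in u, forall z : Y * R, susp_norm z <= B2}); first by case: ng.
  by rewrite -ltNge => zB; rewrite (g1_big _ z).
rewrite dlN dlB dl_dl subr0 dl_prim ?opprK//.
by apply: small_le S; have := e0; lra.
Qed.

End Step.
End Suspension.
End Smallness.

Section CompactSupportResults.
Variables (F : fieldType) (R : realType).
Notation cs_cocycle := (@cs_cocycle F R _).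
Notation cs_bound := (@cs_bound F R _).
Notation cs_vanish := (@cs_vanish F R _).
Notation cs_dim1 := (@cs_dim1 F R _).
Notation cs_nonzero := (@cs_nonzero F R _).

Lemma supported_le (T : eqType) (n : T -> R) B B' (f : seq T -> F) :
  B <= B' -> supported n B f -> supported n B' f.
Proof. by move=> BB H s [x xs xB]; apply: H; exists x => //; apply: le_lt_trans xB. Qed.

Lemma cocycle_small_le (T : eqType) (d : T -> T -> R) e e' k (f : seq T -> F) :
  e <= e' -> cocycle (small d e') k f -> cocycle (small d e) k f.
Proof. by move=> ee H s sz S; apply: H => //; apply: small_le S. Qed.

Lemma cs_cocycle2 (T : eqType) (d : T -> T -> R) n k f1 f2 :
  cs_cocycle d n k f1 -> cs_cocycle d n k f2 ->
  exists e B : R, [/\ 0 < e, e <= 1 & 0 <= B] /\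
    [/\ supported n B f1, cocycle (small d e) k f1,
        supported n B f2 & cocycle (small d e) k f2].
Proof.
move=> [e1 [B1 [e10 s1 c1]]] [e2 [B2 [e20 s2 c2]]].
exists (Num.min 1 (Num.min e1 e2)), (Num.max 0 (Num.max B1 B2)); split; split.
- by rewrite !lt_min ltr01 e10.
- by rewrite ge_min lexx.
- by rewrite le_max lexx.
- by apply: supported_le s1; rewrite !le_max lexx ?orbT.
- by apply: cocycle_small_le c1; rewrite !ge_min lexx ?orbT.
- by apply: supported_le s2; rewrite !le_max lexx ?orbT.
- by apply: cocycle_small_le c2; rewrite !ge_min lexx ?orbT.
Qed.

Lemma supported_lin (T : eqType) (n : T -> R) B m1 m2 (f1 f2 : seq T -> F) :
  supported n B f1 -> supported n B f2 ->
  supported n B (fun s => m1 * f1 s + m2 * f2 s).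
Proof. by move=> h1 h2 s xs; rewrite h1// h2// !mulr0 addr0. Qed.

Lemma dl_lin (T : Type) m1 m2 (f1 f2 : seq T -> F) s :
  dl (fun s => m1 * f1 s + m2 * f2 s) s = m1 * dl f1 s + m2 * dl f2 s.
Proof. by rewrite dlD !dlZ. Qed.

Lemma cocycle_lin (T : Type) (P : seq T -> Prop) k m1 m2 (f1 f2 : seq T -> F) :
  cocycle P k f1 -> cocycle P k f2 ->
  cocycle P k (fun s => m1 * f1 s + m2 * f2 s).
Proof. by move=> h1 h2 s sz Ps; rewrite dl_lin h1// h2// !mulr0 addr0. Qed.

Lemma cs_cocycle_lin (T : eqType) (d : T -> T -> R) n k m1 m2 f1 f2 :
  cs_cocycle d n k f1 -> cs_cocycle d n k f2 ->
  cs_cocycle d n k (fun s => m1 * f1 s + m2 * f2 s).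
Proof.
move=> c1 c2; have [e [B [[e0 _ _] [s1 h1 s2 h2]]]] := cs_cocycle2 c1 c2.
by exists e, B; split => //; [exact: supported_lin|exact: cocycle_lin].
Qed.

Section SuspensionResults.
Variables (Y : eqType) (dY : Y -> Y -> R) (nY : Y -> R).
Hypothesis nY_lip : forall y y', nY y <= nY y' + dY y y'.
Notation dZ := (susp_dist dY).
Notation nZ := (susp_norm nY).

Lemma susp_vanish k : (0 < k)%N -> cs_vanish dY nY k -> cs_vanish dZ nZ k.+1.
Proof.
move=> k0 V f fc; have [e [B [[e0 e1 B0] [s1 h1 _ _]]]] := cs_cocycle2 fc fc.
apply: (susp_restr_bound nY_lip e0 e1 B0 s1 h1 k0).
apply: V; exists (e / 2), B; split; first by rewrite divr_gt0.
- exact: susp_restr_supported s1.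
- exact: (susp_restr_cocycle e0 B0 s1 h1).
Qed.

Lemma susp_dim1 k : (0 < k)%N -> cs_dim1 dY nY k -> cs_dim1 dZ nZ k.+1.
Proof.
move=> k0 V f1 f2 c1 c2; have [e [B [[e0 e1 B0] [s1 h1 s2 h2]]]] := cs_cocycle2 c1 c2.
have C f : supported nZ B f -> cocycle (small dZ e) k.+1 f ->
    cs_cocycle dY nY k (susp_restr f e B).
  move=> s h; exists (e / 2), B; split; first by rewrite divr_gt0.
    exact: susp_restr_supported s.
  exact: (susp_restr_cocycle e0 B0 s h).
have [m1 [m2 [m12 H]]] := V _ _ (C _ s1 h1) (C _ s2 h2).
exists m1, m2; split => //.
apply: (susp_restr_bound nY_lip e0 e1 B0 _ _ k0).
- exact: supported_lin.
- exact: cocycle_lin.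
rewrite (_ : susp_restr _ _ _ =
  fun s => m1 * susp_restr f1 e B s + m2 * susp_restr f2 e B s)//.
by apply/funext => s; rewrite /susp_restr /susp_prim psumD !psumZ.
Qed.

(** A locally constant function does not change along small upward steps, and enough of them leave
    the support. *)
Lemma susp_vanish1 : cs_vanish dZ nZ 1.
Proof.
move=> f fc; have [e [B [[e0 e1 B0] [s1 h1 _ _]]]] := cs_cocycle2 fc fc.
exists (e / 2), 0, (fun=> 0); split => //; first by rewrite divr_gt0.
move=> [//|z [|//]] _ S; rewrite dl0.
pose eta := e / 4; have eta0 : 0 < eta by rewrite divr_gt0.
pose r j (w : Y * R) : Y * R := (w.1, w.2 + j%:R * eta).
pose M := Num.bound ((B + `|z.2|) / eta).
have hM : B + `|z.2| < M%:R * eta.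
  by rewrite -ltr_pdivrMr// archi_boundP// divr_ge0 ?(ltW eta0)// addr_ge0.
have := psum_homotopy r M f [:: z]; rewrite psum_eq0; last first.
  move=> j t _ ts tsz _; apply: h1 => //; apply: (small_sub ts).
  apply: (@small_move _ _ _ e) => //; last by apply: small_le S; have := e0; lra.
  move=> w w'; rewrite !inE => /eqP-> /eqP->; rewrite /= !subrr normr0.
  split=> //; split=> //; rewrite -addn1 natrD mulrDl mul1r addrA opprD addrA subrr sub0r.
  by rewrite normrN gtr0_norm// /eta; lra.
rewrite addr0 /= psum_nil subr0 => /esym/eqP; rewrite subr_eq0 => /eqP.
rewrite {2}/r mul0r addr0 -surjective_pairing => <-.
apply: s1; exists (r M z); first exact: mem_head.
rewrite /susp_norm lt_max /=; apply/orP; right; apply: lt_le_trans (ler_norm _).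
by have := ler_norm (- z.2); rewrite normrN; lra.
Qed.

(** The inverse of fibre integration: pull [z] back, cut it off at negative heights and take the
    coboundary. The result is concentrated near height 0, hence compactly supported. *)
Lemma susp_nonzero k : (0 < k)%N -> cs_nonzero dY nY k -> cs_nonzero dZ nZ k.+1.
Proof.
move=> k0 [z zc nb]; have [e [B [[e0 e1 B0] [zB zco _ _]]]] := cs_cocycle2 zc zc.
pose u (s : seq (Y * R)) := if `[< s <> [::] /\ {in s, forall w : Y * R, w.2 < 0} >]
  then z (map fst s) else 0.
pose B2 := B + 1.
pose z' s := if `[< {in s, forall w : Y * R, nZ w <= B2} >] then dl u s else 0.
have z'E s : size s = k.+1 -> small dZ e s -> z' s = dl u s.
  move=> sz S; rewrite /z'; case: asboolP => // /existsNP[w /not_implyP[ws /negP]].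
  rewrite -ltNge /susp_norm lt_max => /orP[wB|wB].
    rewrite dl_eq0// => v vs vsz; rewrite /u; case: asboolP => // -[v0 _].
    case: v vs vsz v0 => // x v vs vsz _; apply: zB; exists x.1; first exact: mem_head.
    have := S _ _ ws (vs x (mem_head _ _)); rewrite /susp_dist gt_max => /andP[+ _].
    by have := nY_lip w.1 x.1; move: wB; rewrite /B2; lra.
  have [wp|wn] := leP 0 w.2.
    rewrite dl_eq0// => v vs vsz; rewrite /u; case: asboolP => // -[v0].
    case: v vs vsz v0 => // x v vs vsz _ /(_ x (mem_head _ _)) x0.
    have := S _ _ ws (vs x (mem_head _ _)); rewrite /susp_dist gt_max => /andP[_].
    move: wB; rewrite ger0_norm// => wB /(le_lt_trans (ler_norm _)) h.
    by exfalso; move: wB h x0; rewrite /B2; have := B0; have := e1; lra.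
  rewrite (@dl_ext _ _ u (fun t => z (map fst t))); last first.
    move=> v vs vsz; rewrite /u; case: asboolP => // -[]; split.
      by move=> v0; move: vsz; rewrite sz v0 /= => k1; move: k0; rewrite -k1.
    move=> x /vs xs; have := S _ _ xs ws; rewrite /susp_dist gt_max => /andP[_].
    move: wB; rewrite ltr0_norm// => wB /(le_lt_trans (ler_norm _)) h.
    by move: wB h; rewrite /B2; have := B0; have := e1; lra.
  by rewrite dl_map zco ?size_map//; apply: small_fst S.
exists z'.
  exists e, B2; split => //.
    move=> s [w ws wB]; rewrite /z'; case: asboolP => // /(_ w ws).
    by rewrite leNgt wB.
  move=> s sz S; rewrite (@dl_ext _ _ z' (dl u)) ?dl_dl// => t ts tsz.
  by apply: z'E; [rewrite tsz sz|apply: small_sub ts S].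
move=> [e3 [B3 [g [e30 gB g0 gb]]]]; apply: nb.
pose e4 := Num.min e e3; have e40 : 0 < e4 by rewrite lt_min e0.
(* If [z'] bounds, [w] is a cocycle that restricts to [z] at height [-L] and to 0 at height [L]; the
   vertical homotopy between these levels is then a primitive of [z]. *)
pose w s := u s - g s.
have wco s : size s = k.+1 -> small dZ e4 s -> dl w s = 0.
  move=> sz S; rewrite /w dlB -z'E// ?gb ?subrr//; apply: small_le S.
    by rewrite ge_min lexx orbT.
  by rewrite ge_min lexx.
pose L := Num.max 0 B3 + 1.
have L0 : 0 < L by rewrite /L ltr_wpDl// le_max lexx.
have LB3 : B3 < L by rewrite (@le_lt_trans _ _ (Num.max 0 B3)) ?le_max ?lexx ?orbT// ltrDl.
pose M := (Num.bound (4 * L / e4)).+1; pose eta := 2 * L / M%:R.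
have M0 : 0 < M%:R :> R by rewrite ltr0n.
have Meta : M%:R * eta = 2 * L by rewrite /eta mulrC divfK// gt_eqF.
have eta_e : eta < e4 / 2.
  have h : 4 * L / e4 < M%:R.
    apply: (@lt_trans _ _ (Num.bound (4 * L / e4))%:R); last by rewrite ltr_nat.
    by apply: archi_boundP; rewrite divr_ge0 ?mulr_ge0// ltW.
  move: h; rewrite /eta ltr_pdivrMr// => h.
  by rewrite ltr_pdivrMr//; move: h; lra.
pose r j (y : Y) : Y * R := (y, - L + j%:R * eta).
have eta0 : 0 < eta by rewrite /eta divr_gt0 ?mulr_gt0.
exists (e4 / 2), (Num.max B B3), (fun s => - psum r M w s).
have gfst (s : seq (Y * R)) x : x \in s -> Num.max B B3 < nY x.1 -> w s = 0.
  move=> xs; rewrite gt_max => /andP[xB xB3].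
  rewrite /w gB ?subr0; last by exists x => //; rewrite /susp_norm lt_max xB3.
  rewrite /u; case: asboolP => // _; apply: zB; exists x.1 => //.
  by apply/mapP; exists x.
split; first by rewrite divr_gt0.
- move=> s [y ys yB]; rewrite psum_eq0 ?oppr0// => j t _ _ _ /(_ y ys).
  by case=> h; apply: (gfst _ _ h).
- by rewrite psum_nil oppr0.
move=> s sz S; rewrite dlN.
have := psum_homotopy r M w s; rewrite [psum _ _ (dl w) s]psum_eq0; last first.
  move=> j t _ ts tsz _; apply: wco; first by rewrite tsz sz.
  apply: (small_sub ts) => a b; rewrite !mem_cat /susp_dist gt_max.
  have h1 : `|- L + j%:R * eta - (- L + j.+1%:R * eta)| < e4.
    rewrite -addn1 natrD (_ : _ - _ = - eta); last by ring.
    by rewrite normrN gtr0_norm//; have := eta_e; have := e40; lra.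
  case/orP => /mapP[x xs ->] /orP[] /mapP[x' xs' ->] /=; rewrite ?subrr ?normr0 ?e40 ?h1;
    rewrite ?andbT; try (by rewrite (lt_trans (S _ _ xs xs'))//; have := e40; lra).
  by rewrite distrC h1 andbT (lt_trans (S _ _ xs xs'))//; have := e40; lra.
rewrite addr0 => ->; case: s sz S => [sz|y s sz S]; first by move: k0; rewrite -sz.
have wM : w (map (r M) (y :: s)) = 0.
  rewrite /w gB ?subr0; last first.
    exists (r M y); first by rewrite /= mem_head.
    rewrite /susp_norm lt_max /= Meta; apply/orP; right; apply: lt_le_trans (ler_norm _).
    by move: LB3; lra.
  rewrite /u; case: asboolP => // -[_] /(_ (r M y)) /=; rewrite mem_head Meta.
  by move=> /(_ isT) h; exfalso; move: h L0; lra.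
have w0 : w (map (r 0) (y :: s)) = z (y :: s).
  rewrite /w gB ?subr0; last first.
    exists (r 0%N y); first by rewrite /= mem_head.
    rewrite /susp_norm lt_max /= mul0r addr0 normrN; apply/orP; right.
    by apply: lt_le_trans (ler_norm _).
  rewrite /u; case: asboolP => [_|[]].
    by rewrite -map_comp -[in RHS](map_id (y :: s)); congr z; apply: eq_map.
  by split=> // _ /mapP[x _ ->]; rewrite /= mul0r addr0 oppr_lt0.
by rewrite wM w0 sub0r opprK.
Qed.

End SuspensionResults.

Definition unit_dist (x y : unit) : R := 0.
Definition unit_norm (x : unit) : R := 0.

Lemma unit_vanish k : (1 < k)%N -> cs_vanish unit_dist unit_norm k.
Proof.
move=> k1 f [e [B [e0 fB fco]]].
exists e, 0, (fun s => if s is [::] then 0 else f (tt :: s)); split => //.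
  by move=> s [x _]; rewrite ltxx.
move=> s sz S; rewrite (@dl_ext _ _ _ (fun t => f (tt :: t))); last first.
  by case=> // _; rewrite sz /=; move: k1; case: (k) => [|[|]].
by rewrite (dl_cone f tt s) fco ?subr0//= ?sz// => *; rewrite /unit_dist.
Qed.

Lemma unit_dim1 : cs_dim1 unit_dist unit_norm 1.
Proof.
move=> f1 f2 _ _.
have H m1 m2 : m1 * f1 [:: tt] + m2 * f2 [:: tt] = 0 ->
    cs_bound unit_dist unit_norm 1 (fun s => m1 * f1 s + m2 * f2 s).
  move=> E; exists 1, 0, (fun=> 0); split => //.
  by move=> [//|[] [|//]] _ _; rewrite E dl0.
have [E|E] := eqVneq (f2 [:: tt]) 0.
  by exists 0, 1; rewrite oner_neq0 orbT; split => //; apply: H; rewrite E mul0r mulr0 addr0.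
exists (f2 [:: tt]), (- f1 [:: tt]); rewrite E; split => //; apply: H; ring.
Qed.

(** The constant 1 is bounding only in the augmented complex; here [g [::] = 0] excludes it. *)
Lemma unit_nonzero : cs_nonzero unit_dist unit_norm 1.
Proof.
exists (fun=> 1).
  exists 1, 0; split => //; first by move=> s [x _]; rewrite ltxx.
  by move=> [//|x [//|y [|//]]] _ _ /=; rewrite !subr0 subrr.
move=> [e [B [g [e0 _ g0 gb]]]].
have S : small unit_dist e [:: tt] by move=> *; rewrite /unit_dist.
by have := gb [:: tt] erefl S; rewrite /= g0 subr0 => /eqP; rewrite oner_eq0.
Qed.

Definition space3 : Type := (unit * R * R * R)%type.
Definition dist3 : space3 -> space3 -> R := susp_dist (susp_dist (susp_dist unit_dist)).
Definition norm3 : space3 -> R := susp_norm (susp_norm (susp_norm unit_norm)).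

Let lip0 y y' : unit_norm y <= unit_norm y' + unit_dist y y'.
Proof. by rewrite addr0. Qed.
Let lip1 := susp_norm_lip lip0.
Let lip2 := susp_norm_lip lip1.

Lemma norm3_lip x y : norm3 x <= norm3 y + dist3 x y.
Proof. exact: susp_norm_lip lip2 x y. Qed.

Lemma space3_vanish k : (0 < k)%N -> k != 4 -> cs_vanish dist3 norm3 k.
Proof.
case: k => [|[|[|[|[|k]]]]] // _ _.
- exact: susp_vanish1.
- by apply: (susp_vanish lip2) => //; apply: susp_vanish1.
- apply: (susp_vanish lip2) => //; apply: (susp_vanish lip1) => //.
  exact: susp_vanish1.
- apply: (susp_vanish lip2) => //; apply: (susp_vanish lip1) => //.
  by apply: (susp_vanish lip0) => //; apply: unit_vanish.
Qed.

Lemma space3_dim1 : cs_dim1 dist3 norm3 4.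
Proof.
apply: (susp_dim1 lip2) => //; apply: (susp_dim1 lip1) => //.
by apply: (susp_dim1 lip0) => //; apply: unit_dim1.
Qed.

Lemma space3_nonzero : cs_nonzero dist3 norm3 4.
Proof.
apply: (susp_nonzero lip2) => //; apply: (susp_nonzero lip1) => //.
by apply: (susp_nonzero lip0) => //; apply: unit_nonzero.
Qed.

End CompactSupportResults.

(** * Smith theory for free periodic maps *)

Section Smith.
Variables (F : fieldType) (R : realType) (T : choiceType) (d : T -> T -> R).
Variables (psi : T -> T) (p : nat) (t0 : T).
Hypothesis p_gt0 : (0 < p)%N.
Hypothesis psi_p : forall x, iter p psi x = x.
Hypothesis psi_iso : forall x y, d (psi x) (psi y) = d x y.

Definition invariant (f : seq T -> F) := forall s, f (map psi s) = f s.
Definition trace (f : seq T -> F) (s : seq T) : F :=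
  \sum_(i < p) f (map (iter i psi) s).

Lemma iter_mod i x : iter (i %% p) psi x = iter i psi x.
Proof.
rewrite {2}(divn_eq i p) addnC iterD; congr (iter _ _ _).
by elim: (i %/ p)%N => [//|n IH]; rewrite mulSn iterD -IH psi_p.
Qed.

Lemma map_iter i (s : seq T) : map (iter i psi) (map psi s) = map (iter i.+1 psi) s.
Proof. by rewrite -map_comp; apply: eq_map => x /=; rewrite -iterSr. Qed.

Lemma invariant_iter f i s : invariant f -> f (map (iter i psi) s) = f s.
Proof.
move=> fi; elim: i s => [|i IH] s; first by rewrite map_id.
by rewrite -map_iter IH fi.
Qed.

Lemma map_iter_p (s : seq T) : map (iter p psi) s = s.
Proof. by rewrite -[RHS]map_id; apply: eq_map. Qed.

Lemma dl_trace f s : dl (trace f) s = trace (dl f) s.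
Proof. by rewrite /trace dl_sum; apply: eq_bigr => i _; rewrite dl_map. Qed.

Lemma trace_invariant f : invariant (trace f).
Proof.
move=> s; rewrite /trace; case: p p_gt0 psi_p => // n _ psi_n.
rewrite big_ord_recr [RHS]big_ord_recl /= addrC; congr (_ + _).
  by rewrite map_iter; congr f; apply: eq_map => x; rewrite psi_n.
by apply: eq_bigr => i _; rewrite map_iter.
Qed.

Lemma trace_diff f s : trace (fun t => f (map psi t) - f t) s = 0.
Proof.
rewrite /trace sumrB.
have -> : \sum_(i < p) f (map psi (map (iter i psi) s)) = trace f (map psi s).
  apply: eq_bigr => i _; congr f; rewrite -!map_comp; apply: eq_map => x /=.
  by rewrite -iterS -iterSr.
by rewrite trace_invariant subrr.
Qed.

(** A partial equivalence relation whose classes are permuted by [psi] and disjoint from their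
    nontrivial translates. The classes stand for the sheets over evenly covered sets; [rel x x] says
    that [x] lies in one of them. *)
Record free_per (rel : T -> T -> Prop) : Prop := FreePer {
  per_sym : forall x y, rel x y -> rel y x;
  per_trans : forall x y z, rel x y -> rel y z -> rel x z;
  per_psi : forall x y, rel x y -> rel (psi x) (psi y);
  per_free : forall x i, rel x (iter i psi x) -> (p %| i)%N }.

Lemma per_iter rel i x y : free_per rel -> rel x y -> rel (iter i psi x) (iter i psi y).
Proof. by move=> H; elim: i => [//|i IH] /IH /(per_psi H). Qed.

(** One base point [b x] is chosen in each orbit of classes, and [m x] counts the translates that
    lead from it to the class of [x]. *)
Lemma equivariant_representative rel : free_per rel ->
  exists (b : T -> T) (m : T -> nat), forall x, rel x x ->
    [/\ (m x < p)%N, rel (iter (m x) psi (b x)) x, b (psi x) = b x,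
        m (psi x) = ((m x).+1 %% p)%N &
        forall y, rel x y -> b x = b y /\ m x = m y].
Proof.
move=> H; pose O x : set T := [set y | exists i, rel (iter i psi x) y].
pose b x := xget t0 (O x).
pose W x : set nat := [set i | (i < p)%N /\ rel (iter i psi (b x)) x].
pose m x := xget 0%N (W x).
have Orel x y : rel x y -> O x = O y.
  move=> xy; apply/seteqP; split => z [i iz]; exists i;
    apply: (per_trans H) iz; apply: per_iter => //; exact: per_sym.
have bO x : rel x x -> O x (b x).
  by move=> xx; apply: (xgetPex t0); exists x; exists 0%N.
have W_ex x : rel x x -> W x (m x).
  move=> xx; apply: (xgetPex 0%N); have [i hi] := bO x xx.
  exists ((p - i %% p) %% p)%N; split; first by rewrite ltn_mod.
  rewrite iter_mod; apply: (per_sym H).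
  have := per_iter (p - i %% p) H hi; rewrite -iterD => h.
  apply: (per_trans H) h.
  suff -> : iter (p - i %% p + i) psi x = x by [].
  by rewrite -iter_mod -modnDmr subnK ?modnn// ltnW// ltn_mod.
have W_uniq x i j : W x i -> W x j -> i = j.
  move=> [ip hi] [jp hj].
  have hij : rel (iter i psi (b x)) (iter j psi (b x)).
    by apply: (per_trans H) hi _; apply: (per_sym H).
  have := per_iter (p - i) H hij; rewrite -!iterD subnK ?(ltnW ip)// psi_p.
  move=> /(per_free H) /dvdnP[q E].
  have q1 : q = 1%N by move: E ip jp; clear; nia.
  by move: E ip jp; rewrite q1; clear; lia.
exists b, m => x xx; have xx' := per_psi H xx.
have Ox : O (psi x) = O x.
  apply/seteqP; split => z [i hi].
    by exists i.+1; rewrite iterSr.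
  exists (p.-1 + i)%N; rewrite -iterSr -addSn prednK// iterD.
  by rewrite psi_p.
have bx : b (psi x) = b x by rewrite /b Ox.
have [mp mr] := W_ex x xx; split => //.
  apply: (W_uniq _ _ _ (W_ex _ xx')); split; first by rewrite ltn_mod.
  by rewrite iter_mod bx iterS; apply: (per_psi H).
move=> y xy; have bxy : b x = b y by rewrite /b (Orel _ _ xy).
split=> //; have yy : rel y y := per_trans H (per_sym H xy) xy.
apply: (W_uniq y); last exact: W_ex.
by split=> //; rewrite -bxy; exact: (per_trans H mr xy).
Qed.

Hypothesis psi_free : forall x i, iter i psi x = x -> (p %| i)%N.

(** An equivariant map to the integers modulo [p], by a choice in each orbit. It is not continuous,
    which cochains on lists tolerate. *)
Lemma phase_exists : exists ph : T -> nat, forall x,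
  (ph x < p)%N /\ ph (psi x) = ((ph x).+1 %% p)%N.
Proof.
have H : free_per eq.
  split => [x y ->|x y z -> //|x y ->|x i /esym]//; exact: psi_free.
have [b [m hm]] := equivariant_representative H.
by exists m => x; have [] := hm x erefl.
Qed.

(** The phase of the first vertex makes the nonempty lists a free set over the cyclic group. Hence
    an invariant cochain is the trace of its part of phase 0. *)
Lemma trace_onto f : invariant f -> exists g, forall s, s <> [::] -> trace g s = f s.
Proof.
move=> fi; have [ph hph] := phase_exists.
have phi i x : ph (iter i psi x) = ((ph x + i) %% p)%N.
  elim: i => [|i IH]; first by rewrite addn0 modn_small//; have [] := hph x.
  by rewrite iterS; have [_ ->] := hph (iter i psi x); rewrite IH -addn1 modnDml addn1 addnS.
exists (fun s => if s is x :: _ then if ph x == 0%N then f s else 0 else 0).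
case=> [//|x s] _; rewrite /trace /=.
have [hp _] := hph x.
have i0p : ((p - ph x) %% p < p)%N by rewrite ltn_mod.
rewrite (bigD1 (Ordinal i0p)) //= phi modnDmr subnKC ?(ltnW hp)// modnn eqxx.
rewrite big1 ?addr0 => [|i /eqP/eqP ni].
  exact: (invariant_iter _ (x :: s)).
rewrite phi; case: eqP => // h; exfalso; apply/negP: ni => /=.
rewrite -val_eqE /=; apply/eqP; have := ltn_ord i; have /eqP/dvdnP[q] := h => E.
move=> ip; have [ph0|ph0] := posnP (ph x).
  by rewrite ph0 subn0 modnn; move: h; rewrite ph0 add0n modn_small// => ->.
rewrite modn_small; last by move: ph0 hp; clear; lia.
have q1 : q = 1%N by move: E ip ph0 hp; clear; nia.
by move: E; rewrite q1; clear -hp; lia.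
Qed.

(** For the same reason the kernel of the trace is the image of [psi - 1]: the primitive sums [f]
    along the orbit of a list, from its translate of phase 0 up to the list itself. The total over
    the orbit is zero, so the sum closes up. *)
Lemma diff_onto f : (forall s, trace f s = 0) ->
  exists g, forall s, s <> [::] -> g (map psi s) - g s = f s.
Proof.
move=> f0; have [ph hph] := phase_exists.
exists (fun s => if s is x :: _ then \sum_(j < ph x) f (map (iter (p - j.+1) psi) s) else 0).
case=> [//|x s] _; rewrite [map psi _]/=.
have [hp hS] := hph x; rewrite hS.
have E j : (j < p)%N -> map (iter (p - j.+1) psi) (psi x :: map psi s) =
    map (iter (p - j) psi) (x :: s).
  by move=> jp; rewrite -[_ :: map psi s]/(map psi (x :: s)) map_iter subnSK.
have [hlt|hge] := ltnP (ph x).+1 p.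
  rewrite modn_small//.
  under eq_bigr => j _ do rewrite (E j (leq_trans (ltn_ord j) hp)).
  by rewrite big_ord_recl /= subn0 -/(map _ (x :: s)) map_iter_p addrK.
have ep : (ph x).+1 = p by apply/eqP; rewrite eqn_leq hge hp.
rewrite ep modnn big_ord0 sub0r.
have := f0 (x :: s); rewrite /trace -ep big_ord_recl => /eqP.
rewrite addr_eq0 => /eqP hE; rewrite -[f (x :: s)]opprK; congr (- _).
have -> : f (x :: s) = f (map (iter 0 psi) (x :: s)) by rewrite /= map_id.
rewrite hE opprK (reindex_inj rev_ord_inj) /=.
apply: eq_bigr => j _; have jp := ltn_ord j.
have -> : ((ph x).+1 - (ph x - j.+1).+1 = bump 0 j)%N by rewrite /bump; lia.
by [].
Qed.

End Smith.

(** * Smith exact sequences for invariant cochains and for the kernel of the trace *)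

Section SmithSequence.
Variables (F : fieldType) (R : realType) (T : choiceType) (d : T -> T -> R).
Variables (psi : T -> T) (p : nat) (t0 : T) (A : T -> Prop).
Hypothesis p_gt0 : (0 < p)%N.
Hypothesis psi_p : forall x, iter p psi x = x.
Hypothesis psi_iso : forall x y, d (psi x) (psi y) = d x y.
Hypothesis psi_A : forall x, A (psi x) <-> A x.
Hypothesis psi_free : forall x i, iter i psi x = x -> (p %| i)%N.

Notation invariant := (@invariant F T psi).
Notation tr := (@trace F T psi p).

Definition small_in (e : R) (s : seq T) : Prop :=
  small d e s /\ {in s, forall x, A x}.

Lemma small_in_sub e s t : {subset t <= s} -> small_in e s -> small_in e t.
Proof. by move=> ts [S sA]; split; [exact: small_sub S|move=> x /ts /sA]. Qed.

Lemma small_in_le e e' s : e <= e' -> small_in e s -> small_in e' s.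
Proof. by move=> ee [S sA]; split=> //; apply: small_le S. Qed.

Lemma small_in_psi e s : small_in e (map psi s) <-> small_in e s.
Proof.
split=> -[S sA]; split.
- by move=> x y xs ys; rewrite -psi_iso; apply: S; apply: map_f.
- by move=> x xs; apply/psi_A/sA/map_f.
- by move=> _ _ /mapP[x xs ->] /mapP[y ys ->]; rewrite psi_iso; apply: S.
- by move=> _ /mapP[x xs ->]; apply/psi_A/sA.
Qed.

Lemma small_in_iter e i s : small_in e s -> small_in e (map (iter i psi) s).
Proof.
elim: i s => [|i IH] s; first by rewrite map_id.
by move=> S; rewrite -map_iter; apply: IH; apply/small_in_psi.
Qed.

Lemma small_in_iterE e i s : small_in e (map (iter i psi) s) <-> small_in e s.
Proof.
elim: i s => [|i IH] s; first by rewrite map_id.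
by rewrite -map_iter IH small_in_psi.
Qed.

Definition vanish k := forall (f : seq T -> F) e, 0 < e -> cocycle (small_in e) k f ->
  exists (g : seq T -> F) e', 0 < e' /\ bounds (small_in e') k f g.

Definition vanish_inv k := forall (f : seq T -> F) e, 0 < e -> invariant f ->
  cocycle (small_in e) k f ->
  exists g e', [/\ 0 < e', invariant g & bounds (small_in e') k f g].

Definition vanish_ker k := forall (f : seq T -> F) e, 0 < e ->
  (forall s, tr f s = 0) -> cocycle (small_in e) k f ->
  exists g e', [/\ 0 < e', forall s, tr g s = 0 & bounds (small_in e') k f g].

(** Invariance and vanishing trace are asked on all lists, whereas coboundaries are controlled on
    small ones only. Truncation to small lists of one length commutes with [psi], an isometry, and
    turns the local properties into global ones. *)
Definition trunc k e (f : seq T -> F) (s : seq T) : F :=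
  if `[< size s = k /\ small_in e s >] then f s else 0.

Lemma truncE k e f s : size s = k -> small_in e s -> trunc k e f s = f s.
Proof. by move=> sz S; rewrite /trunc asboolT. Qed.

Lemma trunc_cocycle k e f : cocycle (small_in e) k (trunc k e (dl f)).
Proof.
move=> s sz S; rewrite (@dl_ext _ _ _ (dl f)) ?dl_dl// => t ts tsz.
by apply: truncE; [rewrite tsz sz|apply: small_in_sub S].
Qed.

Lemma trunc_map k e f i s : trunc k e f (map (iter i psi) s) =
  trunc k e (fun t => f (map (iter i psi) t)) s.
Proof.
rewrite /trunc size_map; congr (if _ then _ else _).
by apply/asbool_equiv_eq; split=> -[-> S]; split=> //; apply/small_in_iterE; exact: S.
Qed.

Lemma trunc_trace k e f s : tr (trunc k e f) s = trunc k e (tr f) s.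
Proof.
rewrite {1}/trace; under eq_bigr do rewrite trunc_map.
by rewrite /trunc; case: asboolP => _ //; rewrite big1.
Qed.

Lemma face_nonempty k (s t : seq T) : (0 < k)%N -> size s = k.+1 ->
  size t = (size s).-1 -> t <> [::].
Proof. by move=> k0 sz tsz E; move: tsz; rewrite E sz /= => k00; rewrite -k00 in k0. Qed.

(** The exact sequence in which [psi - 1] maps all cochains onto the kernel of the trace, with the
    invariants as kernel: the coboundary of a lift of [f] is an invariant cocycle one degree
    higher. *)
Lemma vanish_ker_of k : (0 < k)%N -> vanish k -> vanish_inv k.+1 -> vanish_ker k.
Proof.
move=> k0 H HI f e e0 f0 fc.
have [g0 hg0] := diff_onto t0 p_gt0 psi_p psi_free f0.
have wi : invariant (trunc k.+1 e (dl g0)).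
  move=> s; rewrite (trunc_map _ _ _ 1) /trunc /=; case: asboolP => // -[sz S].
  apply/eqP; rewrite -subr_eq0 -dl_map -dlB; apply/eqP.
  rewrite -(fc s sz S); apply: dl_ext => t _ tsz; apply: hg0.
  exact: face_nonempty sz tsz.
have [h [e1 [e10 hi hb]]] := HI _ e e0 wi (@trunc_cocycle _ _ _).
have [k' [e2 [e20 kb]]] : exists k' e', 0 < e' /\
    bounds (small_in e') k (fun s => g0 s - h s) k'.
  apply: (H _ (Num.min e e1)); first by rewrite lt_min e0.
  move=> s sz S; rewrite dlB -hb//; last by apply: small_in_le S; rewrite ge_min lexx orbT.
  by rewrite truncE ?subrr//; apply: small_in_le S; rewrite ge_min lexx.
exists (fun s => k' (map psi s) - k' s), e2; split => //.
  by move=> s; apply: trace_diff.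
move=> s sz S; rewrite dlB dl_map -!kb ?size_map//; last exact/small_in_psi.
rewrite hi -hg0 => [|E]; first by ring.
by move: k0; rewrite -sz E.
Qed.

Lemma trace_lift k f e : (0 < k)%N -> vanish_ker k.+1 -> 0 < e -> invariant f ->
  cocycle (small_in e) k f -> exists g e', [/\ 0 < e', cocycle (small_in e') k g &
    forall s, s <> [::] -> f s = tr g s].
Proof.
move=> k0 HN e0 fi fc.
have [g0 hg0] := trace_onto t0 p_gt0 psi_p psi_free fi.
have w0 s : tr (trunc k.+1 e (dl g0)) s = 0.
  rewrite trunc_trace /trunc; case: asboolP => // -[sz S].
  rewrite -dl_trace -(fc s sz S); apply: dl_ext => t _ tsz.
  by apply: hg0; apply: face_nonempty sz tsz.
have [h [e1 [e10 h0 hb]]] := HN _ e e0 w0 (@trunc_cocycle _ _ _).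
exists (fun s => g0 s - h s), (Num.min e e1); split.
- by rewrite lt_min e0.
- move=> s sz S; rewrite dlB -hb//; last by apply: small_in_le S; rewrite ge_min lexx orbT.
  by rewrite truncE ?subrr//; apply: small_in_le S; rewrite ge_min lexx.
- move=> s s0; rewrite -hg0//; apply/esym.
  by rewrite [LHS]sumrB -/(tr h s) h0 subr0.
Qed.

(** The sequence in which the trace maps all cochains onto the invariants. Isolating the hypothesis
    on traces matters in index 4 on the sphere, where the cohomology of all cochains does not
    vanish. *)
Lemma vanish_inv_of_trace k : (0 < k)%N -> vanish_ker k.+1 ->
  (forall g e, 0 < e -> cocycle (small_in e) k g -> exists h e',
     [/\ 0 < e', invariant h & bounds (small_in e') k (tr g) h]) ->
  vanish_inv k.
Proof.
move=> k0 HN H f e e0 fi fc.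
have [g [e1 [e10 gc gE]]] := trace_lift k0 HN e0 fi fc.
have [h [e2 [e20 hi hb]]] := H g e1 e10 gc.
exists h, e2; split=> // s sz S; rewrite gE ?hb// => E; by move: k0; rewrite -sz E.
Qed.

Lemma vanish_inv_of k : (0 < k)%N -> vanish k -> vanish_ker k.+1 -> vanish_inv k.
Proof.
move=> k0 H HN; apply: vanish_inv_of_trace => // g e e0 gc.
have [h [e' [e'0 hb]]] := H g e e0 gc.
exists (tr h), e'; split=> //; first exact: trace_invariant.
move=> s sz S; rewrite dl_trace; apply: eq_bigr => i _; apply: hb.
  by rewrite size_map.
exact: small_in_iter.
Qed.

(** Far above the dimension the invariant cohomology vanishes; the two sequences then carry
    vanishing down one index at a time, as long as the cohomology of all cochains vanishes. *)
Lemma vanish_descend k0 K : (0 < k0)%N -> (forall k, (k0 <= k)%N -> vanish k) ->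
  (forall k, (K <= k)%N -> vanish_inv k) ->
  forall k, (k0 <= k)%N -> vanish_inv k /\ vanish_ker k.
Proof.
move=> k00 H HI k.
have base j : (k0 + K <= j)%N -> vanish_inv j /\ vanish_ker j.
  move=> hj; have j1 : (K <= j)%N by lia.
  split; first exact: HI.
  by apply: vanish_ker_of; [lia|apply: H; lia|apply: HI; lia].
have step n j : (k0 <= j)%N -> (k0 + K <= j + n)%N -> vanish_inv j /\ vanish_ker j.
  elim: n j => [|n IH] j hj hn; first by apply: base; lia.
  have [h1 h2] : vanish_inv j.+1 /\ vanish_ker j.+1 by apply: IH; lia.
  by split; [apply: vanish_inv_of|apply: vanish_ker_of] => //; (try lia); apply: H.
by move=> hk; apply: (step (k0 + K)%N) => //; lia.
Qed.

Definition piece (rel : T -> T -> Prop) (s : seq T) : Prop :=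
  {in s &, forall x y, rel x y}.

Definition pieces (rels : nat -> T -> T -> Prop) n (s : seq T) : Prop :=
  exists2 i, (i < n)%N & piece (rels i) s.

Lemma piece_sub rel s t : {subset t <= s} -> piece rel s -> piece rel t.
Proof. by move=> ts H x y /ts xs /ts ys; apply: H. Qed.

Notation free_per := (free_per psi p).

Lemma piece_psi rel s : free_per rel -> piece rel (map psi s) <-> piece rel s.
Proof.
move=> H; split=> S; last first.
  by move=> _ _ /mapP[x xs ->] /mapP[y ys ->]; apply: (per_psi H); apply: S.
move=> x y xs ys; rewrite -[x]psi_p -[y]psi_p -(prednK p_gt0) !iterSr.
by apply: (per_iter _ H); apply: S; apply: map_f.
Qed.

Lemma free_perI rel rel' : free_per rel -> free_per rel' ->
  free_per (fun x y => rel x y /\ rel' x y).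
Proof.
move=> H H'; split.
- by move=> x y [h h']; split; [exact: (per_sym H)|exact: (per_sym H')].
- move=> x y z [h1 h1'] [h2 h2']; split.
    exact: (per_trans H h1 h2).
  exact: (per_trans H' h1' h2').
- by move=> x y [h h']; split; [exact: (per_psi H)|exact: (per_psi H')].
- by move=> x i [h _]; exact: (per_free H h).
Qed.

(* Induction on the number of relations by Mayer-Vietoris; on a single piece an
   equivariantly chosen base point provides a cone. *)
Lemma pieces_vanish n : forall rels, (forall i, (i < n)%N -> free_per (rels i)) ->
  forall k (f : seq T -> F), (n < k)%N -> invariant f -> cocycle (pieces rels n) k f ->
  exists2 g, invariant g & bounds (pieces rels n) k f g.
Proof.
elim: n => [|n IH] rels H k f nk fi fc.
  by exists (fun=> 0) => // s sz [i].
have Hn := H n (ltnSn n).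
have [g' g'i g'b] : exists2 g, invariant g & bounds (pieces rels n) k f g.
  apply: IH => //.
  - by move=> i hi; apply: H; rewrite ltnS ltnW.
  - exact: ltnW.
  - by move=> s sz [i hi si]; apply: fc => //; exists i => //; rewrite ltnS ltnW.
have [b [m hm]] := equivariant_representative t0 p_gt0 psi_p Hn.
pose rho x := iter (m x) psi (b x).
have rhoP x : rels n x x -> rels n (rho x) x by move=> /hm[].
have rho_eq x y : rels n x y -> rho x = rho y.
  move=> xy; have xx := per_trans Hn xy (per_sym Hn xy).
  by have [_ _ _ _ /(_ y xy)[hb hmm]] := hm x xx; rewrite /rho hb hmm.
have rho_psi x : rels n x x -> rho (psi x) = psi (rho x).
  by move=> /hm[_ _ hb hmm _]; rewrite /rho hb hmm iter_mod.
pose gV s := if s is x :: _ then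
  (if `[< piece (rels n) s >] then f (rho x :: s) else 0) else 0.
have gVi : invariant gV.
  case=> [//|x s]; rewrite /gV [map _ _]/=.
  rewrite (asbool_equiv_eq (piece_psi (x :: s) Hn)); case: asboolP => // S.
  rewrite rho_psi; last by apply: S; rewrite mem_head.
  by rewrite -[RHS]fi.
have gVb s : size s = k -> piece (rels n) s -> dl gV s = f s.
  move=> sz S; case: s sz S => [|x s] sz S; first by move: nk; rewrite -sz.
  rewrite (@dl_ext _ _ _ (fun t => f (rho x :: t))); last first.
    case=> [|y t] ts tsz; first by move: tsz nk; rewrite sz; case: (k) => [|[|]].
    rewrite /gV asboolT; last exact: piece_sub S.
    by congr (f (_ :: _)); apply: rho_eq; apply: S; [apply: ts|]; rewrite mem_head.
  rewrite (dl_cone f (rho x)) fc ?subr0//=; first by rewrite -sz.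
  exists n => // y z; have xx : rels n x x by apply: S; rewrite mem_head.
  rewrite ![_ \in _ :: _ :: _]in_cons => /orP[/eqP->|ys] /orP[/eqP->|zs].
  - exact: (per_trans Hn (rhoP _ xx) (per_sym Hn (rhoP _ xx))).
  - by apply: (per_trans Hn (rhoP _ xx)); apply: S; rewrite ?mem_head.
  - by apply: (per_sym Hn); apply: (per_trans Hn (rhoP _ xx)); apply: S; rewrite ?mem_head.
  - exact: S.
pose rels' i x y := rels i x y /\ rels n x y.
have pI i s : piece (rels' i) s <-> piece (rels i) s /\ piece (rels n) s.
  split=> [S|[S S'] x y xs ys]; last by split; [apply: S|apply: S'].
  by split=> x y xs ys; have [] := S x y xs ys.
have [h hi hb] : exists2 h, invariant h &
    bounds (pieces rels' n) k.-1 (fun s => g' s - gV s) h.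
  apply: IH => //.
  - by move=> i hin; apply: free_perI => //; apply: H; rewrite ltnS ltnW.
  - by move: nk; case: (k).
  - by move=> s; rewrite g'i gVi.
  move=> s sz [i hin /pI[S S']]; have {}sz : size s = k.
    by rewrite sz prednK//; apply: leq_trans nk.
  by rewrite dlB gVb// -g'b ?subrr//; exists i.
exists (fun s => if `[< piece (rels n) s >] then gV s + dl h s else g' s).
  move=> s; rewrite (asbool_equiv_eq (piece_psi s Hn)).
  case: asboolP => // _; rewrite gVi -dl_map; congr (_ + _); apply: dl_ext => t _ _.
  exact: hi.
move=> s sz [i hi1 S]; have [Sn|Sn] := pselect (piece (rels n) s).
  rewrite (@dl_ext _ _ _ (fun s => gV s + dl h s)).
    by rewrite dlD dl_dl addr0 gVb.
  by move=> t ts tsz; rewrite asboolT//; apply: piece_sub Sn.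
have hin : (i < n)%N.
  by move: hi1; rewrite ltnS leq_eqVlt => /orP[/eqP E|//]; case: Sn; rewrite -E.
rewrite (g'b s sz); last by exists i.
apply: dl_ext => t ts tsz; case: asboolP => // tn.
rewrite -hb ?(addrC (gV t)) ?subrK//; first by rewrite tsz sz.
by exists i => //; apply/pI; split=> //; apply: piece_sub S.
Qed.

(** Covering dimension of the quotient, at most [n - 1], in the coloured form of Ostrand: [n]
    families of arbitrarily small sets, disjoint within each family and from their own translates,
    with a Lebesgue number [e']. *)
Definition dim_le n := forall e, 0 < e -> exists rels : nat -> T -> T -> Prop,
  [/\ forall i, (i < n)%N -> free_per (rels i),
      forall i x y, (i < n)%N -> rels i x y -> [/\ A x, A y & d x y < e] &
      exists2 e', 0 < e' & forall s, s <> [::] -> small_in e' s -> pieces rels n s].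

Lemma dim_le_vanish_inv n k : (n < k)%N -> dim_le n -> vanish_inv k.
Proof.
move=> nk D f e e0 fi fc; have [rels [rp rs [e' e'0 rc]]] := D e e0.
have [|g gi gb] := pieces_vanish rp nk fi.
  move=> s sz [i hi S]; apply: fc => //; split=> [x y xs ys|x xs].
    by have [] := rs i x y hi (S x y xs ys).
  by have [] := rs i x x hi (S x x xs xs).
exists g, e'; split=> // s sz S; apply: gb => //; apply: rc => // E.
by move: nk; rewrite -sz E.
Qed.

End SmithSequence.

(** * Cohomology through a chart at infinity *)

Section Space3.
Variables (F : fieldType) (R : realType).
Notation space3 := (space3 R).
Notation dist3 := (@dist3 R).
Notation norm3 := (@norm3 R).

Definition point3 (a b c : R) : space3 := (tt, a, b, c).
Definition aff3 (x : space3) (rho : R) (u : space3) : space3 :=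
  point3 ((u.1.1.2 - x.1.1.2) / rho) ((u.1.2 - x.1.2) / rho) ((u.2 - x.2) / rho).
Definition affV3 (x : space3) (rho : R) (u : space3) : space3 :=
  point3 (x.1.1.2 + rho * u.1.1.2) (x.1.2 + rho * u.1.2) (x.2 + rho * u.2).
Definition mid3 (x y : space3) (t : R) : space3 :=
  point3 (x.1.1.2 + t * (y.1.1.2 - x.1.1.2)) (x.1.2 + t * (y.1.2 - x.1.2))
    (x.2 + t * (y.2 - x.2)).

Lemma dist3E x y : dist3 x y = Num.max (Num.max (Num.max 0
  `|x.1.1.2 - y.1.1.2|) `|x.1.2 - y.1.2|) `|x.2 - y.2|.
Proof. by []. Qed.

Lemma norm3E x : norm3 x = Num.max (Num.max (Num.max 0
  `|x.1.1.2|) `|x.1.2|) `|x.2|.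
Proof. by []. Qed.

Lemma dist3_ge0 x y : 0 <= dist3 x y.
Proof. by rewrite dist3E !le_max lexx. Qed.

Lemma dist3xx x : dist3 x x = 0.
Proof. by rewrite dist3E !subrr normr0 !maxxx. Qed.

Lemma dist3C x y : dist3 x y = dist3 y x.
Proof.
by rewrite !dist3E (distrC x.1.1.2) (distrC x.1.2) (distrC x.2).
Qed.

Lemma dist3_triangle x y z : dist3 x z <= dist3 x y + dist3 y z.
Proof.
rewrite !dist3E !ge_max; apply/andP; split; [apply/andP; split; [apply/andP; split|]|].
- by rewrite addr_ge0// !le_max lexx.
- apply: le_trans (ler_distD y.1.1.2 _ _) _.
  by apply: lerD; rewrite !le_max lexx ?orbT.
- apply: le_trans (ler_distD y.1.2 _ _) _.
  by apply: lerD; rewrite !le_max lexx ?orbT.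
- apply: le_trans (ler_distD y.2 _ _) _.
  by apply: lerD; rewrite !le_max lexx ?orbT.
Qed.

Let max_scale (a b c : R) : 0 <= c -> Num.max a b * c = Num.max (a * c) (b * c).
Proof. by move=> c0; rewrite maxr_pMl. Qed.

Lemma dist3_aff x rho u v : 0 < rho ->
  dist3 (aff3 x rho u) (aff3 x rho v) = dist3 u v / rho.
Proof.
move=> r0; have ri : 0 <= rho^-1 by rewrite invr_ge0 ltW.
have E a b c : `|(a - c) / rho - (b - c) / rho| = `|a - b| / rho.
  by rewrite -mulrBl normrM normfV (gtr0_norm r0); congr (`|_| / _); ring.
by rewrite !dist3E /= !max_scale// mul0r !E.
Qed.

Lemma norm3_aff x rho u : 0 < rho -> norm3 (aff3 x rho u) = dist3 u x / rho.
Proof.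
move=> r0; have ri : 0 <= rho^-1 by rewrite invr_ge0 ltW.
rewrite dist3E norm3E /= !max_scale// mul0r.
by rewrite !normrM normfV (gtr0_norm r0).
Qed.

Lemma aff3K x rho : 0 < rho -> cancel (aff3 x rho) (affV3 x rho).
Proof.
move=> r0 [[[[] a] b] c]; rewrite /aff3 /affV3 /point3 /=.
by congr (_, _, _, _); rewrite mulrC divfK ?gt_eqF// addrC subrK.
Qed.

Lemma affV3K x rho : 0 < rho -> cancel (affV3 x rho) (aff3 x rho).
Proof.
move=> r0 [[[[] a] b] c]; rewrite /aff3 /affV3 /point3 /=.
by congr (_, _, _, _); rewrite addrAC subrr add0r mulrC mulKf ?gt_eqF.
Qed.

Lemma dist3_affV x rho u v : 0 < rho ->
  dist3 (affV3 x rho u) (affV3 x rho v) = rho * dist3 u v.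
Proof.
move=> r0; rewrite -{2}(affV3K x r0 u) -{2}(affV3K x r0 v) dist3_aff//.
by rewrite mulrC divfK ?gt_eqF.
Qed.

Lemma dist3_mid x y t t' : dist3 (mid3 x y t) (mid3 x y t') = `|t - t'| * dist3 x y.
Proof.
have E a b : `|a + t * (b - a) - (a + t' * (b - a))| = `|a - b| * `|t - t'|.
  by rewrite -normrM -normrN; congr `|_|; ring.
by rewrite !dist3E /= [RHS]mulrC !max_scale// mul0r !E.
Qed.

Lemma mid3_0 x y : mid3 x y 0 = x.
Proof. by case: x => [[[[] a] b] c]; rewrite /mid3 /point3 /= !mul0r !addr0. Qed.

Lemma mid3_1 x y : mid3 x y 1 = y.
Proof.
case: x y => [[[[] a] b] c] [[[[] a'] b'] c']; rewrite /mid3 /point3 /= !mul1r.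
by congr (_, _, _, _); rewrite addrC subrK.
Qed.

Lemma dist3_aff_shift x y rho u : 0 < rho ->
  dist3 (aff3 x rho u) (aff3 y rho u) = dist3 x y / rho.
Proof.
move=> r0; have ri : 0 <= rho^-1 by rewrite invr_ge0 ltW.
have E a b c : `|(c - a) / rho - (c - b) / rho| = `|a - b| / rho.
  rewrite -mulrBl normrM normfV (gtr0_norm r0) (distrC a); congr (`|_| / _); ring.
by rewrite !dist3E /= !max_scale// mul0r !E.
Qed.

Section Pullback.
Variables (h : space3 -> space3) (C C' D : R).
Hypothesis C0 : 0 < C.
Hypothesis C'0 : 0 <= C'.
Hypothesis h_lip : forall u v, dist3 (h u) (h v) <= C * dist3 u v.
Hypothesis h_proper : forall u, norm3 u <= C' * norm3 (h u) + D.

Let small_h e s : small dist3 (e / C) s -> small dist3 e (map h s).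
Proof.
move=> S _ _ /mapP[x xs ->] /mapP[y ys ->]; apply: le_lt_trans (h_lip _ _) _.
by rewrite mulrC -ltr_pdivlMr//; apply: S.
Qed.

Let supported_h B (f : seq space3 -> F) : supported norm3 B f ->
  supported norm3 (C' * Num.max 0 B + D) (fun s => f (map h s)).
Proof.
move=> fB s [x xs xB]; apply: fB; exists (h x); first exact: map_f.
rewrite ltNge; apply/negP => hB.
move: xB; rewrite ltNge => /negP; apply; apply: le_trans (h_proper x) _.
by rewrite lerD2r ler_wpM2l// le_max hB orbT.
Qed.

Lemma pullback_cocycle k (f : seq space3 -> F) : cs_cocycle dist3 norm3 k f ->
  cs_cocycle dist3 norm3 k (fun s => f (map h s)).
Proof.
move=> [e [B [e0 fB fc]]]; exists (e / C), (C' * Num.max 0 B + D); split.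
- exact: divr_gt0.
- exact: supported_h.
- by move=> s sz S; rewrite dl_map fc ?size_map//; apply: small_h.
Qed.

Lemma pullback_bound k (f : seq space3 -> F) : cs_bound dist3 norm3 k f ->
  cs_bound dist3 norm3 k (fun s => f (map h s)).
Proof.
move=> [e [B [g [e0 gB g0 gb]]]].
exists (e / C), (C' * Num.max 0 B + D), (fun s => g (map h s)); split => //.
- exact: divr_gt0.
- exact: supported_h.
- by move=> s sz S; rewrite dl_map gb ?size_map//; apply: small_h.
Qed.
End Pullback.

(** A generator of compactly supported H^3 of three-space, as a property that rescaling and
    translation preserve. *)
Definition spanning (z : seq space3 -> F) := [/\ cs_cocycle dist3 norm3 4 z,
  ~ cs_bound dist3 norm3 4 z & forall f, cs_cocycle dist3 norm3 4 f ->
    exists m, cs_bound dist3 norm3 4 (fun s => f s - m * z s)].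

Lemma cs_bound_ext k (f g : seq space3 -> F) : f = g ->
  cs_bound dist3 norm3 k f -> cs_bound dist3 norm3 k g.
Proof. by move=> ->. Qed.

Lemma cs_boundZ k m (f : seq space3 -> F) : cs_bound dist3 norm3 k f ->
  cs_bound dist3 norm3 k (fun s => m * f s).
Proof.
move=> [e [B [g [e0 gB g0 gb]]]]; exists e, B, (fun s => m * g s); split => //.
- by move=> s xs; rewrite gB// mulr0.
- by rewrite g0 mulr0.
- by move=> s sz S; rewrite dlZ gb.
Qed.

Lemma spanning_exists : exists z, spanning z.
Proof.
have [z zc zn] := @space3_nonzero F R; exists z; split => // f fc.
have [m1 [m2 [m12 H]]] := space3_dim1 fc zc.
have m10 : m1 != 0.
  apply: contra_notN zn => /eqP m10; move: m12 H; rewrite m10 eqxx /= => m20 H.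
  have := cs_boundZ m2^-1 H; apply: cs_bound_ext; apply/funext => s.
  by rewrite mul0r add0r mulKf.
exists (- m2 / m1); have := cs_boundZ m1^-1 H; apply: cs_bound_ext; apply/funext => s.
by rewrite mulrDr mulKf// !mulNr opprK mulrA (mulrC m2).
Qed.

Lemma norm3_dist x y : norm3 x <= norm3 y + dist3 x y.
Proof. exact: norm3_lip. Qed.

Lemma spanning_aff z x rho : 0 < rho -> spanning z ->
  spanning (fun s => z (map (aff3 x rho) s)).
Proof.
move=> r0 [zc zn zs].
have r1 : 0 < rho^-1 by rewrite invr_gt0.
have L1 u v : dist3 (aff3 x rho u) (aff3 x rho v) <= rho^-1 * dist3 u v.
  by rewrite dist3_aff// mulrC.
have P1 u : norm3 u <= rho * norm3 (aff3 x rho u) + norm3 x.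
  by rewrite norm3_aff// mulrC divfK ?gt_eqF// addrC norm3_dist.
have L2 u v : dist3 (affV3 x rho u) (affV3 x rho v) <= rho * dist3 u v.
  by rewrite dist3_affV.
have P2 u : norm3 u <= rho^-1 * norm3 (affV3 x rho u) + rho^-1 * norm3 x.
  rewrite -{1}(affV3K x r0 u) norm3_aff// mulrC -mulrDr ler_wpM2l ?(ltW r1)//.
  rewrite dist3E; move: (affV3 x rho u) => w; rewrite !norm3E !ge_max.
  apply/andP; split; [apply/andP; split; [apply/andP; split|]|];
    rewrite ?addr_ge0 ?le_max ?lexx//; apply: le_trans (ler_normB _ _) _;
    by apply: lerD; rewrite !le_max lexx ?orbT.
have VK (f : seq space3 -> F) :
    (fun s => f (map (affV3 x rho) (map (aff3 x rho) s))) = f.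
  by apply/funext => s; rewrite -map_comp map_id_in// => u _ /=; rewrite aff3K.
have KV (f : seq space3 -> F) :
    (fun s => f (map (aff3 x rho) (map (affV3 x rho) s))) = f.
  by apply/funext => s; rewrite -map_comp map_id_in// => u _ /=; rewrite affV3K.
split.
- exact: (pullback_cocycle r1 (ltW r0) L1 P1).
- move=> /(pullback_bound r0 (ltW r1) L2 P2) H; apply: zn.
  by move: H; apply: cs_bound_ext; exact: KV.
- move=> f fc.
  have /zs[m] := pullback_cocycle r0 (ltW r1) L2 P2 fc.
  move=> /(pullback_bound r1 (ltW r0) L1 P1) H; exists m.
  move: H; apply: cs_bound_ext; apply/funext => s.
  by rewrite -[in RHS](VK f).
Qed.

(** The primitive is the prism sum along the segment from [x] to [y], so its support stays near that
    segment. *)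
Lemma point_move (z : seq space3 -> F) x y rho e B : 0 < rho -> 0 < e -> 0 <= B ->
  supported norm3 B z -> cocycle (small dist3 e) 4 z ->
  exists tau : seq space3 -> F, [/\ tau [::] = 0,
    forall s u, u \in s -> B * rho + dist3 x y < dist3 u x -> tau s = 0 &
    bounds (small dist3 (e * rho / 2)) 4
      (fun s => z (map (aff3 y rho) s) - z (map (aff3 x rho) s)) tau].
Proof.
move=> r0 e0 B0 zB zc.
(* Each of the [M] steps shifts the centre by less than [e * rho / 2], that is by [e / 2] after
   rescaling, which leaves the other half for the diameter of the list. *)
pose M := (Num.bound (2 * dist3 x y / (e * rho))).+1.
have M0 : 0 < M%:R :> R by rewrite ltr0n.
have Me : dist3 x y / M%:R < e * rho / 2.
  have h : 2 * dist3 x y / (e * rho) < M%:R.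
    apply: (@lt_trans _ _ (Num.bound (2 * dist3 x y / (e * rho)))%:R).
      by apply: archi_boundP; rewrite divr_ge0 ?mulr_ge0 ?dist3_ge0// ltW.
    by rewrite ltr_nat.
  move: h; rewrite ltr_pdivrMr ?mulr_gt0// => h.
  by rewrite ltr_pdivrMr//; move: h; lra.
pose xx (j : nat) := mid3 x y (j%:R / M%:R).
pose r j u := aff3 (xx j) rho u.
exists (psum r M z); split; first exact: psum_nil.
  move=> s u us ub; apply: psum_eq0 => j t jM _ _ /(_ u us).
  have K i : (i <= M)%N -> B < norm3 (r i u).
    move=> iM; rewrite /r norm3_aff// ltr_pdivlMr//.
    have h1 : dist3 (xx i) x <= dist3 x y.
      rewrite -[X in dist3 _ X](mid3_0 x y) dist3_mid subr0 ger0_norm ?divr_ge0//.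
      by rewrite ler_piMl ?dist3_ge0// ler_pdivrMr// mul1r ler_nat.
    by have := dist3_triangle u (xx i) x; move: ub h1; lra.
  case=> h; apply: zB; eexists; try exact: h; apply: K => //; exact: ltnW.
have r_0 : r 0%N = aff3 x rho by rewrite /r /xx mul0r mid3_0.
have r_M : r M = aff3 y rho by rewrite /r /xx divff ?gt_eqF// mid3_1.
move=> s sz S; rewrite -r_0 -r_M -psum_homotopy.
rewrite [psum _ _ (dl z) s]psum_eq0 ?addr0// => j t jM ts tsz _.
apply: zc; first by rewrite tsz sz.
apply: (small_sub ts) => a b; rewrite !mem_cat.
have h1 u v : u \in s -> v \in s -> dist3 u v / rho < e / 2.
  by move=> us vs; rewrite ltr_pdivrMr// mulrAC; apply: S.
have h2 v : dist3 (r j v) (r j.+1 v) < e / 2.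
  rewrite /r dist3_aff_shift// ltr_pdivrMr// mulrAC dist3_mid.
  have -> : `|j%:R / M%:R - j.+1%:R / M%:R| = M%:R^-1 :> R.
    rewrite -addn1 natrD mulrDl mul1r opprD addrA subrr sub0r normrN ger0_norm//.
  by rewrite mulrC.
have ee : e / 2 <= e by rewrite ler_pdivrMr// mulr_natr mulr2n lerDl ltW.
case/orP => /mapP[u us ->] /orP[] /mapP[v vs ->].
- by rewrite dist3_aff//; apply: lt_le_trans ee; apply: h1.
- apply: le_lt_trans (dist3_triangle _ (r j v) _) _.
  by have := h1 u v us vs; have := h2 v; rewrite {2}/r dist3_aff//; lra.
- apply: le_lt_trans (dist3_triangle _ (r j u) _) _.
  rewrite (dist3C (r j.+1 u)).
  by have := h1 u v us vs; have := h2 u; rewrite {3}/r dist3_aff//; lra.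
- by rewrite dist3_aff//; apply: lt_le_trans ee; apply: h1.
Qed.

End Space3.

(** * From compactly supported cohomology of three-space to a space with a point at infinity *)

Section Chart.
Variables (F : fieldType) (R : realType) (T : choiceType) (d : T -> T -> R).
Variables (oo : T) (sigma : T -> space3 R) (pi : space3 R -> T).
Notation dist3 := (@dist3 R).
Notation norm3 := (@norm3 R).
Hypothesis d_refl : forall x, d x x = 0.
Hypothesis d_sym : forall x y, d x y = d y x.
Hypothesis d_triangle : forall x y z, d x z <= d x y + d y z.
Hypothesis piK : forall x, x <> oo -> pi (sigma x) = x.
Hypothesis sigmaK : forall y, sigma (pi y) = y.
Hypothesis pi_unif : forall e, 0 < e ->
  exists2 de, 0 < de & forall y y', dist3 y y' < de -> d (pi y) (pi y') < e.
Hypothesis sigma_unif : forall eta e, 0 < eta -> 0 < e ->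
  exists2 de, 0 < de & forall x x', eta <= d x oo -> eta <= d x' oo -> d x x' < de ->
    dist3 (sigma x) (sigma x') < e.
Hypothesis sigma_bdd : forall eta, 0 < eta ->
  exists B, forall x, eta <= d x oo -> norm3 (sigma x) <= B.
Hypothesis pi_away : forall B, exists2 eta, 0 < eta &
  forall y, norm3 y <= B -> eta <= d (pi y) oo.

Definition extend0 (f : seq (space3 R) -> F) (s : seq T) : F :=
  if `[< {in s, forall x, x <> oo} >] then f (map sigma s) else 0.

Lemma extend0_lin m (f g : seq (space3 R) -> F) s :
  extend0 (fun s => f s - m * g s) s = extend0 f s - m * extend0 g s.
Proof. by rewrite /extend0; case: asboolP => _ //; rewrite mulr0 subrr. Qed.

Let near_oo B : exists2 eta, 0 < eta & forall x, x <> oo -> d x oo < eta ->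
  B < norm3 (sigma x).
Proof.
have [eta eta0 H] := pi_away B; exists eta => // x xoo xe.
by rewrite ltNge; apply/negP => /H; rewrite piK// leNgt xe.
Qed.

(** The chart distorts distances without bound near [oo]. A small list is therefore either wholly
    near [oo], where compactly supported cochains vanish, or has a small image in the chart. *)
Let small_cases eta e : 0 < eta -> 0 < e -> exists2 e', 0 < e' & forall s,
  small d e' s -> {in s, forall x, d x oo < eta} \/
    ({in s, forall x, x <> oo} /\ small dist3 e (map sigma s)).
Proof.
move=> eta0 e0; have eta2 : 0 < eta / 2 by rewrite divr_gt0.
have [de de0 H] := sigma_unif eta2 e0.
exists (Num.min de (eta / 2)); first by rewrite lt_min de0.
move=> s S; have [sA|/existsNP[x /not_implyP[xs /negP]]] :=
    pselect {in s, forall x, eta / 2 <= d x oo}.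
  right; split=> [x xs E|_ _ /mapP[x xs ->] /mapP[y ys ->]].
    by have := sA x xs; rewrite E d_refl leNgt eta2.
  apply: H; [exact: sA|exact: sA|]; have := S x y xs ys.
  by rewrite lt_min => /andP[].
rewrite -ltNge => xe; left => y ys; apply: le_lt_trans (d_triangle y x oo) _.
by have := S y x ys xs; rewrite lt_min => /andP[_]; move: xe; lra.
Qed.

Let extend0_near B (f : seq (space3 R) -> F) eta s : supported norm3 B f ->
  (forall x, x <> oo -> d x oo < eta -> B < norm3 (sigma x)) ->
  {in s, forall x, d x oo < eta} -> s <> [::] ->
  {in s, forall x, x <> oo} -> f (map sigma s) = 0.
Proof.
move=> fB H; case: s => // x s sE _ soo; apply: fB; exists (sigma x).
  by rewrite mem_head.
by apply: H; [apply: soo|apply: sE]; rewrite mem_head.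
Qed.

Lemma extend0_dl B (f : seq (space3 R) -> F) : supported norm3 B f ->
  exists2 e, 0 < e & forall s, small d e s -> (1 < size s)%N \/ f [::] = 0 ->
    dl (extend0 f) s = extend0 (dl f) s.
Proof.
move=> fB; have [eta eta0 H] := near_oo B.
have [e e0 E] := @small_cases eta 1 eta0 ltr01.
exists e => // s S s1; rewrite {2}/extend0; case: asboolP => soo.
  rewrite -dl_map; apply: dl_ext => t ts _; rewrite /extend0 asboolT//.
  by move=> x /ts /soo.
have {E} : {in s, forall x, d x oo < eta}.
  by case: (E s S) => // -[].
move=> sE; apply: dl_eq0 => t ts tsz; rewrite /extend0; case: asboolP => // too.
have [t0|t0] := pselect (t = [::]).
  case: s1 => [s1|f0]; last by rewrite t0 /= f0.
  by move: s1 tsz; rewrite t0 /=; case: (s) => [//|? [|]].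
by apply: (extend0_near fB H) => // x /ts /sE.
Qed.

Lemma extend0_cocycle k f : (0 < k)%N -> cs_cocycle dist3 norm3 k f ->
  exists2 e, 0 < e & cocycle (small d e) k (extend0 f).
Proof.
move=> k0 [e [B [e0 fB fc]]].
have [eta eta0 H] := near_oo B.
have [e1 e10 E1] := extend0_dl fB.
have [e2 e20 E2] := small_cases eta0 e0.
exists (Num.min e1 e2); first by rewrite lt_min e10.
move=> s sz S; rewrite E1; last by left; rewrite sz.
  rewrite /extend0; case: asboolP => // soo.
  have {}S : small d e2 s by apply: small_le S; rewrite ge_min lexx orbT.
  have [sE|[_ S3]] := E2 s S; last by rewrite fc// size_map.
  rewrite -dl_map; apply: dl_eq0 => t ts tsz.
  apply: (extend0_near fB H) => //; try by move=> x /ts; first [exact: sE|exact: soo].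
  by move=> t0; move: tsz k0; rewrite t0 sz /= => <-.
by apply: small_le S; rewrite ge_min lexx.
Qed.

Lemma extend0_bound k f : (0 < k)%N -> cs_cocycle dist3 norm3 k f ->
  cs_bound dist3 norm3 k f ->
  exists (g : seq T -> F) e, 0 < e /\ bounds (small d e) k (extend0 f) g.
Proof.
move=> k0 [_ [B1 [_ fB _]]] [e [B [g [e0 gB g0 gb]]]].
have [eta eta0 H] := near_oo (Num.max B1 B).
have [e1 e10 E1] := extend0_dl gB.
have [e2 e20 E2] := small_cases eta0 e0.
exists (extend0 g), (Num.min e1 e2); rewrite lt_min e10; split=> // s sz S.
rewrite E1; last 2 first.
- by apply: small_le S; rewrite ge_min lexx.
- by right.
rewrite /extend0; case: asboolP => // soo.
have {}S : small d e2 s by apply: small_le S; rewrite ge_min lexx orbT.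
have [sE|[_ S3]] := E2 s S; last by rewrite gb// size_map.
have {}fB : supported norm3 (Num.max B1 B) f by apply: supported_le fB; rewrite le_max lexx.
have {}gB : supported norm3 (Num.max B1 B) g.
  by apply: supported_le gB; rewrite le_max lexx orbT.
rewrite (extend0_near fB H)//; last by move=> s0; move: k0; rewrite -sz s0.
rewrite -dl_map dl_eq0// => t ts tsz.
have [->//|t0] := pselect (t = [::]).
by apply: (extend0_near gB H) => // x /ts; [exact: sE|exact: soo].
Qed.

(** Near [oo] the cone with apex [oo] bounds [f]. Subtracting the coboundary of this cone, cut off
    near [oo], leaves a cocycle with compact support in the chart. *)
Lemma chart_transfer k (f : seq T -> F) e : (0 < k)%N -> 0 < e -> cocycle (small d e) k f ->
  exists f' g1 e', [/\ cs_cocycle dist3 norm3 k f', 0 < e' &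
    forall s, size s = k -> small d e' s -> f s = dl g1 s + extend0 f' s].
Proof.
move=> k0 e0 fc.
pose near (s : seq T) := {in s, forall x, d x oo < e / 2}.
pose g1 s := if `[< near s >] then f (oo :: s) else 0.
pose f1 s := f s - dl g1 s.
have f1near s : size s = k -> small d e s -> near s -> f1 s = 0.
  move=> sz S sn; rewrite /f1 (@dl_ext _ _ g1 (fun t => f (oo :: t))); last first.
    by move=> t ts _; rewrite /g1 asboolT// => x /ts /sn.
  rewrite (dl_cone f oo) fc ?subr0 ?subrr//=; first by rewrite sz.
  have e2 : e / 2 < e by move: e0; lra.
  move=> x y; rewrite !in_cons => /orP[/eqP->|xs] /orP[/eqP->|ys].
  - by rewrite d_refl.
  - by rewrite d_sym; apply: lt_trans (sn _ ys) e2.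
  - by apply: lt_trans (sn _ xs) e2.
  - exact: S.
have f1c : cocycle (small d e) k f1 by move=> s sz S; rewrite /f1 dlB dl_dl fc// subrr.
have e4 : 0 < e / 4 by rewrite divr_gt0.
have [B0 hB0] := sigma_bdd e4.
have [de de0 hde] := pi_unif e4.
pose f' (s : seq (space3 R)) :=
  if `[< {in s, forall u, norm3 u <= B0} >] then f1 (map pi s) else 0.
have map_near (s : seq (space3 R)) u : small dist3 de s -> u \in s -> B0 < norm3 u ->
    near (map pi s).
  move=> S us uB _ /mapP[v vs ->].
  have h1 : d (pi u) oo < e / 4.
    by rewrite ltNge; apply/negP => /hB0; rewrite sigmaK leNgt uB.
  apply: le_lt_trans (d_triangle _ (pi u) _) _.
  by have := hde _ _ (S v u vs us); move: h1; lra.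
have map_small (s : seq (space3 R)) : small dist3 de s -> small d e (map pi s).
  move=> S _ _ /mapP[u us ->] /mapP[v vs ->].
  by have := hde _ _ (S u v us vs); move: e0; lra.
have f'E s : size s = k -> small dist3 de s -> f' s = f1 (map pi s).
  move=> sz S; rewrite /f'; case: asboolP => // /existsNP[u /not_implyP[us /negP]].
  rewrite -ltNge => uB; rewrite f1near ?size_map//; first exact: map_small.
  exact: (map_near _ u).
have [e1 e10 E1] := small_cases e4 de0.
exists f', g1, (Num.min e e1); split.
- exists de, B0; split => //.
    move=> s [u us uB]; rewrite /f'; case: asboolP => // /(_ u us).
    by rewrite leNgt uB.
  move=> s sz S; rewrite (@dl_ext _ _ f' (fun t => f1 (map pi t))).
    by rewrite dl_map f1c ?size_map//; apply: map_small.
  by move=> t ts tsz; apply: f'E; [rewrite tsz sz|apply: small_sub S].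
- by rewrite lt_min e0.
move=> s sz S; rewrite -[f s](subrK (dl g1 s)) addrC; congr (_ + _).
rewrite -/(f1 s).
have Se : small d e s by apply: small_le S; rewrite ge_min lexx.
have {}S : small d e1 s by apply: small_le S; rewrite ge_min lexx orbT.
have piKs : {in s, forall x, x <> oo} -> map pi (map sigma s) = s.
  by move=> soo; rewrite -map_comp map_id_in// => x /soo /piK.
have [sE|[soo S3]] := E1 s S; last first.
  by rewrite /extend0 asboolT// f'E ?size_map// piKs.
rewrite f1near//; last by move=> x /sE h; move: e0 h; lra.
rewrite /extend0; case: asboolP => // soo; rewrite /f'; case: asboolP => // _.
by rewrite piKs// f1near// => x /sE h; move: e0 h; lra.
Qed.

Lemma chart_vanish k (f : seq T -> F) e : (0 < k)%N -> k != 4 -> 0 < e -> cocycle (small d e) k f ->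
  exists (g : seq T -> F) e', 0 < e' /\ bounds (small d e') k f g.
Proof.
move=> k0 k4 e0 fc.
have [f' [g1 [e1 [f'c e10 E]]]] := chart_transfer k0 e0 fc.
have [g2 [e2 [e20 E2]]] := extend0_bound k0 f'c (space3_vanish k0 k4 f'c).
exists (fun s => g1 s + g2 s), (Num.min e1 e2); rewrite lt_min e10; split=> // s sz S.
rewrite dlD -E2// ?E//; apply: small_le S; by rewrite ge_min lexx ?orbT.
Qed.

Definition bounding4 (f : seq T -> F) := exists g e, 0 < e /\ bounds (small d e) 4 f g.

Lemma extend0_not_bounding z : spanning z -> ~ bounding4 (extend0 z).
Proof.
move=> [zc zn _] [g [e [e0 gb]]]; apply: zn.
have [ez [B [ez0 zB zco]]] := zc.
have [eta eta0 H] := near_oo B.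
pose e1 := Num.min e eta / 2.
have e10 : 0 < e1 by rewrite divr_gt0// lt_min e0.
pose near (s : seq T) := {in s, forall x, d x oo < e1}.
have e1e : e1 + e1 <= e.
  by rewrite -splitr ge_min lexx.
have e1eta : e1 <= eta.
  have : e1 + e1 <= eta by rewrite -splitr ge_min lexx orbT.
  by move: e10; lra.
have near_small s : near s -> small d e s.
  move=> sn x y xs ys; apply: le_lt_trans (d_triangle x oo y) _.
  by have := sn x xs; have := sn y ys; rewrite (d_sym oo); move: e1e; lra.
(* on a neighbourhood of the point at infinity the primitive is itself a cocycle,
   hence a coboundary there, so it can be corrected to have compact support *)
pose g1 s := if `[< near s >] then g (oo :: s) else 0.
pose g2 s := g s - dl g1 s.
have gnear s : size s = 4 -> near s -> dl g s = 0.
  move=> sz sn; rewrite -gb//; last exact: near_small.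
  rewrite /extend0; case: asboolP => // soo; case: s sz sn soo => // x s _ sn soo.
  apply: zB; exists (sigma x); first by rewrite mem_head.
  apply: H; first by apply: soo; rewrite mem_head.
  by apply: lt_le_trans e1eta; apply: sn; rewrite mem_head.
have g2near s : size s = 3 -> near s -> g2 s = 0.
  move=> sz sn; rewrite /g2 (@dl_ext _ _ g1 (fun t => g (oo :: t))).
    rewrite (dl_cone g oo) gnear ?subr0 ?subrr//=; first by rewrite sz.
    by move=> x; rewrite in_cons => /orP[/eqP->|/sn//]; rewrite d_refl.
  by move=> t ts _; rewrite /g1 asboolT// => x /ts /sn.
have [de de0 hde] := pi_unif (divr_gt0 e10 (ltr0n R 2)).
have [B0 hB0] := sigma_bdd (divr_gt0 e10 (ltr0n R 2)).
pose e3 := Num.min de 1.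
pose G (s : seq (space3 R)) := if `[< [/\ s <> [::], small dist3 de s &
  {in s, forall u, norm3 u <= B0}] >] then g2 (map pi s) else 0.
have GE s : size s = 3 -> small dist3 de s -> G s = g2 (map pi s).
  move=> sz S; rewrite /G; case: asboolP => // ng.
  have [sB|/existsNP[u /not_implyP[us /negP]]] := pselect {in s, forall u, norm3 u <= B0}.
    by case: ng; split=> // h; move: sz; rewrite h.
  move=> uB; rewrite g2near ?size_map//; move: uB.
  rewrite -ltNge => uB _ /mapP[v vs ->].
  have h1 : d (pi u) oo < e1 / 2.
    by rewrite ltNge; apply/negP => /hB0; rewrite sigmaK leNgt uB.
  apply: le_lt_trans (d_triangle _ (pi u) _) _.
  by have := hde _ _ (S v u vs us); move: h1; lra.
exists de, B0, G; split=> //.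
- move=> s [u us uB]; rewrite /G; case: asboolP => // -[_ _ /(_ u us)].
  by rewrite leNgt uB.
- by rewrite /G; case: asboolP => // -[].
move=> s sz S; rewrite (@dl_ext _ _ G (fun t => g2 (map pi t))); last first.
  by move=> t ts tsz; apply: GE; [rewrite tsz sz|apply: small_sub S].
rewrite dl_map /g2 dlB dl_dl subr0 -gb ?size_map//.
  rewrite /extend0 asboolT; first by rewrite -map_comp map_id_in// => u _ /=.
  move=> _ /mapP[u us ->] E; have [eta' eta'0 /(_ u (lexx _))] := pi_away (norm3 u).
  by rewrite E d_refl leNgt eta'0.
move=> _ _ /mapP[u us ->] /mapP[v vs ->].
by have := hde _ _ (S u v us vs); move: e1e e10; lra.
Qed.

Lemma chart_spanning z : spanning z -> forall f e, 0 < e -> cocycle (small d e) 4 f ->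
  exists m, bounding4 (fun s => f s - m * extend0 z s).
Proof.
move=> [zc zn zs] f e e0 fc.
have [f' [g1 [e1 [f'c e10 E]]]] := @chart_transfer 4 _ _ isT e0 fc.
have [m mb] := zs f' f'c; exists m.
have cc : cs_cocycle dist3 norm3 4 (fun s => f' s - m * z s).
  have := cs_cocycle_lin 1 (- m) f'c zc; congr (cs_cocycle _ _ _ _).
  by apply/funext => s; rewrite mul1r mulNr.
have [g2 [e2 [e20 E2]]] := @extend0_bound 4 _ isT cc mb.
exists (fun s => g1 s + g2 s), (Num.min e1 e2); rewrite lt_min e10; split=> // s sz S.
rewrite dlD -E2//; last by apply: small_le S; rewrite ge_min lexx orbT.
rewrite extend0_lin addrA E//.
by apply: small_le S; rewrite ge_min lexx.
Qed.

Definition away_from (x : space3 R) (r : R) (f : seq T -> F) := forall s u, u \in s ->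
  (u = oo \/ r < dist3 (sigma u) x) -> f s = 0.

(** Contracting a generator by the factor [rho] concentrates it in a ball of radius [r]: these are
    the cohomology classes dual to points, and [tau] is the dual of a segment joining two of
    them. *)
Lemma point_classes r : 0 < r -> exists pt : space3 R -> seq T -> F,
  [/\ forall x, exists2 e, 0 < e & cocycle (small d e) 4 (pt x),
      forall x, away_from x r (pt x),
      forall x, ~ bounding4 (pt x),
      forall x f e, 0 < e -> cocycle (small d e) 4 f ->
        exists m, bounding4 (fun s => f s - m * pt x s) &
      forall x y, exists tau e, [/\ 0 < e, away_from x (r + dist3 x y) tau &
        bounds (small d e) 4 (fun s => pt y s - pt x s) tau]].
Proof.
move=> r0; have [z zs] := spanning_exists F R; have [zc zn zsp] := zs.
have [e0 [B [e00 zB0 zco]]] := zc.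
pose B' := Num.max B 1; have B'0 : 0 < B' by rewrite lt_max ltr01 orbT.
have zB : supported norm3 B' z by apply: supported_le zB0; rewrite le_max lexx.
pose rho := r / B'; have rho0 : 0 < rho by rewrite divr_gt0.
have Br : B' * rho = r by rewrite mulrC divfK// gt_eqF.
pose z1 x s := z (map (aff3 x rho) s).
have z1s x : spanning (z1 x) by apply: spanning_aff.
have z1B x s u : u \in s -> r < dist3 u x -> z1 x s = 0.
  move=> us ux; apply: zB; exists (aff3 x rho u); first exact: map_f.
  by rewrite norm3_aff// ltr_pdivlMr// Br.
have ext_away x r' f : (forall s u, u \in s -> r' < dist3 u x -> f s = 0) ->
    away_from x r' (extend0 f).
  move=> H s u us uE; rewrite /extend0; case: asboolP => // soo.
  case: uE => [/(soo u us)//|ux]; apply: (H _ (sigma u)) => //.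
  exact: map_f.
exists (fun x => extend0 (z1 x)); split => //.
- by move=> x; apply: extend0_cocycle => //; have [] := z1s x.
- by move=> x; apply: ext_away; apply: z1B.
- by move=> x; apply: extend0_not_bounding.
- by move=> x; apply: chart_spanning.
move=> x y.
have [tau [tau0 tauB taub]] := point_move x y rho0 e00 (ltW B'0) zB zco.
have tB : supported norm3 (norm3 x + (r + dist3 x y)) tau.
  move=> s [u us uB]; apply: (tauB _ u) => //; rewrite Br.
  by have := norm3_dist u x; move: uB; lra.
pose f s := z1 y s - 1 * z1 x s.
have fc : cs_cocycle dist3 norm3 4 f.
  have [yc _ _] := z1s y; have [xc _ _] := z1s x.
  have := cs_cocycle_lin 1 (- 1) yc xc; congr (cs_cocycle _ _ _ _).
  by apply/funext => s; rewrite mul1r mulNr.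
pose et := e0 * rho / 2; have et0 : 0 < et by rewrite divr_gt0// mulr_gt0.
have {}taub : bounds (small dist3 et) 4 f tau.
  by move=> s sz S; rewrite -taub// /f mul1r.
have [eta eta0 H] := near_oo (norm3 x + (r + dist3 x y)).
have [e1 e10 E1] := extend0_dl tB.
have [e2 e20 E2] := small_cases eta0 et0.
exists (extend0 tau), (Num.min e1 e2); split.
- by rewrite lt_min e10.
- by apply: ext_away => s u us uB; apply: (tauB _ u) => //; rewrite Br.
move=> s sz S; rewrite E1; last 2 first.
- by apply: small_le S; rewrite ge_min lexx.
- by right.
rewrite -[extend0 (z1 x) s]mul1r -extend0_lin -/f /extend0; case: asboolP => // soo.
have {}S : small d e2 s by apply: small_le S; rewrite ge_min lexx orbT.
have [sE|[_ S3]] := E2 s S; last by rewrite taub// size_map.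
have s0 : s <> [::] by move=> s0; move: sz; rewrite s0.
have far u : u \in s -> norm3 x + (r + dist3 x y) < norm3 (sigma u).
  by move=> us; apply: H; [exact: soo|exact: sE].
have hd u : u \in s -> r + dist3 x y < dist3 (sigma u) x.
  by move=> /far; have := norm3_dist (sigma u) x; lra.
have f0 : f (map sigma s) = 0.
  case: s s0 far hd {sz S sE soo} => // u s _ far hd.
  have hu := hd u (mem_head _ _).
  rewrite /f !(z1B _ _ (sigma u)) ?mulr0 ?subrr//= ?mem_head//.
    by have := dist3_ge0 x y; move: hu; lra.
  by have := dist3_triangle (sigma u) y x; rewrite (dist3C y); move: hu; lra.
rewrite f0 -dl_map dl_eq0// => t ts tsz; have [->//|t0] := pselect (t = [::]).
case: t t0 ts {tsz} => // u t _ ts.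
apply: (tauB _ (sigma u)); first by rewrite mem_head.
by rewrite Br; apply: hd; apply: ts; rewrite mem_head.
Qed.

End Chart.

(** * Duality for a closed set *)

Section Duality.
Variables (F : fieldType) (R : realType) (T : choiceType) (d : T -> T -> R).
Variables (oo : T) (sigma : T -> space3 R) (pi : space3 R -> T).
Notation dist3 := (@dist3 R).
Notation norm3 := (@norm3 R).
Hypothesis d_refl : forall x, d x x = 0.
Hypothesis d_sym : forall x y, d x y = d y x.
Hypothesis d_triangle : forall x y z, d x z <= d x y + d y z.
Hypothesis piK : forall x, x <> oo -> pi (sigma x) = x.
Hypothesis sigmaK : forall y, sigma (pi y) = y.
Hypothesis pi_unif : forall e, 0 < e ->
  exists2 de, 0 < de & forall y y', dist3 y y' < de -> d (pi y) (pi y') < e.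
Hypothesis sigma_unif : forall eta e, 0 < eta -> 0 < e ->
  exists2 de, 0 < de & forall x x', eta <= d x oo -> eta <= d x' oo -> d x x' < de ->
    dist3 (sigma x) (sigma x') < e.
Hypothesis sigma_bdd : forall eta, 0 < eta ->
  exists B, forall x, eta <= d x oo -> norm3 (sigma x) <= B.
Hypothesis pi_away : forall B, exists2 eta, 0 < eta &
  forall y, norm3 y <= B -> eta <= d (pi y) oo.

Variable K : T -> Prop.
Hypothesis K_oo : K oo.

Notation small := (small d).
Notation bounding4 := (@bounding4 F R T d).

Definition nearK (eta : R) (x : T) := exists2 y, K y & d x y < eta.
Definition farK (eta : R) (x : T) := forall y, K y -> eta <= d x y.

Lemma nearK_or_far eta x : nearK eta x \/ farK eta x.
Proof.
have [h|h] := pselect (nearK eta x); first by left.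
by right=> y Ky; rewrite leNgt; apply/negP => hy; apply: h; exists y.
Qed.

Lemma near_far eta x : nearK eta x -> ~ farK eta x.
Proof. by move=> [y Ky hy] /(_ y Ky); rewrite leNgt hy. Qed.

Lemma nearK_le eta eta' x : eta <= eta' -> nearK eta x -> nearK eta' x.
Proof. by move=> ee [y Ky hy]; exists y => //; apply: lt_le_trans ee. Qed.

Lemma small_near_or_far eta s : 0 < eta -> small (eta / 2) s ->
  {in s, forall x, nearK eta x} \/ {in s, forall x, farK (eta / 2) x}.
Proof.
move=> eta0 S; have [h|/existsNP[x /not_implyP[xs xf]]] :=
  pselect {in s, forall x, farK (eta / 2) x}; first by right.
left=> y ys; have [[z Kz xz]|//] := nearK_or_far (eta / 2) x.
exists z => //; apply: le_lt_trans (d_triangle _ x _) _.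
by have := S y x ys xs; move: xz; lra.
Qed.

(** Continuity is not asked: for composition with cochains it is enough that the displacement tends
    to 0 at [K]. *)
Definition retraction (r : T -> T) := (forall x, K x -> r x = x) /\
  forall eta, 0 < eta -> exists2 eta', 0 < eta' &
    forall x, nearK eta' x -> K (r x) /\ d x (r x) < eta.

Section Taut.
Variable r : T -> T.
Hypothesis rP : retraction r.

Lemma retract_small e : 0 < e -> exists eta e', [/\ 0 < eta, 0 < e' &
  forall s, small e' s -> {in s, forall x, nearK eta x} ->
    small_in d K e (map r s) /\ small e (s ++ map r s)].
Proof.
move=> e0; have e4 : 0 < e / 4 by rewrite divr_gt0.
have [eta eta0 H] := rP.2 _ e4.
exists eta, (e / 4); split=> // s S sn.
have rs x : x \in s -> d x (r x) < e / 4 by move=> /sn /H[].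
have h2 x y : x \in s -> y \in s -> d x (r y) < e / 2.
  move=> xs ys; apply: le_lt_trans (d_triangle _ y _) _.
  by have := S x y xs ys; have := rs y ys; lra.
have h3 x y : x \in s -> y \in s -> d (r x) (r y) < e.
  move=> xs ys; apply: le_lt_trans (d_triangle _ x _) _.
  by rewrite (d_sym (r x)); have := h2 x y xs ys; have := rs x xs; move: e0; lra.
split; [split|].
- by move=> _ _ /mapP[x xs ->] /mapP[y ys ->]; apply: h3.
- by move=> _ /mapP[x /sn/H[] ? _ ->].
move=> u v; rewrite !mem_cat => /orP[us|/mapP[x xs ->]] /orP[vs|/mapP[y ys ->]].
- by apply: lt_le_trans (S u v us vs) _; move: e0; lra.
- by apply: lt_le_trans (h2 _ _ us ys) _; move: e0; lra.
- by rewrite d_sym; apply: lt_le_trans (h2 _ _ vs xs) _; move: e0; lra.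
- exact: h3.
Qed.

Definition near_bounds k (f g : seq T -> F) := exists eta e, [/\ 0 < eta, 0 < e &
  forall s, size s = k -> small e s -> {in s, forall x, nearK eta x} -> f s = dl g s].

Definition near_cocycle k (f : seq T -> F) := exists eta e, [/\ 0 < eta, 0 < e &
  forall s, size s = k.+1 -> small e s -> {in s, forall x, nearK eta x} -> dl f s = 0].

(** Pulling the primitive on [K] back along [r] bounds the pullback of [f]; the prism between the
    identity and [r] accounts for the difference with [f]. *)
Lemma taut k f g e : near_cocycle k f -> 0 < e -> bounds (small_in d K e) k f g ->
  exists g', near_bounds k f g'.
Proof.
move=> [eta1 [e1 [eta10 e10 fc]]] e0 gb.
have m0 : 0 < Num.min e1 e by rewrite lt_min e10.
have [eta [e' [eta0 e'0 H]]] := retract_small m0.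
have h0 : 0 < Num.min eta eta1 by rewrite lt_min eta0.
exists (fun s => g (map r s) - prism id r f s), (Num.min eta eta1), e'; split=> //.
move=> s sz S sn.
have {}sn : {in s, forall x, nearK eta x} /\ {in s, forall x, nearK eta1 x}.
  by split=> x /sn; apply: nearK_le; rewrite ge_min lexx ?orbT.
have [[S1 S2] S3] := H s S sn.1.
rewrite dlB dl_map -gb ?size_map//; last first.
  by split=> // u v us vs; apply: lt_le_trans (S1 u v us vs) _; rewrite ge_min lexx orbT.
have := prism_homotopy id r f s; rewrite map_id [prism _ _ (dl f) s]prism_eq0.
  by rewrite addr0 => ->; rewrite subKr.
move=> t; rewrite map_id => ts tsz _; apply: fc; first by rewrite tsz sz.
  apply: small_sub ts _; apply: small_le S3; by rewrite ge_min lexx.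
move=> x /ts; rewrite mem_cat => /orP[/sn.2//|/S2 Kx].
by exists x => //; rewrite d_refl.
Qed.

Lemma retract_cocycle k (f : seq T -> F) e : 0 < e -> cocycle (small_in d K e) k f ->
  near_cocycle k (fun s => f (map r s)).
Proof.
move=> e0 fc; have [eta [e' [eta0 e'0 H]]] := retract_small e0.
exists eta, e'; split=> // s sz S sn; rewrite dl_map fc ?size_map//.
by have [] := H s S sn.
Qed.

End Taut.

(** The scale depends on the distance [eta] to [K], since a cocycle on the complement need not be
    uniform near [K]. *)
Definition local_cocycle (th : T -> T -> F) := forall eta, 0 < eta ->
  exists2 e, 0 < e & forall x y z, farK eta x -> farK eta y -> farK eta z ->
    d x y < e -> d y z < e -> d x z < e -> th x y + th y z = th x z.

Definition near_zero k (f : seq T -> F) := exists eta e, [/\ 0 < eta, 0 < e &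
  forall s, size s = k -> small e s -> {in s, forall x, nearK eta x} -> f s = 0].

(** A small list is either near [K], where [beta] vanishes, or far from it, where [th] is a cocycle.
    In both cases the product obeys the Leibniz rule of a globally closed [th]. *)
Lemma cup_cut th k beta : local_cocycle th -> (0 < k)%N -> near_zero k beta ->
  exists2 e, 0 < e & forall s, size s = k.+2 -> small e s ->
    dl (cup1 th beta) s = - cup1 th (dl beta) s.
Proof.
move=> thc k0 [eta [e1 [eta0 e10 bz]]].
have eta2 : 0 < eta / 2 by rewrite divr_gt0.
have [e2 e20 th2] := thc _ eta2.
exists (Num.min (eta / 2) (Num.min e1 e2)); first by rewrite !lt_min eta2 e10.
move=> s sz S.
have S0 : small (eta / 2) s by apply: small_le S; rewrite ge_min lexx.
have S1 : small e1 s by apply: small_le S; rewrite !ge_min lexx ?orbT.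
have S2 : small e2 s by apply: small_le S; rewrite !ge_min lexx ?orbT.
case: s sz S0 S1 S2 {S} => [//|x [//|y [|z t]]]; first by case: (k) k0.
move=> sz S0 S1 S2.
have [xin yin zin] : [/\ x \in [:: x, y, z & t], y \in [:: x, y, z & t] &
    z \in [:: x, y, z & t]] by rewrite !in_cons !eqxx ?orbT.
have [sn|sf] := small_near_or_far eta0 S0; last first.
  by rewrite dl_cup1 th2 ?subrr ?mul0r ?sub0r//; first [exact: sf|exact: S2].
have bzero u : {subset u <= [:: x, y, z & t]} -> size u = k -> beta u = 0.
  move=> us usz; apply: bz => //; first exact: small_sub S1.
  by move=> w /us /sn.
rewrite dl_cup1 bzero ?mulr0 ?sub0r//; last 1 first.
- by move: sz => /= [].
- by move=> w wt; rewrite !in_cons; move: wt; rewrite in_cons => ->; rewrite !orbT.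
Qed.

Lemma bounding4D f g : bounding4 f -> bounding4 g -> bounding4 (fun s => f s + g s).
Proof.
move=> [f' [e [e0 H]]] [g' [e' [e'0 H']]].
exists (fun s => f' s + g' s), (Num.min e e'); rewrite lt_min e0; split=> // s sz S.
by rewrite dlD H ?H'//; apply: small_le S; rewrite ge_min lexx ?orbT.
Qed.

Lemma bounding4Z m f : bounding4 f -> bounding4 (fun s => m * f s).
Proof.
move=> [f' [e [e0 H]]]; exists (fun s => m * f' s), e; split=> // s sz S.
by rewrite dlZ H.
Qed.

Lemma bounding4_ext f g : (exists2 e, 0 < e & forall s, size s = 4 -> small e s -> f s = g s) ->
  bounding4 f -> bounding4 g.
Proof.
move=> [e e0 H] [f' [e' [e'0 H']]].
exists f', (Num.min e e'); rewrite lt_min e0; split=> // s sz S.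
by rewrite -H ?H'//; apply: small_le S; rewrite ge_min lexx ?orbT.
Qed.

Lemma bounding4_eq f g : f =1 g -> bounding4 f -> bounding4 g.
Proof. by move=> H; apply: bounding4_ext; exists 1. Qed.

(** * The class dual to a closed chain of points *)

Section Cycle.
Variables (x : nat -> space3 R) (M : nat) (r eta : R).
Hypothesis r0 : 0 < r.
Hypothesis eta0 : 0 < eta.
Hypothesis x_closed : x M = x 0%N.
Hypothesis x_step : forall i, dist3 (x i) (x i.+1) < r.
Hypothesis x_far : forall i u, dist3 u (x i) <= 4 * r -> farK eta (pi u).

Definition cocycle_along (th : T -> T -> F) := forall i u v w,
  dist3 u (x i) <= 4 * r -> dist3 v (x i) <= 4 * r -> dist3 w (x i) <= 4 * r ->
  th (pi u) (pi v) + th (pi v) (pi w) = th (pi u) (pi w).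

Definition holonomy (th : T -> T -> F) := \sum_(i < M) th (pi (x i)) (pi (x i.+1)).

Let far_sigma i u : u <> oo -> dist3 (sigma u) (x i) <= 4 * r -> farK eta u.
Proof. by move=> uo; rewrite -{2}(piK uo); apply: x_far. Qed.

(** The duals of the successive segments add up to a closed cochain [tau], because their
    coboundaries telescope around the chain. Cup product with [tau] is evaluation on the chain: it
    gives the holonomy of [th] times the class of a point, up to sign. *)
Lemma cycle_dual : exists pt tau, [/\
  exists2 e, 0 < e & cocycle (small e) 4 pt, ~ bounding4 pt,
  forall f e, 0 < e -> cocycle (small e) 4 f ->
    exists m, bounding4 (fun s => f s - m * pt s),
  exists2 e, 0 < e & cocycle (small e) 3 tau &
  near_zero 3 tau /\ forall th, cocycle_along th ->
    bounding4 (fun s => cup1 th tau s + holonomy th * pt s)].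
Proof.
have [pt [ptc pta ptn pts ptm]] := @point_classes F R T d oo sigma pi d_refl d_sym
  d_triangle piK sigmaK pi_unif sigma_unif sigma_bdd pi_away r r0.
have [tau tauP] : exists tau : nat -> seq T -> F, forall i, exists e, [/\ 0 < e,
    away_from oo sigma (x i) (r + dist3 (x i) (x i.+1)) (tau i) &
    bounds (small e) 4 (fun s => pt (x i.+1) s - pt (x i) s) (tau i)].
  have [f fP] := choice (fun i => ptm (x i) (x i.+1)).
  by exists f.
have [ee eeP] := choice tauP.
pose e1 := \big[Num.min/1]_(i < M) ee i.
have e10 : 0 < e1.
  by rewrite /e1; elim/big_ind: _ => // [a b a0 b0|i _]; [rewrite lt_min a0|case: (eeP i)].
have e1P i s : (i < M)%N -> size s = 4 -> small e1 s ->
    pt (x i.+1) s - pt (x i) s = dl (tau i) s.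
  move=> iM sz S; have [_ _ h] := eeP i; apply: h => //; apply: small_le S.
  by rewrite /e1 (bigD1 (Ordinal iM)) //= ge_min lexx.
have tau_supp i s u : u \in s -> tau i s <> 0 -> u <> oo /\ dist3 (sigma u) (x i) <= 2 * r.
  move=> us tn; have [_ h _] := eeP i; split=> [uo|]; first by apply: tn; apply: (h _ u us); left.
  rewrite leNgt; apply/negP => hu; apply: tn; apply: (h _ u us); right.
  by have := x_step i; move: hu; lra.
have pt_supp i s u : u \in s -> pt (x i) s <> 0 -> u <> oo /\ dist3 (sigma u) (x i) <= r.
  move=> us tn; split=> [uo|]; first by apply: tn; apply: (pta _ _ u us); left.
  by rewrite leNgt; apply/negP => hu; apply: tn; apply: (pta _ _ u us); right.
pose t s := \sum_(i < M) tau i s.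
have dlt s : size s = 4 -> small e1 s -> dl t s = 0.
  move=> sz S; rewrite /t dl_sum (eq_bigr (fun i : 'I_M => pt (x i.+1) s - pt (x i) s)).
    rewrite -(big_mkord xpredT (fun i => pt (x i.+1) s - pt (x i) s)).
    by rewrite telescope_sumr// x_closed subrr.
  by move=> i _; rewrite e1P.
exists (pt (x 0%N)), t; split.
- exact: ptc.
- exact: ptn.
- exact: pts.
- by exists e1.
split.
  exists eta, 1; split=> // s sz S sn; rewrite /t big1// => i _.
  apply/eqP/negPn/negP => /eqP tn; case: s sz S sn tn => // u s sz S sn tn.
  have [uo ux] := tau_supp i _ u (mem_head _ _) tn.
  apply: near_far (sn u (mem_head _ _)) _; apply: (@far_sigma i) => //.
  by apply: le_trans ux _; move: r0; lra.
move=> th thc.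
(* A primitive of [th] on the ball around [x i]. Near [x i.+1] it differs from [A i.+1] by the
   constant [th (pi (x i)) (pi (x i.+1))]; summation by parts collects these constants into the
   holonomy. *)
pose A i u := th (pi (x i)) u.
have r4 : 0 <= 4 * r by move: r0; lra.
have thA i u v : u <> oo -> v <> oo -> dist3 (sigma u) (x i) <= 4 * r ->
    dist3 (sigma v) (x i) <= 4 * r -> A i v - A i u = th u v.
  move=> uo vo ud vd; have := thc i (x i) (sigma u) (sigma v).
  rewrite dist3xx !piK// /A => <- //; by rewrite addrAC subrr add0r.
have [e2 e20 e2P] : exists2 e2, 0 < e2 & forall i u v, (i < M)%N -> u <> oo -> d u v < e2 ->
    dist3 (sigma u) (x i) <= 2 * r -> v <> oo /\ dist3 (sigma v) (x i) <= 4 * r.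
  have [B hB] : exists B, forall i, (i < M)%N -> norm3 (x i) + 2 * r <= B.
    exists (\big[Num.max/0]_(i < M) (norm3 (x i) + 2 * r)) => i iM.
    by rewrite (bigD1 (Ordinal iM)) //= le_max lexx.
  have [et et0 hEt] := pi_away B.
  have et2 : 0 < et / 2 by rewrite divr_gt0.
  have r2 : 0 < 2 * r by rewrite mulr_gt0.
  have [de de0 hde] := sigma_unif et2 r2.
  exists (Num.min de (et / 2)); first by rewrite lt_min de0.
  move=> i u v iM uo; rewrite lt_min => /andP[uv1 uv2] ud.
  have h1 : et <= d u oo.
    rewrite -(piK uo); apply: hEt; apply: le_trans (hB i iM).
    by have := norm3_dist (sigma u) (x i); move: ud; lra.
  have h2 : et / 2 <= d v oo by have := d_triangle u v oo; move: h1 uv2; lra.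
  split=> [vo|]; first by move: h2; rewrite vo d_refl; move: et0; lra.
  have h3 := hde u v _ h2 uv1; apply: le_trans (dist3_triangle _ (sigma u) _) _.
  rewrite (dist3C (sigma v)); have : et / 2 <= d u oo by move: et0 h1; lra.
  by move=> /h3 h4; move: ud h4; lra.
(* The partial sums [C i] carry the point class at [x i] back to the one at [x 0]. *)
pose C i s := \sum_(j < i) tau j s.
have CP i s : (i <= M)%N -> size s = 4 -> small e1 s ->
    pt (x i) s = pt (x 0%N) s + dl (C i) s.
  move=> iM sz S; rewrite /C dl_sum.
  rewrite (eq_bigr (fun j : 'I_i => pt (x j.+1) s - pt (x j) s)).
    rewrite -(big_mkord xpredT (fun i => pt (x i.+1) s - pt (x i) s)).
    by rewrite telescope_sumr// addrC subrK.
  by move=> j _; rewrite e1P// (leq_trans (ltn_ord j)).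
exists (fun s => \sum_(i < M) cup0 (A i) (tau i) s -
   \sum_(i < M) th (pi (x i)) (pi (x i.+1)) * C i.+1 s), (Num.min e1 e2).
rewrite lt_min e10; split=> // s sz S.
have S1 : small e1 s by apply: small_le S; rewrite ge_min lexx.
have S2 : small e2 s by apply: small_le S; rewrite ge_min lexx orbT.
rewrite dlB !dl_sum.
rewrite [X in _ = _ - X](eq_bigr (fun i : 'I_M =>
    th (pi (x i)) (pi (x i.+1)) * (pt (x i.+1) s - pt (x 0%N) s))); last first.
  by move=> i _; rewrite dlZ (CP i.+1)// addrAC subrr add0r.
case: s sz S S1 S2 => [//|u [//|v s]] sz S S1 S2.
have [us vs] : u \in [:: u, v & s] /\ v \in [:: u, v & s] by rewrite !in_cons !eqxx ?orbT.
have E1 i : (i < M)%N -> dl (cup0 (A i) (tau i)) [:: u, v & s] =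
    th u v * tau i (v :: s) + A i u * (pt (x i.+1) [:: u, v & s] - pt (x i) [:: u, v & s]).
  move=> iM; rewrite dl_cup0 e1P//; congr (_ + _).
  have [->|/eqP tn] := eqVneq (tau i (v :: s)) 0; first by rewrite !mulr0.
  have [vo vd] := tau_supp i _ v (mem_head _ _) tn.
  have [uo ud] := e2P i v u iM vo (S2 v u vs us) vd.
  by rewrite (thA i u v)//; apply: le_trans vd _; move: r0; lra.
have E2 i : (i < M)%N -> A i u * pt (x i.+1) [:: u, v & s] =
   (th (pi (x i)) (pi (x i.+1)) + A i.+1 u) * pt (x i.+1) [:: u, v & s].
  move=> iM; have [->|/eqP tn] := eqVneq (pt (x i.+1) [:: u, v & s]) 0.
    by rewrite !mulr0.
  have [uo ud] := pt_supp _ _ u us tn; congr (_ * _); rewrite /A.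
  rewrite -(piK uo); apply/esym; apply: (thc i).
  - by rewrite dist3xx.
  - by rewrite dist3C; apply/ltW; apply: lt_le_trans (x_step i) _; move: r0; lra.
  - apply: le_trans (dist3_triangle _ (x i.+1) _) _; rewrite (dist3C (x i.+1)).
    by have := x_step i; move: ud r0; lra.
rewrite [X in _ = X - _](eq_bigr (fun i : 'I_M => th u v * tau i (v :: s) +
    (th (pi (x i)) (pi (x i.+1)) * pt (x i.+1) [:: u, v & s] +
     (A i.+1 u * pt (x i.+1) [:: u, v & s] - A i u * pt (x i) [:: u, v & s])))).
  rewrite 2!big_split /= -(big_mkord xpredT
    (fun i => A i.+1 u * pt (x i.+1) [:: u, v & s] - A i u * pt (x i) [:: u, v & s])).
  rewrite telescope_sumr// /A x_closed subrr addr0 -mulr_sumr -/(t (v :: s)).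
  rewrite -addrA; congr (_ + _); rewrite -sumrB /holonomy mulr_suml.
  apply: eq_bigr => i _; by ring.
by move=> i _; rewrite E1// mulrBr E2//; congr (_ + _); ring.
Qed.

End Cycle.
End Duality.

(** * Linking with the closed set, and the first cohomology of its complement *)

Section Link.
Variables (F : fieldType) (R : realType) (T : choiceType) (d : T -> T -> R).
Variables (oo : T) (sigma : T -> space3 R) (pi : space3 R -> T).
Notation dist3 := (@dist3 R).
Notation norm3 := (@norm3 R).
Hypothesis d_refl : forall x, d x x = 0.
Hypothesis d_sym : forall x y, d x y = d y x.
Hypothesis d_triangle : forall x y z, d x z <= d x y + d y z.
Hypothesis piK : forall x, x <> oo -> pi (sigma x) = x.
Hypothesis sigmaK : forall y, sigma (pi y) = y.
Hypothesis pi_unif : forall e, 0 < e ->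
  exists2 de, 0 < de & forall y y', dist3 y y' < de -> d (pi y) (pi y') < e.
Hypothesis sigma_unif : forall eta e, 0 < eta -> 0 < e ->
  exists2 de, 0 < de & forall x x', eta <= d x oo -> eta <= d x' oo -> d x x' < de ->
    dist3 (sigma x) (sigma x') < e.
Hypothesis sigma_bdd : forall eta, 0 < eta ->
  exists B, forall x, eta <= d x oo -> norm3 (sigma x) <= B.
Hypothesis pi_away : forall B, exists2 eta, 0 < eta &
  forall y, norm3 y <= B -> eta <= d (pi y) oo.
Variable K : T -> Prop.
Hypothesis K_oo : K oo.
Hypothesis K_H1 : forall (f1 f2 : seq T -> F) e, 0 < e ->
  cocycle (small_in d K e) 2 f1 -> cocycle (small_in d K e) 2 f2 ->
  exists m1 m2 h e', [/\ (m1 != 0) || (m2 != 0), 0 < e' &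
    bounds (small_in d K e') 2 (fun s => m1 * f1 s + m2 * f2 s) h].

Notation small := (small d).
Notation bounding4 := (@bounding4 F R T d).
Notation farK := (farK d K).
Notation nearK := (nearK d K).

Definition spans_H1 (s1 : seq T -> F) :=
  (exists2 e, 0 < e & cocycle (small_in d K e) 2 s1) /\
  forall f e, 0 < e -> cocycle (small_in d K e) 2 f -> exists l h e', 0 < e' /\
    bounds (small_in d K e') 2 (fun s => f s - l * s1 s) h.

Lemma spans_H1_nonbounding s1 e : 0 < e -> cocycle (small_in d K e) 2 s1 ->
  (forall h e', 0 < e' -> ~ bounds (small_in d K e') 2 s1 h) -> spans_H1 s1.
Proof.
move=> e0 sc sn; split; first by exists e.
move=> f e1 e10 fc; have e20 : 0 < Num.min e e1 by rewrite lt_min e0.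
have [||m1 [m2 [h [e' [m12 e'0 hb]]]]] := @K_H1 f s1 _ e20.
- by move=> s sz S; apply: fc => //; apply: small_in_le S; rewrite ge_min lexx orbT.
- by move=> s sz S; apply: sc => //; apply: small_in_le S; rewrite ge_min lexx.
have m10 : m1 != 0.
  apply/negP => /eqP m10; move: m12 hb; rewrite m10 eqxx /= => m20 hb.
  apply: (sn (fun s => m2^-1 * h s) e' e'0) => s sz S.
  by rewrite dlZ -hb// mul0r add0r mulKf.
exists (- m2 / m1), (fun s => m1^-1 * h s), e'; split=> // s sz S.
by rewrite dlZ -hb// mulrDr mulKf// !mulNr opprK mulrA (mulrC m2).
Qed.

Lemma spans_H1_exists : exists s1, spans_H1 s1.
Proof.
have [[s1 [e [e0 sc sn]]]|H] := pselect (exists (s1 : seq T -> F) (e : R), [/\ 0 < e,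
    cocycle (small_in d K e) 2 s1 &
    forall h e', 0 < e' -> ~ bounds (small_in d K e') 2 s1 h]).
  by exists s1; exact: (spans_H1_nonbounding e0 sc sn).
exists (fun=> 0); split; first by exists 1 => // s _ _; rewrite dl0.
move=> f e e0 fc; apply: contrapT => nb; apply: H; exists f, e; split=> // h e' e'0 hb.
by apply: nb; exists 0, h, e'; split=> // s sz S; rewrite mul0r subr0 hb.
Qed.

Variable r : T -> T.
Hypothesis rP : retraction d K r.

Definition cutoff (s1 : seq T -> F) (s : seq T) : F :=
  if `[< {in s, forall x, nearK 1 x} >] then s1 (map r s) else 0.

(** The dual [tau] of the chain bounds on the sphere, [tau = dl beta], and vanishes near [K]. So
    [beta] restricts to a cocycle on [K], equal to [l] times [s1] up to a coboundary; [l] plays the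
    part of a linking number. *)
Lemma link s1 (x : nat -> space3 R) (M : nat) (rr eta : R) :
  spans_H1 s1 -> 0 < rr -> 0 < eta -> x M = x 0%N ->
  (forall i, dist3 (x i) (x i.+1) < rr) ->
  (forall i u, dist3 u (x i) <= 4 * rr -> farK eta (pi u)) ->
  exists pt l, [/\ exists2 e, 0 < e & cocycle (small e) 4 pt, ~ bounding4 pt,
    forall f e, 0 < e -> cocycle (small e) 4 f ->
      exists m, bounding4 (fun s => f s - m * pt s) &
    forall th, local_cocycle d K th -> cocycle_along pi x rr th ->
      bounding4 (fun s => holonomy pi x M th * pt s +
        l * cup1 th (dl (cutoff s1)) s)].
Proof.
move=> [[es es0 sc] ss] rr0 eta0 xM xs xf.
have [pt [tau [ptc ptn pts [et et0 tauc] [tauz tauH]]]] :=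
  @cycle_dual F R T d oo sigma pi d_refl d_sym
  d_triangle piK sigmaK pi_unif sigma_unif sigma_bdd pi_away K x M rr eta rr0 eta0 xM xs xf.
have [beta [e1 [e10 hb]]] := @chart_vanish F R T d oo sigma pi d_refl d_sym
  d_triangle piK sigmaK pi_unif sigma_unif sigma_bdd pi_away 3 tau et isT isT et0 tauc.
have [eta1 [e2 [eta10 e20 tz]]] := tauz.
have e30 : 0 < Num.min e1 e2 by rewrite lt_min e10.
have e31 s : small (Num.min e1 e2) s -> small e1 s /\ small e2 s.
  by move=> S; split; apply: small_le S; rewrite ge_min lexx ?orbT.
have bco s : size s = 3 -> small (Num.min e1 e2) s -> {in s, forall y, nearK eta1 y} ->
    dl beta s = 0.
  by move=> sz /e31[S1 S2] sn; rewrite -hb// tz.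
have [l [h [e4 [e40 lb]]]] : exists l h e', 0 < e' /\
    bounds (small_in d K e') 2 (fun s => beta s - l * s1 s) h.
  apply: (ss _ _ e30) => s sz [S sK]; apply: bco => // y /sK Ky.
  by exists y => //; rewrite d_refl.
have [eta2 [e5 [eta20 e50 rc]]] := retract_cocycle d_sym d_triangle rP es0 sc.
have [h' [eta3 [e6 [eta30 e60 hb']]]] : exists g',
    near_bounds d K 2 (fun s => beta s - l * s1 (map r s)) g'.
  apply: (taut d_refl d_sym d_triangle rP (g := h) _ e40); last first.
    move=> s sz S; rewrite -lb//; congr (_ - _ * s1 _).
    by rewrite map_id_in// => y ys; apply: rP.1; apply: S.2.
  exists (Num.min eta1 eta2), (Num.min (Num.min e1 e2) e5).
  rewrite !lt_min eta10 eta20 e10 e20 e50; split=> // s sz S sn.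
  rewrite dlB dlZ bco ?rc ?mulr0 ?subrr//.
  - by apply: small_le S; rewrite ge_min lexx orbT.
  - by move=> y /sn; apply: nearK_le; rewrite ge_min lexx orbT.
  - by apply: small_le S; rewrite ge_min lexx.
  - by move=> y /sn; apply: nearK_le; rewrite ge_min lexx.
exists pt, l; split=> // th thc tha.
(* By tautness [bo] vanishes near [K], so its product with [th] is defined everywhere and its
   coboundary compares the product with [tau] to [l] times the product with the coboundary of
   [cutoff s1]. *)
pose bo s := beta s - dl h' s - l * cutoff s1 s.
have boz : near_zero d K 2 bo.
  exists (Num.min eta3 1), e6; rewrite lt_min eta30 ltr01; split=> // s sz S sn.
  rewrite /bo -hb'//; last by move=> y /sn; apply: nearK_le; rewrite ge_min lexx.
  rewrite /cutoff asboolT; first by ring.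
  by move=> y /sn; apply: nearK_le; rewrite ge_min lexx orbT.
have [e7 e70 H7] := cup_cut d_triangle thc (k := 2) isT boz.
have h1 : bounding4 (fun s => - (cup1 th tau s - l * cup1 th (dl (cutoff s1)) s)).
  exists (cup1 th bo), (Num.min e1 e7); rewrite lt_min e10; split=> // s sz S.
  rewrite H7//; last by apply: small_le S; rewrite ge_min lexx orbT.
  case: s sz S => [//|a [//|b s]] sz S; congr (- _); rewrite /cup1 /bo.
  rewrite dlB dlB dl_dl dlZ subr0 -hb; first by ring.
    by move: sz => /= [->].
  apply: (@small_le _ _ _ (Num.min e1 e7)); first by rewrite ge_min lexx.
  by apply: small_sub S => v vt; rewrite in_cons vt orbT.
have := bounding4D h1 (tauH th tha); apply: bounding4_eq => s; ring.
Qed.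

(** By [link] the holonomy of a cocycle along a chain is governed by one class in H^3, its product
    with the coboundary of [cutoff s1]. The coefficients [l], [l'] and [m] depend on the chains
    only, so they cancel between the two cocycles. *)
Lemma holonomy_proportional (x x' : nat -> space3 R) M M' rr rr' eta eta' (a b : T -> T -> F) :
  0 < rr -> 0 < eta -> x M = x 0%N ->
  (forall i, dist3 (x i) (x i.+1) < rr) ->
  (forall i u, dist3 u (x i) <= 4 * rr -> farK eta (pi u)) ->
  0 < rr' -> 0 < eta' -> x' M' = x' 0%N ->
  (forall i, dist3 (x' i) (x' i.+1) < rr') ->
  (forall i u, dist3 u (x' i) <= 4 * rr' -> farK eta' (pi u)) ->
  local_cocycle d K a -> local_cocycle d K b ->
  cocycle_along pi x rr a -> cocycle_along pi x rr b ->
  cocycle_along pi x' rr' a -> cocycle_along pi x' rr' b ->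
  holonomy pi x M a * holonomy pi x' M' b = holonomy pi x M b * holonomy pi x' M' a.
Proof.
move=> h1 h2 h3 h4 h5 h1' h2' h3' h4' h5' ac bc ax bx ax' bx'.
have [s1 s1P] := spans_H1_exists.
have [pt [l [ptc ptn pts ptH]]] := link s1P h1 h2 h3 h4 h5.
have [pt' [l' [ptc' ptn' pts' ptH']]] := link s1P h1' h2' h3' h4' h5'.
have [e' e'0 pc'] := ptc'; have [m mb] := pts _ _ e'0 pc'.
have m0 : m != 0.
  apply/negP => /eqP m0; apply: ptn'; move: mb; rewrite m0.
  by apply: bounding4_eq => s; rewrite mul0r subr0.
have no c : bounding4 (fun s => c * pt s) -> c = 0.
  move=> cb; apply/eqP/negPn/negP => c0; apply: ptn.
  by have := bounding4Z c^-1 cb; apply: bounding4_eq => s; rewrite mulKf.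
have key th : local_cocycle d K th -> cocycle_along pi x rr th ->
    cocycle_along pi x' rr' th ->
    l' * holonomy pi x M th = l * m * holonomy pi x' M' th.
  move=> tc tx tx'; apply/eqP; rewrite -subr_eq0; apply/eqP; apply: no.
  have b1 := bounding4Z l' (ptH th tc tx).
  have b2 := bounding4Z (- l) (ptH' th tc tx').
  have b3 := bounding4Z (l * holonomy pi x' M' th) mb.
  by have := bounding4D (bounding4D b1 b2) b3; apply: bounding4_eq => s; ring.
have ka := key a ac ax ax'; have kb := key b bc bx bx'.
have [l0|l0] := eqVneq l 0.
  have z (th : T -> T -> F) : local_cocycle d K th -> cocycle_along pi x rr th ->
      holonomy pi x M th = 0.
    move=> tc tx; apply: no; have := ptH th tc tx; apply: bounding4_eq => s.
    by rewrite l0 mul0r addr0.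
  by rewrite !z// !mul0r.
have lm : l * m != 0 by rewrite mulf_neq0.
apply: (mulfI lm); rewrite mulrCA -kb mulrCA [RHS]mulrCA -ka; ring.
Qed.

Hypothesis K_H2 : vanish F d K 3.

(** The points [x] and [y] have cohomologous duals, and their difference can be bounded by a cochain
    vanishing near [K], because the cohomology of [K] vanishes in that degree. Multiplying by the
    locally constant [ch] makes [ch y] and [ch x] times the two classes cohomologous, and a point
    class does not bound. *)
Lemma complement_connected (ch : T -> F) x y eta : 0 < eta ->
  (forall eta, 0 < eta -> exists2 e, 0 < e & forall u v, farK eta u -> farK eta v ->
     d u v < e -> ch u = ch v) ->
  farK eta x -> farK eta y -> ch x = ch y.
Proof.
move=> eta0 chc xf yf.
have xo : x <> oo by move=> E; have := xf oo K_oo; rewrite E d_refl leNgt eta0.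
have yo : y <> oo by move=> E; have := yf oo K_oo; rewrite E d_refl leNgt eta0.
have eta2 : 0 < eta / 2 by rewrite divr_gt0.
have [ec ec0 chP] := chc _ eta2.
have [de de0 hde] : exists2 de, 0 < de & forall u v, dist3 u v < de ->
    d (pi u) (pi v) < Num.min (eta / 2) ec.
  by apply: pi_unif; rewrite lt_min eta2.
have d2 : 0 < de / 2 by rewrite divr_gt0.
have [pt [ptc pta ptn pts ptm]] := @point_classes F R T d oo sigma pi d_refl d_sym
  d_triangle piK sigmaK pi_unif sigma_unif sigma_bdd pi_away _ d2.
have near_ball z u : z <> oo -> farK eta z -> u <> oo ->
    dist3 (sigma u) (sigma z) <= de / 2 -> farK (eta / 2) u /\ ch u = ch z.
  move=> zo zf uo uz.
  have : d u z < Num.min (eta / 2) ec.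
    rewrite -{1}(piK uo) -{1}(piK zo); apply: hde; apply: le_lt_trans uz _.
    by move: de0; lra.
  rewrite lt_min => /andP[uz1 uz2].
  have zf2 : farK (eta / 2) z by move=> w /zf; move: eta0; lra.
  have uf : farK (eta / 2) u.
    by move=> w Kw; have := zf w Kw; have := d_triangle z u w; rewrite (d_sym z u); move: uz1; lra.
  by split=> //; apply: chP.
have pt_near z s u : z <> oo -> farK eta z -> u \in s -> pt (sigma z) s <> 0 ->
    farK (eta / 2) u /\ ch u = ch z.
  move=> zo zf us pn; have uo : u <> oo.
    by move=> uo; apply: pn; apply: (pta _ _ u us); left.
  apply: near_ball => //; rewrite leNgt; apply/negP => h; apply: pn.
  by apply: (pta _ _ u us); right.
have [tau [e [e0 _ taub]]] := ptm (sigma x) (sigma y).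
have ptz z s : z <> oo -> farK eta z -> s <> [::] ->
    {in s, forall u, nearK (eta / 2) u} -> pt (sigma z) s = 0.
  move=> zo zf; case: s => // u s _ sn.
  have [//|/eqP pn] := eqVneq (pt (sigma z) (u :: s)) 0.
  have [uf _] := pt_near z _ u zo zf (mem_head _ _) pn.
  by case: (near_far (sn u (mem_head _ _)) uf).
have tc s : size s = 4 -> small e s -> {in s, forall u, nearK (eta / 2) u} -> dl tau s = 0.
  move=> sz S sn; rewrite -taub// !ptz ?subrr// => s0; by move: sz; rewrite s0.
have [h [e1 [e10 hb]]] : exists g e', 0 < e' /\ bounds (small_in d K e') 3 tau g.
  apply: (K_H2 e0) => s sz [S sK]; apply: tc => // u /sK Ku.
  by exists u => //; rewrite d_refl.
have [h' [eta3 [e2 [eta30 e20 hb']]]] : exists g', near_bounds d K 3 tau g'.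
  by apply: (taut d_refl d_sym d_triangle rP _ e10 hb); exists (eta / 2), e.
pose bo s := tau s - dl h' s.
have eta4 : 0 < eta3 / 2 by rewrite divr_gt0.
have [e3 e30 chP3] := chc _ eta4.
have main : bounding4 (fun s => ch y * pt (sigma y) s - ch x * pt (sigma x) s).
  exists (cup0 ch bo), (Num.min (Num.min e e2) (Num.min e3 (eta3 / 2))).
  rewrite !lt_min e0 e20 e30 eta4; split=> // s sz S.
  have S1 : small e s by apply: small_le S; rewrite !ge_min lexx.
  have S2 : small e2 s by apply: small_le S; rewrite !ge_min lexx ?orbT.
  have S3 : small e3 s by apply: small_le S; rewrite !ge_min lexx ?orbT.
  have S4 : small (eta3 / 2) s by apply: small_le S; rewrite !ge_min lexx ?orbT.
  case: s sz S1 S2 S3 S4 {S} => [//|u [//|v s]] sz S1 S2 S3 S4.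
  have [us vs] : u \in [:: u, v & s] /\ v \in [:: u, v & s].
    by rewrite !in_cons !eqxx ?orbT.
  have vsub : {subset v :: s <= [:: u, v & s]} by move=> w wt; rewrite in_cons wt orbT.
  have E1 : (ch v - ch u) * bo (v :: s) = 0.
    have [sn|sf] := small_near_or_far d_triangle K eta30 S4.
      rewrite /bo hb' ?subrr ?mulr0//; first by move: sz => /= [->].
        exact: small_sub S2.
      by move=> w /vsub /sn.
    by rewrite (chP3 v u) ?subrr ?mul0r//; [exact: sf|exact: sf|exact: S3].
  have ptE z : z <> oo -> farK eta z ->
      ch z * pt (sigma z) [:: u, v & s] = ch u * pt (sigma z) [:: u, v & s].
    move=> zo zf; have [->|/eqP pn] := eqVneq (pt (sigma z) [:: u, v & s]) 0.
      by rewrite !mulr0.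
    by have [_ ->] := pt_near z _ u zo zf us pn.
  by rewrite dl_cup0 E1 add0r /bo dlB dl_dl subr0 -taub// !ptE// -mulrBr.
have b2 : bounding4 (fun s => pt (sigma y) s - pt (sigma x) s) by exists tau, e.
apply/eqP; rewrite -subr_eq0; apply/eqP/eqP/negPn/negP => n0.
apply: (ptn (sigma x)).
have := bounding4Z (ch x - ch y)^-1 (bounding4D (bounding4Z (ch y) b2) (bounding4Z (- 1) main)).
by apply: bounding4_eq => s; rewrite -[RHS](mulKf n0); congr (_ * _); ring.
Qed.

End Link.

(** * Classes invariant under a free map of prime order *)

Section Retraction.
Variables (R : realType) (T : choiceType) (d : T -> T -> R).
Variables (psi : T -> T) (p : nat) (oo : T) (K : T -> Prop).
Hypothesis d_refl : forall x, d x x = 0.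
Hypothesis d_ge0 : forall x y, 0 <= d x y.
Hypothesis p_gt0 : (0 < p)%N.
Hypothesis psi_p : forall x, iter p psi x = x.
Hypothesis psi_iso : forall x y, d (psi x) (psi y) = d x y.
Hypothesis psi_K : forall x, K (psi x) <-> K x.
Hypothesis psi_free : forall x i, iter i psi x = x -> (p %| i)%N.
Hypothesis K_oo : K oo.
Hypothesis K_closed : forall y, ~ K y -> exists2 eta, 0 < eta & farK d K eta y.

(** The infimum of the distances to [K] is positive off [K], so a point within twice the infimum
    exists without any attainment argument. *)
Lemma near_point_exists y : exists z, ~ K y -> K z /\
  forall eta, nearK d K eta y -> d y z < 2 * eta.
Proof.
have [Ky|nK] := pselect (K y); first by exists oo.
have [eta0 eta00 yf] := K_closed nK.
pose E := [set d y z | z in K].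
have Ei : has_inf E.
  split; first by exists (d y oo), oo.
  by exists 0 => _ [z _ <-].
have E0 : eta0 <= inf E.
  by apply: lb_le_inf; [exact: Ei.1|move=> _ [z Kz <-]; exact: yf].
have E00 : 0 < inf E by apply: lt_le_trans E0.
have [_ [z Kz <-] zE] := inf_adherent E00 Ei.
exists z => _; split=> // eta [w Kw wy].
have : inf E <= d y w by apply: ge_inf; [exact: Ei.2|exists w].
by move: zE wy; lra.
Qed.

Lemma iter_iso i x y : d (iter i psi x) (iter i psi y) = d x y.
Proof. by elim: i => //= i <-; rewrite psi_iso. Qed.

Lemma iter_K i x : K (iter i psi x) <-> K x.
Proof. by elim: i => //= i <-; rewrite psi_K. Qed.

(** Equivariance is forced: the near point is chosen for the translate of phase 0 and carried to the
    other phases by the isometry [psi]. *)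
Lemma retraction_exists : exists r, [/\ retraction d K r, forall x, K (r x) &
  forall x, r (psi x) = psi (r x)].
Proof.
have [ph hph] := phase_exists oo p_gt0 psi_p psi_free.
have [n nP] := choice near_point_exists.
pose b x := iter (p - ph x) psi x.
have bK x : iter (ph x) psi (b x) = x.
  by rewrite /b -iterD subnKC ?psi_p//; apply/ltnW; have [] := hph x.
have b_psi x : b (psi x) = b x.
  have [hp hS] := hph x; rewrite /b hS -iterSr.
  have [hlt|hge] := ltnP (ph x).+1 p; first by rewrite modn_small// subnSK.
  have -> : (ph x).+1 = p by apply/eqP; rewrite eqn_leq hp.
  rewrite modnn subn0 iterSr psi_p.
  by rewrite (_ : p - ph x = 1)%N// -(subnn (ph x).+1); move: hp hge; clear; lia.
exists (fun x => if `[< K x >] then x else iter (ph x) psi (n (b x))); split; last 2 first.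
- move=> x; case: asboolP => // Kx.
  have nKb : ~ K (b x) by rewrite /b iter_K.
  by rewrite iter_K; have [] := nP (b x) nKb.
- move=> x; rewrite (asbool_equiv_eq (psi_K x)); case: asboolP => // _.
  by rewrite b_psi; have [_ ->] := hph x; rewrite iter_mod.
split=> [x Kx|eta eta0]; first by rewrite asboolT.
exists (eta / 2); first by rewrite divr_gt0.
move=> x xn; case: asboolP => Kx; first by rewrite d_refl.
have nKb : ~ K (b x) by rewrite /b iter_K.
have [Kn nb] := nP (b x) nKb; split; first by rewrite iter_K.
rewrite -{1}(bK x) iter_iso.
have := nb (eta / 2); rewrite (_ : 2 * (eta / 2) = eta); last by rewrite mulrC divfK.
apply.
have [z Kz xz] := xn; exists (iter (p - ph x) psi z); first by rewrite iter_K.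
by rewrite /b iter_iso.
Qed.

End Retraction.

(** * Smith theory against an invariant class of nonzero holonomy *)

Section NoInvariantClass.
Variables (F : fieldType) (R : realType) (T : choiceType) (d : T -> T -> R).
Variables (oo : T) (sigma : T -> space3 R) (pi : space3 R -> T).
Notation dist3 := (@dist3 R).
Notation norm3 := (@norm3 R).
Hypothesis d_refl : forall x, d x x = 0.
Hypothesis d_sym : forall x y, d x y = d y x.
Hypothesis d_triangle : forall x y z, d x z <= d x y + d y z.
Hypothesis d_ge0 : forall x y, 0 <= d x y.
Hypothesis piK : forall x, x <> oo -> pi (sigma x) = x.
Hypothesis sigmaK : forall y, sigma (pi y) = y.
Hypothesis pi_unif : forall e, 0 < e ->
  exists2 de, 0 < de & forall y y', dist3 y y' < de -> d (pi y) (pi y') < e.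
Hypothesis sigma_unif : forall eta e, 0 < eta -> 0 < e ->
  exists2 de, 0 < de & forall x x', eta <= d x oo -> eta <= d x' oo -> d x x' < de ->
    dist3 (sigma x) (sigma x') < e.
Hypothesis sigma_bdd : forall eta, 0 < eta ->
  exists B, forall x, eta <= d x oo -> norm3 (sigma x) <= B.
Hypothesis pi_away : forall B, exists2 eta, 0 < eta &
  forall y, norm3 y <= B -> eta <= d (pi y) oo.
Variable K : T -> Prop.
Hypothesis K_oo : K oo.
Hypothesis K_closed : forall y, ~ K y -> exists2 eta, 0 < eta & farK d K eta y.
Hypothesis K_H1 : forall (f1 f2 : seq T -> F) e, 0 < e ->
  cocycle (small_in d K e) 2 f1 -> cocycle (small_in d K e) 2 f2 ->
  exists m1 m2 h e', [/\ (m1 != 0) || (m2 != 0), 0 < e' &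
    bounds (small_in d K e') 2 (fun s => m1 * f1 s + m2 * f2 s) h].
Hypothesis K_H0 : vanish F d K 1.
Hypothesis K_H2 : forall k, (3 <= k)%N -> vanish F d K k.

Variables (psi : T -> T) (p : nat).
Hypothesis p_gt0 : (0 < p)%N.
Hypothesis p_char : p%:R = 0 :> F.
Hypothesis psi_p : forall x, iter p psi x = x.
Hypothesis psi_iso : forall x y, d (psi x) (psi y) = d x y.
Hypothesis psi_K : forall x, K (psi x) <-> K x.
Hypothesis psi_free : forall x i, iter i psi x = x -> (p %| i)%N.
Variables n n' : nat.
Hypothesis dim_T : dim_le d psi p (fun=> True) n.
Hypothesis dim_K : dim_le d psi p K n'.

Notation small := (small d).
Notation bounding4 := (@bounding4 F R T d).
Notation farK := (farK d K).
Notation nearK := (nearK d K).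
Notation tr := (@trace F T psi p).

Let Tt : T -> Prop := fun=> True.

Let small_T e s : small_in d Tt e s <-> small e s.
Proof. by split=> [[]|]. Qed.

Let T_vanish k : (0 < k)%N -> k != 4 -> vanish F d Tt k.
Proof.
move=> k0 k4 f e e0 fc.
have fc' : cocycle (small e) k f by move=> s sz /small_T S; apply: fc.
have [g [e' [e'0 gb]]] := @chart_vanish F R T d oo sigma pi d_refl d_sym
  d_triangle piK sigmaK pi_unif sigma_unif sigma_bdd pi_away k f e k0 k4 e0 fc'.
by exists g, e'; split=> // s sz /small_T S; apply: gb.
Qed.

Lemma nearK_psi eta x : nearK eta (psi x) <-> nearK eta x.
Proof.
split=> [[y Ky h]|[y Ky h]]; last by exists (psi y); [apply/psi_K|rewrite psi_iso].
exists (iter p.-1 psi y); first exact/(iter_K psi_K).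
by rewrite -psi_iso -iterS prednK// psi_p.
Qed.

Lemma nearK_iter eta i x : nearK eta (iter i psi x) <-> nearK eta x.
Proof. by elim: i => //= i <-; rewrite nearK_psi. Qed.

Lemma farK_iter eta i x : farK eta x -> farK eta (iter i psi x).
Proof.
move=> xf; have [h|//] := nearK_or_far d K eta (iter i psi x).
by case: (near_far ((nearK_iter _ _ _).1 h) xf).
Qed.

Let phase_mod (ph : T -> nat) : (forall x, (ph x < p)%N /\ ph (psi x) = ((ph x).+1 %% p)%N) ->
  forall x, (ph (psi x))%:R = (ph x)%:R + 1 :> F.
Proof.
move=> H x; have [hp ->] := H x; have [hlt|hge] := ltnP (ph x).+1 p.
  by rewrite modn_small// -addn1 natrD.
have E : (ph x).+1 = p by apply/eqP; rewrite eqn_leq hp.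
by rewrite natr1 E modnn p_char.
Qed.

(** The coboundary [eps] of the phase represents the class of the free action in invariant
    cohomology. On [K] it is the trace of a cocycle [s1] that spans H^1. If the holonomy were
    nonzero, the product of [th] with the coboundary of [s1] would span H^3 of the sphere by [link].
    Its trace bounds an invariant cochain, as [th] is invariant and the trace of [s1] extends to the
    closed [eps]. So all traces bound invariantly, and the Smith sequences descend until [eps]
    itself bounds, which the phase forbids. *)
Lemma no_invariant_class (th : T -> T -> F) (x : nat -> space3 R) (M : nat) (rr eta : R) :
  0 < rr -> 0 < eta -> x M = x 0%N ->
  (forall i, dist3 (x i) (x i.+1) < rr) ->
  (forall i u, dist3 u (x i) <= 4 * rr -> farK eta (pi u)) ->
  local_cocycle d K th -> cocycle_along pi x rr th ->
  (forall eta, 0 < eta -> exists2 e, 0 < e & forall u v, farK eta u -> farK eta v ->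
     d u v < e -> th (psi u) (psi v) = th u v) ->
  holonomy pi x M th = 0.
Proof.
move=> rr0 eta0 xM xs xf thc tha thi; apply/eqP/negPn/negP => hol0.
have [r [rP r_K r_psi]] := retraction_exists d_refl d_ge0 p_gt0 psi_p psi_iso psi_K psi_free
  K_oo K_closed.
have r_iter i u : r (iter i psi u) = iter i psi (r u).
  by elim: i => //= i <-; rewrite r_psi.
have KV k : (3 <= k)%N -> vanish_inv F d psi K k /\ vanish_ker F d psi p K k.
  apply: (vanish_descend oo p_gt0 psi_p psi_iso psi_K psi_free (k0 := 3) (K := n'.+1)) => //.
  move=> j nj; exact: (dim_le_vanish_inv oo p_gt0 psi_p nj dim_K).
have TV k : (5 <= k)%N -> vanish_inv F d psi Tt k /\ vanish_ker F d psi p Tt k.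
  apply: (vanish_descend oo p_gt0 psi_p psi_iso _ psi_free (k0 := 5) (K := n.+1)) => //.
    by move=> j hj; apply: T_vanish; [exact: leq_trans hj|apply/eqP; lia].
  move=> j nj; exact: (dim_le_vanish_inv oo p_gt0 psi_p nj dim_T).
have [ph hph] := phase_exists oo p_gt0 psi_p psi_free.
(* The phase is read after [r] so that [e (r u) = e u]; the pullback of [eps] along [r] is then
   [eps] itself. *)
pose e u : F := (ph (r u))%:R.
have e_psi u : e (psi u) = e u + 1 by rewrite /e r_psi phase_mod.
pose eps (s : seq T) : F := if s is [:: u; v] then e v - e u else 0.
have eps_inv : invariant psi eps.
  by case=> [|u [|v [|w s]]] //=; rewrite !e_psi; ring.
have eps_dl (s : seq T) : size s = 3 -> dl eps s = 0.
  by case: s => [|u [|v [|w [|z s]]]] //= _; ring.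
(* An invariant primitive [h] would make [e - h] constant on [A], while [e] grows by 1 along [psi]
   and [h] does not change. *)
have eps_nontrivial (A : T -> Prop) h e' : A oo -> (forall u, A (psi u) <-> A u) ->
    vanish F d A 1 -> 0 < e' -> invariant psi h ->
    ~ bounds (small_in d A e') 2 eps h.
  move=> Aoo psiA A0 e'0 hi hb.
  have [|g [e2 [e20 gb]]] := @A0 (fun s => if s is u :: _ then e u - h [:: u] else 0) e' e'0.
    move=> [//|u [//|v [|//]]] _ S.
    have := hb [:: u; v] erefl S; rewrite /= subr0 !subr0 => E.
    have -> : e v - h [:: v] - (e u - h [:: u]) = (e v - e u) - (h [:: v] - h [:: u]) by ring.
    by rewrite E; ring.
  have cst u : A u -> e u - h [:: u] = g [::].
    move=> Au; have := gb [:: u] erefl; rewrite /= subr0; apply; split.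
      by move=> a b; rewrite !inE => /eqP-> /eqP->; rewrite d_refl.
    by move=> a; rewrite inE => /eqP->.
  have := cst (psi oo); rewrite psiA => /(_ Aoo); rewrite -(cst _ Aoo) e_psi.
  rewrite (hi [:: oo] : h [:: psi oo] = _) => /eqP.
  by rewrite -subr_eq0 (_ : _ - _ = 1) ?oner_eq0//; ring.
(* Index 3 for the kernel of the trace vanishes on [K], so the invariant cocycle [eps] lifts through
   the trace to a cocycle on [K]. *)
have [s1 [e1 [e10 s1c s1E]]] : exists g e', [/\ 0 < e', cocycle (small_in d K e') 2 g &
    forall s, s <> [::] -> eps s = tr g s].
  have eco : cocycle (small_in d K 1) 2 eps by move=> s sz _; apply: eps_dl.
  exact: (trace_lift oo p_gt0 psi_p psi_iso psi_K psi_free (k := 2) isT (KV 3 isT).2 ltr01 eps_inv eco).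
have s1S : spans_H1 d K s1.
  apply: (spans_H1_nonbounding K_H1 e10 s1c) => h e' e'0 hb.
  apply: (eps_nontrivial K (tr h) e') => //; first exact: trace_invariant.
  move=> s sz S; rewrite s1E; last by move=> s0; move: sz; rewrite s0.
  rewrite dl_trace; apply: eq_bigr => i _; apply: hb; first by rewrite size_map.
  exact: (small_in_iter psi_iso psi_K).
have [pt [l [_ ptn pts ptH]]] := @link F R T d oo sigma pi d_refl d_sym d_triangle piK sigmaK
  pi_unif sigma_unif sigma_bdd pi_away K r rP s1 x M rr eta s1S rr0 eta0 xM xs xf.
pose z := cup1 th (dl (cutoff d K r s1)).
have zspan f e' : 0 < e' -> cocycle (small e') 4 f ->
    exists m, bounding4 (fun s => f s - m * z s).
  move=> e'0 /(pts _ _ e'0)[m mb].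
  exists (- m * l / holonomy pi x M th).
  have := bounding4D mb (bounding4Z (m / holonomy pi x M th) (ptH th thc tha)).
  by apply: bounding4_eq => s; rewrite -/(z s) mulrDr mulrA divfK//; ring.
(* th is invariant only on nearby pairs; moving the first point to phase 0 makes
   it exactly invariant *)
pose th' u v := th (iter (p - ph u) psi u) (iter (p - ph u) psi v).
have th'_inv u v : th' (psi u) (psi v) = th' u v.
  have [hp hS] := hph u; rewrite /th' hS -!iterSr.
  have [hlt|hge] := ltnP (ph u).+1 p; first by rewrite modn_small// subnSK.
  have E : (ph u).+1 = p by apply/eqP; rewrite eqn_leq hp.
  by rewrite E modnn subn0 !iterSr !psi_p (_ : p - ph u = 1)%N// -E subSnn.
have th'_iter i u v : th' (iter i psi u) (iter i psi v) = th' u v.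
  by elim: i => //= i <-; rewrite th'_inv.
have thE et : 0 < et -> exists2 e', 0 < e' & forall u v, farK et u -> farK et v ->
    d u v < e' -> th' u v = th u v.
  move=> et0; have [e' e'0 H] := thi _ et0; exists e' => // u v uf vf uv.
  rewrite /th'; elim: (p - ph u)%N => //= i <-; apply: H; try exact: farK_iter.
  by rewrite (iter_iso psi_iso).
have th'c : local_cocycle d K th'.
  move=> et et0; have [e2 e20 H2] := thE _ et0; have [e3 e30 H3] := thc _ et0.
  exists (Num.min e2 e3); first by rewrite lt_min e20.
  move=> u v w uf vf wf; rewrite !lt_min => /andP[a1 a2] /andP[b1 b2] /andP[c1 c2].
  by rewrite !H2// H3.
pose sc := cutoff d K r s1.
have scz : near_zero d K 3 (dl sc).
  have [et [e2 [et0 e20 H]]] := retract_cocycle d_sym d_triangle rP e10 s1c.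
  exists (Num.min et 1), e2; rewrite lt_min et0 ltr01; split=> // s sz S sn.
  rewrite (@dl_ext _ _ sc (fun t => s1 (map r t))).
    by apply: H => // u /sn; apply: nearK_le; rewrite ge_min lexx.
  move=> t ts _; rewrite /sc /cutoff asboolT// => u /ts /sn; apply: nearK_le.
  by rewrite ge_min lexx orbT.
pose z' := cup1 th' (dl sc).
have zz' : exists2 e', 0 < e' & forall s, size s = 4 -> small e' s -> z s = z' s.
  have [et [e2 [et0 e20 H]]] := scz; have et2 : 0 < et / 2 by rewrite divr_gt0.
  have [e3 e30 H3] := thE _ et2.
  exists (Num.min (et / 2) (Num.min e2 e3)); first by rewrite !lt_min et2 e20.
  move=> s sz S.
  have S1 : small (et / 2) s by apply: small_le S; rewrite ge_min lexx.
  have S2 : small e2 s by apply: small_le S; rewrite !ge_min lexx ?orbT.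
  have S3 : small e3 s by apply: small_le S; rewrite !ge_min lexx ?orbT.
  case: s sz S1 S2 S3 {S} => [//|u [//|v s]] sz S1 S2 S3; rewrite /z /z' /cup1.
  have vsub : {subset v :: s <= [:: u, v & s]} by move=> w wt; rewrite in_cons wt orbT.
  have [sn|sf] := small_near_or_far d_triangle K et0 S1.
    rewrite H ?mulr0//; first by move: sz => /= [->].
      exact: small_sub S2.
    by move=> w /vsub /sn.
  have [us vs] : u \in [:: u, v & s] /\ v \in [:: u, v & s].
    by rewrite !in_cons !eqxx ?orbT.
  by rewrite H3//; [exact: sf|exact: sf|exact: S3].
(* The trace acts on the second factor alone because [th'] is exactly invariant. *)
have tr_z' s : tr z' s = cup1 th' (dl (tr sc)) s.
  case: s => [|u [|v s]]; rewrite /z'; try by rewrite /trace big1.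
  rewrite /cup1 dl_trace /trace mulr_sumr; apply: eq_bigr => i _ /=.
  by rewrite th'_iter.
pose epsc s := if `[< {in s, forall u, nearK 1 u} >] then eps s else 0.
have tr_sc s : s <> [::] -> tr sc s = epsc s.
  move=> s0; rewrite /epsc; case: asboolP => sn; last first.
    rewrite /trace big1// => i _; rewrite /sc /cutoff; case: asboolP => // H.
    by case: sn => u us; apply/(nearK_iter 1 i); apply: H; apply: map_f.
  have epsr : eps (map r s) = eps s.
    have rr1 u : e (r u) = e u by rewrite /e (rP.1 (r u)).
    by case: (s) => [|u [|v [|w t]]] //=; rewrite !rr1.
  rewrite -epsr s1E; last by case: (s) s0.
  apply: eq_bigr => i _; rewrite /sc /cutoff asboolT.
    by congr s1; rewrite -!map_comp; apply: eq_map => u /=; rewrite r_iter.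
  by move=> _ /mapP[u us ->]; apply/nearK_iter/sn.
(* The cut-off class and [epso] have opposite coboundaries since [eps] is closed everywhere. As
   [epso] vanishes near [K], its product with [th'] is an invariant primitive of the trace of
   [z']. *)
pose epso s := eps s - epsc s.
have epsoz : near_zero d K 2 epso.
  by exists 1, 1; split=> // s sz S sn; rewrite /epso /epsc asboolT// subrr.
have epso_inv : invariant psi epso.
  move=> s; rewrite /epso eps_inv; congr (_ - _); rewrite /epsc eps_inv.
  congr (if _ then _ else _); apply/asbool_equiv_eq; split=> H u us.
    by apply/nearK_psi; apply: H; apply: map_f.
  by case/mapP: us => w ws ->; apply/nearK_psi; apply: H.
pose h0 := cup1 th' epso.
have h0_inv : invariant psi h0.
  case=> [//|u [//|v s]]; rewrite /h0 /= th'_inv; congr (_ * _).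
  exact: (epso_inv (v :: s)).
have [e4 e40 h0b] : exists2 e', 0 < e' & forall s, size s = 4 -> small e' s ->
    tr z' s = dl h0 s.
  have [e4 e40 H4] := cup_cut d_triangle th'c (k := 2) isT epsoz.
  exists e4 => // s sz S; rewrite H4// tr_z'.
  case: s sz S => [//|u [//|v s]] sz S; rewrite /cup1 -mulrN; congr (_ * _).
  have szt : size (v :: s) = 3 by move: sz => /= [->].
  rewrite /epso dlB eps_dl// sub0r opprK; apply: dl_ext => t _ tsz.
  by apply: tr_sc => t0; move: tsz; rewrite szt t0.
(* Every cocycle of index 4 is a multiple of [z] up to a coboundary, so the invariant primitive of
   the trace of [z'] serves for all of them. *)
have trb g e' : 0 < e' -> cocycle (small_in d Tt e') 4 g -> exists h e'',
    [/\ 0 < e'', invariant psi h & bounds (small_in d Tt e'') 4 (tr g) h].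
  move=> e'0 gc; have [m [k [e5 [e50 kb]]]] : exists m, bounding4 (fun s => g s - m * z s).
    by apply: (zspan _ _ e'0) => s sz S; apply: gc => //; apply/small_T.
  have [e6 e60 zz6] := zz'.
  exists (fun s => m * h0 s + tr k s), (Num.min e4 (Num.min e5 e6)).
  rewrite !lt_min e40 e50 e60; split=> //.
    by move=> s; rewrite h0_inv trace_invariant.
  move=> s sz /small_T S.
  have S4 : small e4 s by apply: small_le S; rewrite ge_min lexx.
  have S56 : small (Num.min e5 e6) s by apply: small_le S; rewrite ge_min lexx orbT.
  rewrite dlD dlZ -h0b// dl_trace /trace mulr_sumr -big_split /=; apply: eq_bigr => i _.
  have Si : small (Num.min e5 e6) (map (iter i psi) s).
    by apply/small_T; apply: (small_in_iter psi_iso) => //; apply/small_T.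
  rewrite -zz6 ?size_map//; last by apply: small_le Si; rewrite ge_min lexx orbT.
  rewrite -kb ?size_map//; first by rewrite addrC subrK.
  by apply: small_le Si; rewrite ge_min lexx.
have psiT u : Tt (psi u) <-> Tt u by [].
(* The descent alternates: kernel of the trace in index 5, invariants in 4, kernel in 3, invariants
   in 2, where [eps] lives. *)
have ker5 := (TV 5 isT).2.
have inv4 : vanish_inv F d psi Tt 4.
  exact: (vanish_inv_of_trace oo p_gt0 psi_p psi_iso psiT psi_free (k := 4) isT ker5 trb).
have ker3 : vanish_ker F d psi p Tt 3.
  exact: (vanish_ker_of oo p_gt0 psi_p psi_iso psiT psi_free (k := 3) isT (@T_vanish 3 isT isT) inv4).
have inv2 : vanish_inv F d psi Tt 2.
  exact: (vanish_inv_of oo p_gt0 psi_p psi_iso psiT psi_free (k := 2) isT (@T_vanish 2 isT isT) ker3).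
have [|h [e5 [e50 hi hb]]] := inv2 eps 1 ltr01 eps_inv.
  by move=> s sz _; apply: eps_dl.
exact: (eps_nontrivial Tt h e5 I psiT (@T_vanish 1 isT isT) e50 hi hb).
Qed.

End NoInvariantClass.

(** * Cohomology of the circle *)

Section Primitive.
Variables (Q : Type) (mul : Q -> Q -> Q) (one : Q).
Hypothesis mulA : associative mul.
Hypothesis mul1 : left_id one mul.
Hypothesis mulone : right_id one mul.

Fixpoint chain (P : Type) (q : P -> P -> Q) (h : nat -> P) (M : nat) : Q :=
  if M is M'.+1 then mul (chain q h M') (q (h M') (h M'.+1)) else one.

(** Two chains form the sides of a ladder with rungs from [h j] to [h' j]; commutation of each
    square lets the last rung be pushed down to the first, which is trivial. *)
Lemma chain_ladder (P : Type) (q : P -> P -> Q) (h h' : nat -> P) M :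
  q (h 0%N) (h' 0%N) = one ->
  (forall j, (j < M)%N -> mul (q (h j) (h j.+1)) (q (h j.+1) (h' j.+1)) =
     mul (q (h j) (h' j)) (q (h' j) (h' j.+1))) ->
  mul (chain q h M) (q (h M) (h' M)) = chain q h' M.
Proof.
move=> h0; elim: M => [|M IH] H /=; first by rewrite mul1.
rewrite -mulA H// mulA IH// => j jM; apply: H; exact: ltnW.
Qed.
End Primitive.

Section RealLine.
Variable R : realType.

Lemma locally_constant01 (Q : Type) (w : R -> Q) (de : R) : 0 < de ->
  (forall s t, 0 <= s <= 1 -> 0 <= t <= 1 -> `|s - t| < de -> w s = w t) ->
  forall s, 0 <= s <= 1 -> w s = w 0.
Proof.
move=> de0 H s s01.
pose M := (Num.bound de^-1).+1.
have M0 : 0 < M%:R :> R by rewrite ltr0n.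
have Mde : M%:R^-1 < de.
  rewrite invf_plt ?posrE//; apply: lt_trans (archi_boundP _) _; last by rewrite ltr_nat.
  by rewrite invr_ge0 ltW.
have E j : (j <= M)%N -> w (j%:R / M%:R * s) = w 0.
  elim: j => [|j IH] jM; first by rewrite !mul0r.
  rewrite -IH; last exact: ltnW.
  have b i : (i <= M)%N -> 0 <= i%:R / M%:R * s <= 1.
    move=> iM; case/andP: s01 => s0 s1.
    rewrite mulr_ge0 ?divr_ge0//= mulr_ile1 ?divr_ge0//.
    by rewrite ler_pdivrMr// mul1r ler_nat.
  apply: H; [exact: b|exact: b (ltnW jM)|].
  rewrite -mulrBl -mulrBl -natrB// subSnn mul1r.
  case/andP: s01 => s0 s1; rewrite ger0_norm ?mulr_ge0 ?invr_ge0//.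
  by apply: le_lt_trans Mde; rewrite ler_piMr ?invr_ge0.
by have := E M (leqnn _); rewrite divff ?gt_eqF// mul1r.
Qed.

(** The interval from 2i + b to 2i + b + 1, in units of [h], enlarged by a quarter on both sides.
    Cells of one colour [b] are disjoint, and any ball of radius [h / 4] fits in a cell of one of
    the two colours. *)
Definition cell (h : R) (b : nat) (i : int) (t : R) : Prop :=
  (2 * i%:~R + b%:R - 1 / 4) * h < t < (2 * i%:~R + b%:R + 5 / 4) * h.

Lemma cell_uniq h b i j t : 0 < h -> cell h b i t -> cell h b j t -> i = j.
Proof.
move=> h0 /andP[a1 a2] /andP[b1 b2].
have h1 : (i%:~R : R) < j%:~R + 1.
  by have := lt_trans a1 b2; rewrite ltr_pM2r//; lra.
have h2 : (j%:~R : R) < i%:~R + 1.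
  by have := lt_trans b1 a2; rewrite ltr_pM2r//; lra.
move: h1 h2; rewrite -!(intrD _ _ 1) !ltr_int; lia.
Qed.

Lemma cell_diam h b i t t' : cell h b i t -> cell h b i t' -> `|t - t'| < 2 * h.
Proof.
move=> /andP[a1 a2] /andP[b1 b2]; rewrite ltr_norml; move: a1 a2 b1 b2.
set c := 2 * _ + _; have -> : (c - 1 / 4) * h = c * h - h / 4 by ring.
have -> : (c + 5 / 4) * h = c * h + 5 / 4 * h by ring.
by move=> *; apply/andP; split; lra.
Qed.

Lemma cell_shift h b i m t : cell h b i t -> cell h b (i + m) (t + (2 * m%:~R) * h).
Proof.
rewrite /cell intrD => /andP[a1 a2].
have E c : (2 * (i%:~R + m%:~R) + b%:R + c) * h = (2 * i%:~R + b%:R + c) * h + 2 * m%:~R * h.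
  by ring.
by rewrite !E !ltrD2r a1 a2.
Qed.

Lemma cell_cover h t : 0 < h -> exists b i, (b < 2)%N /\
  forall t', `|t - t'| < h / 4 -> cell h b i t'.
Proof.
move=> h0; pose i0 := Num.floor (t / h).
have i0P : i0%:~R <= t / h < i0%:~R + 1.
  by have := floor_itv (t / h); rewrite intrD.
have [b [i [b2 E]]] : exists b i, (b < 2)%N /\ i0 = 2 * i + Posz b.
  exists `|(i0 %% 2)%Z|%N, (i0 %/ 2)%Z.
  have m0 : (0 <= i0 %% 2)%Z by rewrite modz_ge0.
  have m2 : (i0 %% 2 < 2)%Z by rewrite ltz_pmod.
  split; first by move: m0 m2; case: (i0 %% 2)%Z => //= n _; rewrite ltz_nat.
  by rewrite gez0_abs// {1}(divz_eq i0 2) mulrC.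
exists b, i; split=> // t'; rewrite ltr_norml => /andP[h1 h2].
have E2 : i0%:~R = 2 * i%:~R + b%:R :> R by rewrite E intrD intrM.
move: i0P; rewrite E2 /cell; set c := 2 * _ + _.
rewrite ler_pdivlMr// ltr_pdivrMr// => /andP[a1 a2].
have -> : (c - 1 / 4) * h = c * h - h / 4 by ring.
have -> : (c + 5 / 4) * h = (c + 1) * h + h / 4 by field.
by apply/andP; split; lra.
Qed.

End RealLine.

Section Circle.
Variables (F : fieldType) (R : realType) (T : choiceType) (d : T -> T -> R).
Variable c : R -> T.
Hypothesis d_refl : forall x, d x x = 0.
Hypothesis c_eq : forall s t, c s = c t <-> exists z : int, s - t = z%:~R.
Hypothesis c_unif : forall e, 0 < e -> exists2 de, 0 < de &
  forall s t, `|s - t| < de -> d (c s) (c t) < e.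
Hypothesis c_inv : forall eta, 0 < eta -> exists2 de, 0 < de &
  forall s t, d (c s) (c t) < de -> exists z : int, `|s - t - z%:~R| < eta.

Let K (x : T) : Prop := exists s, x = c s.

Let c_int s (z : int) : c (s + z%:~R) = c s.
Proof. by apply/c_eq; exists z; rewrite addrAC subrr add0r. Qed.

Lemma circle_param x : K x -> exists2 s, 0 <= s < 1 & x = c s.
Proof.
move=> [s ->]; exists (s - (Num.floor s)%:~R); last first.
  by rewrite -intrN c_int.
have := floor_itv s; rewrite intrD => /andP[h1 h2].
by apply/andP; split; lra.
Qed.

Let c_small e s : 0 < e -> (forall t u, t \in s -> u \in s -> `|t - u| < e) ->
  forall e', (forall s t, `|s - t| < e -> d (c s) (c t) < e') ->
  small_in d K e' (map c s).
Proof.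
move=> e0 H e' He; split=> [_ _ /mapP[t ts ->] /mapP[u us ->]|_ /mapP[t ts ->]].
  exact/He/H.
by exists t.
Qed.

Lemma circle_H0 : vanish F d K 1.
Proof.
move=> f e e0 fc; have [de de0 H] := c_unif e0.
have cst s : 0 <= s <= 1 -> f [:: c s] = f [:: c 0].
  apply: (locally_constant01 (w := fun s => f [:: c s]) de0) => t u _ _ tu.
  have S : small_in d K e (map c [:: u; t]).
    apply: (c_small de0) => // a b; rewrite !inE => /orP[]/eqP-> /orP[]/eqP->;
      by rewrite ?subrr ?normr0// distrC.
  by have := fc (map c [:: u; t]) erefl S; rewrite /= !subr0 => /eqP; rewrite subr_eq0 => /eqP.
exists (fun=> f [:: c 0]), e; split=> // -[//|x [|//]] _ [_ sK] /=.
have /circle_param[s /andP[s0 s1] ->] : K x by apply: sK; rewrite mem_head.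
by rewrite subr0 cst// s0 ltW.
Qed.

(** The sum over [j] is the integral of [f] along the curve from parameter 0 to [t], with the same
    subdivision number for all [t]. The range up to 2 leaves room to cross the base point. *)
Lemma circle_primitive (f : seq T -> F) e : 0 < e -> cocycle (small_in d K e) 2 f ->
  exists M, forall N, (M <= N)%N -> exists2 de, 0 < de & forall s t : R,
    0 <= s <= 2 -> 0 <= t <= 2 -> `|s - t| < de ->
    f [:: c s; c t] =
    \sum_(j < N) f [:: c (j%:R / N%:R * t); c (j.+1%:R / N%:R * t)] -
    \sum_(j < N) f [:: c (j%:R / N%:R * s); c (j.+1%:R / N%:R * s)].
Proof.
move=> e0 fc; have [de de0 H] := c_unif e0.
(* With parameters up to 2, a step along either side is at most 2/N, less than [de / 2]; rungs are
   below [de / 2] as well, so both triangles of each square are below [de]. *)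
exists (Num.bound (4 / de)).+1 => N MN; exists (de / 2); first by rewrite divr_gt0.
move=> s t s2 t2 st.
have N0 : 0 < N%:R :> R by rewrite ltr0n; apply: leq_trans MN.
have NM : 4 / de < N%:R.
  apply: lt_le_trans (_ : (Num.bound (4 / de)).+1%:R <= _); last by rewrite ler_nat.
  apply: lt_trans (archi_boundP _) _; last by rewrite ltr_nat.
  by rewrite divr_ge0// ltW.
have co a b u : `|a - b| < de -> `|b - u| < de -> `|a - u| < de ->
    f [:: c a; c b] + f [:: c b; c u] = f [:: c a; c u].
  move=> ab bu au; have S : small_in d K e (map c [:: a; b; u]).
    apply: (c_small de0) => // x y; rewrite !inE.
    by move=> /or3P[]/eqP-> /or3P[]/eqP->; rewrite ?subrr ?normr0// distrC.
  have := fc (map c [:: a; b; u]) erefl S; rewrite /= => E; apply/eqP; rewrite -subr_eq0; apply/eqP.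
  by rewrite -E; ring.
pose q (a b : R) := f [:: c a; c b].
pose h u (j : nat) : R := j%:R / N%:R * u.
have chainE u : chain +%R 0 q (h u) N = \sum_(j < N) q (h u j) (h u j.+1).
  by move: (h u) => g; elim: (N) => [|n IH]; rewrite ?big_ord0//= IH big_ord_recr.
have qq a : q a a = 0.
  have : q a a + q a a = q a a by apply: co; rewrite subrr normr0.
  by move=> E; apply: (addrI (q a a)); rewrite E addr0.
have step u j : 0 <= u <= 2 -> `|h u j - h u j.+1| < de / 2.
  move=> /andP[u0 u2]; rewrite /h -mulrBl -mulrBl normrM normrM distrC -natrB// subSnn.
  rewrite normr1 mul1r normfV (gtr0_norm N0) ger0_norm//.
  apply: (@le_lt_trans _ _ (2 / N%:R)); first by rewrite mulrC ler_wpM2r// invr_ge0 ltW.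
  by move: NM; rewrite ltr_pdivrMr// => NM; rewrite ltr_pdivrMr//; move: NM; lra.
have side j : (j <= N)%N -> `|h s j - h t j| < de / 2.
  move=> jN; rewrite /h -mulrBr normrM ger0_norm ?divr_ge0//.
  by apply: le_lt_trans st; rewrite ler_piMl// ler_pdivrMr// mul1r ler_nat.
have de2 : de / 2 < de by rewrite ltr_pdivrMr// mulr_natr mulr2n ltrDl.
have := chain_ladder (@addrA F) (@add0r F) (q := q) (h := h s) (h' := h t) (M := N).
have q0 : q (h s 0%N) (h t 0%N) = 0 by rewrite /h !mul0r qq.
rewrite !chainE => /(_ q0) K1.
have qE : q (h s N) (h t N) = f [:: c s; c t] by rewrite /q /h divff ?gt_eqF// !mul1r.
rewrite -qE; apply/esym/eqP; rewrite subr_eq addrC; apply/eqP/esym; apply: K1.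
move=> j jN.
have sd := side j (ltnW jN); have sd1 := side _ jN.
have ss := step s j s2; have tt := step t j t2.
have diag : `|h s j - h t j.+1| < de.
  by apply: le_lt_trans (ler_distD (h t j) _ _) _; move: sd tt; lra.
by rewrite !co//; apply: lt_trans de2.
Qed.

Lemma circle_H1 (f1 f2 : seq T -> F) e : 0 < e ->
  cocycle (small_in d K e) 2 f1 -> cocycle (small_in d K e) 2 f2 ->
  exists m1 m2 h e', [/\ (m1 != 0) || (m2 != 0), 0 < e' &
    bounds (small_in d K e') 2 (fun s => m1 * f1 s + m2 * f2 s) h].
Proof.
move=> e0 c1 c2.
have [M1 H1] := circle_primitive e0 c1; have [M2 H2] := circle_primitive e0 c2.
pose N := maxn M1 M2.
have {H1}[de1 de10 H1] := H1 N (leq_maxl _ _).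
have {H2}[de2 de20 H2] := H2 N (leq_maxr _ _).
pose S f (t : R) : F := \sum_(j < N) f [:: c (j%:R / N%:R * t); c (j.+1%:R / N%:R * t)].
pose hol f := S f 1 - S f 0.
(* The combination is chosen with total integral 0 around the circle; its primitive is then periodic
   and descends to [K]. *)
have [m1 [m2 [m12 mh]]] : exists m1 m2, (m1 != 0) || (m2 != 0) /\
    m1 * hol f1 + m2 * hol f2 = 0.
  have [E|E] := eqVneq (hol f2) 0.
    by exists 0, 1; rewrite oner_neq0 orbT E mul0r mulr0 addr0.
  by exists (hol f2), (- hol f1); rewrite E; split=> //; ring.
pose f s := m1 * f1 s + m2 * f2 s.
pose u (t : R) := m1 * S f1 t + m2 * S f2 t.
pose de := Num.min (Num.min de1 de2) (1 / 2).
have de0 : 0 < de by rewrite !lt_min de10 de20 divr_gt0.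
have uP s t : 0 <= s <= 2 -> 0 <= t <= 2 -> `|s - t| < de -> f [:: c s; c t] = u t - u s.
  move=> s2 t2; rewrite !lt_min => /andP[/andP[st1 st2] _].
  by rewrite /f (H1 s t)// (H2 s t)// /u /S; ring.
have u01 : u 1 = u 0.
  by apply/eqP; rewrite -subr_eq0; apply/eqP; rewrite -mh /u /hol; ring.
have u_per t : 0 <= t <= 1 -> u (t + 1) = u t.
  move=> t01; apply/eqP; rewrite -subr_eq0; apply/eqP.
  have E : u (0 + 1) - u 0 = 0 by rewrite add0r u01 subrr.
  rewrite -E; apply: (locally_constant01 (w := fun t => u (t + 1) - u t) de0) => //.
  move=> a b /andP[a0 a1] /andP[b0 b1] ab.
  have e1 : f [:: c a; c b] = u b - u a by apply: uP => //; lra.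
  have e2 : f [:: c (a + 1); c (b + 1)] = u (b + 1) - u (a + 1).
    apply: uP; [lra|lra|]; by rewrite opprD addrACA subrr addr0.
  have e3 : f [:: c (a + 1); c (b + 1)] = f [:: c a; c b] by rewrite !(c_int _ 1).
  move: e3; rewrite e1 e2 => E3; apply/eqP; rewrite -subr_eq0; apply/eqP.
  transitivity ((u b - u a) - (u (b + 1) - u (a + 1))); first by ring.
  by rewrite E3 subrr.
have pm_ex x : exists s : R, K x -> 0 <= s < 1 /\ x = c s.
  by have [/circle_param[s s01 xs]|nK] := pselect (K x); [exists s|exists 0].
have [pm pmP] := choice pm_ex.
have [e' e'0 He'] := c_inv de0.
exists m1, m2, (fun s => if s is x :: _ then u (pm x) else 0), e'; split=> //.
move=> [//|x [//|y [|//]]] _ [Sm sK] /=; rewrite !subr0 -/(f [:: x; y]).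
have [/andP[s0 s1] xE] := pmP x (sK x (mem_head _ _)).
have yin : y \in [:: x; y] by rewrite !inE eqxx orbT.
have [/andP[t0 t1] yE] := pmP y (sK y yin).
have := Sm x y (mem_head _ _) yin; rewrite [in X in X -> _]xE [in X in X -> _]yE.
move=> /He'[z zP].
rewrite [in LHS]xE [in LHS]yE.
move: (pm x) (pm y) s0 s1 t0 t1 zP => s t s0 s1 t0 t1 zP.
have dehalf : de <= 1 / 2 by rewrite ge_min lexx orbT.
have zb : (-2 < z%:~R :> R) /\ (z%:~R < 2 :> R).
  by move: zP; rewrite ltr_norml => /andP[]; split; lra.
have : [\/ z = 0, z = 1 | z = -1].
  have h1 : (- 2 < z)%R by rewrite -(ltr_int R) intrN; exact: zb.1.
  have h2 : (z < 2)%R by rewrite -(ltr_int R); exact: zb.2.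
  have : (z == 0) || (z == 1) || (z == -1) by move: h1 h2; clear; lia.
  by case/orP => [/orP[]|] /eqP; [constructor 1|constructor 2|constructor 3].
case=> zE; move: zP; rewrite zE.
- by rewrite subr0 => st; apply: uP => //; lra.
- move=> st; rewrite -(c_int t 1) -[u t]u_per; last lra.
  by apply: uP; [lra|lra|]; rewrite opprD addrA.
- move=> st; rewrite -(c_int s 1) -[u s]u_per; last lra.
  by apply: uP; [lra|lra|]; move: st; rewrite intrN opprK addrAC.
Qed.

(** Arcs of two alternating colours. The order 1 and the map [id] make the equivariant notion the
    ordinary covering dimension. *)
Lemma circle_dim : dim_le d id 1 K 2.
Proof.
move=> e e0; have [de de0 H] := c_unif e0.
(* The period 1 is a whole multiple of [2 * h], so translation by an integer preserves the colours
   of the cells. *)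
pose m := (Num.bound (2 / de)).+1; pose h : R := (2 * m%:R)^-1.
have m0 : 0 < m%:R :> R by rewrite ltr0n.
have h0 : 0 < h by rewrite invr_gt0 mulr_gt0.
have hde : 2 * h < de.
  rewrite /h invfM mulrA divff// mul1r invf_plt ?posrE//.
  have h1 : 2 / de < m%:R.
    by apply: lt_trans (archi_boundP _) _; rewrite ?ltr_nat// divr_ge0// ltW.
  apply: le_lt_trans h1; have := invr_ge0 de; rewrite (ltW de0) => h1; lra.
have hm (z : int) : z%:~R = 2 * (Posz m * z)%:~R * h.
  by rewrite intrM /h -[(Posz m)%:~R]/(m%:R); field; rewrite gt_eqF.
exists (fun b x y => exists s t i, [/\ x = c s, y = c t, cell h b i s & cell h b i t]).
split.
- move=> b _; split.
  + by move=> x y [s [t [i [xs yt cs ct]]]]; exists t, s, i.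
  + move=> x y w [s [t [i [xs yt cs ct]]]] [t' [v [j [yt' wv ct' cv]]]].
    have /c_eq[z zE] : c t = c t' by rewrite -yt.
    have tE : t = t' + z%:~R by rewrite -zE addrC subrK.
    have := cell_shift (Posz m * z) ct'; rewrite -hm -tE => ct2.
    have ij := cell_uniq h0 ct ct2.
    exists s, (v + z%:~R), i; split=> //; first by rewrite c_int.
    by rewrite ij hm; apply: cell_shift.
  + by [].
  + by move=> *; rewrite dvd1n.
- move=> b x y _ [s [t [i [-> -> cs ct]]]]; split; [by exists s|by exists t|].
  by apply: H; apply: lt_trans hde; apply: cell_diam cs ct.
have [e' e'0 He'] := c_inv (divr_gt0 h0 (ltr0n R 4)).
exists e' => // -[//|x0 l] _ [S sK].
have [s0 x0E] := sK x0 (mem_head _ _).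
have [b [i [b2 bi]]] := cell_cover s0 h0.
exists b => // x y xs ys.
have rep w : w \in x0 :: l -> exists2 t, w = c t & cell h b i t.
  move=> ws; have [t wE] := sK w ws.
  have := S x0 w (mem_head _ _) ws; rewrite x0E wE => /He'[z zP].
  exists (t + z%:~R); first by rewrite c_int.
  by apply: bi; rewrite opprD addrA.
have [s xE cs] := rep x xs; have [t yE ct] := rep y ys.
by exists s, t, i.
Qed.

(** For the trivial group every cochain is invariant, so the vanishing of invariant cohomology above
    the dimension is plain vanishing. *)
Lemma circle_H2 k : (3 <= k)%N -> vanish F d K k.
Proof.
move=> k3 f e e0 fc.
have fi : invariant id f by move=> s; rewrite map_id.
have [g [e' [e'0 _ gb]]] := dim_le_vanish_inv (c 0) (ltn0Sn 0) (fun x => erefl) k3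
  circle_dim e0 fi fc.
by exists g, e'.
Qed.

End Circle.

(** * Compactness *)

Section Compactness.
Variable R : realType.

(** A positive constant valid near each point becomes uniform when the property improves as the
    constant shrinks: compactness is applied to the filter of small positive constants. *)
Lemma compact_uniform (V : normedModType R) (A : set V) (P : R -> V -> Prop) :
  compact A -> (forall e e' y, e' <= e -> P e y -> P e' y) ->
  (forall x, A x -> exists2 e, 0 < e & forall y, A y -> `|x - y| < e -> P e y) ->
  exists2 e, 0 < e & forall y, A y -> P e y.
Proof.
move=> /compact_near_coveringP cA anti H.
have near_e : \forall e \near (0 : R)^'+, A `<=` (fun y => A y -> P e y).
  apply: (cA R (0 : R)^'+ (fun e y => A y -> P e y)) => x Ax.
  have [e e0 he] := H x Ax.
  near=> y e' => /= Ay; apply: (anti e).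
    by near: e'; apply: nbhs_right_le.
  apply: he => //; near: y; apply/nbhs_ballP; exists e.
near (0 : R)^'+ => e; exists e; first by near: e; exact: nbhs_right_gt.
have h : A `<=` (fun y => A y -> P e y) by near: e.
by move=> y Ay; apply: h.
Unshelve. all: by end_near. Qed.

Lemma compact_net (V : normedModType R) (A : set V) e : compact A -> 0 < e ->
  exists s : seq V, (forall y, y \in s -> A y) /\
    forall x, A x -> exists2 y, y \in s & `|y - x| < e.
Proof.
move=> /compact_near_coveringP cA e0.
pose G : set_system (seq V) := [set Q | exists2 s0 : seq V,
  (forall y, y \in s0 -> A y) & forall s : seq V, {subset s0 <= s} -> Q s].
have FG : Filter G.
  split.
  - by exists [::].
  - move=> Q Q' [s0 h0 H] [s1 h1 H']; exists (s0 ++ s1) => [y|s hs].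
      by rewrite mem_cat => /orP[/h0|/h1].
    by split; [apply: H|apply: H'] => y ys; apply: hs; rewrite mem_cat ys ?orbT.
  - by move=> Q Q' QQ [s0 h0 H]; exists s0 => // s hs; apply/QQ/H.
have [s0 h0 H] : G (fun s : seq V => A `<=` (fun x => exists2 y, y \in s & `|y - x| < e)).
  apply: (cA _ G (fun (s : seq V) x => exists2 y, y \in s & `|y - x| < e)) => x Ax.
  exists (ball x e, [set s : seq V | x \in s]) => /=.
    split; first exact: nbhsx_ballx.
    exists [:: x] => [y|s hs /=]; first by rewrite inE => /eqP->.
    by apply: hs; rewrite inE.
  by move=> [y s] /= [xy xs]; exists x => //; move: xy; rewrite -ball_normE.
by exists s0; split=> //; apply: H.
Qed.

Lemma compact_unif_continuous (V W : normedModType R) (A : set V) (g : V -> W) :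
  compact A -> (forall x, A x -> {for x, continuous g}) -> forall e, 0 < e ->
  exists2 de, 0 < de & forall x y, A x -> A y -> `|x - y| < de -> `|g x - g y| < e.
Proof.
move=> cA gc e e0.
have [de de0 H] : exists2 de, 0 < de & forall y, A y ->
    forall z, A z -> `|y - z| < de -> `|g y - g z| < e.
  apply: (compact_uniform (P := fun de y => forall z, A z -> `|y - z| < de -> `|g y - g z| < e)) => //.
    by move=> e1 e2 y e21 h z Az yz; apply: h => //; apply: lt_le_trans e21.
  move=> x Ax; have e2 : 0 < e / 2 by rewrite divr_gt0.
  have := gc x Ax => /cvgrPdist_lt /(_ _ e2) /nbhs_ballP[d0 /= d00 Hd].
  exists (d0 / 2); first by rewrite divr_gt0.
  move=> y Ay xy z Az yz.
  have dd : d0 / 2 < d0 by rewrite ltr_pdivrMr// mulr_natr mulr2n ltrDl.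
  have h1 : `|g x - g y| < e / 2 by apply: Hd; rewrite -ball_normE /=; apply: lt_trans dd.
  have h2 : `|g x - g z| < e / 2.
    apply: Hd; rewrite -ball_normE /=; apply: le_lt_trans (ler_distD y _ _) _.
    by move: xy yz; lra.
  apply: le_lt_trans (ler_distD (g x) _ _) _; rewrite (distrC (g y)).
  by move: h1 h2; lra.
by exists de => // x y Ax Ay; apply: H.
Qed.

End Compactness.

Section Circle4.
Variables (R : realType) (V : normedModType R) (c : R -> V).
Hypothesis c_cont : continuous c.
Hypothesis c_eq : forall s t, c s = c t <-> exists z : int, s - t = z%:~R.

Lemma circle_shift s (z : int) : c (s + z%:~R) = c s.
Proof. by apply/c_eq; exists z; rewrite addrAC subrr add0r. Qed.

Lemma frac01 (s : R) : 0 <= s - (Num.floor s)%:~R < 1.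
Proof. by have := floor_itv s; rewrite intrD => /andP[h1 h2]; apply/andP; split; lra. Qed.

Lemma circle_unif e : 0 < e -> exists2 de, 0 < de &
  forall s t, `|s - t| < de -> `|c s - c t| < e.
Proof.
move=> e0; have [de de0 H] := @compact_unif_continuous R R^o V `[-1, 2]%classic c
  (@segment_compact R (-1) 2) (fun x _ => @c_cont x) e e0.
exists (Num.min de 1); first by rewrite lt_min de0 ltr01.
move=> s t; rewrite lt_min => /andP[st1 st2].
have /andP[f0 f1] := frac01 s; set z := Num.floor s in f0 f1.
rewrite -(circle_shift s (- z)) -(circle_shift t (- z)) !intrN.
move: st2; rewrite ltr_norml => /andP[a1 a2].
apply: H.
- by rewrite /= in_itv /=; apply/andP; split; lra.
- by rewrite /= in_itv /=; apply/andP; split; lra.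
- by rewrite opprB addrA subrK.
Qed.

(** Uniform continuity of the inverse of the parametrization, by compactness on pairs of parameters:
    pairs with the same image are an integer apart, the other pairs stay apart locally. *)
Lemma circle_inv eta : 0 < eta -> exists2 de, 0 < de &
  forall s t, `|c s - c t| < de -> exists z : int, `|s - t - z%:~R| < eta.
Proof.
move=> eta0.
pose A := `[0 : R, 1]%classic `*` `[0 : R, 1]%classic.
have cA : compact A by apply: compact_setX; exact: segment_compact.
pose P (de : R) (w : R * R) :=
  `|c w.1 - c w.2| < de -> exists z : int, `|w.1 - w.2 - z%:~R| < eta.
have [de de0 H] : exists2 de, 0 < de & forall w, A w -> P de w.
  apply: compact_uniform => // [e e' w ee h hw|[s0 t0] _].
    by apply: h; apply: lt_le_trans ee.
  have [E|E] := eqVneq (c s0) (c t0).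
    have /c_eq[z zE] := E.
    exists (eta / 2); first by rewrite divr_gt0.
    move=> [s t] _ /=; rewrite prod_normE /= gt_max => /andP[h1 h2] _; exists z.
    have -> : s - t - z%:~R = (t0 - t) - (s0 - s) by rewrite -zE; ring.
    by apply: le_lt_trans (ler_normB _ _) _; move: h1 h2; lra.
  pose e := `|c s0 - c t0| / 3.
  have e0 : 0 < e by rewrite divr_gt0// normr_gt0 subr_eq0.
  have [de de0 H] := circle_unif e0.
  exists (Num.min de e); first by rewrite lt_min de0.
  move=> [s t] _ /=; rewrite prod_normE /= gt_max !lt_min => /andP[/andP[h1 _] /andP[h2 _]].
  rewrite /P /= lt_min => /andP[_ h3]; exfalso.
  have k1 := H _ _ h1; have k2 := H _ _ h2.
  have : `|c s0 - c t0| < `|c s0 - c t0|.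
    apply: le_lt_trans (ler_distD (c s) _ _) _.
    apply: le_lt_trans (lerD (lexx _) (ler_distD (c t) _ _)) _.
    by rewrite (distrC (c t)); move: h3 k1 k2; rewrite /e; lra.
  by rewrite ltxx.
exists de => // s t st.
have /andP[f0 f1] := frac01 s; have /andP[g0 g1] := frac01 t.
set zs := Num.floor s in f0 f1; set zt := Num.floor t in g0 g1.
have [||z zP] := H (s - zs%:~R, t - zt%:~R).
- by split; rewrite /= in_itv /=; apply/andP; split=> //; exact: ltW.
- by rewrite -!intrN /= !circle_shift.
exists (z + zs - zt); move: zP => /=; rewrite intrB intrD.
by congr (`|_| < _); ring.
Qed.

Lemma range_far y : ~ range c y -> exists2 eta, 0 < eta & forall s, eta <= `|y - c s|.
Proof.
move=> ny.
have [e e0 H] : exists2 e, 0 < e & forall s, `[0 : R, 1]%classic s -> e <= `|y - c s|.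
  apply: (compact_uniform (P := fun e s => e <= `|y - c s|)); first exact: segment_compact.
    by move=> e e' s; apply: le_trans.
  move=> s _; pose e := `|y - c s| / 2.
  have yc : 0 < `|y - c s|.
    by rewrite normr_gt0 subr_eq0; apply/eqP => E; apply: ny; exists s.
  have e0 : 0 < e by rewrite divr_gt0.
  have [de de0 H] := circle_unif e0.
  exists (Num.min de e); first by rewrite lt_min de0.
  move=> t _; rewrite lt_min => /andP[/H st _].
  apply: (@le_trans _ _ e); first by rewrite ge_min lexx orbT.
  by have := ler_distD (c t) y (c s); move: st; rewrite (distrC (c s)) /e; lra.
exists e => // s; rewrite -(circle_shift s (- Num.floor s)) intrN; apply: H.
by have /andP[f0 f1] := frac01 s; rewrite /= in_itv /= f0 ltW.
Qed.

End Circle4.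

(** * Stereographic charts of the sphere *)

Section Sphere.
Variable R : realType.
Notation V := 'rV[R]_4.

Definition co (x : V) (k : nat) : R := x ord0 (inord k).
Definition vec4 (a b c e : R) : V := \row_(i < 4) nth 0 [:: a; b; c; e] i.
Definition dot (x y : V) : R :=
  co x 0 * co y 0 + co x 1 * co y 1 + co x 2 * co y 2 + co x 3 * co y 3.

Lemma co_vec4 a b c e : [/\ co (vec4 a b c e) 0 = a, co (vec4 a b c e) 1 = b,
  co (vec4 a b c e) 2 = c & co (vec4 a b c e) 3 = e].
Proof. by split; rewrite /co mxE inordK. Qed.

Lemma eq_co (x y : V) : (forall k, (k < 4)%N -> co x k = co y k) -> x = y.
Proof.
move=> H; apply/rowP => i; have := H i (ltn_ord i).
by rewrite /co inord_val.
Qed.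

Lemma coD x y k : co (x + y) k = co x k + co y k. Proof. by rewrite /co mxE. Qed.
Lemma coN x k : co (- x) k = - co x k. Proof. by rewrite /co mxE. Qed.
Lemma coZ a x k : co (a *: x) k = a * co x k. Proof. by rewrite /co mxE. Qed.

Lemma sum_co (x : V) (f : R -> R) : \sum_(i < 4) f (x ord0 i) =
  f (co x 0) + f (co x 1) + f (co x 2) + f (co x 3).
Proof.
rewrite !big_ord_recr big_ord0 /= add0r /co.
by congr (f (x ord0 _) + f (x ord0 _) + f (x ord0 _) + f (x ord0 _));
  apply/val_inj; rewrite /= ?inordK.
Qed.

Lemma enormE x : enorm x = Num.sqrt (dot x x).
Proof. by rewrite /enorm (sum_co x (fun t => t ^+ 2)) /dot !expr2. Qed.

Lemma dot_ge0 x : 0 <= dot x x.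
Proof. by rewrite /dot -!expr2 !addr_ge0// sqr_ge0. Qed.

Lemma S3P x : S3 R x <-> dot x x = 1.
Proof.
rewrite /S3 /= enormE; split=> [E|->]; last by rewrite sqrtr1.
by rewrite -(sqr_sqrtr (dot_ge0 x)) E expr1n.
Qed.

Lemma co_le_norm (x : V) k : `|co x k| <= `|x|.
Proof.
rewrite [leRHS]mx_normrE.
exact: (le_bigmax _ (fun ij : 'I_1 * 'I_4 => `|x ij.1 ij.2|) (ord0, inord k)).
Qed.

Lemma norm_le_co (x : V) B : 0 <= B -> (forall k, (k < 4)%N -> `|co x k| <= B) -> `|x| <= B.
Proof.
move=> B0 H; rewrite [leLHS]mx_normrE; apply: bigmax_le => // -[i j] _ /=.
by have := H j (ltn_ord j); rewrite /co inord_val (ord1 i).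
Qed.

Lemma norm_sqr_le_dot x : `|x| ^+ 2 <= dot x x.
Proof.
rewrite -(sqr_sqrtr (dot_ge0 x)) ler_pXn2r// ?nnegrE ?sqrtr_ge0//.
apply: norm_le_co; first exact: sqrtr_ge0.
move=> k k4; rewrite -sqrtr_sqr ler_wsqrtr// /dot -!expr2.
have p j : 0 <= co x j ^+ 2 by exact: sqr_ge0.
have := p 0%N; have := p 1%N; have := p 2%N; have := p 3%N.
by case: k k4 => [|[|[|[|//]]]] _; lra.
Qed.

Lemma dot_le_norm x : dot x x <= 4 * `|x| ^+ 2.
Proof.
have p j : co x j * co x j <= `|x| ^+ 2.
  by rewrite -expr2 -(real_normK (num_real (co x j))) ler_pXn2r ?nnegrE// co_le_norm.
by rewrite /dot; have := p 0%N; have := p 1%N; have := p 2%N; have := p 3%N; lra.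
Qed.

Definition e0 : V := vec4 1 0 0 0.

(* The reflection exchanging the unit vector v with e0; when v = e0 the division
   by zero makes it the identity. *)
Definition reflect4 (v x : V) : V :=
  x - (2 * dot x (v - e0) / dot (v - e0) (v - e0)) *: (v - e0).

Lemma dot_reflect v x y : dot (reflect4 v x) (reflect4 v y) = dot x y.
Proof.
rewrite /reflect4; move: (v - e0) => w.
have [E|E] := eqVneq (dot w w) 0; first by rewrite E invr0 !mulr0 !scale0r !subr0.
set a := 2 * dot x w / dot w w; set b := 2 * dot y w / dot w w.
have -> : dot (x - a *: w) (y - b *: w) =
    dot x y - a * dot y w - b * dot x w + a * b * dot w w.
  by rewrite /dot !coD !coN !coZ; ring.
by rewrite /a /b; field.
Qed.

Lemma reflectB v x y : reflect4 v x - reflect4 v y = reflect4 v (x - y).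
Proof.
apply: eq_co => k _; rewrite /reflect4; move: (v - e0) => w.
by rewrite /dot !(coD, coN, coZ); ring.
Qed.

Lemma reflectK v : involutive (reflect4 v).
Proof.
move=> x; rewrite /reflect4; move: (v - e0) => w.
have [E|E] := eqVneq (dot w w) 0.
  by rewrite !E !invr0 !mulr0 !scale0r !subr0.
set a := 2 * dot x w / dot w w.
have -> : dot (x - a *: w) w = - dot x w.
  have -> : dot (x - a *: w) w = dot x w - a * dot w w by rewrite /dot !coD !coN !coZ; ring.
  by rewrite /a; field.
by rewrite mulrN mulNr scaleNr opprK -/a subrK.
Qed.

Lemma reflect_v v : dot v v = 1 -> reflect4 v v = e0.
Proof.
move=> v1; rewrite /reflect4; set w := v - e0.
have [c0 c1 c2 c3] := co_vec4 1 0 0 0.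
have Ew : dot w w = 2 - 2 * co v 0.
  transitivity (dot v v - 2 * co v 0 + 1); last by rewrite v1; ring.
  by rewrite /w /dot !coD !coN /e0 c0 c1 c2 c3; ring.
have Ev : dot v w = 1 - co v 0.
  transitivity (dot v v - co v 0); last by rewrite v1.
  by rewrite /w /dot !coD !coN /e0 c0 c1 c2 c3; ring.
have [E|E] := eqVneq (dot w w) 0.
  rewrite E invr0 mulr0 scale0r subr0; apply/eqP; rewrite -subr_eq0 -/w; apply/eqP.
  have h : `|w| ^+ 2 = 0.
    by apply/eqP; rewrite eq_le sqr_ge0 andbT -E norm_sqr_le_dot.
  by apply/eqP; rewrite -normr_eq0 -sqrf_eq0 h.
have -> : 2 * dot v w / dot w w = 1.
  by rewrite Ev (_ : 2 * (1 - co v 0) = dot w w) ?divff// Ew; ring.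
by rewrite scale1r /w opprB addrC subrK.
Qed.

Definition sqn (u : space3 R) : R := u.1.1.2 ^+ 2 + u.1.2 ^+ 2 + u.2 ^+ 2.
Definition sqd (u u' : space3 R) : R :=
  (u.1.1.2 - u'.1.1.2) ^+ 2 + (u.1.2 - u'.1.2) ^+ 2 + (u.2 - u'.2) ^+ 2.

Definition stereo (y : V) : space3 R :=
  point3 (co y 1 / (1 - co y 0)) (co y 2 / (1 - co y 0)) (co y 3 / (1 - co y 0)).
Definition stereo_inv (u : space3 R) : V :=
  vec4 ((sqn u - 1) / (sqn u + 1)) (2 * u.1.1.2 / (sqn u + 1))
    (2 * u.1.2 / (sqn u + 1)) (2 * u.2 / (sqn u + 1)).

Lemma sqn_ge0 u : 0 <= sqn u.
Proof. by rewrite /sqn !addr_ge0// sqr_ge0. Qed.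

Let sqn1 u : sqn u + 1 != 0.
Proof. by rewrite gt_eqF// ltr_wpDl// sqn_ge0. Qed.

Lemma stereo_inv_S3 u : dot (stereo_inv u) (stereo_inv u) = 1.
Proof.
rewrite /dot /stereo_inv; have [-> -> -> ->] := co_vec4 ((sqn u - 1) / (sqn u + 1))
  (2 * u.1.1.2 / (sqn u + 1)) (2 * u.1.2 / (sqn u + 1)) (2 * u.2 / (sqn u + 1)).
have := sqn1 u; rewrite /sqn => h; by field.
Qed.

Lemma stereo_invK u : stereo (stereo_inv u) = u.
Proof.
rewrite /stereo; have [-> -> -> ->] := co_vec4 ((sqn u - 1) / (sqn u + 1))
  (2 * u.1.1.2 / (sqn u + 1)) (2 * u.1.2 / (sqn u + 1)) (2 * u.2 / (sqn u + 1)).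
have h := sqn1 u.
have E : 1 - (sqn u - 1) / (sqn u + 1) = 2 / (sqn u + 1) by field.
rewrite E; case: u h E => [[[[] a] b] c] h E; rewrite /point3 /=.
by congr (_, _, _, _); field.
Qed.

Lemma stereoK y : dot y y = 1 -> y != e0 -> stereo_inv (stereo y) = y.
Proof.
move=> y1 ye.
have [c0 c1 c2 c3] := co_vec4 1 0 0 0.
have h : 1 - co y 0 != 0.
  apply: contra ye; rewrite subr_eq0 => /eqP h0; apply/eqP.
  have z : co y 1 ^+ 2 + co y 2 ^+ 2 + co y 3 ^+ 2 = 0.
    by move: y1; rewrite /dot -h0 => E; apply: (addrI (1 * 1)); rewrite addr0 mul1r -[RHS]E; ring.
  have p j : 0 <= co y j ^+ 2 by exact: sqr_ge0.
  have z1 : co y 1 ^+ 2 = 0 by have := p 1%N; have := p 2%N; have := p 3%N; lra.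
  have z2 : co y 2 ^+ 2 = 0 by have := p 1%N; have := p 2%N; have := p 3%N; lra.
  have z3 : co y 3 ^+ 2 = 0 by have := p 1%N; have := p 2%N; have := p 3%N; lra.
  move: z1 z2 z3 => /eqP; rewrite sqrf_eq0 => /eqP z1 /eqP; rewrite sqrf_eq0 => /eqP z2 /eqP.
  rewrite sqrf_eq0 => /eqP z3.
  by apply: eq_co => -[|[|[|[|//]]]] _; rewrite /e0 ?c0 ?c1 ?c2 ?c3.
have E : sqn (stereo y) = (1 + co y 0) / (1 - co y 0).
  rewrite /sqn /stereo /point3 /=.
  have -> : (co y 1 / (1 - co y 0)) ^+ 2 + (co y 2 / (1 - co y 0)) ^+ 2 +
     (co y 3 / (1 - co y 0)) ^+ 2 = (dot y y - co y 0 * co y 0) / (1 - co y 0) ^+ 2.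
    by rewrite /dot; field.
  by rewrite y1; field.
have E1 : sqn (stereo y) + 1 = 2 / (1 - co y 0) by rewrite E; field.
have E2 : sqn (stereo y) - 1 = 2 * co y 0 / (1 - co y 0) by rewrite E; field.
have [d0 d1 d2 d3] := co_vec4 ((sqn (stereo y) - 1) / (sqn (stereo y) + 1))
  (2 * (stereo y).1.1.2 / (sqn (stereo y) + 1)) (2 * (stereo y).1.2 / (sqn (stereo y) + 1))
  (2 * (stereo y).2 / (sqn (stereo y) + 1)).
apply: eq_co => -[|[|[|[|//]]]] _; rewrite /stereo_inv ?d0 ?d1 ?d2 ?d3 ?E2 E1 /=;
  by field.
Qed.

(** The conformal factor of stereographic projection. The uniformity properties of the chart, on
    bounded sets and near the pole, reduce to this identity and to [stereo_pole]. *)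
Lemma stereo_chord u u' : dot (stereo_inv u - stereo_inv u') (stereo_inv u - stereo_inv u') *
  ((sqn u + 1) * (sqn u' + 1)) = 4 * sqd u u'.
Proof.
rewrite /dot !coD !coN /stereo_inv.
have [-> -> -> ->] := co_vec4 ((sqn u - 1) / (sqn u + 1))
  (2 * u.1.1.2 / (sqn u + 1)) (2 * u.1.2 / (sqn u + 1)) (2 * u.2 / (sqn u + 1)).
have [-> -> -> ->] := co_vec4 ((sqn u' - 1) / (sqn u' + 1))
  (2 * u'.1.1.2 / (sqn u' + 1)) (2 * u'.1.2 / (sqn u' + 1)) (2 * u'.2 / (sqn u' + 1)).
have := sqn1 u; have := sqn1 u'; rewrite /sqn /sqd => h h'; field; by rewrite h h'.
Qed.

Lemma stereo_pole u : dot (stereo_inv u - e0) (stereo_inv u - e0) * (sqn u + 1) = 4.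
Proof.
rewrite /dot !coD !coN /stereo_inv /e0.
have [-> -> -> ->] := co_vec4 ((sqn u - 1) / (sqn u + 1))
  (2 * u.1.1.2 / (sqn u + 1)) (2 * u.1.2 / (sqn u + 1)) (2 * u.2 / (sqn u + 1)).
have [-> -> -> ->] := co_vec4 1 0 0 0.
have := sqn1 u; rewrite /sqn => h; by field.
Qed.

Lemma dist3_sqr_le u u' : dist3 u u' ^+ 2 <= sqd u u'.
Proof.
have p1 : 0 <= (u.1.1.2 - u'.1.1.2) ^+ 2 by exact: sqr_ge0.
have p2 : 0 <= (u.1.2 - u'.1.2) ^+ 2 by exact: sqr_ge0.
have p3 : 0 <= (u.2 - u'.2) ^+ 2 by exact: sqr_ge0.
have s0 : 0 <= sqd u u' by rewrite /sqd !addr_ge0.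
rewrite -(sqr_sqrtr s0) ler_pXn2r// ?nnegrE ?sqrtr_ge0 ?dist3_ge0//.
rewrite dist3E !ge_max sqrtr_ge0 -!sqrtr_sqr !ler_wsqrtr// /sqd; lra.
Qed.

Lemma sqd_le_dist3 u u' : sqd u u' <= 3 * dist3 u u' ^+ 2.
Proof.
have H t : `|t| <= dist3 u u' -> t ^+ 2 <= dist3 u u' ^+ 2.
  by move=> h; rewrite -(real_normK (num_real t)) ler_pXn2r ?nnegrE ?dist3_ge0.
have h1 := H (u.1.1.2 - u'.1.1.2); have h2 := H (u.1.2 - u'.1.2); have h3 := H (u.2 - u'.2).
have {h1}h1 := h1 _; have {h2}h2 := h2 _; have {h3}h3 := h3 _.
have k1 : `|u.1.1.2 - u'.1.1.2| <= dist3 u u' by rewrite dist3E !le_max lexx ?orbT.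
have k2 : `|u.1.2 - u'.1.2| <= dist3 u u' by rewrite dist3E !le_max lexx ?orbT.
have k3 : `|u.2 - u'.2| <= dist3 u u' by rewrite dist3E !le_max lexx ?orbT.
by move: (h1 k1) (h2 k2) (h3 k3); rewrite /sqd; lra.
Qed.

Lemma sqn_le_norm3 u : sqn u <= 3 * norm3 u ^+ 2.
Proof.
have -> : sqn u = sqd u (point3 0 0 0) by rewrite /sqn /sqd /= !subr0.
have -> : norm3 u = dist3 u (point3 0 0 0) by rewrite norm3E dist3E /= !subr0.
exact: sqd_le_dist3.
Qed.

Lemma norm3_sqr_le u : norm3 u ^+ 2 <= sqn u.
Proof.
have -> : sqn u = sqd u (point3 0 0 0) by rewrite /sqn /sqd /= !subr0.
have -> : norm3 u = dist3 u (point3 0 0 0) by rewrite norm3E dist3E /= !subr0.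
exact: dist3_sqr_le.
Qed.

End Sphere.

Section SphereType.
Variable R : realType.
Notation V := 'rV[R]_4.
Definition sphere : choiceType := set_type (S3 R).
Implicit Types x y : sphere.

Lemma sphereP x : S3 R (val x). Proof. exact: set_valP. Qed.
Lemma sphere_dot x : dot (val x) (val x) = 1. Proof. exact/S3P/sphereP. Qed.
Definition to_sphere (x : V) (H : S3 R x) : sphere := exist _ x (mem_set H).

Lemma S3_compact : compact (S3 R).
Proof.
apply: bounded_closed_compact.
  exists 1; split; first exact: num_real.
  move=> B B1 x /S3P x1; apply: (@le_trans _ _ 1); last exact: ltW.
  by rewrite -(ler_pXn2r (n := 2))// ?nnegrE// expr1n -x1 norm_sqr_le_dot.
have -> : S3 R = (fun x : V => dot x x) @^-1` [set 1].
  by apply/seteqP; split => x /S3P.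
apply: closed_comp; last exact: closed_eq.
have cc k : continuous (fun x : V => co x k).
  by move=> x; exact: (@coord_continuous R 1 4 ord0 (inord k) x).
have c2 k : continuous (fun x : V => co x k * co x k).
  by move=> x; exact: (continuousM (cc k x) (cc k x)).
move=> x _; rewrite /dot.
exact: (continuousD (continuousD (continuousD (c2 0%N x) (c2 1%N x)) (c2 2 x)) (c2 3 x)).
Qed.

Variables (d : sphere -> sphere -> R).
Hypothesis d_refl : forall x, d x x = 0.
Hypothesis d_sym : forall x y, d x y = d y x.
Hypothesis d_triangle : forall x y z, d x z <= d x y + d y z.
Hypothesis d_ge : forall x y, `|val x - val y| <= d x y.
Hypothesis d_le : forall e, 0 < e -> exists2 de, 0 < de &
  forall x y, `|val x - val y| < de -> d x y < e.

Section Chart.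
Variable oo : sphere.

Definition chart (x : sphere) : space3 R := stereo (reflect4 (val oo) (val x)).

Lemma chart_inv_subproof u : S3 R (reflect4 (val oo) (stereo_inv u)).
Proof. by apply/S3P; rewrite dot_reflect stereo_inv_S3. Qed.
Definition chart_inv (u : space3 R) : sphere := to_sphere (chart_inv_subproof u).

Lemma chart_invK u : chart (chart_inv u) = u.
Proof. by rewrite /chart /= reflectK stereo_invK. Qed.

Lemma chartK x : x <> oo -> chart_inv (chart x) = x.
Proof.
move=> xo; apply: val_inj; rewrite /= /chart stereoK ?reflectK//.
  by rewrite dot_reflect sphere_dot.
apply/eqP => E; apply: xo; apply: val_inj.
rewrite -(reflectK (val oo) (val x)) E -(reflect_v (sphere_dot oo)).
by rewrite reflectK.
Qed.

Lemma chart_inv_chord u u' :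
  dot (val (chart_inv u) - val (chart_inv u')) (val (chart_inv u) - val (chart_inv u')) *
  ((sqn u + 1) * (sqn u' + 1)) = 4 * sqd u u'.
Proof. by rewrite /= reflectB dot_reflect stereo_chord. Qed.

Lemma chart_inv_pole u :
  dot (val (chart_inv u) - val oo) (val (chart_inv u) - val oo) * (sqn u + 1) = 4.
Proof.
rewrite -{1 2}(reflectK (val oo) (val oo)) reflect_v ?sphere_dot//=.
by rewrite reflectB dot_reflect stereo_pole.
Qed.

Lemma chart_inv_unif e : 0 < e -> exists2 de, 0 < de &
  forall u u', dist3 u u' < de -> d (chart_inv u) (chart_inv u') < e.
Proof.
move=> e0; have [de de0 H] := d_le e0.
exists (de / 4); first by rewrite divr_gt0.
move=> u u' uu; apply: H.
rewrite -(ltr_pXn2r (n := 2))// ?nnegrE ?normr_ge0 ?(ltW de0)//.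
apply: le_lt_trans (norm_sqr_le_dot _) _.
have E := chart_inv_chord u u'; set D := dot _ _ in E *.
have D0 : 0 <= D by exact: dot_ge0.
have : D <= 4 * sqd u u'.
  by rewrite -E ler_peMr// mulr_ege1// lerDr sqn_ge0.
have := sqd_le_dist3 u u'.
have : dist3 u u' ^+ 2 < (de / 4) ^+ 2.
  by rewrite ltr_pXn2r ?nnegrE ?dist3_ge0// ltW// divr_gt0.
by rewrite expr_div_n; lra.
Qed.

Let far_sqn eta x : 0 < eta -> eta <= `|val x - val oo| -> x <> oo /\
  (sqn (chart x) + 1) * eta ^+ 2 <= 4.
Proof.
move=> eta0 h; have xo : x <> oo.
  by move=> E; move: h; rewrite E subrr normr0 leNgt eta0.
split=> //; have E := chart_inv_pole (chart x); rewrite chartK// in E.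
rewrite -[leRHS]E mulrC; apply: ler_wpM2r; first by rewrite addr_ge0 ?sqn_ge0.
by apply: le_trans (norm_sqr_le_dot _); rewrite ler_pXn2r ?nnegrE ?(ltW eta0).
Qed.

Let d_far eta : 0 < eta -> exists2 eta', 0 < eta' & forall x,
  eta <= d x oo -> eta' <= `|val x - val oo|.
Proof.
move=> eta0; have [de de0 H] := d_le eta0; exists de => // x hx.
by rewrite leNgt; apply/negP => /H; rewrite ltNge hx.
Qed.

Lemma chart_unif eta e : 0 < eta -> 0 < e -> exists2 de, 0 < de &
  forall x x', eta <= d x oo -> eta <= d x' oo -> d x x' < de ->
    dist3 (chart x) (chart x') < e.
Proof.
move=> eta0 ee; have [b b0 H] := d_far eta0.
exists (e * b ^+ 2 / 8); first by rewrite divr_gt0// mulr_gt0// exprn_gt0.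
move=> x x' /H hx /H hx' xx.
have [xo sx] := far_sqn b0 hx; have [xo' sx'] := far_sqn b0 hx'.
have E := chart_inv_chord (chart x) (chart x'); rewrite !chartK// in E.
rewrite -(ltr_pXn2r (n := 2))// ?nnegrE ?dist3_ge0 ?(ltW ee)//.
apply: le_lt_trans (dist3_sqr_le _ _) _.
set S := sqd _ _ in E *; set D := dot _ _ in E.
have D0 : 0 <= D by exact: dot_ge0.
have Dle : D <= 4 * (e * b ^+ 2 / 8) ^+ 2.
  apply: le_trans (dot_le_norm _) _; rewrite ler_pM2l//.
  rewrite ler_pXn2r ?nnegrE//; first by apply: ltW; apply: le_lt_trans xx; apply: d_ge.
  by rewrite divr_ge0// mulr_ge0 ?sqr_ge0// ltW.
have p1 : 0 <= sqn (chart x) + 1 by rewrite addr_ge0 ?sqn_ge0.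
have p2 : 0 <= sqn (chart x') + 1 by rewrite addr_ge0 ?sqn_ge0.
have b2 : 0 < b ^+ 2 by rewrite exprn_gt0.
have PP : (sqn (chart x) + 1) * (sqn (chart x') + 1) * (b ^+ 2) ^+ 2 <= 16.
  have := ler_pM (mulr_ge0 p1 (ltW b2)) (mulr_ge0 p2 (ltW b2)) sx sx'.
  rewrite (_ : 4 * 4 = 16 :> R); last by ring.
  by apply: le_trans; rewrite le_eqVlt; apply/orP; left; apply/eqP; ring.
have S4 : 4 * S <= 4 * (e * b ^+ 2 / 8) ^+ 2 * ((sqn (chart x) + 1) * (sqn (chart x') + 1)).
  by rewrite -E; apply: ler_wpM2r => //; apply: mulr_ge0.
have K : (e * b ^+ 2 / 8) ^+ 2 * ((sqn (chart x) + 1) * (sqn (chart x') + 1)) <= e ^+ 2 / 4.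
  have -> : (e * b ^+ 2 / 8) ^+ 2 * ((sqn (chart x) + 1) * (sqn (chart x') + 1)) =
    e ^+ 2 / 64 * ((sqn (chart x) + 1) * (sqn (chart x') + 1) * (b ^+ 2) ^+ 2) by field.
  have e2 : 0 <= e ^+ 2 / 64 by rewrite divr_ge0// sqr_ge0.
  by have := ler_wpM2l e2 PP; lra.
have e2 : 0 < e ^+ 2 by rewrite exprn_gt0.
by move: S4 K e2; lra.
Qed.

Lemma chart_bdd eta : 0 < eta ->
  exists B, forall x, eta <= d x oo -> norm3 (chart x) <= B.
Proof.
move=> eta0; have [b b0 H] := d_far eta0.
exists (4 / b ^+ 2) => x /H hx; have [_ sx] := far_sqn b0 hx.
have b2 : 0 < b ^+ 2 by rewrite exprn_gt0.
rewrite ler_pdivlMr//; apply: le_trans sx; rewrite ler_pM2r//.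
have := norm3_sqr_le (chart x); have : 0 <= (norm3 (chart x) - 1 / 2) ^+ 2 by exact: sqr_ge0.
rewrite sqrrB; lra.
Qed.

Lemma chart_away B : exists2 eta, 0 < eta &
  forall u, norm3 u <= B -> eta <= d (chart_inv u) oo.
Proof.
pose eta : R := (1 + 3 * B ^+ 2)^-1.
have B2 : 0 <= B ^+ 2 by exact: sqr_ge0.
have den : 0 < 1 + 3 * B ^+ 2 by move: B2; lra.
have eta0 : 0 < eta by rewrite invr_gt0.
have eta1 : eta <= 1 by rewrite invf_le1//; move: B2; lra.
exists eta => // u uB; apply: le_trans (d_ge _ _).
rewrite -(ler_pXn2r (n := 2))// ?nnegrE ?normr_ge0 ?(ltW eta0)//.
have E := chart_inv_pole u; have := dot_le_norm (val (chart_inv u) - val oo).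
set D := dot _ _ in E *; set N := `|_| ^+ 2.
have n0 : 0 <= norm3 u by rewrite norm3E !le_max lexx.
have un : sqn u + 1 <= 1 + 3 * B ^+ 2.
  have := sqn_le_norm3 u; have : norm3 u ^+ 2 <= B ^+ 2.
    by rewrite ler_pXn2r ?nnegrE// (le_trans n0).
  lra.
have D4 : 4 * eta <= D.
  rewrite -E /eta -mulrA ler_piMr ?dot_ge0// ler_pdivrMr// mul1r//.
have : eta ^+ 2 <= eta by rewrite expr2 ler_piMr// ltW.
by move: D4 eta0; lra.
Qed.

End Chart.

(** * Equivariant covering dimension of the sphere *)

Section Dimension.
Variables (psi : sphere -> sphere) (p : nat) (A : sphere -> Prop).
Hypothesis p_gt0 : (0 < p)%N.
Hypothesis psi_p : forall x, iter p psi x = x.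
Hypothesis psi_iso : forall x y, d (psi x) (psi y) = d x y.
Hypothesis psi_A : forall x, A (psi x) <-> A x.
Hypothesis psi_free : forall x i, iter i psi x = x -> (p %| i)%N.

Let d_ge0 x y : 0 <= d x y. Proof. by apply: le_trans (d_ge x y). Qed.

Lemma uniformly_free : exists2 r0, 0 < r0 &
  forall x i, d x (iter i psi x) < r0 -> (p %| i)%N.
Proof.
pose P (e : R) (v : V) := forall x, val x = v ->
  forall i, (0 < i < p)%N -> e <= d x (iter i psi x).
have [r0 r00 H] : exists2 e, 0 < e & forall v, S3 R v -> P e v.
  apply: compact_uniform; first exact: S3_compact.
    by move=> e e' v ee h x xv i ip; apply: le_trans ee _; apply: h.
  move=> v vS; pose x := to_sphere vS.
  pose m := \big[Num.min/1]_(i < p | (0 < i)%N) d x (iter i psi x).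
  have m0 : 0 < m.
    rewrite /m; elim/big_ind: _ => // [a b a0 b0|i i0]; first by rewrite lt_min a0.
    rewrite lt_neqAle d_ge0 andbT eq_sym; apply/eqP => E.
    have xE : iter i psi x = x.
      apply: val_inj; apply/eqP; rewrite -subr_eq0 -normr_le0 distrC -E; exact: d_ge.
    by have := dvdn_leq i0 (psi_free xE); rewrite leqNgt ltn_ord.
  have [de de0 Hd] := d_le (divr_gt0 m0 (ltr0n R 4)).
  exists (Num.min de (m / 2)); first by rewrite lt_min de0 divr_gt0.
  move=> w wS; rewrite lt_min => /andP[vw _] y yw i /andP[i0 ip].
  have xy : d x y < m / 4 by apply: Hd; rewrite yw.
  have mi : m <= d x (iter i psi x).
    by rewrite /m (bigD1 (Ordinal ip)) //= ge_min lexx.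
  have h1 := d_triangle x y (iter i psi x).
  have h2 := d_triangle y (iter i psi y) (iter i psi x).
  rewrite (iter_iso psi_iso i y x) (d_sym y x) in h2.
  by rewrite ge_min; apply/orP; right; move: xy mi h1 h2; lra.
exists r0 => // x i hi; rewrite /dvdn; case: posnP => // i0.
have := H (val x) (sphereP x) x erefl (i %% p)%N.
rewrite i0 ltn_mod p_gt0 => /(_ isT); rewrite (iter_mod psi_p) leNgt hi //.
Qed.

(** A colour consists of a ball of a fixed net and a colour of grid cells in each of the four
    coordinates. Two points are related when one common iterate brings both into that ball and into
    the same grid cell. *)
Lemma sphere_dim : exists n, dim_le d psi p A n.
Proof.
have [r0 r00 Hr] := uniformly_free.
have r8 : 0 < r0 / 8 by rewrite divr_gt0.
have [dn dn0 Hdn] := d_le r8.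
have [net [netS netP]] := compact_net S3_compact dn0.
pose C : finType := ('I_(size net) * {ffun 'I_4 -> 'I_2})%type.
(* The radius [r0 / 4] keeps two points of one ball closer than [r0]; by freeness, iterates of one
   point in the same ball come from the same power of [psi]. *)
pose B (j : nat) x := exists y, val y = nth 0 net j /\ d x y < r0 / 4.
have B_uniq j x i i' : B j (iter i psi x) -> B j (iter i' psi x) ->
    forall z, iter i psi z = iter i' psi z.
  move=> [y [yE yd]] [y' [yE' yd']].
  have yy : y' = y by apply: val_inj; rewrite yE yE'.
  have dd : d (iter i psi x) (iter i' psi x) < r0.
    apply: le_lt_trans (d_triangle _ y _) _; rewrite (d_sym y).
    by move: yd yd'; rewrite yy; move: r00; lra.
  have wlog_le a b : (a <= b)%N -> d (iter a psi x) (iter b psi x) < r0 ->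
      forall z, iter a psi z = iter b psi z.
    move=> ab; rewrite -(subnKC ab) iterD (iter_iso psi_iso) => /Hr pd z.
    rewrite iterD; congr (iter a psi _); apply/esym.
    by rewrite -(iter_mod psi_p) (eqP pd).
  have [ii|ii] := leqP i i'; first exact: wlog_le.
  by move=> z; apply/esym; apply: wlog_le; rewrite 1?d_sym// ltnW.
(* The number of colours is fixed before [e]; only the mesh [h] of the grid depends on [e]. *)
exists #|C| => e e0; have [de de0 Hde] := d_le e0.
pose h := de / 2 / 2; have h0 : 0 < h by rewrite !divr_gt0.
pose same (c : C) x y := forall k : 'I_4, exists i,
  cell h (c.2 k) i (co (val x) k) /\ cell h (c.2 k) i (co (val y) k).
pose rel (c : C) x y := [/\ A x, A y & exists m,
  [/\ B c.1 (iter m psi x), B c.1 (iter m psi y) & same c (iter m psi x) (iter m psi y)]].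
exists (fun i x y => exists2 c : C, nat_of_ord (enum_rank c) = i & rel c x y).
have rel_free c : free_per psi p (rel c).
  split.
  - move=> x y [Ax Ay [m [bx by_ s]]]; split=> //; exists m; split=> // k.
    by have [i [c1 c2]] := s k; exists i.
  - move=> x y z [Ax Ay [m [bx by_ s]]] [_ Az [m' [by' bz s']]]; split=> //; exists m.
    have E := B_uniq _ _ _ _ by_ by'; split=> //; first by rewrite E.
    move=> k; have [i [c1 c2]] := s k; have [i' [c1' c2']] := s' k.
    rewrite -(E y) in c1'; have ii := cell_uniq h0 c2 c1'.
    by exists i; split=> //; rewrite E ii.
  - move=> x y [Ax Ay [m [bx by_ s]]]; split; [exact/psi_A|exact/psi_A|].
    exists (m + p.-1)%N.
    have E z : iter (m + p.-1) psi (psi z) = iter m psi z.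
      by rewrite -iterSr -addnS prednK// iterD psi_p.
    by rewrite !E.
  - move=> x i [_ _ [m [bx by_ _]]].
    rewrite -iterD in by_; have := B_uniq _ _ _ _ bx by_ x; rewrite iterD => E.
    apply: (psi_free (x := x)); apply: val_inj; apply/eqP; rewrite -subr_eq0 -normr_le0.
    apply: le_trans (d_ge _ _) _; rewrite -(iter_iso psi_iso m) -E d_refl //.
split.
- move=> i _; have [[c ci]|nc] := pselect (exists c : C, nat_of_ord (enum_rank c) = i).
    have -> : (fun x y => exists2 c : C, nat_of_ord (enum_rank c) = i & rel c x y) = rel c.
      apply/funext => x; apply/funext => y; apply/propext; split=> [[c' c'i]|]; last by exists c.
      suff -> : c' = c by [].
      by apply: enum_rank_inj; apply: val_inj; rewrite /= c'i ci.
    exact: rel_free.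
  by split => [x y [c ci _]|x y z [c ci _]|x y [c ci _]|x j [c ci _]]; case: nc; exists c.
- move=> i x y _ [c _ [Ax Ay [m [bx by_ s]]]]; split=> //.
  rewrite -(iter_iso psi_iso m); apply: Hde.
  apply: (@le_lt_trans _ _ (de / 2)); last by rewrite ltr_pdivrMr// mulr_natr mulr2n ltrDl.
  apply: norm_le_co; first by rewrite divr_ge0// ltW.
  move=> k k4; have [j [c1 c2]] := s (Ordinal k4); rewrite coD coN.
  apply/ltW; apply: lt_le_trans (cell_diam c1 c2) _.
  by rewrite /h mulrC divfK.
exists (Num.min (r0 / 8) (h / 4)); first by rewrite lt_min r8 divr_gt0.
move=> [//|x0 s] _ [S sA].
have [y0 y0n y0d] := netP _ (sphereP x0).
have jn : (index y0 net < size net)%N by rewrite index_mem.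
have cov k : exists bi : nat * int, (bi.1 < 2)%N /\
    forall t', `|co (val x0) k - t'| < h / 4 -> cell h bi.1 bi.2 t'.
  by have [b [i [b2 H]]] := cell_cover (co (val x0) k) h0; exists (b, i).
have [bi biP] := choice cov.
pose c : C := (Ordinal jn, [ffun k : 'I_4 => inord (bi k).1]).
have c2 (k : 'I_4) : (c.2 k : nat) = (bi k).1.
  by rewrite ffunE inordK//; have [] := biP k.
exists (enum_rank c) => //.
have inB w : w \in x0 :: s -> B c.1 w.
  move=> ws; exists (to_sphere (netS _ y0n)); rewrite /= nth_index//; split=> //.
  apply: le_lt_trans (d_triangle _ x0 _) _.
  have h1 := S w x0 ws (mem_head _ _); rewrite lt_min in h1; have /andP[h2 _] := h1.
  have h3 : d (to_sphere (netS _ y0n)) x0 < r0 / 8 by apply: Hdn.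
  by rewrite (d_sym x0); move: h2 h3; lra.
have inC w (k : 'I_4) : w \in x0 :: s -> cell h (c.2 k) (bi k).2 (co (val w) k).
  move=> ws; rewrite c2; have [_] := biP k; apply.
  have h1 := S x0 w (mem_head _ _) ws; rewrite lt_min in h1; have /andP[_ h2] := h1.
  apply: le_lt_trans h2; apply: le_trans (d_ge _ _).
  by rewrite -coN -coD; exact: co_le_norm.
move=> x y xs ys; exists c => //; split; [exact: sA|exact: sA|exists 0%N].
by split; [exact: inB|exact: inB|move=> k; exists (bi k).2; split; exact: inC].
Qed.

End Dimension.
End SphereType.

(** * Paths and homotopies *)

Section Clamp.
Variable R : realType.

Definition clamp (s : R) : R := Num.max 0 (Num.min 1 s).

Lemma clamp01 s : 0 <= clamp s <= 1.
Proof. by rewrite /clamp le_max lexx ge_max ler01 ge_min lexx. Qed.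

Lemma clamp_id s : 0 <= s <= 1 -> clamp s = s.
Proof. by case/andP => s0 s1; rewrite /clamp (min_idPr s1) (max_idPr s0). Qed.

Lemma clamp_le0 s : s <= 0 -> clamp s = 0.
Proof. by move=> s0; rewrite /clamp max_l// ge_min s0 orbT. Qed.

Lemma clamp_ge1 s : 1 <= s -> clamp s = 1.
Proof. by move=> s1; rewrite /clamp (min_idPl s1) max_r. Qed.

Lemma clamp_dist s t : `|clamp s - clamp t| <= `|s - t|.
Proof.
have E x : clamp x = if x <= 0 then 0 else if x <= 1 then x else 1.
  have [x0|/ltW x0] := leP x 0; first exact: clamp_le0.
  by have [x1|/ltW x1] := leP x 1; [rewrite clamp_id ?x0|rewrite clamp_ge1].
have h1 := ler_norm (s - t); have h2 := ler_norm (t - s); rewrite distrC in h2.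
rewrite !E ler_norml; move: (`|s - t|) h1 h2 => n h1 h2.
by apply/andP; case: (leP s 0) => a; case: (leP s 1) => b; case: (leP t 0) => c;
  case: (leP t 1) => e; split; lra.
Qed.

Lemma clamp_continuous : continuous clamp.
Proof.
move=> s; apply/cvgrPdist_lt => e e0; near=> t.
apply: le_lt_trans (clamp_dist _ _) _; near: t.
by apply/nbhs_ballP; exists e.
Unshelve. all: by end_near. Qed.

Lemma locally_constant_line (Q : Type) (w : R -> Q) :
  (forall s, exists2 de, 0 < de & forall t, `|s - t| < de -> w t = w s) ->
  forall s t, w s = w t.
Proof.
move=> H s t.
pose v (x : R) := w (s + x * (t - s)).
have L x : exists2 de, 0 < de & forall y, `|x - y| < de -> v y = v x.
  have [de de0 h] := H (s + x * (t - s)).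
  have ts : 0 < `|t - s| + 1 by apply: ltr_wpDl.
  exists (de / (`|t - s| + 1)); first by rewrite divr_gt0.
  move=> y xy; apply: h.
  rewrite opprD addrACA subrr add0r -mulrBl normrM.
  rewrite ltr_pdivlMr// in xy; apply: le_lt_trans xy.
  by rewrite ler_wpM2l// lerDl.
have [de de0 h] : exists2 e, 0 < e & forall y, `[0, 1]%classic y ->
    forall z, `[0, 1]%classic z -> `|y - z| < e -> v y = v z.
  apply: (@compact_uniform R R `[0, 1]%classic
    (fun e y => forall z, `[0, 1]%classic z -> `|y - z| < e -> v y = v z)).
  - exact: (@segment_compact R 0 1).
  - by move=> e e' y ee h z zI yz; apply: h => //; apply: lt_le_trans ee.
  move=> x _; have [de de0 h] := L x.
  exists (de / 2); first by rewrite divr_gt0.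
  move=> y _ xy z _ yz; rewrite (h y) ?(h z)//.
    by apply: le_lt_trans (ler_distD y _ _) _; move: xy yz; lra.
  by move: xy; lra.
have <- : v 0 = w s by rewrite /v mul0r addr0.
have <- : v 1 = w t by rewrite /v mul1r subrKC.
apply/esym; apply: (locally_constant01 de0) => [a b a01 b01 ab|]; last by rewrite ler01 lexx.
by apply: h => //; rewrite /= in_itv.
Qed.

End Clamp.

Section Continuity.
Variables (R : realType) (V : normedModType R).

Lemma continuous_pair (T : topologicalType) (U W : normedModType R) (f : T -> U) (g : T -> W) :
  continuous f -> continuous g -> continuous (fun z => (f z, g z)).
Proof. by move=> cf cg z; apply: cvg_pair; [exact: cf|exact: cg]. Qed.

Lemma continuous_comp2 (T U W : topologicalType) (f : T -> U) (g : U -> W) :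
  continuous f -> continuous g -> continuous (g \o f).
Proof. by move=> cf cg z; apply: continuous_comp; [exact: cf|exact: cg]. Qed.

Lemma continuous_add2 (T : topologicalType) (f g : T -> V) :
  continuous f -> continuous g -> continuous (fun z => f z + g z).
Proof. by move=> cf cg z; apply: (continuousD (cf z) (cg z)). Qed.

Lemma continuous_opp (T : topologicalType) (f : T -> V) :
  continuous f -> continuous (fun z => - f z).
Proof. by move=> cf z; apply: (continuousN (cf z)). Qed.

Lemma continuous_scale2 (T : topologicalType) (h : T -> R) (f : T -> V) :
  continuous h -> continuous f -> continuous (fun z => h z *: f z).
Proof. by move=> ch cf z; apply: (continuousZ (ch z) (cf z)). Qed.

Lemma continuous_affine (a b : R) : continuous (fun s : R => a * s + b).
Proof.
move=> s; apply: (@continuousD R R R (fun s => a * s) (fun=> b) s); last exact: cst_continuous.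
exact: mulrl_continuous.
Qed.

End Continuity.

Section Paths.
Variables (R : realType) (V : normedModType R) (X : set V).

Definition path_in (x y : V) (p : R -> V) := [/\ continuous p, forall s, X (p s),
  forall s, s <= 0 -> p s = x & forall s, 1 <= s -> p s = y].

Definition path_homotopic (x y : V) (p q : R -> V) := exists H : R * R -> V,
  [/\ continuous H, forall z, X (H z),
   forall u s, s <= 0 -> H (u, s) = x, forall u s, 1 <= s -> H (u, s) = y &
   forall s, H (0, s) = p s /\ H (1, s) = q s].

(* Paths are constant outside [0, 1], so no case distinction is needed. *)
Definition path_cat (y : V) (p q : R -> V) (s : R) : V := p (2 * s) + q (2 * s - 1) - y.
Definition path_rev (p : R -> V) (s : R) : V := p (1 - s).

Lemma path_in_cst x : X x -> path_in x x (fun=> x).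
Proof. by move=> Xx; split=> //; exact: cst_continuous. Qed.

Lemma path_cat_cases x y z p q s : path_in x y p -> path_in y z q ->
  (s <= 2^-1 -> path_cat y p q s = p (2 * s)) /\ (2^-1 <= s -> path_cat y p q s = q (2 * s - 1)).
Proof.
move=> [_ _ _ p1] [_ _ q0 _]; rewrite /path_cat; split=> h.
  by rewrite q0 ?addrK//; lra.
by rewrite p1 1?addrC ?addrA ?addNr ?add0r ?addKr//; lra.
Qed.

Lemma path_in_cat x y z p q : path_in x y p -> path_in y z q -> path_in x z (path_cat y p q).
Proof.
move=> hp hq; have [cp Xp p0 p1] := hp; have [cq Xq q0 q1] := hq; split.
- apply: continuous_add2; last exact: cst_continuous.
  apply: continuous_add2.
    apply: (continuous_comp2 (f := fun s : R => 2 * s)) => //.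
    exact: mulrl_continuous.
  by apply: (continuous_comp2 (f := fun s : R => 2 * s - 1)) => //; exact: continuous_affine.
- move=> s; have [h1 h2] := path_cat_cases s hp hq.
  by have [h|/ltW h] := leP s 2^-1; [rewrite (h1 h); exact: Xp|rewrite (h2 h); exact: Xq].
- by move=> s s0; rewrite (path_cat_cases s hp hq).1 ?p0//; lra.
- by move=> s s0; rewrite (path_cat_cases s hp hq).2 ?q1//; lra.
Qed.

Lemma path_in_rev x y p : path_in x y p -> path_in y x (path_rev p).
Proof.
move=> [cp Xp p0 p1]; rewrite /path_rev; split=> // [|s s0|s s1].
- apply: (continuous_comp2 (f := fun s : R => 1 - s)) => //.
  rewrite (_ : (fun s : R => 1 - s) = (fun s => -1 * s + 1)).
    exact: continuous_affine.
  by apply/funext => t; rewrite mulN1r addrC.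
- by apply: p1; lra.
- by apply: p0; lra.
Qed.

Lemma path_homotopic_refl x y p : path_in x y p -> path_homotopic x y p p.
Proof.
move=> [cp Xp p0 p1]; exists (p \o snd); split.
- by apply: (continuous_comp2 (f := snd)) => // z; exact: cvg_snd.
- by move=> z; exact: Xp.
- by move=> u s; exact: p0.
- by move=> u s; exact: p1.
- by [].
Qed.

Lemma path_homotopic_sym x y p q : path_homotopic x y p q -> path_homotopic x y q p.
Proof.
move=> [H [cH XH H0 H1 Hpq]]; exists (fun z => H (1 - z.1, z.2)); split.
- apply: (continuous_comp2 (f := fun z : R * R => (1 - z.1, z.2))) => //.
  apply: continuous_pair; last by move=> z; exact: cvg_snd.
  move=> z; apply: (@continuousB R R); first exact: cst_continuous.
  exact: cvg_fst.
- by move=> z; exact: XH.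
- by move=> u s; exact: H0.
- by move=> u s; exact: H1.
- by move=> s /=; rewrite subr0 subrr; have [] := Hpq s.
Qed.

Lemma path_homotopic_trans x y p q r :
  path_homotopic x y p q -> path_homotopic x y q r -> path_homotopic x y p r.
Proof.
move=> [H [cH XH H0 H1 Hpq]] [K [cK XK K0 K1 Kqr]].
have E u s : u <= 0 -> H (clamp u, s) = p s by move/clamp_le0 ->; have [] := Hpq s.
have E1 u s : 1 <= u -> H (clamp u, s) = q s by move/clamp_ge1 ->; have [] := Hpq s.
have F u s : u <= 0 -> K (clamp u, s) = q s by move/clamp_le0 ->; have [] := Kqr s.
have F2 u s : 1 <= u -> K (clamp u, s) = r s by move/clamp_ge1 ->; have [] := Kqr s.
pose L (z : R * R) := H (clamp (2 * z.1), z.2) + K (clamp (2 * z.1 - 1), z.2) - H (1, z.2).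
have L1 u s : u <= 2^-1 -> L (u, s) = H (clamp (2 * u), s).
  by move=> h; rewrite /L/= F; [rewrite (Hpq s).2 addrK|lra].
have L2 u s : 2^-1 <= u -> L (u, s) = K (clamp (2 * u - 1), s).
  by move=> h; rewrite /L/= E1; [rewrite (Hpq s).2 addrC addrA addNr add0r|lra].
have csnd : continuous (snd : R * R -> R) by move=> z; exact: cvg_snd.
have caff a b : continuous (fun z : R * R => clamp (a * z.1 + b)).
  apply: (continuous_comp2 (f := fun z : R * R => a * z.1 + b)); last exact: clamp_continuous.
  apply: (continuous_comp2 (f := fst) (g := fun t => a * t + b)); last exact: continuous_affine.
  by move=> z; exact: cvg_fst.
have cdbl : continuous (fun z : R * R => clamp (2 * z.1)).
  by have := caff 2 0; rewrite (_ : (fun z : R * R => clamp (2 * z.1 + 0)) = (fun z => clamp (2 * z.1)))//; apply/funext => w; rewrite addr0.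
exists L; split.
- apply: continuous_add2; [apply: continuous_add2|apply: continuous_opp].
  + apply: (continuous_comp2 (f := fun z : R * R => (clamp (2 * z.1), z.2))) => //.
    apply: (@continuous_pair R _ R R (fun z : R * R => clamp (2 * z.1)) snd) => //.
  + apply: (continuous_comp2 (f := fun z : R * R => (clamp (2 * z.1 - 1), z.2))) => //.
    by apply: (@continuous_pair R _ R R (fun z : R * R => clamp (2 * z.1 - 1)) snd) => //; exact: caff.
  + apply: (continuous_comp2 (f := fun z : R * R => (1 : R, z.2))) => //.
    by apply: (@continuous_pair R _ R R (fun=> 1) snd) => //; exact: cst_continuous.
- by move=> [u s]; have [h|/ltW h] := leP u 2^-1; [rewrite (L1 _ _ h); exact: XH|rewrite (L2 _ _ h); exact: XK].
- by move=> u s h; have [h'|/ltW h'] := leP u 2^-1; [rewrite (L1 _ _ h') H0|rewrite (L2 _ _ h') K0].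
- by move=> u s h; have [h'|/ltW h'] := leP u 2^-1; [rewrite (L1 _ _ h') H1|rewrite (L2 _ _ h') K1].
- move=> s; rewrite L1; last lra; rewrite L2; last lra.
  by rewrite E; [rewrite F2//; lra|lra].
Qed.

Lemma path_homotopic_cat x y z p p' q q' :
  path_homotopic x y p p' -> path_homotopic y z q q' ->
  path_homotopic x z (path_cat y p q) (path_cat y p' q').
Proof.
move=> [H [cH XH H0 H1 Hpq]] [K [cK XK K0 K1 Kqr]].
pose L (z : R * R) := H (z.1, 2 * z.2) + K (z.1, 2 * z.2 - 1) - y.
have L1 u s : s <= 2^-1 -> L (u, s) = H (u, 2 * s).
  by move=> h; rewrite /L/= K0 ?addrK//; lra.
have L2 u s : 2^-1 <= s -> L (u, s) = K (u, 2 * s - 1).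
  by move=> h; rewrite /L/= H1; [rewrite addrC addrA addNr add0r|lra].
have cfst : continuous (fst : R * R -> R) by move=> w; exact: cvg_fst.
have caff a b : continuous (fun z : R * R => a * z.2 + b).
  apply: (continuous_comp2 (f := snd) (g := fun t => a * t + b)); last exact: continuous_affine.
  by move=> w; exact: cvg_snd.
have cdbl : continuous (fun z : R * R => 2 * z.2).
  by have := caff 2 0; rewrite (_ : (fun z : R * R => 2 * z.2 + 0) = (fun z => 2 * z.2))//; apply/funext => w; rewrite addr0.
exists L; split.
- apply: continuous_add2; last exact: cst_continuous.
  apply: continuous_add2.
  + apply: (continuous_comp2 (f := fun z : R * R => (z.1, 2 * z.2))) => //.
    exact: (@continuous_pair R _ R R fst (fun z : R * R => 2 * z.2)).
  + apply: (continuous_comp2 (f := fun z : R * R => (z.1, 2 * z.2 - 1))) => //.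
    by apply: (@continuous_pair R _ R R fst (fun z : R * R => 2 * z.2 - 1)) => //; exact: caff.
- by move=> [u s]; have [h|/ltW h] := leP s 2^-1; [rewrite (L1 _ _ h); exact: XH|rewrite (L2 _ _ h); exact: XK].
- by move=> u s h; rewrite L1 ?H0//; lra.
- by move=> u s h; rewrite L2 ?K1//; lra.
- by move=> s; rewrite /L /path_cat/=; have [-> ->] := Hpq (2 * s); have [-> ->] := Kqr (2 * s - 1).
Qed.


(** Both paths run through one curve [G], so interpolating the two parameter functions linearly
    gives the homotopy. The conditions on [G] keep the endpoints fixed, though the parameters may
    differ there. *)
Lemma path_homotopic_reparam x y (phi psi : R -> R) (p q : R -> V) (G : R -> V) :
  continuous G -> (forall t, X (G t)) -> continuous phi -> continuous psi ->
  (forall s t, s <= 0 -> phi s <= t <= psi s \/ psi s <= t <= phi s -> G t = x) ->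
  (forall s t, 1 <= s -> phi s <= t <= psi s \/ psi s <= t <= phi s -> G t = y) ->
  (forall s, p s = G (phi s)) -> (forall s, q s = G (psi s)) ->
  path_homotopic x y p q.
Proof.
move=> cG XG cphi cpsi G0 G1 pE qE.
pose m (z : R * R) := phi z.2 + clamp z.1 * (psi z.2 - phi z.2).
have mb u s : phi s <= m (u, s) <= psi s \/ psi s <= m (u, s) <= phi s.
  have /andP[c0 c1] := clamp01 u; rewrite /m/=.
  have [h|/ltW h] := leP (phi s) (psi s); [left|right]; apply/andP; split; nra.
have csnd : continuous (snd : R * R -> R) by move=> w; exact: cvg_snd.
have cps f : continuous f -> continuous (fun z : R * R => f z.2 : R).
  by move=> cf; apply: (continuous_comp2 (f := snd)).
have cm : continuous m.
  apply: (@continuous_add2 R R); first exact: (cps phi).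
  apply: (@continuous_scale2 R R); last first.
    by apply: (@continuous_add2 R R); [exact: (cps psi)|apply: continuous_opp; exact: (cps phi)].
  apply: (continuous_comp2 (f := fst) (g := @clamp R)); last exact: clamp_continuous.
  by move=> w; exact: cvg_fst.
exists (G \o m); split.
- exact: continuous_comp2.
- by move=> z; exact: XG.
- by move=> u s s0; apply: (G0 s).
- by move=> u s s0; apply: (G1 s).
- move=> s; rewrite /m /= clamp_le0// clamp_ge1// mul0r addr0 mul1r.
  by rewrite addrC subrK pE qE.
Qed.

End Paths.

(** * Groupoid laws for paths up to homotopy *)

Section Groupoid.
Variables (R : realType) (V : normedModType R) (X : set V).
Notation path_in := (path_in X).
Notation path_homotopic := (path_homotopic X).

Lemma continuous_abs_affine (a b : R) : continuous (fun s : R => (a * s + b * (1 - `|2 * s - 1|)) / 2).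
Proof.
have c1 : continuous (fun s : R => `|2 * s - 1|).
  by apply: (continuous_comp2 (f := fun s : R => 2 * s - 1)); [exact: continuous_affine|exact: norm_continuous].
have -> : (fun s : R => (a * s + b * (1 - `|2 * s - 1|)) / 2) =
    (fun s => (a / 2 * s + b / 2) + (- (b / 2)) * `|2 * s - 1|).
  by apply/funext => s; field.
apply: (@continuous_add2 R R); first exact: continuous_affine.
by apply: (continuous_comp2 (f := fun s : R => `|2 * s - 1|)) => //; exact: mulrl_continuous.
Qed.

Lemma path_cat_assoc x y z w p q r : path_in x y p -> path_in y z q -> path_in z w r ->
  path_homotopic x w (path_cat z (path_cat y p q) r) (path_cat y p (path_cat z q r)).
Proof.
move=> hp hq hr; have hpq := path_in_cat hp hq; have hqr := path_in_cat hq hr.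
have [cp Xp p0 p1] := hp; have [cq Xq q0 q1] := hq; have [cr Xr r0 r1] := hr.
(* The three paths in succession on the interval from 0 to 3, again without case distinction; the
   two bracketings are reparametrizations of [G]. *)
pose G t := p t + (q (t - 1) - y) + (r (t - 2) - z).
have G1 t : t <= 1 -> G t = p t.
  by move=> h; rewrite /G q0 ?r0 ?subrr ?addr0//; lra.
have G2 t : 1 <= t -> t <= 2 -> G t = q (t - 1).
  by move=> h h'; rewrite /G p1// r0 ?subrr ?addr0 1?addrC ?subrK//; lra.
have G3 t : 2 <= t -> G t = r (t - 2).
  move=> h; rewrite /G p1; last lra; rewrite q1; last lra.
  by rewrite [y + _]addrC subrK addrC subrK.
pose phi (s : R) := (6 * s + 1 * (1 - `|2 * s - 1|)) / 2.
pose psi (s : R) := (8 * s + (-1) * (1 - `|2 * s - 1|)) / 2 - s.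
have phi1 s : s <= 2^-1 -> phi s = 4 * s.
  by move=> h; rewrite /phi ler0_norm; [field|lra].
have phi2 s : 2^-1 <= s -> phi s = 2 * s + 1.
  by move=> h; rewrite /phi ger0_norm; [field|lra].
have psi1 s : s <= 2^-1 -> psi s = 2 * s.
  by move=> h; rewrite /psi ler0_norm; [field|lra].
have psi2 s : 2^-1 <= s -> psi s = 4 * s - 1.
  by move=> h; rewrite /psi ger0_norm; [field|lra].
apply: (@path_homotopic_reparam _ _ X x w phi psi _ _ G).
- have csub a : continuous (fun t : R => t - a).
    rewrite (_ : (fun t : R => t - a) = (fun t => 1 * t - a)); first exact: continuous_affine.
    by apply/funext => t; rewrite mul1r.
  apply: continuous_add2; [apply: continuous_add2 => //|];
  apply: continuous_add2; try exact: cst_continuous.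
    exact: (continuous_comp2 (csub 1) cq).
  exact: (continuous_comp2 (csub 2) cr).
- move=> t; have [h|/ltW h] := leP t 1; first by rewrite G1.
  by have [h'|/ltW h'] := leP t 2; [rewrite G2|rewrite G3].
- exact: continuous_abs_affine.
- apply: (@continuous_add2 R R); first exact: continuous_abs_affine.
  by move=> s; apply: (@continuousN R R); exact: cvg_id.
- move=> s t s0; rewrite phi1; last lra; rewrite psi1; last lra.
  by move=> h; rewrite G1 ?p0//; case: h => /andP[h1 h2]; lra.
- move=> s t s1; rewrite phi2; last lra; rewrite psi2; last lra.
  by move=> h; rewrite G3 ?r1//; case: h => /andP[h1 h2]; lra.
- move=> s; have [h|/ltW h] := leP s 2^-1.
    rewrite (path_cat_cases s hpq hr).1// phi1//.
    have [h'|/ltW h'] := leP (2 * s) 2^-1.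
      rewrite (path_cat_cases (2 * s) hp hq).1// G1; last lra.
      by congr p; ring.
    rewrite (path_cat_cases (2 * s) hp hq).2// G2; [|lra|lra].
    by congr q; ring.
  rewrite (path_cat_cases s hpq hr).2// phi2// G3; last lra.
  by congr r; ring.
- move=> s; have [h|/ltW h] := leP s 2^-1.
    by rewrite (path_cat_cases s hp hqr).1// psi1// G1//; lra.
  rewrite (path_cat_cases s hp hqr).2// psi2//.
  have [h'|/ltW h'] := leP (2 * s - 1) 2^-1.
    rewrite (path_cat_cases (2 * s - 1) hq hr).1// G2; [|lra|lra].
    by congr q; ring.
  rewrite (path_cat_cases (2 * s - 1) hq hr).2// G3; last lra.
  by congr r; ring.
Qed.

Lemma path_cat_cstl x y p : path_in x y p ->
  path_homotopic x y (path_cat x (fun=> x) p) p.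
Proof.
move=> [cp Xp p0 p1].
apply: (@path_homotopic_reparam _ _ X x y (fun s => 2 * s - 1) id _ _ p) => //.
- exact: continuous_affine.
- by move=> s; exact: cvg_id.
- by move=> s t s0 h; apply: p0; case: h => /= /andP[h1 h2]; lra.
- by move=> s t s0 h; apply: p1; case: h => /= /andP[h1 h2]; lra.
- by move=> s; rewrite /path_cat addrC addrA addNr add0r.
Qed.

Lemma path_cat_cstr x y p : path_in x y p ->
  path_homotopic x y (path_cat y p (fun=> y)) p.
Proof.
move=> [cp Xp p0 p1].
apply: (@path_homotopic_reparam _ _ X x y (fun s => 2 * s) id _ _ p) => //.
- exact: mulrl_continuous.
- by move=> s; exact: cvg_id.
- by move=> s t s0 h; apply: p0; case: h => /= /andP[h1 h2]; lra.
- by move=> s t s0 h; apply: p1; case: h => /= /andP[h1 h2]; lra.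
- by move=> s; rewrite /path_cat addrK.
Qed.

Lemma path_cat_revl x y p : path_in x y p ->
  path_homotopic y y (path_cat x (path_rev p) p) (fun=> y).
Proof.
move=> hp; have hr := path_in_rev hp; have [cp Xp p0 p1] := hp.
apply: (@path_homotopic_reparam _ _ X y y (fun s => `|2 * s - 1|) (fun=> 1) _ _ p) => //.
- by apply: (continuous_comp2 (f := fun s : R => 2 * s - 1)); [exact: continuous_affine|exact: norm_continuous].
- exact: cst_continuous.
- move=> s t s0; rewrite ler0_norm; last lra.
  by move=> h; apply: p1; case: h => /andP[h1 h2]; lra.
- move=> s t s0; rewrite ger0_norm; last lra.
  by move=> h; apply: p1; case: h => /andP[h1 h2]; lra.
- move=> s; have [h|/ltW h] := leP s 2^-1.
    rewrite (path_cat_cases s hr hp).1// /path_rev ler0_norm; last lra.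
    by congr p; ring.
  rewrite (path_cat_cases s hr hp).2// ger0_norm//; lra.
- by move=> s; rewrite p1.
Qed.

Lemma path_cat_cancel x y z p q : path_in x y p -> path_in y z q ->
  path_homotopic y z (path_cat x (path_rev p) (path_cat y p q)) q.
Proof.
move=> hp hq; have hr := path_in_rev hp.
apply: path_homotopic_trans (path_homotopic_sym (path_cat_assoc hr hp hq)) _.
apply: path_homotopic_trans (path_cat_cstl hq).
by apply: path_homotopic_cat; [exact: path_cat_revl|exact: path_homotopic_refl].
Qed.

(** Arcs closed up by paths to the base point multiply like the arcs, since the two tails in the
    middle cancel. This is what makes [word_cocycle] a cocycle. *)
Lemma path_cat_conj x y z x0 p p' p'' s s' s'' :
  path_in x0 x p -> path_in x0 y p' -> path_in x0 z p'' ->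
  path_in x y s -> path_in y z s' -> path_in x z s'' ->
  path_homotopic x z (path_cat y s s') s'' ->
  path_homotopic x0 x0
   (path_cat x0 (path_cat x p (path_cat y s (path_rev p')))
      (path_cat y p' (path_cat z s' (path_rev p''))))
   (path_cat x p (path_cat z s'' (path_rev p''))).
Proof.
move=> hp hp' hp'' hs hs' hs'' ss.
have r' := path_in_rev hp'; have r'' := path_in_rev hp''.
have hD := path_in_cat hs' r''.
apply: path_homotopic_trans (path_cat_assoc hp (path_in_cat hs r') (path_in_cat hp' hD)) _.
apply: path_homotopic_cat; first exact: path_homotopic_refl hp.
apply: path_homotopic_trans (path_cat_assoc hs r' (path_in_cat hp' hD)) _.
apply: (@path_homotopic_trans _ _ _ _ _ _ (path_cat y s (path_cat z s' (path_rev p'')))).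
  apply: path_homotopic_cat; first exact: path_homotopic_refl hs.
  exact: path_cat_cancel hp' hD.
apply: path_homotopic_trans (path_homotopic_sym (path_cat_assoc hs hs' r'')) _.
by apply: path_homotopic_cat => //; exact: path_homotopic_refl.
Qed.

(** * Straight segments pushed into the space by a local retraction *)

Section Local.
Variable nu : V -> V.
Hypothesis nu_id : forall y, X y -> nu y = y.
Hypothesis nu_local : forall x, X x -> exists2 r, 0 < r &
  forall v, `|x - v| < r -> X (nu v) /\ {for v, continuous nu}.

Definition segment (y z : V) (s : R) : V := nu (y + clamp s *: (z - y)).

Lemma convex_ball (x y z : V) (r t : R) : `|x - y| < r -> `|x - z| < r -> 0 <= t <= 1 ->
  `|x - (y + t *: (z - y))| < r.
Proof.
move=> xy xz /andP[t0 t1].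
have -> : x - (y + t *: (z - y)) = (1 - t) *: (x - y) + t *: (x - z).
  have -> : z - y = (x - y) - (x - z) by rewrite opprB [RHS]addrC addrA subrK.
  by rewrite opprD addrA; move: (x - y) (x - z) => a b; rewrite scalerBl scale1r scalerBr opprB addrA addrAC.
apply: le_lt_trans (ler_normD _ _) _; rewrite !normrZ !ger0_norm//; last lra.
have [t1' | /eqP t1'] := eqVneq t 1; first by rewrite t1' subrr mul0r add0r mul1r.
have : (1 - t) * `|x - y| < (1 - t) * r by rewrite ltr_pM2l//; lra.
have : t * `|x - z| <= t * r by rewrite ler_wpM2l// ltW.
lra.
Qed.

Lemma segment_in x : X x -> forall r, 0 < r -> exists2 e, 0 < e & forall y z,
  X y -> X z -> `|x - y| < e -> `|x - z| < e -> path_in y z (segment y z) /\ forall s, `|x - segment y z s| < r.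
Proof.
move=> Xx r r0; have [e1 e10 he1] := nu_local Xx.
have xx : `|x - x| < e1 by rewrite subrr normr0.
have [_ /cvgrPdist_lt] := he1 x xx.
move=> /(_ r r0)/nbhs_ballP[e2 /= e20 he2].
exists (Num.min e1 e2); first by rewrite lt_min e10.
move=> y z Xy Xz xy xz.
have B s : `|x - (y + clamp s *: (z - y))| < Num.min e1 e2.
  by apply: convex_ball => //; exact: clamp01.
have B1 s : `|x - (y + clamp s *: (z - y))| < e1 by have := B s; rewrite lt_min => /andP[].
split; last first.
  move=> s; rewrite /segment -{1}(nu_id Xx); apply: he2.
  by rewrite -ball_normE /=; have := B s; rewrite lt_min => /andP[].
split.
- move=> s; apply: (@continuous_comp _ _ _ (fun s => y + clamp s *: (z - y)) nu).
    apply: continuous_add2; first exact: cst_continuous.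
    by apply: continuous_scale2; [exact: clamp_continuous|exact: cst_continuous].
  by have [] := he1 _ (B1 s).
- by move=> s; have [] := he1 _ (B1 s).
- by move=> s s0; rewrite /segment clamp_le0// scale0r addr0 nu_id.
- by move=> s s1; rewrite /segment clamp_ge1// scale1r addrC subrK nu_id.
Qed.

Lemma local_path_homotopic x : X x -> exists2 r, 0 < r & forall y z p q,
  path_in y z p -> path_in y z q -> (forall s, `|x - p s| < r) -> (forall s, `|x - q s| < r) ->
  path_homotopic y z p q.
Proof.
move=> Xx; have [r r0 hr] := nu_local Xx; exists r => // y z p q.
move=> [cp Xp p0 p1] [cq Xq q0 q1] pr qr.
pose L (w : R * R) := p w.2 + clamp w.1 *: (q w.2 - p w.2).
have B w : `|x - L w| < r by apply: convex_ball => //; exact: clamp01.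
have csnd f : continuous f -> continuous (fun w : R * R => f w.2 : V).
  by move=> cf; apply: (continuous_comp2 (f := snd)) => // w; exact: cvg_snd.
have cL : continuous L.
  apply: continuous_add2; first exact: csnd.
  apply: continuous_scale2; last by apply: continuous_add2; [exact: csnd|apply: continuous_opp; exact: csnd].
  apply: (continuous_comp2 (f := fst) (g := @clamp R)); last exact: clamp_continuous.
  by move=> w; exact: cvg_fst.
exists (nu \o L); split.
- by move=> w; apply: continuous_comp; [exact: cL|have [] := hr _ (B w)].
- by move=> w; have [] := hr _ (B w).
- by move=> u s s0; rewrite /= /L /= p0// q0// subrr scaler0 addr0 nu_id// -(p0 s).
- by move=> u s s0; rewrite /= /L /= p1// q1// subrr scaler0 addr0 nu_id// -(p1 s).
- move=> s; rewrite /= /L /= clamp_le0// clamp_ge1// scale0r scale1r addr0 addrC subrK.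
  by rewrite !nu_id.
Qed.

Lemma segment_cat x : X x -> exists2 e, 0 < e & forall y z w, X y -> X z -> X w ->
  `|x - y| < e -> `|x - z| < e -> `|x - w| < e ->
  path_homotopic y w (path_cat z (segment y z) (segment z w)) (segment y w).
Proof.
move=> Xx; have [r r0 hr] := local_path_homotopic Xx.
have [e e0 he] := segment_in Xx r0; exists e => // y z w Xy Xz Xw xy xz xw.
have [p1 b1] := he _ _ Xy Xz xy xz; have [p2 b2] := he _ _ Xz Xw xz xw.
have [p3 b3] := he _ _ Xy Xw xy xw.
apply: hr => //; first exact: path_in_cat p1 p2.
move=> s; have [h|/ltW h] := leP s 2^-1.
  by rewrite (path_cat_cases s p1 p2).1.
by rewrite (path_cat_cases s p1 p2).2.
Qed.

Definition subpath (J : R -> V) (t t' s : R) : V := J (t + (t' - t) * clamp s).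

Lemma subpath_in J t t' : continuous J -> (forall s, X (J s)) ->
  path_in (J t) (J t') (subpath J t t').
Proof.
move=> cJ XJ; split.
- apply: (continuous_comp2 (f := fun s => t + (t' - t) * clamp s)) => //.
  apply: (@continuous_add2 R R); first exact: cst_continuous.
  by apply: (@continuous_scale2 R R); [exact: cst_continuous|exact: clamp_continuous].
- by move=> s; exact: XJ.
- by move=> s s0; rewrite /subpath clamp_le0// mulr0 addr0.
- by move=> s s1; rewrite /subpath clamp_ge1// mulr1 addrC subrK.
Qed.

Lemma subpath_cat J t t' t'' : continuous J -> (forall s, X (J s)) ->
  path_homotopic (J t) (J t'') (path_cat (J t') (subpath J t t') (subpath J t' t''))
    (subpath J t t'').
Proof.
move=> cJ XJ.
pose phi s := t + (t' - t) * clamp (2 * s) + (t'' - t') * clamp (2 * s - 1).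
pose psi s := t + (t'' - t) * clamp s.
apply: (@path_homotopic_reparam _ _ X _ _ phi psi _ _ J) => //.
- apply: (@continuous_add2 R R); [apply: (@continuous_add2 R R)|]; first exact: cst_continuous.
    apply: (@continuous_scale2 R R); first exact: cst_continuous.
    apply: (continuous_comp2 (f := fun s : R => 2 * s)); last exact: clamp_continuous.
    exact: mulrl_continuous.
  apply: (@continuous_scale2 R R); first exact: cst_continuous.
  apply: (continuous_comp2 (f := fun s : R => 2 * s - 1)); last exact: clamp_continuous.
  exact: continuous_affine.
- apply: (@continuous_add2 R R); first exact: cst_continuous.
  by apply: (@continuous_scale2 R R); [exact: cst_continuous|exact: clamp_continuous].
- move=> s u s0; rewrite /phi /psi !clamp_le0; [|lra..].
  by rewrite !mulr0 !addr0 => -[] /andP[h1 h2]; congr J; lra.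
- move=> s u s0; rewrite /phi /psi !clamp_ge1; [|lra..].
  by rewrite !mulr1 => -[] /andP[h1 h2]; congr J; lra.
- move=> s; have [h|/ltW h] := leP s 2^-1.
    rewrite (path_cat_cases s (subpath_in t t' cJ XJ) (subpath_in t' t'' cJ XJ)).1//.
    by rewrite /subpath /phi (@clamp_le0 _ (2 * s - 1)) ?mulr0 ?addr0//; lra.
  rewrite (path_cat_cases s (subpath_in t t' cJ XJ) (subpath_in t' t'' cJ XJ)).2//.
  rewrite /subpath /phi (@clamp_ge1 _ (2 * s)) ?mulr1; last lra.
  by congr J; ring.
Qed.

End Local.
End Groupoid.

(** * Holonomy of group-valued cocycles *)

Definition group_laws (G : Type) (mul : G -> G -> G) (one : G) (inv : G -> G) :=
  [/\ associative mul, left_id one mul, right_id one mul,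
      left_inverse one inv mul & right_inverse one inv mul].

Section Holonomy.
Variables (R : realType) (V : normedModType R) (X : set V).
Variables (G : Type) (mul : G -> G -> G) (one : G) (inv : G -> G).
Hypothesis hG : group_laws mul one inv.
Let mulA : associative mul. Proof. by case: hG. Qed.
Let mul1 : left_id one mul. Proof. by case: hG. Qed.
Let mulg1 : right_id one mul. Proof. by case: hG. Qed.
Let mulV : left_inverse one inv mul. Proof. by case: hG. Qed.
Let mulgV : right_inverse one inv mul. Proof. by case: hG. Qed.
Notation path_in := (path_in X).
Notation path_homotopic := (path_homotopic X).

(** The transition data of a flat bundle: parallel transport between nearby points, at a scale that
    may vary with the point. *)
Definition group_cocycle (q : V -> V -> G) := forall x, X x -> exists2 r, 0 < r &
  forall y z w, X y -> X z -> X w -> `|x - y| < r -> `|x - z| < r -> `|x - w| < r ->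
  mul (q y z) (q z w) = q y w.

(** Parallel transport along [p], characterized by its increments over short times; uniqueness then
    follows from connectedness of the line. *)
Definition primitive (q : V -> V -> G) (p : R -> V) (u : R -> G) := forall s,
  exists2 de, 0 < de & forall t, `|s - t| < de -> u t = mul (u s) (q (p s) (p t)).

Definition path_holonomy q p m := exists u, [/\ primitive q p u, u 0 = one & u 1 = m].

Lemma primitive_uniq q p u u' : primitive q p u -> primitive q p u' -> u 0 = u' 0 ->
  forall s, u s = u' s.
Proof.
move=> hu hu' u0 s; pose w s := `[< u s = u' s >].
suff /asboolP : w s by [].
rewrite (@locally_constant_line R bool w _ s 0); first exact/asboolP.
move=> {}s; have [d1 d10 h1] := hu s; have [d2 d20 h2] := hu' s.
exists (Num.min d1 d2); first by rewrite lt_min d10.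
move=> t; rewrite lt_min => /andP[t1 t2]; rewrite /w; apply: asbool_equiv_eq.
rewrite h1// h2//; split=> [E|->//].
move: (congr1 (mul^~ (inv (q (p s) (p t)))) E).
by rewrite -!mulA !mulgV !mulg1.
Qed.

Lemma path_holonomy_uniq q p m m' : path_holonomy q p m -> path_holonomy q p m' -> m = m'.
Proof.
move=> [u [hu u0 <-]] [u' [hu' u'0 <-]].
by apply: (primitive_uniq hu hu'); rewrite u0.
Qed.

Lemma primitive_comp q p u (phi : R -> R) : primitive q p u -> continuous phi ->
  primitive q (p \o phi) (u \o phi).
Proof.
move=> hu cphi s; have [de de0 h] := hu (phi s).
have /cvgrPdist_lt/(_ de de0)/nbhs_ballP[e /= e0 he] := cphi s.
exists e => // t st; apply: h; apply: he; by rewrite -ball_normE.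
Qed.

Section Cocycle.
Variable q : V -> V -> G.
Hypothesis hq : group_cocycle q.

Lemma group_cocycle_refl x : X x -> q x x = one.
Proof.
move=> Xx; have [r r0 h] := hq Xx.
have xx : `|x - x| < r by rewrite subrr normr0.
have := h x x x Xx Xx Xx xx xx xx.
move/(congr1 (mul (inv (q x x)))).
by rewrite mulA !mulV mul1.
Qed.

Lemma primitive_cst x u s t : X x -> primitive q (fun=> x) u -> u s = u t.
Proof.
move=> Xx hu; apply: locally_constant_line => {}s; have [de de0 h] := hu s.
by exists de => // {}t /h ->; rewrite group_cocycle_refl// mulg1.
Qed.

Lemma primitive_outside x y p u : path_in x y p -> primitive q p u ->
  (forall s, s <= 0 -> u s = u 0) /\ (forall s, 1 <= s -> u s = u 1).
Proof.
move=> [cp Xp p0 p1] hu.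
have Xx : X x by rewrite -(p0 0).
have Xy : X y by rewrite -(p1 1).
have cn : continuous (fun s : R => `|s|) by exact: norm_continuous.
split=> s hs.
  have cphi : continuous (fun s : R => - `|s|) by exact: (@continuous_opp R R).
  have := primitive_comp hu cphi.
  rewrite (_ : p \o _ = fun=> x); last by apply/funext => t /=; rewrite p0// oppr_le0.
  move/(primitive_cst s 0 Xx) => /=.
  by rewrite normr0 oppr0 ler0_norm// opprK.
have cphi : continuous (fun s : R => 1 + `|s|).
  by apply: (@continuous_add2 R R) => //; exact: cst_continuous.
have := primitive_comp hu cphi.
rewrite (_ : p \o _ = fun=> y); last by apply/funext => t /=; rewrite p1// lerDl.
move/(primitive_cst (s - 1) 0 Xy) => /=.
by rewrite normr0 addr0 ger0_norm ?subr_ge0// subrKC.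
Qed.

(** Continuation in the stopping time: existence of a transport up to time [t] is a locally constant
    property of [t], and it holds at time 0. *)
Lemma path_holonomy_exists x y p : path_in x y p -> exists m, path_holonomy q p m.
Proof.
move=> [cp Xp p0 p1].
have Xx : X x by rewrite -(p0 0).
pose E t := exists2 u, primitive q (fun s => p (Num.min s t)) u & u 0 = one.
suff [u hu u0] : E 1.
  exists (u 1), u; split=> //.
  move: hu; congr primitive; apply/funext => s.
  by have [//|/ltW h] := leP s 1; rewrite !p1.
have : `[< E 1 >]; last by move/asboolP.
rewrite (@locally_constant_line R bool (fun t => `[< E t >]) _ 1 0).
  apply/asboolP; exists (fun=> one) => // s; exists 1 => // t _.
  by rewrite !p0 ?ge_min ?lexx ?orbT// group_cocycle_refl// mulg1.
move=> t0.
have [r r0 hr] := hq (Xp t0).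
have /cvgrPdist_lt/(_ r r0)/nbhs_ballP[e /= e0 he] := cp t0.
have C a b c : `|t0 - a| < e -> `|t0 - b| < e -> `|t0 - c| < e ->
    mul (q (p a) (p b)) (q (p b) (p c)) = q (p a) (p c).
  by move=> ta tb tc; apply: hr => //; apply: he; rewrite -ball_normE.
have ext t t' : `|t0 - t| < e -> `|t0 - t'| < e -> E t -> E t'.
  move=> tt tt' [u hu u0].
  exists (fun s => mul (u s) (q (p (Num.min s t)) (p (Num.min s t')))); last first.
    rewrite u0 mul1 (p0 (Num.min 0 t)) ?ge_min ?lexx// (p0 (Num.min 0 t')) ?ge_min ?lexx//.
    exact: group_cocycle_refl.
  move=> s; have [d1 d10 h1] := hu s.
  have [sm|sm] := ltP s (Num.min t t').
    exists (Num.min d1 (Num.min t t' - s)); first by rewrite lt_min d10 subr_gt0.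
    move=> s'; rewrite lt_min => /andP[/h1 -> ss].
    have sm' : s' < Num.min t t'.
      by have := ler_norm (s' - s); rewrite distrC; move: ss; lra.
    move: sm sm'; rewrite !lt_min => /andP[/ltW/min_idPl-> /ltW/min_idPl->].
    move=> /andP[/ltW/min_idPl-> /ltW/min_idPl->].
    by rewrite !group_cocycle_refl// !mulg1.
  have bnd b c : t0 - e < b -> `|t0 - c| < e -> `|t0 - Num.min b c| < e.
    move=> hb; rewrite !ltr_norml => /andP[c1 c2].
    by case: (leP b c) => bc; apply/andP; split; lra.
  have se : t0 - e < s.
    apply: lt_le_trans sm; rewrite lt_min; move: tt tt'; rewrite !ltr_norml.
    by move=> /andP[a1 a2] /andP[b1 b2]; apply/andP; split; lra.
  exists (Num.min d1 (s - (t0 - e))); first by rewrite lt_min d10 subr_gt0.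
  move=> s'; rewrite lt_min => /andP[/h1 -> ss].
  have se' : t0 - e < s' by have := ler_norm (s - s'); move: ss; lra.
  by rewrite -!mulA !C //; apply: bnd.
exists e => // t tt; apply: asbool_equiv_eq.
have t00 : `|t0 - t0| < e by rewrite subrr normr0.
by split; apply: ext.
Qed.

Lemma path_holonomy_cst x : X x -> path_holonomy q (fun=> x) one.
Proof.
move=> Xx; exists (fun=> one); split=> // s; exists 1 => // t _.
by rewrite group_cocycle_refl// mulg1.
Qed.

Lemma path_holonomy_cat x y z p p' m m' : path_in x y p -> path_in y z p' ->
  path_holonomy q p m -> path_holonomy q p' m' ->
  path_holonomy q (path_cat y p p') (mul m m').
Proof.
move=> hp hp' [u [hu u0 u1]] [u' [hu' u'0 u'1]].
have [_ ur] := primitive_outside hp hu; have [ul _] := primitive_outside hp' hu'.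
exists (fun s => mul (u (2 * s)) (u' (2 * s - 1))); split; last first.
- by rewrite mulr1 ur ?u1; [congr mul; rewrite -u'1; congr u'; ring|lra].
- by rewrite mulr0 u0 mul1 ul ?u'0//; lra.
have c2 : continuous (fun s : R => 2 * s) by exact: mulrl_continuous.
have [hv hv'] := (primitive_comp hu c2, primitive_comp hu' (@continuous_affine R 2 (-1))).
move=> s; have [d1 d10 h1] := hv s; have [d2 d20 h2] := hv' s.
have [d3 d30 h3] : exists2 d3, 0 < d3 & forall t, `|s - t| < d3 ->
    (s <= 2^-1 /\ t <= 2^-1) \/ (2^-1 <= s /\ 2^-1 <= t).
  case: (ltgtP s 2^-1) => hs.
  - exists (2^-1 - s); rewrite ?subr_gt0// => t st; left.
    by have := ler_norm (t - s); rewrite distrC; move: st; lra.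
  - exists (s - 2^-1); rewrite ?subr_gt0// => t st; right.
    by have := ler_norm (s - t); move: st; lra.
  - by exists 1 => // t _; case: (leP t 2^-1) => ht; [left|right]; rewrite ?(ltW ht).
exists (Num.min (Num.min d1 d2) d3); first by rewrite !lt_min d10 d20.
move=> t; rewrite !lt_min => /andP[/andP[/h1/= E1 /h2/= E2] /h3[[hs ht]|[hs ht]]].
- rewrite (path_cat_cases s hp hp').1// (path_cat_cases t hp hp').1//.
  by rewrite E1 !ul ?u'0 ?mulg1//; lra.
- rewrite (path_cat_cases s hp hp').2// (path_cat_cases t hp hp').2//.
  by rewrite E2 !ur ?mulA//; lra.
Qed.

Lemma path_holonomy_rev p m : path_holonomy q p m -> path_holonomy q (path_rev p) (inv m).
Proof.
move=> [u [hu u0 u1]]; exists (fun s => mul (inv m) (u (1 - s))); split.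
- move=> s; have [de de0 h] := hu (1 - s); exists de => // t st.
  rewrite h ?mulA//; move: st; rewrite distrC; congr (`|_| < _); ring.
- by rewrite subr0 u1 mulV.
- by rewrite subrr u0 mulg1.
Qed.

(** Transport across from one path of the homotopy to a neighbouring one turns a primitive along the
    first into a primitive along the second. The endpoints are fixed, so this crossing is trivial
    there and the holonomy is locally constant. *)
Lemma path_holonomy_homotopic x y p p' m : path_in x y p ->
  path_homotopic x y p p' -> path_holonomy q p m -> path_holonomy q p' m.
Proof.
move=> hp [H [cH XH H0 H1 Hpp]] hm.
have hH u : path_in x y (fun s => H (u, s)).
  split.
  - apply: (continuous_comp2 (f := fun s => (u, s))) => //.
    apply: (@continuous_pair R R R R (fun=> u) id); first exact: cst_continuous.
    by move=> s; exact: cvg_id.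
  - by move=> s; exact: XH.
  - by move=> s; exact: H0.
  - by move=> s; exact: H1.
have pE : p = (fun s => H (0, s)) by apply/funext => s; have [] := Hpp s.
have pE' : p' = (fun s => H (1, s)) by apply/funext => s; have [] := Hpp s.
have : `[< path_holonomy q (fun s => H (1, s)) m >]; last by rewrite pE' => /asboolP.
rewrite (@locally_constant_line R bool
  (fun u => `[< path_holonomy q (fun s => H (u, s)) m >]) _ 1 0); first by apply/asboolP; rewrite -pE.
move=> u0.
(* Commutation of a small square, one side in the homotopy parameter and one along the path,
   uniformly in [s]. *)
pose P (e : R) (s : R) := forall u s' , `|u0 - u| < e -> `|s - s'| < e ->
  mul (q (H (u0, s)) (H (u0, s'))) (q (H (u0, s')) (H (u, s'))) =
  mul (q (H (u0, s)) (H (u, s))) (q (H (u, s)) (H (u, s'))).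
have [e e0 he] : exists2 e, 0 < e & forall s, `[0, 1]%classic s -> P e s.
  apply: (@compact_uniform R R `[0, 1]%classic P); first exact: (@segment_compact R 0 1).
    by move=> e e' s ee h u s' uu ss; apply: h; apply: lt_le_trans ee.
  move=> s _; have [r r0 hr] := hq (XH (u0, s)).
  have /cvgrPdist_lt/(_ r r0)/nbhs_ballP[e /= e0 he] := cH (u0, s).
  have B u t : `|u0 - u| < e -> `|s - t| < e -> `|H (u0, s) - H (u, t)| < r.
    by move=> hu ht; apply: he; split => /=; rewrite -ball_normE.
  have e2 : e / 2 < e by rewrite ltr_pdivrMr// mulr_natr mulr2n ltrDl.
  exists (e / 2); first by rewrite divr_gt0.
  move=> t _ st u s' uu ts.
  have hu0 : `|u0 - u0| < e by rewrite subrr normr0.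
  have hu : `|u0 - u| < e by apply: lt_trans e2.
  have ht : `|s - t| < e by apply: lt_trans e2.
  have hs' : `|s - s'| < e.
    by apply: le_lt_trans (ler_distD t _ _) _; move: st ts; lra.
  rewrite hr ?[in RHS]hr //; exact: B.
have move_ u m' : `|u0 - u| < e -> path_holonomy q (fun s => H (u0, s)) m' ->
    path_holonomy q (fun s => H (u, s)) m'.
  move=> hu [U [hU U0 U1]].
  have Hc v s : H (v, clamp s) = H (v, s).
    have [h|h] := leP s 0; first by rewrite clamp_le0// !H0.
    have [h'|h'] := leP s 1; first by rewrite clamp_id// (ltW h) h'.
    by rewrite clamp_ge1 ?H1 // ltW.
  exists (fun s => mul (U (clamp s)) (q (H (u0, clamp s)) (H (u, clamp s)))); split; last first.
  - by rewrite clamp_ge1// U1 !H1// group_cocycle_refl ?mulg1// -(H1 0 1).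
  - by rewrite clamp_le0// U0 !H0// group_cocycle_refl ?mulg1// -(H0 0 0).
  move=> s; have [d1 d10 h1] := primitive_comp hU (@clamp_continuous R) s.
  exists (Num.min d1 e); first by rewrite lt_min d10.
  move=> t; rewrite lt_min => /andP[/h1/= -> st].
  rewrite -(Hc u s) -(Hc u t) -!mulA; congr mul; apply: he => //.
    by rewrite /= in_itv /=; exact: clamp01.
  exact: le_lt_trans (clamp_dist _ _) st.
exists e => // u hu; apply: asbool_equiv_eq; split; last exact: move_.
have [m' hm'] := path_holonomy_exists (hH u0).
by move=> h; rewrite (path_holonomy_uniq h (move_ _ _ hu hm')).
Qed.

Lemma path_holonomy_segment nu x : X x -> (forall y, X y -> nu y = y) ->
  (forall x, X x -> exists2 r, 0 < r &
     forall v, `|x - v| < r -> X (nu v) /\ {for v, continuous nu}) ->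
  exists2 e, 0 < e & forall y z, X y -> X z -> `|x - y| < e -> `|x - z| < e ->
    path_holonomy q (segment nu y z) (q y z).
Proof.
move=> Xx nu_id nu_loc; have [r r0 hr] := hq Xx.
have [e e0 he] := segment_in nu_id nu_loc Xx r0.
exists (Num.min e r); first by rewrite lt_min e0.
move=> y z Xy Xz; rewrite !lt_min => /andP[xy xy'] /andP[xz _].
have [[_ Xs s0 s1] sr] := he _ _ Xy Xz xy xz.
exists (fun s => q y (segment nu y z s)); split.
- by move=> s; exists 1 => // t _; rewrite hr.
- by rewrite s0// group_cocycle_refl.
- by rewrite s1.
Qed.

Lemma primitive_uniform x y p u : path_in x y p -> primitive q p u ->
  exists2 e, 0 < e & forall s t, 0 <= s <= 1 -> `|s - t| < e -> u t = mul (u s) (q (p s) (p t)).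
Proof.
move=> [cp Xp _ _] hu.
have [e e0 he] : exists2 e, 0 < e & forall s, `[0, 1]%classic s ->
    forall t, `|s - t| < e -> u t = mul (u s) (q (p s) (p t)).
  apply: (@compact_uniform R R `[0, 1]%classic
    (fun e s => forall t, `|s - t| < e -> u t = mul (u s) (q (p s) (p t)))).
  - exact: (@segment_compact R 0 1).
  - by move=> e e' s ee h t st; apply: h; apply: lt_le_trans ee.
  move=> s _; have [d1 d10 h1] := hu s; have [r r0 hr] := hq (Xp s).
  have /cvgrPdist_lt/(_ r r0)/nbhs_ballP[d2 /= d20 h2] := cp s.
  have B t : `|s - t| < Num.min d1 d2 -> u t = mul (u s) (q (p s) (p t)) /\ `|p s - p t| < r.
    by rewrite lt_min => /andP[/h1 -> st]; split=> //; apply: h2; rewrite -ball_normE.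
  exists (Num.min d1 d2 / 2); first by rewrite divr_gt0// lt_min d10.
  have d0 : 0 < Num.min d1 d2 by rewrite lt_min d10.
  move=> t _ st t' tt'.
  have [E1 b1] : u t = mul (u s) (q (p s) (p t)) /\ `|p s - p t| < r by apply: B; move: st d0; lra.
  have [E2 b2] : u t' = mul (u s) (q (p s) (p t')) /\ `|p s - p t'| < r.
    by apply: B; apply: le_lt_trans (ler_distD t _ _) _; move: st tt'; lra.
  by rewrite E1 E2 -mulA hr// subrr normr0.
by exists e => // s t s01; apply: he; rewrite /= in_itv.
Qed.

End Cocycle.
End Holonomy.

(** * Loops on the unit interval compared with paths on the whole line *)

Section LoopsAndPaths.
Variables (R : realType) (X : set 'rV[R]_4).
Notation V := 'rV[R]_4.
Implicit Types (p q : R -> V) (x : V).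

Lemma within_continuousP (U W : normedModType R) (A : set U) (f : U -> W) :
  {within A, continuous f} -> forall x : U, A x -> forall e, 0 < e ->
  exists2 de, 0 < de & forall y, A y -> `|x - y| < de -> `|f x - f y| < e.
Proof.
move=> /subspace_continuousP cf x Ax e e0.
have /cvgrPdist_lt/(_ e e0) := cf x Ax.
rewrite near_withinE => /nbhs_ballP[de /= de0 h]; exists de => // y Ay xy.
by apply: h => //; rewrite -ball_normE.
Qed.

Lemma continuous_clamp_comp (f : R -> V) : {within `[0, 1], continuous f} ->
  continuous (f \o @clamp R).
Proof.
move=> cf s; apply/cvgrPdist_lt => e e0.
have I t : `[0, 1]%classic (clamp t : R) by rewrite /= in_itv /=; exact: clamp01.
have [de de0 h] := within_continuousP cf (I s) e0.
apply/nbhs_ballP; exists de => //= t st.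
by apply: h; [exact: I|exact: le_lt_trans (clamp_dist _ _) st].
Qed.

Lemma continuous_clamp_comp2 (f : R * R -> V) :
  {within `[0, 1] `*` `[0, 1], continuous f} ->
  continuous (fun z => f (clamp z.1, clamp z.2)).
Proof.
move=> cf [u s]; apply/cvgrPdist_lt => e e0.
have I t : `[0, 1]%classic (clamp t : R) by rewrite /= in_itv /=; exact: clamp01.
have I2 (z : R * R) : (`[0, 1] `*` `[0, 1])%classic (clamp z.1, clamp z.2) by split; exact: I.
have [de de0 h] := within_continuousP cf (I2 (u, s)) e0.
exists (ball u de, ball s de) => /=; first by split; exact: nbhsx_ballx.
move=> [v t] [/= uv st]; apply: (h (clamp v, clamp t)).
  exact: (I2 (v, t)).
rewrite prod_normE gt_max /=.
by rewrite (le_lt_trans (clamp_dist _ _) uv) (le_lt_trans (clamp_dist _ _) st).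
Qed.

Lemma path_in_clamp x y p : path_in X x y p -> p \o @clamp R = p.
Proof.
move=> [_ _ p0 p1]; apply/funext => s /=.
have [h|h] := leP s 0; first by rewrite clamp_le0// !p0.
have [h'|h'] := leP s 1; first by rewrite clamp_id// (ltW h) h'.
by rewrite clamp_ge1 ?p1 // ltW.
Qed.

Lemma loop_path_in (x0 : V) p : loop X x0 p -> path_in X x0 x0 (p \o @clamp R).
Proof.
move=> [cp Xp p0 p1]; split.
- exact: continuous_clamp_comp.
- by move=> s; apply: Xp; rewrite in_itv; exact: clamp01.
- by move=> s s0 /=; rewrite clamp_le0.
- by move=> s s1 /=; rewrite clamp_ge1.
Qed.

Lemma path_in_loop (x0 : V) p p' : path_in X x0 x0 p ->
  (forall s, s \in `[0, 1] -> p s = p' s) -> loop X x0 p'.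
Proof.
move=> [cp Xp p0 p1] pp.
have I0 : (0 : R) \in `[0, 1] by rewrite in_itv /= lexx ler01.
have I1 : (1 : R) \in `[0, 1] by rewrite in_itv /= lexx ler01.
split.
- apply: (@subspace_eq_continuous _ _ _ p); last exact: continuous_subspaceT.
  by move=> s /set_mem; exact: pp.
- by move=> s hs; rewrite -pp//; exact: Xp.
- by rewrite -pp// p0.
- by rewrite -pp// p1.
Qed.

Lemma loop_homotopic_path (x0 : V) p q : loop_homotopic X x0 p q ->
  path_homotopic X x0 x0 (p \o @clamp R) (q \o @clamp R).
Proof.
move=> [H [cH LH H0 H1]].
have I (t : R) : clamp t \in `[0, 1] by rewrite in_itv /=; exact: clamp01.
exists (fun z => H (clamp z.1, clamp z.2)); split.
- exact: continuous_clamp_comp2.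
- by move=> z; have [_ h _ _] := LH _ (I z.1); exact: h.
- by move=> u s s0; have [_ _ h _] := LH _ (I u); rewrite /= (clamp_le0 s0).
- by move=> u s s0; have [_ _ _ h] := LH _ (I u); rewrite /= (clamp_ge1 s0).
- by move=> s /=; rewrite clamp_le0// (clamp_ge1 (lexx 1)) H0 ?H1.
Qed.

Lemma path_homotopic_loop (x0 : V) p q p' q' : path_homotopic X x0 x0 p q ->
  (forall s, s \in `[0, 1] -> p s = p' s) -> (forall s, s \in `[0, 1] -> q s = q' s) ->
  loop_homotopic X x0 p' q'.
Proof.
move=> [H [cH XH H0 H1 Hpq]] pp qq; exists H; split.
- exact: continuous_subspaceT.
- move=> u _; split.
  + apply: continuous_subspaceT.
    apply: (continuous_comp2 (f := fun s => (u, s))) => //.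
    apply: (@continuous_pair R R R R (fun=> u) id); first exact: cst_continuous.
    by move=> s; exact: cvg_id.
  + by move=> s _; exact: XH.
  + exact: H0.
  + exact: H1.
- by move=> s hs; rewrite (Hpq s).1 pp.
- by move=> s hs; rewrite (Hpq s).2 qq.
Qed.

Section Words.
Variables (x0 : V) (n : nat) (g : 'I_n -> R -> V).
Hypothesis gl : forall i, loop X x0 (g i).
Hypothesis Xx0 : X x0.

Definition letter_path (l : 'I_n * bool) : R -> V :=
  if l.2 then g l.1 \o @clamp R else path_rev (g l.1 \o @clamp R).
Definition word_path (w : word n) : R -> V :=
  foldr (fun l p => path_cat x0 (letter_path l) p) (fun=> x0) w.

Lemma letter_path_in l : path_in X x0 x0 (letter_path l).
Proof.
by rewrite /letter_path; case: ifP => _; [|apply: path_in_rev]; apply: loop_path_in.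
Qed.

Lemma word_path_in w : path_in X x0 x0 (word_path w).
Proof.
elim: w => [|l w IH] /=; first exact: path_in_cst.
exact: path_in_cat (letter_path_in l) IH.
Qed.

Lemma word_loopE w s : s \in `[0, 1] -> word_path w s = word_loop x0 g w s.
Proof.
elim: w s => // l w IH s; rewrite in_itv /= => /andP[s0 s1].
have hc := path_cat_cases s (letter_path_in l) (word_path_in w).
rewrite /loop_cat; case: leP => h.
  rewrite hc.1// /letter_path; case: ifP => _ /=; rewrite /path_rev /loop_rev /= clamp_id//;
    apply/andP; split; lra.
rewrite hc.2 1?ltW// IH// in_itv /=; apply/andP; split; lra.
Qed.

Lemma word_loop_clamp w : word_loop x0 g w \o @clamp R = word_path w.
Proof.
rewrite -(path_in_clamp (word_path_in w)); apply/funext => s /=.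
by rewrite word_loopE// in_itv; exact: clamp01.
Qed.

Lemma word_path_cat v w :
  path_homotopic X x0 x0 (word_path (v ++ w)) (path_cat x0 (word_path v) (word_path w)).
Proof.
elim: v => [|l v IH] /=.
  by apply: path_homotopic_sym; apply: path_cat_cstl; exact: word_path_in.
apply: path_homotopic_trans (path_homotopic_sym
  (path_cat_assoc (letter_path_in l) (word_path_in v) (word_path_in w))).
by apply: path_homotopic_cat => //; apply: path_homotopic_refl; exact: letter_path_in.
Qed.

Lemma word_path1 i : path_homotopic X x0 x0 (word_path [:: (i, true)]) (g i \o @clamp R).
Proof. by apply: (@path_cat_cstr _ _ X x0); exact: (letter_path_in (i, true)). Qed.

Section WordHolonomy.
Variables (G : Type) (mul : G -> G -> G) (one : G) (inv : G -> G).
Hypothesis hG : group_laws mul one inv.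
Let mulA : associative mul. Proof. by case: hG. Qed.
Let mul1 : left_id one mul. Proof. by case: hG. Qed.

Definition word_value (mu : 'I_n -> G) (w : word n) : G :=
  foldr (fun l a => mul (if l.2 then mu l.1 else inv (mu l.1)) a) one w.

Lemma word_value_cat mu v w : word_value mu (v ++ w) = mul (word_value mu v) (word_value mu w).
Proof. by elim: v => [|l v IH] /=; rewrite ?mul1// IH mulA. Qed.

Lemma path_holonomy_word (q : V -> V -> G) mu : group_cocycle X mul q ->
  (forall i, path_holonomy mul one q (g i \o @clamp R) (mu i)) ->
  forall w, path_holonomy mul one q (word_path w) (word_value mu w).
Proof.
move=> hq hmu; elim=> [|l w IH] /=.
  exact: (path_holonomy_cst hG hq Xx0).
apply: (path_holonomy_cat hG hq (letter_path_in l) (word_path_in w)) => //.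
rewrite /letter_path; case: ifP => _; first exact: hmu.
exact: (path_holonomy_rev hG).
Qed.

End WordHolonomy.
End Words.

End LoopsAndPaths.

(** * Homomorphisms on words and cocycles on the space *)

Section Presentation.
Variables (R : realType) (X : set 'rV[R]_4).
Notation V := 'rV[R]_4.
Variables (x0 : V) (n m : nat) (g : 'I_n -> R -> V) (r : 'I_m -> word n).
Hypothesis Xx0 : X x0.
Hypothesis pres : pi1_presentation X x0 g r.
Variable nu : V -> V.
Hypothesis nu_id : forall y, X y -> nu y = y.
Hypothesis nu_local : forall x, X x -> exists2 r, 0 < r &
  forall v, `|x - v| < r -> X (nu v) /\ {for v, continuous nu}.

Notation path_in := (path_in X).
Notation path_homotopic := (path_homotopic X).

Let gl i : loop X x0 (g i). Proof. by case: pres. Qed.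

Lemma word_choice : exists W : (R -> V) -> word n,
  forall p, path_in x0 x0 p -> path_homotopic x0 x0 p (word_path x0 g (W p)).
Proof.
have H p : exists w : word n, path_in x0 x0 p -> path_homotopic x0 x0 p (word_path x0 g w).
  have [hp|np] := pselect (path_in x0 x0 p); last by exists [::].
  have [_ /(_ p) h _] := pres.
  have [w hw] := h (path_in_loop hp (fun s _ => erefl)).
  exists w => _; have := loop_homotopic_path hw.
  by rewrite (path_in_clamp hp) (word_loop_clamp gl Xx0).
by have [W WP] := choice H; exists W.
Qed.

Lemma path_choice : (forall x, X x -> exists p, path_in x0 x p) ->
  exists P : V -> R -> V, (forall x, X x -> path_in x0 x (P x)) /\ P x0 = fun=> x0.
Proof.
move=> conn.
have H x : exists p, (X x -> path_in x0 x p) /\ (x = x0 -> p = fun=> x0).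
  have [->|xx] := pselect (x = x0); first by exists (fun=> x0); split=> // _; exact: path_in_cst.
  have [Xx|nx] := pselect (X x); last by exists (fun=> x0).
  by have [p hp] := conn x Xx; exists p.
have [P PP] := choice H; exists P; split=> [x Xx|]; first exact: (PP x).1.
exact: (PP x0).2.
Qed.

Variable W : (R -> V) -> word n.
Hypothesis WP : forall p, path_in x0 x0 p -> path_homotopic x0 x0 p (word_path x0 g (W p)).
Variable P : V -> R -> V.
Hypothesis PP : forall x, X x -> path_in x0 x (P x).
Hypothesis P0 : P x0 = fun=> x0.

Definition loop_through x y : R -> V :=
  path_cat x (P x) (path_cat y (segment nu x y) (path_rev (P y))).

Lemma loop_through_in x : X x -> exists2 e, 0 < e & forall y z, X y -> X z ->
  `|x - y| < e -> `|x - z| < e ->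
  path_in y z (segment nu y z) /\ path_in x0 x0 (loop_through y z).
Proof.
move=> Xx; have [e e0 he] := segment_in nu_id nu_local Xx ltr01.
exists e => // y z Xy Xz xy xz; have [hs _] := he _ _ Xy Xz xy xz; split=> //.
apply: path_in_cat (PP Xy) _; apply: path_in_cat hs _.
exact: path_in_rev (PP Xz).
Qed.

Section Values.
Variables (G : Type) (mul : G -> G -> G) (one : G) (inv : G -> G).
Hypothesis hG : group_laws mul one inv.

Section WordCocycle.
Variable rho : word n -> G.
Hypothesis rhoM : forall v w, rho (v ++ w) = mul (rho v) (rho w).
Hypothesis rho1 : rho [::] = one.
Hypothesis rho_pres : forall v w, pres_eq r v w -> rho v = rho w.

(** The cocycle of the flat bundle with monodromy [rho], trivialized along the chosen paths [P]: the
    segment from [x] to [y] is closed into a loop and read as a word. *)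
Definition word_cocycle x y : G := rho (W (loop_through x y)).

Lemma rho_word_path v w : path_homotopic x0 x0 (word_path x0 g v) (word_path x0 g w) ->
  rho v = rho w.
Proof.
move=> vw; apply: rho_pres; have [_ _ h] := pres; apply/h.
by apply: path_homotopic_loop vw _ _ => s hs; apply: (word_loopE gl Xx0).
Qed.

Lemma rho_W p p' : path_in x0 x0 p -> path_in x0 x0 p' -> path_homotopic x0 x0 p p' ->
  rho (W p) = rho (W p').
Proof.
move=> hp hp' pp; apply: rho_word_path.
apply: path_homotopic_trans (path_homotopic_sym (WP hp)) _.
exact: path_homotopic_trans pp (WP hp').
Qed.

Lemma rho_W_word w : rho (W (word_path x0 g w)) = rho w.
Proof.
apply: rho_word_path; apply: path_homotopic_sym; apply: WP.
exact: word_path_in.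
Qed.

Lemma rho_W_cat p p' : path_in x0 x0 p -> path_in x0 x0 p' ->
  rho (W (path_cat x0 p p')) = mul (rho (W p)) (rho (W p')).
Proof.
move=> hp hp'; rewrite -rhoM; apply: rho_word_path.
apply: path_homotopic_trans (path_homotopic_sym (WP (path_in_cat hp hp'))) _.
apply: path_homotopic_trans (path_homotopic_sym (word_path_cat gl Xx0 _ _)).
by apply: path_homotopic_cat; exact: WP.
Qed.

Lemma word_cocycleP : group_cocycle X mul word_cocycle.
Proof.
move=> x Xx; have [e e0 he] := loop_through_in Xx.
have [e' e'0 he'] := segment_cat nu_id nu_local Xx.
exists (Num.min e e'); first by rewrite lt_min e0.
move=> y z w Xy Xz Xw; rewrite !lt_min => /andP[xy xy'] /andP[xz xz'] /andP[xw xw'].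
have [s1 l1] := he _ _ Xy Xz xy xz; have [s2 l2] := he _ _ Xz Xw xz xw.
have [s3 l3] := he _ _ Xy Xw xy xw.
rewrite /word_cocycle -rho_W_cat//; apply: rho_W => //; first exact: path_in_cat.
apply: (path_cat_conj (PP Xy) (PP Xz) (PP Xw) s1 s2 s3); exact: he'.
Qed.

Lemma word_cocycle_holonomy J : path_in x0 x0 J ->
  path_holonomy mul one word_cocycle J (rho (W J)).
Proof.
move=> hJ; have [cJ XJ J0 J1] := hJ.
have J00 : J 0 = x0 by rewrite J0.
(* The loop that follows [J] up to time [t] and returns along the chosen path. The constant path in
   front gives it the shape required by [path_cat_conj]. Its value runs from the trivial word to the
   class of [J]. *)
pose A t := path_cat x0 (fun=> x0) (path_cat (J t) (subpath J 0 t) (path_rev (P (J t)))).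
have hs t : path_in x0 (J t) (subpath J 0 t) by rewrite -{1}J00; apply: subpath_in.
have hA t : path_in x0 x0 (A t).
  apply: path_in_cat (path_in_cst Xx0) _; apply: path_in_cat (hs t) _.
  by apply: path_in_rev; apply: PP.
exists (fun t => rho (W (A t))); split.
- move=> t; have [e e0 he] := loop_through_in (XJ t).
  have [r0 r00 hr] := local_path_homotopic nu_id nu_local (XJ t).
  have [e1 e10 he1] := segment_in nu_id nu_local (XJ t) r00.
  have m0 : 0 < Num.min r0 (Num.min e e1) by rewrite !lt_min r00 e0.
  have /cvgrPdist_lt/(_ _ m0)/nbhs_ballP[de /= de0 hde] := cJ t.
  exists de => // t' tt'.
  have B u : `|t - u| < de -> [/\ `|J t - J u| < r0, `|J t - J u| < e & `|J t - J u| < e1].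
    by move=> tu; have := hde u; rewrite -ball_normE /= => /(_ tu); rewrite !lt_min => /and3P.
  have tt : `|t - t| < de by rewrite subrr normr0.
  have [_ b2 b3] := B _ tt; have [_ c2 c3] := B _ tt'.
  have [s1 l1] := he _ _ (XJ t) (XJ t') b2 c2.
  have [s2 sr] := he1 _ _ (XJ t) (XJ t') b3 c3.
  rewrite /word_cocycle -rho_W_cat//; apply: rho_W => //; first exact: path_in_cat.
  apply: path_homotopic_sym.
  apply: (path_cat_conj (path_in_cst Xx0) (PP (XJ t)) (PP (XJ t')) (hs t) s1 (hs t')).
  rewrite -{1}J00.
  apply: path_homotopic_trans (subpath_cat 0 t t' cJ XJ).
  apply: path_homotopic_cat.
    by apply: path_homotopic_refl; apply: subpath_in.
  apply: hr => //; first exact: subpath_in.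
  move=> s; have /andP[c0 c1] := clamp01 s.
  have [] // := B (t + (t' - t) * clamp s).
  rewrite opprD addrA subrr sub0r normrN normrM (ger0_norm c0).
  by apply: le_lt_trans tt'; rewrite distrC ler_piMr.
- rewrite -rho1 -(rho_W_word [::]); congr (rho (W _)).
  apply/funext => s; rewrite /A J00 P0 /path_cat /path_rev /subpath subrr mul0r addr0.
  by rewrite J00 !addrK.
- apply: rho_W => //; rewrite /A J1// P0.
  apply: path_homotopic_trans (path_cat_cstl _) _.
    by apply: path_in_cat (path_in_cst Xx0); rewrite -[X in path_in _ X](J1 1)//.
  have -> : path_rev (fun=> x0) = (fun=> x0) :> (R -> V) by [].
  have -> : subpath J 0 1 = J.
    by rewrite -[RHS](path_in_clamp hJ); apply/funext => s; rewrite /subpath add0r subr0 mul1r.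
  exact: path_cat_cstr.
Qed.

End WordCocycle.

(* With h trivial for all words this says that q is the coboundary of U. *)
Lemma based_holonomy (q : V -> V -> G) : group_cocycle X mul q ->
  exists U : V -> G, (forall x, X x -> path_holonomy mul one q (P x) (U x)) /\
  forall x, X x -> exists2 e, 0 < e & forall y z, X y -> X z ->
    `|x - y| < e -> `|x - z| < e -> exists w h,
     path_holonomy mul one q (word_path x0 g w) h /\ mul (U y) (q y z) = mul h (U z).
Proof.
move=> hq.
have H x : exists u, X x -> path_holonomy mul one q (P x) u.
  have [Xx|nx] := pselect (X x); last by exists one.
  by have [u hu] := path_holonomy_exists hG hq (PP Xx); exists u.
have [U UP] := choice H; exists U; split=> // x Xx.
have [e e0 he] := loop_through_in Xx.
have [e' e'0 he'] := path_holonomy_segment hG hq Xx nu_id nu_local.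
exists (Num.min e e'); first by rewrite lt_min e0.
move=> y z Xy Xz; rewrite !lt_min => /andP[xy xy'] /andP[xz xz'].
have [s l] := he _ _ Xy Xz xy xz.
exists (W (loop_through y z)), (mul (U y) (mul (q y z) (inv (U z)))); split.
  apply: (path_holonomy_homotopic hG hq l (WP l)).
  apply: (path_holonomy_cat hG hq (PP Xy)); [|exact: UP|].
    by apply: path_in_cat s _; apply: path_in_rev; exact: PP.
  apply: (path_holonomy_cat hG hq s); [|exact: he'|].
    by apply: path_in_rev; exact: PP.
  by apply: (path_holonomy_rev hG); exact: UP.
case: hG => mA m1 mg mV mgV.
by rewrite -!mA mV mg.
Qed.

Lemma word_value_pres (q : V -> V -> G) mu : group_cocycle X mul q ->
  (forall i, path_holonomy mul one q (g i \o @clamp R) (mu i)) ->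
  forall v w, pres_eq r v w -> word_value mul one inv mu v = word_value mul one inv mu w.
Proof.
move=> hq hmu v w vw; have [_ _ h] := pres.
have /h/loop_homotopic_path := vw; rewrite !(word_loop_clamp gl Xx0) => vw'.
have hv := path_holonomy_word gl Xx0 hG hq hmu v.
have hw := path_holonomy_word gl Xx0 hG hq hmu w.
apply: (path_holonomy_uniq hG (q := q) (p := word_path x0 g w)) => //.
exact: (path_holonomy_homotopic hG hq (word_path_in gl Xx0 v) vw' hv).
Qed.

End Values.
End Presentation.

(** * The knot complement and an invariant metric *)

Section Complement.
Variable R : realType.
Notation V := 'rV[R]_4.

Lemma dot_continuous : continuous (fun x : V => dot x x).
Proof.
have cc k : continuous (fun x : V => co x k).
  by move=> x; exact: (@coord_continuous R 1 4 ord0 (inord k) x).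
have c2 k : continuous (fun x : V => co x k * co x k).
  by move=> x; exact: (continuousM (cc k x) (cc k x)).
move=> x; rewrite /dot.
exact: (continuousD (continuousD (continuousD (c2 0%N x) (c2 1%N x)) (c2 2 x)) (c2 3 x)).
Qed.

Lemma dotZ (a : R) (x : V) : dot (a *: x) (a *: x) = a ^+ 2 * dot x x.
Proof. by rewrite /dot !coZ; ring. Qed.

Lemma dot_gt0 (x : V) : x != 0 -> 0 < dot x x.
Proof.
move=> x0; rewrite lt_neqAle dot_ge0 andbT eq_sym; apply: contraNneq x0 => d0.
have := norm_sqr_le_dot x; rewrite d0 => h.
by rewrite -normr_eq0 -sqrf_eq0 eq_le h sqr_ge0.
Qed.

Lemma enorm_gt0 (x : V) : x != 0 -> 0 < enorm x.
Proof. by move=> x0; rewrite enormE sqrtr_gt0 dot_gt0. Qed.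

Lemma S3_neq0 (x : V) : S3 R x -> x != 0.
Proof.
move=> /S3P; apply: contra_eqN => /eqP ->.
by rewrite -(scale0r (0 : V)) dotZ expr2 !mul0r eq_sym oner_eq0.
Qed.

Definition normalize (x : V) : V := (enorm x)^-1 *: x.

Lemma normalize_S3 x : x != 0 -> S3 R (normalize x).
Proof.
move=> x0; apply/S3P; rewrite dotZ enormE exprVn sqr_sqrtr ?dot_ge0//.
by rewrite mulVf// gt_eqF// dot_gt0.
Qed.

Lemma normalize_id x : S3 R x -> normalize x = x.
Proof. by move=> x1; rewrite /normalize x1 invr1 scale1r. Qed.

Lemma normalize_continuous x : x != 0 -> {for x, continuous normalize}.
Proof.
move=> x0; have ce : {for x, continuous (@enorm R)}.
  rewrite (_ : @enorm R = Num.sqrt \o (fun x => dot x x)); last by apply/funext => y; rewrite enormE.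
  by apply: continuous_comp; [exact: dot_continuous|exact: sqrt_continuous].
apply: (@continuousZ _ _ _ (fun y : V => (enorm y)^-1) id x); last exact: cvg_id.
by apply: continuousV => //; rewrite gt_eqF// enorm_gt0.
Qed.

Variable c : R -> V.
Hypothesis c_cont : continuous c.
Hypothesis c_S3 : forall s, S3 R (c s).
Hypothesis c_eq : forall s t, c s = c t <-> exists z : int, s - t = z%:~R.

Definition complement : set V := S3 R `\` range c.
Notation X := complement.

Lemma complement_S3 x : X x -> S3 R x. Proof. by case. Qed.

Lemma normalize_idX x : X x -> normalize x = x.
Proof. by move=> /complement_S3/normalize_id. Qed.

Lemma normalize_local x : X x -> exists2 r, 0 < r &
  forall v, `|x - v| < r -> X (normalize v) /\ {for v, continuous normalize}.
Proof.
move=> Xx; have [x1 xc] := Xx; have xn0 := S3_neq0 x1.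
have [eta eta0 far] := range_far c_cont c_eq xc.
have /cvgrPdist_lt/(_ _ eta0)/nbhs_ballP[e /= e0 he] := normalize_continuous xn0.
have x0 : 0 < `|x| by rewrite normr_gt0.
exists (Num.min e `|x|); first by rewrite lt_min e0.
move=> v; rewrite lt_min => /andP[xe xv].
have v0 : v != 0 by apply: contraTneq xv => ->; rewrite subr0 ltxx.
split; last exact: normalize_continuous.
split; first exact: normalize_S3.
move=> [s _ E]; have := far s; rewrite leNgt => /negP; apply.
by rewrite E -{1}(normalize_id x1); apply: he; rewrite -ball_normE.
Qed.

Section Metric.
Variables (f : V -> V) (n : nat).
Hypothesis n_gt0 : (0 < n)%N.
Hypothesis f_S3 : forall x, S3 R x -> S3 R (f x).
Hypothesis f_cont : forall x, S3 R x -> forall e, 0 < e -> exists2 de, 0 < de &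
  forall y, S3 R y -> `|x - y| < de -> `|f x - f y| < e.
Hypothesis f_n : forall x, S3 R x -> iter n f x = x.

Lemma iter_S3 i x : S3 R x -> S3 R (iter i f x).
Proof. by move=> hx; elim: i => //= i; exact: f_S3. Qed.

Lemma iter_cont i x : S3 R x -> forall e, 0 < e -> exists2 de, 0 < de &
  forall y, S3 R y -> `|x - y| < de -> `|iter i f x - iter i f y| < e.
Proof.
move=> hx; elim: i => [|i IH] e e0; first by exists e.
have [d1 d10 h1] := f_cont (iter_S3 i hx) e0.
have [d2 d20 h2] := IH _ d10; exists d2 => // y hy xy /=.
by apply: h1; [exact: iter_S3|exact: h2].
Qed.

Lemma iter_unif i e : 0 < e -> exists2 de, 0 < de &
  forall x y, S3 R x -> S3 R y -> `|x - y| < de -> `|iter i f x - iter i f y| < e.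
Proof.
move=> e0.
have [de de0 H] : exists2 de, 0 < de & forall x, S3 R x ->
    forall y, S3 R y -> `|x - y| < de -> `|iter i f x - iter i f y| < e.
  apply: (compact_uniform (A := S3 R)
    (P := fun de x => forall y, S3 R y -> `|x - y| < de -> `|iter i f x - iter i f y| < e)).
  - exact: S3_compact.
  - by move=> d1 d2 y dd h z Sz yz; apply: h => //; apply: lt_le_trans dd.
  move=> x hx; have e2 : 0 < e / 2 by rewrite divr_gt0.
  have [de de0 h] := iter_cont i hx e2.
  exists (de / 2); first by rewrite divr_gt0.
  move=> y hy xy z hz yz.
  have h1 : `|iter i f x - iter i f y| < e / 2 by apply: h => //; move: xy de0; lra.
  have h2 : `|iter i f x - iter i f z| < e / 2.
    by apply: h => //; apply: le_lt_trans (ler_distD y _ _) _; move: xy yz; lra.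
  apply: le_lt_trans (ler_distD (iter i f x) _ _) _; rewrite (distrC (iter i f y)).
  by move: h1 h2; lra.
by exists de => // x y hx hy; apply: H.
Qed.

Definition sphere_map (x : sphere R) : sphere R := to_sphere (f_S3 (sphereP x)).

Lemma val_iter_sphere_map i x : val (iter i sphere_map x) = iter i f (val x).
Proof. by elim: i => //= i ->. Qed.

(** Taking the maximum over the orbit makes [f] an isometry and keeps the topology, so smallness of
    lists is invariant under the action. *)
Definition orbit_dist (x y : sphere R) : R :=
  \big[Num.max/0]_(i < n) `|iter i f (val x) - iter i f (val y)|.

Lemma orbit_dist_ge i x y : (i < n)%N -> `|iter i f (val x) - iter i f (val y)| <= orbit_dist x y.
Proof. by move=> ni; rewrite /orbit_dist (bigD1 (Ordinal ni)) //= le_max lexx. Qed.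

Lemma orbit_dist_le B x y : 0 <= B ->
  (forall i, (i < n)%N -> `|iter i f (val x) - iter i f (val y)| <= B) -> orbit_dist x y <= B.
Proof.
move=> B0 H; rewrite /orbit_dist; elim/big_ind: _ => // [a b ha hb|i _]; last exact: H.
by rewrite ge_max ha.
Qed.

Lemma orbit_dist_ge0 x y : 0 <= orbit_dist x y.
Proof. by rewrite /orbit_dist; elim/big_ind: _ => // a b a0 b0; rewrite le_max a0. Qed.

Lemma orbit_distxx x : orbit_dist x x = 0.
Proof.
apply/eqP; rewrite eq_le orbit_dist_ge0 andbT; apply: orbit_dist_le => // i _.
by rewrite subrr normr0.
Qed.

Lemma orbit_distC x y : orbit_dist x y = orbit_dist y x.
Proof. by rewrite /orbit_dist; apply: eq_bigr => i _; rewrite distrC. Qed.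

Lemma orbit_dist_triangle x y z : orbit_dist x z <= orbit_dist x y + orbit_dist y z.
Proof.
apply: orbit_dist_le => [|i ni]; first by rewrite addr_ge0// orbit_dist_ge0.
apply: le_trans (ler_distD (iter i f (val y)) _ _) _.
by apply: lerD; exact: orbit_dist_ge.
Qed.

Lemma norm_le_orbit_dist x y : `|val x - val y| <= orbit_dist x y.
Proof. exact: orbit_dist_ge n_gt0. Qed.

Lemma orbit_dist_unif e : 0 < e -> exists2 de, 0 < de &
  forall x y, `|val x - val y| < de -> orbit_dist x y < e.
Proof.
move=> e0; have e2 : 0 < e / 2 by rewrite divr_gt0.
have H i : exists de, 0 < de /\ forall x y, S3 R x -> S3 R y -> `|x - y| < de ->
    `|iter i f x - iter i f y| < e / 2.
  by have [de de0 h] := iter_unif i e2; exists de.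
have [D DP] := choice H.
exists (\big[Num.min/1]_(i < n) D i).
  by elim/big_ind: _ => // [a b a0 b0|i _]; [rewrite lt_min a0|exact: (DP i).1].
move=> x y xy; apply: (@le_lt_trans _ _ (e / 2)); last by lra.
apply: orbit_dist_le => [|i ni]; first exact: ltW.
apply/ltW/(DP i).2; try exact: sphereP.
by apply: lt_le_trans xy _; rewrite (bigD1 (Ordinal ni)) //= ge_min lexx.
Qed.

Lemma orbit_dist_iso x y : orbit_dist (sphere_map x) (sphere_map y) = orbit_dist x y.
Proof.
have le x' y' : orbit_dist (sphere_map x') (sphere_map y') <= orbit_dist x' y'.
  apply: orbit_dist_le => [|i ni]; first exact: orbit_dist_ge0.
  rewrite /= -!iterSr; have [->|in1] := eqVneq i.+1 n.
    by rewrite !f_n ?norm_le_orbit_dist//; exact: sphereP.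
  by apply: orbit_dist_ge; rewrite ltn_neqAle in1.
apply/eqP; rewrite eq_le le /=.
have it z : iter n sphere_map z = z.
  by apply: val_inj; rewrite val_iter_sphere_map f_n//; exact: sphereP.
rewrite -{1}(it x) -{1}(it y); rewrite -(prednK n_gt0) !iterSr.
by elim: n.-1 => //= i; apply: le_trans; exact: le.
Qed.

End Metric.
End Complement.

(** * Duality and dimension for the knot in its invariant metric *)

Section KnotComplement.
Variable R : realType.
Notation V := 'rV[R]_4.
Variable c : R -> V.
Hypothesis c_cont : continuous c.
Hypothesis c_S3 : forall s, S3 R (c s).
Hypothesis c_eq : forall s t, c s = c t <-> exists z : int, s - t = z%:~R.
Notation X := (complement c).
Variables (f : V -> V) (n : nat).
Hypothesis n_gt0 : (0 < n)%N.
Hypothesis f_S3 : forall x, S3 R x -> S3 R (f x).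
Hypothesis f_cont : forall x, S3 R x -> forall e, 0 < e -> exists2 de, 0 < de &
  forall y, S3 R y -> `|x - y| < de -> `|f x - f y| < e.
Hypothesis f_n : forall x, S3 R x -> iter n f x = x.
Hypothesis f_free : forall x, S3 R x -> forall i, iter i f x = x -> (n %| i)%N.
Hypothesis f_K : forall x, S3 R x -> range c (f x) <-> range c x.

Notation T := (sphere R).
Notation d := (orbit_dist f n).
Notation fT := (sphere_map f_S3).
Definition knot_point (s : R) : T := to_sphere (c_S3 s).
Definition on_knot (x : T) : Prop := exists s, x = knot_point s.
Notation K := on_knot.
Notation oo := (knot_point 0).
Notation sigma := (chart oo).
Notation pi := (chart_inv oo).
Notation dist3 := (@dist3 R).

Let d_ge x y : `|val x - val y| <= d x y.
Proof. exact: norm_le_orbit_dist. Qed.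
Let d_le e : 0 < e -> exists2 de, 0 < de & forall x y, `|val x - val y| < de -> d x y < e.
Proof. exact: orbit_dist_unif. Qed.
Let d_iso x y : d (fT x) (fT y) = d x y.
Proof. exact: orbit_dist_iso. Qed.
Let d_refl x : d x x = 0. Proof. exact: orbit_distxx. Qed.
Let d_sym x y : d x y = d y x. Proof. exact: orbit_distC. Qed.
Let d_triangle x y z : d x z <= d x y + d y z. Proof. exact: orbit_dist_triangle. Qed.
Let d_ge0 x y : 0 <= d x y. Proof. exact: orbit_dist_ge0. Qed.
Let piK x (h : x <> oo) : pi (sigma x) = x. Proof. exact: chartK. Qed.
Let sigmaK u : sigma (pi u) = u. Proof. exact: chart_invK. Qed.
Let pi_unif e : 0 < e -> exists2 de, 0 < de & forall u u', dist3 u u' < de -> d (pi u) (pi u') < e.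
Proof. exact: (chart_inv_unif d_le). Qed.
Let sigma_unif eta e : 0 < eta -> 0 < e -> exists2 de, 0 < de &
  forall x x', eta <= d x oo -> eta <= d x' oo -> d x x' < de -> dist3 (sigma x) (sigma x') < e.
Proof. exact: (chart_unif d_ge d_le). Qed.
Let sigma_bdd eta : 0 < eta -> exists B, forall x, eta <= d x oo -> norm3 (sigma x) <= B.
Proof. exact: (chart_bdd d_le). Qed.
Let pi_away B : exists2 eta, 0 < eta & forall u : space3 R, norm3 u <= B -> eta <= d (pi u) oo.
Proof. exact: (chart_away d_ge). Qed.

Lemma on_knotP x : K x <-> range c (val x).
Proof.
split=> [[s ->]|[s _ E]]; first by exists s.
by exists s; apply: val_inj.
Qed.

Lemma complementP x : X (val x) <-> ~ K x.
Proof.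
split=> [[_ h] /on_knotP//|h]; split; first exact: sphereP.
by move/on_knotP.
Qed.

Lemma knot_point_eq s t : knot_point s = knot_point t <-> exists z : int, s - t = z%:~R.
Proof.
rewrite -c_eq; split=> [/(congr1 val)//|E]; exact: val_inj.
Qed.

Lemma knot_point_unif e : 0 < e -> exists2 de, 0 < de &
  forall s t, `|s - t| < de -> d (knot_point s) (knot_point t) < e.
Proof.
move=> /d_le[d1 d10 h1]; have [d2 d20 h2] := circle_unif c_cont c_eq d10.
by exists d2 => // s t st; apply: h1; apply: h2.
Qed.

Lemma knot_point_inv eta : 0 < eta -> exists2 de, 0 < de &
  forall s t, d (knot_point s) (knot_point t) < de -> exists z : int, `|s - t - z%:~R| < eta.
Proof.
move=> /(circle_inv c_cont c_eq)[de de0 h]; exists de => // s t st; apply: h.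
exact: le_lt_trans (d_ge (knot_point s) (knot_point t)) st.
Qed.

Lemma on_knot_map x : K (fT x) <-> K x.
Proof. by rewrite !on_knotP; apply: f_K; exact: sphereP. Qed.

Lemma on_knot_oo : K oo. Proof. by exists 0. Qed.

Lemma complement_far x : ~ K x -> exists2 eta, 0 < eta & farK d K eta x.
Proof.
move=> /complementP[_ /(range_far c_cont c_eq)[eta eta0 h]]; exists eta => // y [s ->].
exact: le_trans (h s) (d_ge x (knot_point s)).
Qed.

Lemma far_complement eta x : 0 < eta -> farK d K eta x -> X (val x).
Proof.
move=> eta0 h; apply/complementP => Kx; have := h x Kx.
by rewrite d_refl leNgt eta0.
Qed.

(** Local properties on the complement are uniform away from the knot: compactness is applied to the
    whole sphere, and near a point of the knot the statement is vacuous. *)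
Lemma far_uniform (Q : R -> V -> Prop) :
  (forall e e' y, e' <= e -> Q e y -> Q e' y) ->
  (forall x, X x -> exists2 e, 0 < e & forall y, X y -> `|x - y| < e -> Q e y) ->
  forall eta, 0 < eta -> exists2 e, 0 < e & forall x, farK d K eta x -> Q e (val x).
Proof.
move=> anti loc eta eta0.
have [e e0 he] : exists2 e, 0 < e & forall v, S3 R v ->
    forall x, val x = v -> farK d K eta x -> Q e v.
  apply: (compact_uniform (A := S3 R) (P := fun e v => forall x, val x = v -> farK d K eta x -> Q e v)).
  - exact: S3_compact.
  - by move=> e e' y ee h x xE xf; apply: anti ee _; apply: h xf.
  move=> x Sx; have [cx|ncx] := pselect (range c x).
    have [de de0 h] := d_le eta0; exists de => // y Sy xy z zE zf.
    have Kx : K (to_sphere Sx) by apply/on_knotP.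
    by have := zf _ Kx; rewrite leNgt (h z (to_sphere Sx)) //= zE distrC.
  have [e e0 h] := loc x (conj Sx ncx); exists e => // y Sy xy z zE zf.
  by apply: h => //; rewrite -zE; apply: far_complement zf.
by exists e => // x; apply: he => //; exact: sphereP.
Qed.

Lemma fT_iter x : iter n fT x = x.
Proof. by apply: val_inj; rewrite val_iter_sphere_map f_n//; exact: sphereP. Qed.

Lemma fT_free x i : iter i fT x = x -> (n %| i)%N.
Proof.
move/(congr1 val); rewrite val_iter_sphere_map; apply: f_free; exact: sphereP.
Qed.

Lemma knot_retraction : exists r, retraction d K r.
Proof.
have [r [h _ _]] := retraction_exists d_refl d_ge0 n_gt0 fT_iter d_iso on_knot_map
  fT_free on_knot_oo complement_far.
by exists r.
Qed.

(** The indicator function of a path component is locally constant, hence constant by duality. *)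
Lemma complement_path_connected x y : X x -> X y -> exists p, path_in X x y p.
Proof.
move=> Xx Xy; pose xT := to_sphere (complement_S3 Xx); pose yT := to_sphere (complement_S3 Xy).
pose ch (u : T) : rat := (`[< exists p, path_in X x (val u) p >] : bool)%:R.
have loc eta : 0 < eta -> exists2 e, 0 < e & forall u v, farK d K eta u -> farK d K eta v ->
    d u v < e -> ch u = ch v.
  move=> eta0.
  pose Q e v := forall z, X z -> `|v - z| < e -> exists p, path_in X v z p.
  have anti e e' v : e' <= e -> Q e v -> Q e' v.
    by move=> ee h z Xz vz; apply: h => //; apply: lt_le_trans ee.
  have loc v : X v -> exists2 e, 0 < e & forall y, X y -> `|v - y| < e -> Q e y.
    move=> Xv; have [e e0 he] := segment_in (@normalize_idX _ c) (normalize_local c_cont c_eq) Xv ltr01.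
    exists (e / 2); first by rewrite divr_gt0.
    move=> w Xw vw z Xz wz; exists (segment (@normalize R) w z).
    have [] // := he w z Xw Xz; first by move: vw e0; lra.
    by apply: le_lt_trans (ler_distD w _ _) _; move: vw wz; lra.
  have [e e0 he] := far_uniform anti loc eta0.
  exists e => // u v uf vf uv; rewrite /ch; congr (nat_of_bool _)%:R; apply: asbool_equiv_eq.
  have Xv := far_complement eta0 vf.
  have [s hs] := he u uf (val v) Xv (le_lt_trans (d_ge u v) uv).
  split=> [[p hp]|[p hp]]; first by exists (path_cat (val u) p s); exact: path_in_cat hs.
  by exists (path_cat (val v) p (path_rev s)); apply: path_in_cat hp _; exact: path_in_rev.
have [eta1 e10 f1] := complement_far ((complementP xT).1 Xx).
have [eta2 e20 f2] := complement_far ((complementP yT).1 Xy).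
have [r rP] := knot_retraction.
pose eta := Num.min eta1 eta2.
have eta0 : 0 < eta by rewrite lt_min e10.
have g1 : farK d K eta xT by move=> z Kz; apply: le_trans (f1 z Kz); rewrite ge_min lexx.
have g2 : farK d K eta yT by move=> z Kz; apply: le_trans (f2 z Kz); rewrite ge_min lexx orbT.
have := complement_connected d_refl d_sym d_triangle piK sigmaK pi_unif sigma_unif sigma_bdd
  pi_away on_knot_oo rP (circle_H2 knot_point_eq knot_point_unif knot_point_inv (isT : (3 <= 3)%N))
  eta0 loc g1 g2.
rewrite /ch; have -> : `[< exists p, path_in X x (val xT) p >].
  by apply/asboolP; exists (fun=> x); apply: path_in_cst.
by case: asboolP => // _ /eqP; rewrite oner_eq0.
Qed.

(** * Loops in the complement as closed chains of points in the chart *)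

Section Discretize.
Variable F : fieldType.

Definition lift_cocycle (q : V -> V -> F) (x y : T) : F := q (val x) (val y).

Lemma additive_group_laws : group_laws +%R (0 : F) -%R.
Proof.
by split; [exact: addrA|exact: add0r|exact: addr0|exact: addNr|exact: addrN].
Qed.

Lemma lift_local_cocycle q : group_cocycle X +%R q -> local_cocycle d K (lift_cocycle q).
Proof.
move=> hq eta eta0.
pose Q e x := forall y z, X y -> X z -> `|x - y| < e -> `|x - z| < e -> q x y + q y z = q x z.
have anti e e' v : e' <= e -> Q e v -> Q e' v.
  by move=> ee h y z Xy Xz vy vz; apply: h => //; [exact: lt_le_trans vy ee|exact: lt_le_trans vz ee].
have loc v : X v -> exists2 e, 0 < e & forall y, X y -> `|v - y| < e -> Q e y.
  move=> Xv; have [r r0 hr] := hq v Xv.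
  exists (r / 2); first by rewrite divr_gt0.
  move=> x Xx vx y z Xy Xz xy xz; apply: hr => //; first by move: vx r0; lra.
    by apply: le_lt_trans (ler_distD x _ _) _; move: vx xy; lra.
  by apply: le_lt_trans (ler_distD x _ _) _; move: vx xz; lra.
have [e e0 he] := far_uniform anti loc eta0.
exists e => // x y z xf yf zf xy yz xz; apply: he => //.
- exact: far_complement yf.
- exact: far_complement zf.
- exact: le_lt_trans (d_ge x y) xy.
- exact: le_lt_trans (d_ge x z) xz.
Qed.

(** Two cocycles are treated on one and the same chain because proportionality compares their
    holonomies along it. *)
Lemma discretize (q : bool -> V -> V -> F) y J : (forall b, group_cocycle X +%R (q b)) ->
  path_in X y y J -> exists x M rr eta, [/\ 0 < rr /\ 0 < eta, x M = x 0%N,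
   forall i, dist3 (x i) (x i.+1) < rr,
   forall i u, dist3 u (x i) <= 4 * rr -> farK d K eta (pi u) &
   forall b, cocycle_along pi x rr (lift_cocycle (q b)) /\
     forall h, path_holonomy +%R 0 (q b) J h -> holonomy pi x M (lift_cocycle (q b)) = h].
Proof.
move=> hq hJ; have [cJ XJ J0 J1] := hJ.
pose JT s : T := to_sphere (complement_S3 (XJ s)).
have JTc e : 0 < e -> exists2 de, 0 < de & forall s t, `|s - t| < de -> d (JT s) (JT t) < e.
  move=> /d_le[d1 d10 h1].
  have [d2 d20 h2] := @compact_unif_continuous R R V `[0, 1]%classic J
    (@segment_compact R 0 1) (fun s _ => cJ s) d1 d10.
  exists d2 => // s t st; apply: h1 => /=.
  rewrite -(path_in_clamp hJ) /=; apply: h2; try by rewrite /= in_itv /=; exact: clamp01.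
  exact: le_lt_trans (clamp_dist _ _) st.
have [eta eta0 Jf] : exists2 eta, 0 < eta & forall s, farK d K eta (JT s).
  have [eta eta0 h] : exists2 eta, 0 < eta & forall s, `[0, 1]%classic s -> farK d K eta (JT s).
    apply: (@compact_uniform R R `[0, 1]%classic (fun eta s => farK d K eta (JT s))).
    - exact: (@segment_compact R 0 1).
    - by move=> e e' s ee h z Kz; apply: le_trans ee _; exact: h.
    move=> s _; have [e1 e10 h1] := complement_far ((complementP (JT s)).1 (XJ s)).
    have e12 : 0 < e1 / 2 by rewrite divr_gt0.
    have [d1 d10 h2] := JTc _ e12.
    exists (Num.min d1 (e1 / 2)); first by rewrite lt_min d10.
    move=> t _; rewrite lt_min => /andP[/h2 st _] z Kz.
    rewrite ge_min; apply/orP; right.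
    by have := h1 z Kz; have := d_triangle (JT s) (JT t) z; move: st; lra.
  exists eta => // s; have -> : JT s = JT (clamp s).
    by apply: val_inj; rewrite /= -{1}(path_in_clamp hJ).
  by apply: h; rewrite /= in_itv /=; exact: clamp01.
have e2 : 0 < eta / 2 by rewrite divr_gt0.
have lc b : exists e, 0 < e /\ forall x y z, farK d K (eta / 2) x -> farK d K (eta / 2) y ->
    farK d K (eta / 2) z -> d x y < e -> d y z < e -> d x z < e ->
    lift_cocycle (q b) x y + lift_cocycle (q b) y z = lift_cocycle (q b) x z.
  by have [e e0 he] := lift_local_cocycle (hq b) e2; exists e.
have [E EP] := choice lc.
pose ep := Num.min (eta / 2) (Num.min (E true) (E false) / 2).
have ep0 : 0 < ep by rewrite lt_min e2 divr_gt0// lt_min !(EP _).1.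
have [de de0 hde] := pi_unif ep0.
pose rr := de / 8; have rr0 : 0 < rr by rewrite divr_gt0.
have [d1 d10 h1] := sigma_unif eta0 rr0.
have [d2 d20 h2] := JTc _ d10.
have pu b : exists w : R -> F, primitive +%R (q b) J w /\ w 0 = 0.
  by have [h [w [hw w0 _]]] := path_holonomy_exists additive_group_laws (hq b) hJ; exists w.
have [w wP] := choice pu.
have pe b : exists e, 0 < e /\ forall s t, 0 <= s <= 1 -> `|s - t| < e ->
    w b t = w b s + q b (J s) (J t).
  have [e e0 he] := primitive_uniform additive_group_laws (hq b) hJ (wP b).1.
  by exists e.
have [e eP] := choice pe.
pose mm := Num.min d2 (Num.min (e true) (e false)).
have mm0 : 0 < mm by rewrite !lt_min d20 !(eP _).1.
pose M := (Num.bound mm^-1).+1.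
have M0 : 0 < M%:R :> R by rewrite ltr0n.
have Mm : M%:R^-1 < mm.
  rewrite invf_plt ?posrE//; apply: lt_trans (archi_boundP _) _; last by rewrite ltr_nat.
  by rewrite invr_ge0 ltW.
have step i : `|i%:R / M%:R - i.+1%:R / M%:R| = M%:R^-1 :> R.
  by rewrite -mulrBl -natr1 opprD addrA subrr sub0r mulN1r normrN ger0_norm ?invr_ge0 ?ltW.
pose x i := sigma (JT (i%:R / M%:R)).
have JToo s : JT s <> oo by move=> E'; apply: (((complementP (JT s)).1 (XJ s))); rewrite E'; exact: on_knot_oo.
have pix i : pi (x i) = JT (i%:R / M%:R) by rewrite /x piK.
have close i u : dist3 u (x i) <= 4 * rr -> d (pi u) (JT (i%:R / M%:R)) < ep.
  by move=> ux; rewrite -pix; apply: hde; apply: le_lt_trans ux _; rewrite /rr; move: de0; lra.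
have ufar i u : dist3 u (x i) <= 4 * rr -> farK d K (eta / 2) (pi u).
  move=> /close; rewrite lt_min => /andP[ux _] z Kz.
  have := Jf (i%:R / M%:R) z Kz; have := d_triangle (JT (i%:R / M%:R)) (pi u) z.
  by rewrite (d_sym (JT _) (pi u)); move: ux; lra.
exists x, M, rr, (eta / 2); split=> //.
- rewrite /x mul0r divff ?gt_eqF//; congr (sigma _); apply: val_inj => /=.
  by rewrite (J0 0)// (J1 1).
- move=> i; apply: h1; [exact: Jf on_knot_oo|exact: Jf on_knot_oo|].
  by apply: h2; rewrite step; apply: lt_le_trans Mm _; rewrite ge_min lexx.
move=> b; split.
  have two i u v : dist3 u (x i) <= 4 * rr -> dist3 v (x i) <= 4 * rr -> d (pi u) (pi v) < E b.
    move=> /close; rewrite lt_min => /andP[_ ux] /close; rewrite lt_min => /andP[_ vx].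
    have := d_triangle (pi u) (JT (i%:R / M%:R)) (pi v); rewrite (d_sym (JT _) (pi v)).
    have : Num.min (E true) (E false) <= E b by case: b => //; rewrite ge_min lexx ?orbT.
    by move: ux vx; lra.
  move=> i u v z iu iv iz; apply: (EP b).2; try exact: (ufar i); exact: (two i).
move=> h [w' [hw' w'0 <-]].
have ww := primitive_uniq additive_group_laws hw' (wP b).1.
rewrite ww; last by rewrite w'0 (wP b).2.
have S k : (k <= M)%N -> \sum_(i < k) lift_cocycle (q b) (pi (x i)) (pi (x i.+1)) = w b (k%:R / M%:R).
  elim: k => [|k IH] kM; first by rewrite big_ord0 mul0r (wP b).2.
  rewrite big_ord_recr /= IH; last exact: ltnW.
  rewrite !pix; apply/esym; apply: (eP b).2.
    by rewrite divr_ge0//= ler_pdivrMr// mul1r ler_nat ltnW.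
  rewrite step; apply: lt_le_trans Mm _.
  by case: (b); rewrite !ge_min lexx ?orbT.
by rewrite /holonomy S// divff// gt_eqF.
Qed.

End Discretize.
End KnotComplement.

(** * The degree cocycle and its shift *)

Section Degree.
Variables (n m : nat) (r : 'I_m -> word n) (a : 'I_n -> int).

Lemma word_degree_cat v w : word_degree a (v ++ w) = word_degree a v + word_degree a w.
Proof. by rewrite /word_degree big_cat. Qed.

Lemma word_degree_nil : word_degree a [::] = 0.
Proof. by rewrite /word_degree big_nil. Qed.

Lemma word_degree_pres : (forall j, word_degree a (r j) = 0) ->
  forall v w, pres_eq r v w -> word_degree a v = word_degree a w.
Proof.
move=> ar v w; elim=> // {v w} [u v w _ -> //|u v i b|u v j].
- rewrite !word_degree_cat; congr (_ + _); rewrite -[RHS]add0r; congr (_ + _).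
  by rewrite /word_degree !big_cons big_nil; case: b => /=; rewrite addr0 ?subrr ?addNr.
- by rewrite !word_degree_cat ar add0r.
Qed.

End Degree.

Section IntCocycle.
Variables (R : realType) (V : normedModType R) (X : set V).

Lemma int_group_laws : group_laws +%R (0 : int) -%R.
Proof.
by split; [exact: addrA|exact: add0r|exact: addr0|exact: addNr|exact: addrN].
Qed.

Variables (F : pzRingType) (q : V -> V -> int).

Lemma intr_cocycle : group_cocycle X +%R q ->
  group_cocycle X +%R (fun x y => (q x y)%:~R : F).
Proof.
move=> hq x Xx; have [e e0 h] := hq x Xx; exists e => // y z w Xy Xz Xw xy xz xw.
by rewrite -(h y z w)// intrD.
Qed.

Lemma intr_holonomy p h : path_holonomy +%R 0 q p h ->
  path_holonomy +%R 0 (fun x y => (q x y)%:~R : F) p h%:~R.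
Proof.
move=> [u [hu u0 u1]]; exists (fun s => (u s)%:~R); rewrite u0 u1; split=> // s.
by have [e e0 he] := hu s; exists e => // t /he ->; rewrite intrD.
Qed.

End IntCocycle.

Section Monodromy.
Variable R : realType.
Notation V := 'rV[R]_4.
Variable c : R -> V.
Hypothesis c_cont : continuous c.
Hypothesis c_S3 : forall s, S3 R (c s).
Hypothesis c_eq : forall s t, c s = c t <-> exists z : int, s - t = z%:~R.
Notation X := (complement c).
Variables (f : V -> V) (n : nat).
Hypothesis n_gt0 : (0 < n)%N.
Hypothesis f_S3 : forall x, S3 R x -> S3 R (f x).
Hypothesis f_cont : forall x, S3 R x -> forall e, 0 < e -> exists2 de, 0 < de &
  forall y, S3 R y -> `|x - y| < de -> `|f x - f y| < e.
Hypothesis f_n : forall x, S3 R x -> iter n f x = x.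
Hypothesis f_free : forall x, S3 R x -> forall i, iter i f x = x -> (n %| i)%N.
Hypothesis f_K : forall x, S3 R x -> range c (f x) <-> range c x.

Variables (x0 : V) (nn mm : nat) (g : 'I_nn -> R -> V) (r : 'I_mm -> word nn).
Variable a : 'I_nn -> int.
Hypothesis Xx0 : X x0.
Hypothesis pres : pi1_presentation X x0 g r.
Hypothesis a_r : forall j, word_degree a (r j) = 0.
Hypothesis a_surj : exists w, word_degree a w = 1.
Variables (W : (R -> V) -> word nn) (P : V -> R -> V).
Hypothesis WP : forall p, path_in X x0 x0 p -> path_homotopic X x0 x0 p (word_path x0 g (W p)).
Hypothesis PP : forall x, X x -> path_in X x0 x (P x).
Hypothesis P0 : P x0 = fun=> x0.

Notation nu := (@normalize R).
Let nu_id := @normalize_idX R c.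
Let nu_local := normalize_local c_cont c_eq.
Let gl i : loop X x0 (g i). Proof. by case: pres. Qed.

Definition degree_cocycle : V -> V -> int := word_cocycle nu W P (word_degree a).
Notation ac := degree_cocycle.

Lemma degree_cocycleP : group_cocycle X +%R ac.
Proof.
exact: (word_cocycleP Xx0 pres nu_id nu_local WP PP (word_degree_cat a) (word_degree_pres a_r)).
Qed.

Lemma degree_cocycle_holonomy J : path_in X x0 x0 J ->
  path_holonomy +%R 0 ac J (word_degree a (W J)).
Proof.
exact: (word_cocycle_holonomy Xx0 pres nu_id nu_local WP PP P0 (word_degree_cat a)
  (word_degree_nil a) (word_degree_pres a_r)).
Qed.

Lemma f_X x : X x -> X (f x).
Proof. by move=> [Sx cx]; split; [exact: f_S3|move/(f_K Sx)]. Qed.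

Lemma path_in_map x y p : path_in X x y p -> path_in X (f x) (f y) (f \o p).
Proof.
move=> [cp Xp p0 p1]; split.
- move=> s; apply/cvgrPdist_lt => e e0.
  have [d1 d10 h1] := f_cont (complement_S3 (Xp s)) e0.
  have /cvgrPdist_lt/(_ _ d10)/nbhs_ballP[d2 /= d20 h2] := cp s.
  apply/nbhs_ballP; exists d2 => //= t st.
  by apply: h1; [exact: complement_S3 (Xp t)|exact: h2].
- by move=> s; exact: f_X.
- by move=> s s0 /=; rewrite p0.
- by move=> s s1 /=; rewrite p1.
Qed.

Lemma path_in_iter i x y p : path_in X x y p ->
  path_in X (iter i f x) (iter i f y) (iter i f \o p).
Proof. by elim: i => //= i IH hp; exact: (path_in_map (IH hp)). Qed.

Lemma composed_cocycle (G : Type) (mul : G -> G -> G) q : group_cocycle X mul q ->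
  group_cocycle X mul (fun x y => q (f x) (f y)).
Proof.
move=> hq x Xx; have [e e0 he] := hq _ (f_X Xx).
have [d d0 hd] := f_cont (complement_S3 Xx) e0.
exists d => // y z w Xy Xz Xw xy xz xw.
have S u : X u -> S3 R u by case.
by apply: (he (f y) (f z) (f w)); do ?[exact: f_X]; apply: hd => //; apply: S.
Qed.

(** Duality needs coefficients in a field, so both cocycles are read in the rationals; the resulting
    cross relation is one between integers. *)
Lemma degree_proportional (q : V -> V -> int) J J' y y' ha hb ha' hb' :
  group_cocycle X +%R q -> path_in X y y J -> path_in X y' y' J' ->
  path_holonomy +%R 0 ac J ha -> path_holonomy +%R 0 q J hb ->
  path_holonomy +%R 0 ac J' ha' -> path_holonomy +%R 0 q J' hb' ->
  ha * hb' = hb * ha'.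
Proof.
move=> hq hJ hJ' h1 h2 h1' h2'.
pose Q (b : bool) x y : rat := if b then (ac x y)%:~R else (q x y)%:~R.
have hQ b : group_cocycle X +%R (Q b).
  by case: b; apply: intr_cocycle => //; exact: degree_cocycleP.
have [x [M [rr [eta [[rr0 eta0] xM xs xf H]]]]] :=
  discretize c_cont c_S3 c_eq n_gt0 f_S3 f_cont hQ hJ.
have [x' [M' [rr' [eta' [[rr'0 eta'0] xM' xs' xf' H']]]]] :=
  discretize c_cont c_S3 c_eq n_gt0 f_S3 f_cont hQ hJ'.
have [rt rtP] := knot_retraction c_cont c_S3 c_eq n_gt0 f_S3 f_n f_free f_K.
have lc b := lift_local_cocycle c_S3 n_gt0 f_S3 f_cont (hQ b).
have d_le := orbit_dist_unif n f_S3 f_cont.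
have d_ge := norm_le_orbit_dist f n_gt0.
have := holonomy_proportional (orbit_distxx f n) (orbit_distC f n) (orbit_dist_triangle f n)
  (@chartK R _) (@chart_invK R _) (chart_inv_unif d_le _) (chart_unif d_ge d_le _)
  (chart_bdd d_le _) (chart_away d_ge _)
  (circle_H1 (knot_point_eq c_S3 c_eq) (knot_point_unif c_cont c_S3 c_eq n f_S3 f_cont)
     (knot_point_inv c_cont c_S3 c_eq f n_gt0)) rtP
  rr0 eta0 xM xs xf rr'0 eta'0 xM' xs' xf' (lc true) (lc false)
  (H true).1 (H false).1 (H' true).1 (H' false).1.
rewrite ((H true).2 _ (intr_holonomy _ h1)) ((H false).2 _ (intr_holonomy _ h2)).
rewrite ((H' true).2 _ (intr_holonomy _ h1')) ((H' false).2 _ (intr_holonomy _ h2')).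
by rewrite -!intrM => /eqP; rewrite eqr_int => /eqP.
Qed.

Lemma degree_loop : exists2 J, path_in X x0 x0 J & path_holonomy +%R 0 ac J 1.
Proof.
have [w w1] := a_surj; exists (word_path x0 g w); first exact: word_path_in.
have := degree_cocycle_holonomy (word_path_in gl Xx0 w).
by rewrite (rho_W_word Xx0 pres WP (word_degree_pres a_r)) w1.
Qed.

(** By proportionality the pullback by [f] multiplies every holonomy of the degree cocycle by one
    integer [mu], read off on a loop of degree 1. *)
Lemma degree_pullback2 y J h : path_in X y y J -> path_holonomy +%R 0 ac J h ->
  path_holonomy +%R 0 ac (f \o f \o J) h.
Proof.
have [J1 hJ1 h1] := degree_loop.
have pb := composed_cocycle degree_cocycleP.
have [mu hmu] := path_holonomy_exists int_group_laws pb hJ1.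
have scale z J' h' : path_in X z z J' -> path_holonomy +%R 0 ac J' h' ->
    path_holonomy +%R 0 ac (f \o J') (mu * h').
  move=> hJ' hh; have [hb hhb] := path_holonomy_exists int_group_laws pb hJ'.
  have := degree_proportional pb hJ' hJ1 hh hhb h1 hmu.
  by rewrite mulr1 mulrC => ->.
have it i : path_holonomy +%R 0 ac (iter i f \o J1) (mu ^+ i).
  elim: i => [|i IH]; first exact: h1.
  by rewrite exprS; apply: scale IH; exact: (path_in_iter i hJ1).
(* The n-th iterate of [f] is the identity on the loop; an integer with [mu ^+ n = 1] is a sign, so
   its square is 1. *)
have mun : mu ^+ n = 1.
  apply: (path_holonomy_uniq int_group_laws (it n)).
  rewrite (_ : iter n f \o J1 = J1)//; apply/funext => s /=; apply: f_n.
  by have [_ XJ _ _] := hJ1; exact: complement_S3 (XJ s).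
have mu2 : mu ^+ 2 = 1.
  have : `|mu| ^+ n == 1 by rewrite -normrX mun normr1.
  by rewrite pexpr_eq1// => /eqP m1; rewrite -[LHS]ger0_norm ?sqr_ge0// normrX m1 expr1n.
move=> hJ hh; have := scale _ _ _ (path_in_map hJ) (scale _ _ _ hJ hh).
by rewrite mulrA -expr2 mu2 mul1r.
Qed.

(** The pullback by the square of [f] and the degree cocycle have the same holonomy on all based
    loops, so their difference is the coboundary of its own holonomy along the chosen paths. *)
Lemma degree_shift : exists e : V -> int, forall x, X x -> exists2 d, 0 < d &
  forall y z, X y -> X z -> `|x - y| < d -> `|x - z| < d ->
  ac (f (f y)) (f (f z)) = ac y z + (e z - e y).
Proof.
pose q x y := ac (f (f x)) (f (f y)) - ac x y.
have hac := degree_cocycleP.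
have hff := composed_cocycle (composed_cocycle hac).
have hq : group_cocycle X +%R q.
  move=> x Xx; have [d1 d10 h1] := hac x Xx; have [d2 d20 h2] := hff x Xx.
  exists (Num.min d1 d2); first by rewrite lt_min d10.
  move=> y z w Xy Xz Xw; rewrite !lt_min => /andP[xy xy'] /andP[xz xz'] /andP[xw xw'].
  by rewrite /q addrACA (h2 y z w)// -opprD (h1 y z w).
have [U [UP hU]] := based_holonomy nu_id nu_local WP PP int_group_laws hq.
exists U => x Xx; have [d d0 h] := hU x Xx; exists d => // y z Xy Xz xy xz.
have [w [k [hk E]]] := h y z Xy Xz xy xz.
have hw := word_path_in gl Xx0 w.
have [u hu] := path_holonomy_exists int_group_laws hac hw.
have hu2 := degree_pullback2 hw hu.
have k0 : k = 0.
  apply: (path_holonomy_uniq int_group_laws hk).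
  have [v [hv v0 v1]] := hu; have [v' [hv' v'0 v'1]] := hu2.
  exists (fun s => v' s - v s); rewrite v0 v1 v'0 v'1 !subrr; split=> // s.
  have [d1 d10 h1] := hv s; have [d2 d20 h2] := hv' s.
  exists (Num.min d1 d2); first by rewrite lt_min d10.
  move=> t; rewrite lt_min => /andP[/h1 -> /h2 ->].
  by rewrite /q opprD addrACA.
by move: E; rewrite k0 add0r /q => <-; ring.
Qed.

End Monodromy.

(** * Orbit sums of the shift, and Smith theory modulo a prime *)

Section Coprime.
Variable R : realType.
Notation V := 'rV[R]_4.
Variable c : R -> V.
Hypothesis c_cont : continuous c.
Hypothesis c_S3 : forall s, S3 R (c s).
Hypothesis c_eq : forall s t, c s = c t <-> exists z : int, s - t = z%:~R.
Notation X := (complement c).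
Variables (f : V -> V) (n : nat).
Hypothesis n_gt0 : (0 < n)%N.
Hypothesis f_S3 : forall x, S3 R x -> S3 R (f x).
Hypothesis f_cont : forall x, S3 R x -> forall e, 0 < e -> exists2 de, 0 < de &
  forall y, S3 R y -> `|x - y| < de -> `|f x - f y| < e.
Hypothesis f_n : forall x, S3 R x -> iter n f x = x.
Hypothesis f_free : forall x, S3 R x -> forall i, iter i f x = x -> (n %| i)%N.
Hypothesis f_K : forall x, S3 R x -> range c (f x) <-> range c x.
Variables (ac : V -> V -> int) (x0 : V) (J : R -> V) (e : V -> int).
Hypothesis hac : group_cocycle X +%R ac.
Hypothesis hJ : path_in X x0 x0 J.
Hypothesis J1 : path_holonomy +%R 0 ac J 1.
Hypothesis he : forall x, X x -> exists2 d, 0 < d &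
  forall y z, X y -> X z -> `|x - y| < d -> `|x - z| < d ->
  ac (f (f y)) (f (f z)) = ac y z + (e z - e y).
Variable N : nat.
Hypothesis N_gt0 : (0 < N)%N.
(** This says that [N] is the order of the square of [f]. *)
Hypothesis nN : forall i, (n %| i.*2)%N = (N %| i)%N.

Definition shift_sum M (x : V) : int := \sum_(j < M) e (iter j.*2 f x).

Lemma shift_sumD M M' x : shift_sum (M + M') x = shift_sum M x + shift_sum M' (iter M.*2 f x).
Proof.
elim: M' => [|M' IH]; first by rewrite addn0 [shift_sum 0 _]/shift_sum big_ord0 addr0.
rewrite addnS /shift_sum !big_ord_recr /= -/(shift_sum _ _) IH addrA.
by rewrite -iterD -doubleD (addnC M').
Qed.

Lemma shift_sumM M i x :
  shift_sum (i * M) x = \sum_(j < i) shift_sum M (iter (j * M).*2 f x).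
Proof.
elim: i => [|i IH]; first by rewrite mul0n /shift_sum !big_ord0.
by rewrite big_ord_recr /= -IH mulSn addnC shift_sumD.
Qed.

Let XS x : X x -> S3 R x. Proof. by case. Qed.
Let f_iterX i x : X x -> X (iter i f x).
Proof. by move=> Xx; elim: i => //= i; apply: f_X. Qed.

Lemma iter_shift M x : X x -> exists2 d, 0 < d &
  forall y z, X y -> X z -> `|x - y| < d -> `|x - z| < d ->
  ac (iter M.*2 f y) (iter M.*2 f z) = ac y z + (shift_sum M z - shift_sum M y).
Proof.
move=> Xx; elim: M => [|M [d1 d10 h1]].
  by exists 1 => // y z _ _ _ _; rewrite /shift_sum !big_ord0 subrr addr0.
have [d2 d20 h2] := he (f_iterX M.*2 Xx).
have [d3 d30 h3] := iter_cont f_S3 f_cont M.*2 (XS Xx) d20.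
exists (Num.min d1 d3); first by rewrite lt_min d10.
move=> y z Xy Xz; rewrite !lt_min => /andP[xy xy'] /andP[xz xz'].
rewrite doubleS !iterS (h2 _ _ (f_iterX _ Xy) (f_iterX _ Xz)).
- by rewrite h1// /shift_sum !big_ord_recr /=; ring.
- by apply: h3 => //; exact: XS.
- by apply: h3 => //; exact: XS.
Qed.

Let iterN x : S3 R x -> iter N.*2 f x = x.
Proof.
move=> Sx; have /dvdnP[k ->] : (n %| N.*2)%N by rewrite nN.
by elim: k => // k IH; rewrite mulSn iterD IH f_n.
Qed.

(** Over [N] steps the square of [f] returns to the identity, so [iter_shift] leaves no room for a
    local variation of the sum; paths in the complement do the rest. *)
Lemma shift_sum_cst x y : X x -> X y -> shift_sum N x = shift_sum N y.
Proof.
move=> Xx Xy.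
have [p [cp Xp p0 p1]] := complement_path_connected c_cont c_S3 c_eq n_gt0 f_S3 f_cont f_n f_free f_K Xx Xy.
rewrite -(p0 0)// -(p1 1)//.
apply: (locally_constant_line (w := fun s => shift_sum N (p s))) => s.
have [d d0 hd] := iter_shift N (Xp s).
have /cvgrPdist_lt/(_ _ d0)/nbhs_ballP[r /= r0 hr] := cp s.
exists r => // t st.
have tt : `|p s - p s| < d by rewrite subrr normr0.
have := hd _ _ (Xp s) (Xp t) tt (hr _ st).
rewrite (iterN (XS (Xp s))) (iterN (XS (Xp t))) => /(congr1 (fun z => z - ac (p s) (p t))).
by rewrite subrr addrC addrA addNr add0r => /esym/eqP; rewrite subr_eq0 => /eqP.
Qed.

Notation T := (sphere R).
Notation d := (orbit_dist f n).
Notation fT := (sphere_map f_S3).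
Notation K := (on_knot c_S3).
Notation oo := (knot_point c_S3 0).

(* Modulo a common prime p the sum of the shift over an orbit vanishes, so the
   shift of the power of order p is a coboundary along orbits; subtracting it
   makes the degree cocycle invariant. *)
Lemma shift_sum_coprime k : (forall x, X x -> shift_sum N x = k) -> coprimez k N.
Proof.
move=> hk; rewrite coprimezE /coprime /=; apply/negPn/negP => gk.
have g0 : (0 < gcdn `|k| N)%N by rewrite gcdn_gt0 N_gt0 orbT.
pose p := pdiv (gcdn `|k| N).
have p_pr : prime p by apply: pdiv_prime; rewrite ltn_neqAle eq_sym gk.
have pg : (p %| gcdn `|k| N)%N by exact: pdiv_dvd.
have pk : (p %| `|k|)%N by apply: dvdn_trans pg (dvdn_gcdl _ _).
have pN : (p %| N)%N by apply: dvdn_trans pg (dvdn_gcdr _ _).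
have p_gt0 := prime_gt0 p_pr.
pose M := (N %/ p)%N; have NM : N = (p * M)%N by rewrite mulnC divnK.
have M_gt0 : (0 < M)%N by rewrite divn_gt0// dvdn_leq.
pose F := 'F_p.
have kF : k%:~R = 0 :> F.
  have /dvdzP[j ->] : (p %| k)%Z by rewrite dvdzE.
  by rewrite intrM [X in _ * X]pchar_Fp_0// mulr0.
pose psi := iter M.*2 fT.
have val_psi i x : val (iter i psi x) = iter (i * M).*2 f (val x).
  elim: i => [|i IH]; first by rewrite mul0n.
  by rewrite iterS /psi val_iter_sphere_map IH -iterD -doubleD -mulSn.
have psi_p x : iter p psi x = x.
  by apply: val_inj; rewrite val_psi -NM iterN//; exact: sphereP.
have d_iso := orbit_dist_iso n_gt0 f_S3 f_n.
have d_refl := orbit_distxx f n.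
have psi_iso x y : d (psi x) (psi y) = d x y by exact: (iter_iso d_iso).
have psi_K x : K (psi x) <-> K x by exact: (iter_K (on_knot_map c_S3 f_S3 f_K)).
have psi_free x i : iter i psi x = x -> (p %| i)%N.
  move=> /(congr1 val); rewrite val_psi => /(f_free (sphereP x)).
  by rewrite nN NM dvdn_pmul2r.
have d_le := orbit_dist_unif n f_S3 f_cont.
have d_ge := norm_le_orbit_dist f n_gt0.
have d_sym := orbit_distC f n.
have d_tri := orbit_dist_triangle f n.
have [ph hph] := phase_exists oo p_gt0 psi_p psi_free.
pose b x := iter (p - ph x) psi x.
have bE x : iter (ph x) psi (b x) = x.
  by rewrite /b -iterD subnKC ?psi_p//; apply: ltnW; exact: (hph x).1.
have Xcst x : X (val x) -> shift_sum N (val (b x)) = k.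
  by move=> Xx; apply: hk; rewrite val_psi; exact: f_iterX.
pose E (x : T) : F := (shift_sum M (val x))%:~R.
(* The sum of [E] along the orbit from phase 0 to [x]. When the phase wraps around, the missing
   total is the full sum [k], which is 0 in [F]; so [u (psi x) = u x + E x] holds for every
   phase. *)
pose u (x : T) : F := \sum_(i < ph x) E (iter i psi (b x)).
have u_psi x : X (val x) -> u (psi x) = u x + E x.
  move=> Xx; have [hp hS] := hph x.
  have bpsi : b (psi x) = b x.
    rewrite /b hS -iterSr; have [h|h] := ltnP (ph x).+1 p.
      by rewrite modn_small// -subSn// subSS.
    have pE : p = (ph x).+1 by apply/eqP; rewrite eqn_leq h.
    by rewrite -pE modnn subn0 iterS psi_p {1}pE subSnn.
  rewrite {1}/u bpsi hS; have [h|h] := ltnP (ph x).+1 p.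
    by rewrite modn_small// big_ord_recr /= bE.
  have pE : p = (ph x).+1 by apply/eqP; rewrite eqn_leq h.
  have -> : ((ph x).+1 %% p)%N = 0%N by rewrite -pE modnn.
  rewrite big_ord0.
  have := Xcst x Xx; rewrite NM shift_sumM => /(congr1 (fun z : int => z%:~R : F)).
  rewrite kF rmorph_sum /= => <-.
  rewrite (eq_bigr (fun i : 'I_p => E (iter i psi (b x)))); last first.
    by move=> i _; rewrite /E val_psi.
  rewrite -(big_mkord xpredT (fun i => E (iter i psi (b x)))) [X in \sum_(0 <= i < X) _]pE.
  by rewrite big_nat_recr//= big_mkord bE.
pose q (_ : bool) (x y : V) : F := (ac x y)%:~R.
have hq bb : group_cocycle X +%R (q bb) by exact: intr_cocycle.
have [x [L [rr [eta [[rr0 eta0] xL xs xf H]]]]] :=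
  discretize c_cont c_S3 c_eq n_gt0 f_S3 f_cont hq hJ.
have [qa qh] := H true.
pose th (y z : T) := lift_cocycle (q true) y z - (u z - u y).
have thc y z w : lift_cocycle (q true) y z + lift_cocycle (q true) z w =
    lift_cocycle (q true) y w -> th y z + th z w = th y w.
  by rewrite /th => <-; ring.
have thl : local_cocycle d K th.
  move=> et et0; have [e1 e10 h1] := lift_local_cocycle c_S3 n_gt0 f_S3 f_cont (hq true) et0.
  by exists e1 => // y z w *; apply/thc/h1.
have tha : cocycle_along (chart_inv oo) x rr th.
  by move=> i y z w *; apply/thc/(qa i).
pose Q de v := forall z, X z -> `|v - z| < de ->
  ac (iter M.*2 f v) (iter M.*2 f z) = ac v z + (shift_sum M z - shift_sum M v).
have anti de de' v : de' <= de -> Q de v -> Q de' v.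
  by move=> ee h z Xz vz; apply: h => //; apply: lt_le_trans ee.
have loc v : X v -> exists2 de, 0 < de & forall y, X y -> `|v - y| < de -> Q de y.
  move=> Xv; have [de de0 h] := iter_shift M Xv.
  exists (de / 2); first by rewrite divr_gt0.
  move=> y Xy vy z Xz yz; apply: h => //; first by move: vy de0; lra.
  by apply: le_lt_trans (ler_distD y _ _) _; move: vy yz; lra.
have thi et : 0 < et -> exists2 de, 0 < de & forall y z, farK d K et y -> farK d K et z ->
    d y z < de -> th (psi y) (psi z) = th y z.
  move=> et0; have [de de0 h] := far_uniform c_S3 n f_S3 f_cont anti loc et0.
  exists de => // y z yf zf yz.
  have Xy := far_complement et0 yf; have Xz := far_complement et0 zf.
  rewrite /th !u_psi// /lift_cocycle /q.
  have -> : val (psi y) = iter M.*2 f (val y) by have := val_psi 1%N y; rewrite mul1n.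
  have -> : val (psi z) = iter M.*2 f (val z) by have := val_psi 1%N z; rewrite mul1n.
  rewrite (h y yf _ Xz); last exact: le_lt_trans (d_ge y z) yz.
  by rewrite intrD intrB /E; ring.
have [n1 dim1] := sphere_dim d_refl d_sym d_tri d_ge d_le p_gt0 psi_p psi_iso
  (A := fun=> True) (fun _ => conj id id) psi_free.
have [n2 dim2] := sphere_dim d_refl d_sym d_tri d_ge d_le p_gt0 psi_p psi_iso psi_K psi_free.
have keq := knot_point_eq c_S3 c_eq.
have kun := knot_point_unif c_cont c_S3 c_eq n f_S3 f_cont.
have kin := knot_point_inv c_cont c_S3 c_eq f n_gt0.
have := no_invariant_class d_refl d_sym d_tri (orbit_dist_ge0 f n)
  (@chartK R oo) (@chart_invK R oo) (chart_inv_unif d_le oo) (chart_unif d_ge d_le oo)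
  (chart_bdd d_le oo) (chart_away d_ge oo) (on_knot_oo c_S3)
  (complement_far c_cont c_eq f n_gt0) (circle_H1 keq kun kin) (circle_H0 keq kun)
  (circle_H2 keq kun kin) p_gt0 (pchar_Fp_0 p_pr) psi_p psi_iso psi_K psi_free dim1 dim2
  rr0 eta0 xL xs xf thl tha thi.
have tel l : (l <= L)%N -> \sum_(i < l) th (chart_inv oo (x i)) (chart_inv oo (x i.+1)) =
    \sum_(i < l) lift_cocycle (q true) (chart_inv oo (x i)) (chart_inv oo (x i.+1)) -
    (u (chart_inv oo (x l)) - u (chart_inv oo (x 0%N))).
  elim: l => [|l IH] lL; first by rewrite !big_ord0 !subrr.
  by rewrite !big_ord_recr /= IH 1?ltnW// /th; ring.
rewrite /holonomy tel// xL subrr subr0.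
rewrite -[\sum_(i < L) _]/(holonomy (chart_inv oo) x L (lift_cocycle (q true))).
rewrite (qh _ (intr_holonomy _ J1)) => /eqP.
by rewrite oner_eq0.
Qed.
End Coprime.

(** * Finiteness of the exponents *)

Notation pZtoQ := (map_poly (intr : int -> rat)).
Notation pZtoC := (map_poly (intr : int -> algC)).
Notation pQtoC := (map_poly (ratr : rat -> algC)).

Lemma pQtoC_pZtoQ (p : {poly int}) : pQtoC (pZtoQ p) = pZtoC p.
Proof. by rewrite -map_poly_comp; apply: eq_map_poly => z /=; rewrite ratr_int. Qed.

Lemma coef_prod_XsubC_bound (C : algC) (s : seq algC) i : 0 <= C ->
  (forall z, z \in s -> `|z| <= C) ->
  `|(\prod_(z <- s) ('X - z%:P))`_i| <= (1 + C) ^+ size s.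
Proof.
move=> C0; elim: s i => [|z s IH] i hs.
  by rewrite big_nil coef1; case: (i == 0%N); rewrite ?normr1 ?normr0.
have hs' y : y \in s -> `|y| <= C by move=> ys; apply: hs; rewrite inE ys orbT.
have zC : `|z| <= C by apply: hs; rewrite mem_head.
have B0 : 0 <= (1 + C) ^+ size s by rewrite exprn_ge0// addr_ge0.
rewrite big_cons mulrBl coefB coefXM coefCM /= exprS mulrDl mul1r.
apply: le_trans (ler_normB _ _) _; apply: lerD.
  by case: (i == 0%N); [rewrite normr0|exact: IH].
by rewrite normrM ler_pM// IH.
Qed.

Lemma int_poly_coef_bound (g : {poly int}) (C : algC) i : 0 <= C ->
  (forall z, root (pZtoC g) z -> `|z| <= C) ->
  `|(g`_i)%:~R| <= `|(lead_coef g)%:~R| * (1 + C) ^+ (size g).-1 :> algC.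
Proof.
move=> C0 hz; have [->|g0] := eqVneq g 0.
  by rewrite coef0 lead_coef0 normr0 mul0r.
have [s sE] := closed_field_poly_normal (pZtoC g).
have lg : lead_coef (pZtoC g) = (lead_coef g)%:~R.
  by rewrite lead_coef_map_inj//; exact: intr_inj.
have l0 : (lead_coef g)%:~R != 0 :> algC by rewrite intr_eq0 lead_coef_eq0.
have sg : size s = (size g).-1.
  have : size (pZtoC g) = size g by rewrite size_map_inj_poly//; exact: intr_inj.
  by rewrite sE size_scale ?lg// size_prod_XsubC => <-.
have -> : (g`_i)%:~R = (pZtoC g)`_i :> algC by rewrite coef_map.
rewrite sE coefZ lg normrM ler_wpM2l// -sg coef_prod_XsubC_bound// => z zs.
by apply: hz; rewrite sE rootZ ?lg// root_prod_XsubC.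
Qed.

Lemma finite_bounded_int_poly (B K : nat) :
  finite_set [set p : {poly int} | (size p <= B)%N /\ forall i, (absz (p`_i)%R <= K)%N].
Proof.
pose F (h : {ffun 'I_B -> 'I_(K.*2.+1)}) : {poly int} :=
  \poly_(i < B) (if insub i is Some j then (h j : nat)%:Z - K%:Z else 0).
apply: (@sub_finite_set _ _ (F @` setT)); last exact/finite_image/finite_finset.
move=> p [pB pK].
have hlt (i : nat) : (absz (p`_i + K%:Z)%R < K.*2.+1)%N by have := pK i; lia.
exists [ffun i : 'I_B => Ordinal (hlt i)] => //.
apply/polyP => i; rewrite coef_poly; case: ltnP => iB; last first.
  by rewrite nth_default//; apply: leq_trans iB.
rewrite insubT /= ffunE /= gez0_abs ?addrK//.
by have := pK i; move: (p`_i)%R => t; lia.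
Qed.

Lemma root_bound (q : {poly int}) : q != 0 ->
  exists C : nat, forall z, root (pZtoC q) z -> `|z| <= C%:R.
Proof.
move=> q0; have [s sE] := closed_field_poly_normal (pZtoC q).
have l0 : lead_coef (pZtoC q) != 0.
  by rewrite lead_coef_eq0 map_poly_eq0_id0 ?intr_eq0 ?lead_coef_eq0.
exists (\sum_(z <- s) Num.bound `|z|%R)%N => z.
rewrite sE rootZ// root_prod_XsubC => zs.
apply: le_trans (ltW (archi_boundP (normr_ge0 z))) _; rewrite ler_nat.
by rewrite (big_rem z)//= leq_addr.
Qed.

Lemma finite_root_orders (q : {poly int}) (B : nat) : q != 0 ->
  (forall z, root (pZtoC q) z -> z != 0 /\ forall k, (0 < k)%N -> z ^+ k != 1) ->
  finite_set [set N | (0 < N)%N /\ exists g : {poly rat},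
    [/\ (1 < size g)%N, (size g <= B)%N & g %| pZtoQ (q \Po 'X^N)]].
Proof.
move=> q0 hq; have [C hC] := root_bound q0.
(* Both at least 1 and at least [C], so that a bound [C] on the N-th power of [z] bounds [z] by [D]
   for all N at once. *)
pose D : nat := C.+1.
have D1 : 1 <= D%:R :> algC by rewrite ler1n.
pose K := Num.bound (`|(lead_coef q)%:~R : algC| * (1 + D%:R) ^+ B).
pose S := [set p : {poly int} | (size p <= B)%N /\ forall i, (absz (p`_i)%R <= K)%N].
pose A (p : {poly int}) := [set N : nat | (1 < size p)%N /\ (0 < N)%N /\
  exists r, q \Po 'X^N = p * r].
have rootN p N r z : (0 < N)%N -> q \Po 'X^N = p * r -> root (pZtoC p) z -> root (pZtoC q) (z ^+ N).
  move=> N0 E /rootP pz; apply/rootP.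
  have : (pZtoC (q \Po 'X^N)).[z] = 0 by rewrite E rmorphM hornerM pz mul0r.
  by rewrite map_comp_poly horner_comp map_polyXn hornerXn.
apply: (@sub_finite_set _ _ (\bigcup_(p in S) A p)); last first.
  apply: bigcup_finite; first exact: finite_bounded_int_poly.
  move=> p _; have [sp|sp] := boolP (1 < size p)%N; last first.
    by apply: (@sub_finite_set _ _ set0) => // N [h]; rewrite h in sp.
  have /closed_rootP[z pz] : size (pZtoC p) != 1%N.
    by rewrite size_map_inj_poly ?gtn_eqF//; exact: intr_inj.
  have [s sE] := closed_field_poly_normal (pZtoC q).
  have l0 : lead_coef (pZtoC q) != 0.
    by rewrite lead_coef_eq0 map_poly_eq0_id0 ?intr_eq0 ?lead_coef_eq0.
  (* Exponents in [A p] go to the root [z ^+ N] of q, the others to a separate copy of nat. The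
     preimage of the roots is then [A p], and [h] is injective on it because two equal powers would
     make [z ^+ N] a root of unity. *)
  pose h (N : nat) := if `[< A p N >] then inl (z ^+ N) else inr N : algC + nat.
  apply: (@sub_finite_set _ _ (h @^-1` (inl @` [set` s]))).
    move=> N /= AN; rewrite /h; case: asboolP => // _.
    exists (z ^+ N) => //=; have [_ [N0 [r E]]] := AN.
    by have := rootN _ _ _ _ N0 E pz; rewrite sE rootZ// root_prod_XsubC.
  apply: finite_preimage; last exact/finite_image/finite_seq.
  have key N M : A p N -> (N < M)%N -> z ^+ N = z ^+ M -> False.
    move=> [_ [N0 [r E]]] NM ZE; have [zN0 zN] := hq _ (rootN _ _ _ _ N0 E pz).
    have : z ^+ N * 1 = z ^+ N * z ^+ (M - N) by rewrite mulr1 -exprD subnKC// ltnW.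
    move/(mulfI zN0)/esym => z1; have := zN (M - N)%N; rewrite subn_gt0 => /(_ NM).
    by rewrite exprAC z1 expr1n eqxx.
  move=> N M; rewrite !inE /h /=; case: asboolP => AN; last by move=> [].
  case: asboolP => AM _; last by move=> [].
  move=> _ [ZE]; apply/eqP; rewrite eqn_leq; apply/andP; split; rewrite leqNgt; apply/negP => NM.
    exact: (key _ _ AM NM).
  exact: (key _ _ AN NM).
move=> N [N0 [g [g1 gB gd]]].
have [p [b b0 gE] [r rE]] := dvdpP_rat_int gd.
have sp : size p = size g.
  by rewrite gE size_scale// size_map_inj_poly//; exact: intr_inj.
exists p; last by split; [rewrite sp|split=> //; exists r].
split; first by rewrite sp.
have rb z : root (pZtoC p) z -> `|z| <= D%:R.
  move=> /(rootN _ _ _ _ N0 rE)/hC; rewrite normrX => zC.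
  have zD : `|z| ^+ N <= D%:R ^+ N.
    apply: le_trans zC _; apply: (@le_trans _ _ D%:R); first by rewrite ler_nat.
    by rewrite -{1}(expr1 D%:R); apply: ler_weXn2l.
  by rewrite -(ler_pXn2r N0)// nnegrE.
move=> i; rewrite -ltnS -(ltr_nat algC); apply: le_lt_trans; last first.
  by apply: (@lt_trans _ _ K%:R); [apply: archi_boundP; rewrite mulr_ge0// exprn_ge0// addr_ge0|rewrite ltr_nat].
have -> : (absz p`_i)%:R = `|(p`_i)%:~R| :> algC by rewrite -intr_norm natr_absz.
have D0 : 0 <= D%:R :> algC by [].
apply: le_trans (int_poly_coef_bound i D0 rb) _.
have p1 : 1 <= 1 + D%:R :> algC by rewrite lerDl.
apply: ler_pM; [exact: normr_ge0|by rewrite exprn_ge0// addr_ge0| |].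
  have : lead_coef q = lead_coef p * lead_coef r.
    rewrite -lead_coefM -rE lead_coef_comp ?size_polyXn ?ltnS//.
    by rewrite lead_coefXn expr1n mulr1.
  move=> ->; rewrite intrM normrM ler_peMr//.
  have : lead_coef r != 0.
    rewrite lead_coef_eq0; apply/eqP => r0; move: rE; rewrite r0 mulr0 => /eqP.
    by rewrite comp_poly_eq0 ?size_polyXn// (negbTE q0).
  by rewrite -intr_norm -[1]/(1%:~R) ler_int; lia.
by apply: ler_weXn2l => //; rewrite sp; apply: leq_trans (leq_pred _) gB.
Qed.

(** The minimal polynomial of a root of unity is cyclotomic and that of 0 is X; as a divisor of the
    irreducible [p], either would equal it up to a constant. *)
Lemma irreducible_roots (p : {poly rat}) (q : {poly int}) (a : rat) :
  irreducible_poly p ->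
  (forall (k : nat) (b : rat), (0 < k)%N -> p <> b *: pZtoQ 'Phi_k) ->
  (forall (k : nat) (b : rat), p <> b *: 'X^k) ->
  a != 0 -> p = a *: pZtoQ q ->
  forall z, root (pZtoC q) z -> z != 0 /\ forall k, (0 < k)%N -> z ^+ k != 1.
Proof.
move=> [p1 p_irr] pcyc pX a0 pE z qz.
have pz : root (pQtoC p) z.
  by rewrite pE map_polyZ/= rootZ ?fmorph_eq0// pQtoC_pZtoQ.
have eqp_scale (u : {poly rat}) : u %= p -> exists b, p = b *: u.
  move=> /eqpP[[c1 c2] /= /andP[c10 c20] E]; exists (c2^-1 * c1).
  by rewrite -scalerA E scalerA mulVf// scale1r.
split.
  apply/eqP => z0; have X_p : 'X %| p.
    rewrite -[X in X %| _]subr0 -polyC0 dvdp_XsubCl -(fmorph_root (ratr : rat -> algC)).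
    by rewrite rmorph0 -z0.
  have sX : size ('X : {poly rat}) != 1%N by rewrite size_polyX.
  have [b bE] := eqp_scale _ (p_irr 'X sX X_p).
  by apply: (pX 1%N b); rewrite expr1.
move=> k k0; apply/eqP => zk.
have [m mz _] := prim_order_exists k0 zk.
have [pm [pmE _] pmP] := minCpolyP z.
have pmPhi : pm = pZtoQ 'Phi_m.
  apply: (map_inj_poly (fmorph_inj (ratr : rat -> algC)) (rmorph0 _)).
  by rewrite /= -pmE (minCpoly_cyclotomic mz) pQtoC_pZtoQ (Cintr_Cyclotomic mz).
have pm1 : size pm != 1%N.
  have := size_minCpoly z; rewrite pmE size_map_poly => /gtn_eqF; rewrite eq_sym => ->//.
have [b bE] := eqp_scale _ (p_irr pm pm1 (etrans (esym (pmP p)) pz)).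
by apply: (pcyc m b); [exact: prim_order_gt0 mz|rewrite -pmPhi].
Qed.

(** * Minors of the Fox matrix *)

Lemma scale_mxsub (F : pzRingType) m n m' n' (h : 'I_m' -> 'I_m) (k : 'I_n' -> 'I_n) (x : F)
  (A : 'M[F]_(m, n)) : mxsub h k (x *: A) = x *: mxsub h k A.
Proof. by apply/matrixP => i j; rewrite !mxE. Qed.

Lemma mxrank_mxsub (F : fieldType) m n m' n' (h : 'I_m' -> 'I_m) (k : 'I_n' -> 'I_n)
  (A : 'M[F]_(m, n)) : (\rank (mxsub h k A) <= \rank A)%N.
Proof.
have -> : mxsub h k A = rowsub h (colsub k A) by apply/matrixP => i j; rewrite !mxE.
apply: leq_trans (mxrankS (rowsub_sub _ _)) _.
rewrite -mxrank_tr trmx_mxsub -[leqRHS]mxrank_tr; exact: mxrankS (rowsub_sub _ _).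
Qed.

Section FoxAt.
Variables (L : fieldType) (lam : L).

Fixpoint fox_at (n : nat) (a : 'I_n -> int) (j : 'I_n) (w : word n) : L :=
  match w with
  | [::] => 0
  | (i, true) :: v => (i == j)%:R + lam ^ a i * fox_at a j v
  | (i, false) :: v => lam ^ (- a i) * (fox_at a j v - (i == j)%:R)
  end.

Notation frac := {fraction {poly int}}.
Notation tf := (@FracField.tofrac {poly int}).
Notation ev p := (map_poly (intr : int -> L) p).[lam].

(** Evaluation at [lam] as a relation: Laurent polynomials live in a fraction field without
    evaluation map, and a power of [tvar] clears the denominator. *)
Definition laurent_value (x : frac) (y : L) := exists s (p : {poly int}),
  tvar ^+ s * x = tf p /\ ev p = lam ^+ s * y.

Hypothesis lam0 : lam != 0.

Lemma tvar_neq0 : tvar != 0.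
Proof. by rewrite /tvar tofrac_eq0 polyX_eq0. Qed.

Lemma tvarXn s : tvar ^+ s = tf 'X^s.
Proof. by rewrite /tvar rmorphXn. Qed.

Lemma laurent_value_shift x y s p t : tvar ^+ s * x = tf p -> ev p = lam ^+ s * y -> (s <= t)%N ->
  tvar ^+ t * x = tf ('X^(t - s) * p) /\ ev ('X^(t - s) * p) = lam ^+ t * y.
Proof.
move=> E1 E2 st; split.
  by rewrite rmorphM /= -tvarXn -E1 mulrA -exprD subnK.
by rewrite rmorphM /= hornerM E2 map_polyXn hornerXn mulrA -exprD subnK.
Qed.

Lemma laurent_value_nat k : laurent_value k%:R k%:R.
Proof.
exists 0%N, k%:R; rewrite !expr0 !mul1r !rmorph_nat; split=> //.
by rewrite -polyC_natr hornerC.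
Qed.

Lemma laurent_valueB x y x' y' : laurent_value x y -> laurent_value x' y' ->
  laurent_value (x - x') (y - y').
Proof.
move=> [s [p [E1 E2]]] [s' [p' [E1' E2']]].
have [F1 F2] := laurent_value_shift E1 E2 (leq_maxl s s').
have [F1' F2'] := laurent_value_shift E1' E2' (leq_maxr s s').
exists (maxn s s'), ('X^(maxn s s' - s) * p - 'X^(maxn s s' - s') * p').
by rewrite !mulrBr F1 F1' !rmorphB /= hornerD hornerN F2 F2'.
Qed.

Lemma laurent_valueD x y x' y' : laurent_value x y -> laurent_value x' y' ->
  laurent_value (x + x') (y + y').
Proof.
move=> h h'; rewrite -[x']opprK -[y']opprK; apply: laurent_valueB => //.
rewrite -[- x']add0r -[- y']add0r; apply: laurent_valueB => //; exact: (laurent_value_nat 0).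
Qed.

Lemma laurent_valueZ x y (k : int) : laurent_value x y -> laurent_value (tvar ^ k * x) (lam ^ k * y).
Proof.
move=> [s [p [E1 E2]]]; case: k => k.
  exists s, ('X^k * p); split; first by rewrite mulrCA E1 rmorphM /= -tvarXn.
  by rewrite rmorphM /= hornerM E2 map_polyXn hornerXn mulrCA.
exists (s + k.+1)%N, p; rewrite !NegzE -!exprnN !exprD; split.
  by rewrite mulrA mulfK// expf_neq0// tvar_neq0.
by rewrite mulrA mulfK// expf_neq0.
Qed.

Lemma laurent_value_fox n (a : 'I_n -> int) j w :
  laurent_value (fox a j w) (fox_at a j w).
Proof.
elim: w => [|[i []] w IH] /=; first exact: (laurent_value_nat 0).
  by apply: laurent_valueD (laurent_value_nat _) _; exact: laurent_valueZ.
by apply: laurent_valueZ; apply: laurent_valueB IH (laurent_value_nat _).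
Qed.

Lemma laurent_value_matrix m n (A : 'M[frac]_(m, n)) (E : 'M[L]_(m, n)) :
  (forall i j, laurent_value (A i j) (E i j)) -> exists s (M : 'M[{poly int}]_(m, n)),
  tvar ^+ s *: A = map_mx tf M /\ map_mx (fun p => ev p) M = lam ^+ s *: E.
Proof.
move=> H.
have H' (ij : 'I_m * 'I_n) : exists sp : nat * {poly int},
    tvar ^+ sp.1 * A ij.1 ij.2 = tf sp.2 /\ ev sp.2 = lam ^+ sp.1 * E ij.1 ij.2.
  by have [s [p h]] := H ij.1 ij.2; exists (s, p).
have [F FP] := choice H'.
pose s := \max_(ij : 'I_m * 'I_n) (F ij).1.
have sF ij : ((F ij).1 <= s)%N by apply: (leq_bigmax (F := fun ij => (F ij).1)).
exists s, (\matrix_(i, j) ('X^(s - (F (i, j)).1) * (F (i, j)).2)).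
split; apply/matrixP => i j; rewrite !mxE.
  by have [] := laurent_value_shift (FP (i, j)).1 (FP (i, j)).2 (sF (i, j)).
by have [] := laurent_value_shift (FP (i, j)).1 (FP (i, j)).2 (sF (i, j)).
Qed.

End FoxAt.

Lemma full_rank_minor (F : fieldType) m n k (A : 'M[F]_(m, n)) : (k <= \rank A)%N ->
  exists (h : 'I_k -> 'I_m) (l : 'I_k -> 'I_n), \det (mxsub h l A) != 0.
Proof.
move=> kA; pose f1 := maxrankfun A; pose B := rowsub f1 A.
have Bfree : row_free B by exact: maxrowsub_free.
pose f2 : 'I_k -> 'I_m := f1 \o widen_ord kA.
pose C := rowsub f2 A.
have Cfree : row_free C.
  apply/row_freeP; have /row_freeP[B' BB'] := Bfree.
  exists (colsub (widen_ord kA) B').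
  apply/matrixP => i j; have /matrixP/(_ (widen_ord kA i) (widen_ord kA j)) := BB'.
  rewrite !mxE => E; rewrite -[RHS]/((i == j)%:R) -[(i == j)]/(widen_ord kA i == widen_ord kA j) -E.
  by apply: eq_bigr => t _; rewrite !mxE.
have CTfull : row_full C^T by rewrite /row_full mxrank_tr.
exists f2, (fullrankfun CTfull).
have := fullrowsub_unit CTfull; rewrite unitmxE unitfE -det_tr trmx_mxsub trmxK.
by rewrite /C -mxsub_comp.
Qed.

(** * Powers of an irreducible polynomial that divide a determinant *)

Section Divisibility.
Variables (q : {poly rat}) (L : fieldExtType rat) (z : L).
Hypothesis q_irr : irreducible_poly q.
Hypothesis qz : root (map_poly (in_alg L) q) z.
Hypothesis z_gen : <<1; z>>%VS = fullv.

Notation ev p := (map_poly (in_alg L) p).[z].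

Lemma irreducible_root (p : {poly rat}) : root (map_poly (in_alg L) p) z = (q %| p).
Proof.
apply/idP/idP => [pz|/dvdpP[r ->]]; last by rewrite rmorphM /= rootM qz orbT.
apply/negPn/negP => qp.
have /Bezout_eq1_coprimepP[[u v] /= E] : coprimep q p.
  apply/coprimepP => d dq dp; rewrite -size_poly_eq1; apply/negPn/negP => d1.
  by case/negP: qp; rewrite -(eqp_dvdl _ (q_irr.2 d d1 dq)).
have := congr1 (fun p => ev p) E.
rewrite rmorphD !rmorphM /= hornerD !hornerM (rootP qz) (rootP pz) !mulr0 addr0.
by rewrite rmorph1 hornerC => /esym/eqP; rewrite oner_eq0.
Qed.

Lemma eval_surj (y : L) : exists p : {poly rat}, ev p = y.
Proof.
have : y \in <<1; z>>%VS by rewrite z_gen memvf.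
by case/Fadjoin_polyP => _ /polyOver1P[p ->] ->; exists p.
Qed.

(* Left multiplication by a matrix invertible modulo q produces n - rank rows
   divisible by q. *)
Lemma irreducible_dvd_det n (M : 'M[{poly rat}]_n) :
  q ^+ (n - \rank (map_mx (fun p => ev p) M)) %| \det M.
Proof.
set E := map_mx _ M; set r := \rank E.
pose evm : {rmorphism {poly rat} -> L} := horner_eval z \o map_poly (in_alg L).
pose U := invmx (col_ebase E).
have Uu : U \in unitmx by rewrite unitmx_inv col_ebase_unit.
have UE : U *m E = pid_mx r *m row_ebase E.
  by rewrite -[X in U *m X]mulmx_ebase -mulmxA mulKmx ?col_ebase_unit.
have [p pE] := choice eval_surj.
pose V := map_mx p U.
have VU : map_mx evm V = U.
  by apply/matrixP => i j; rewrite !mxE /= /horner_eval pE.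
have detV : coprimep q (\det V).
  apply/coprimepP => d dq dV; rewrite -size_poly_eq1; apply/negPn/negP => d1.
  have : q %| \det V by rewrite -(eqp_dvdl _ (q_irr.2 d d1 dq)).
  rewrite -irreducible_root => /rootP h.
  have : evm (\det V) = 0 by [].
  rewrite -det_map_mx VU => h'; move: Uu; rewrite unitmxE h' unitr0//.
pose N := V *m M.
pose dg : 'rV[{poly rat}]_n := \row_i (if (i < r)%N then 1 else q).
have Nq (i j : 'I_n) : (r <= i)%N -> q %| N i j.
  move=> ri; rewrite -irreducible_root; apply/rootP.
  have -> : ev (N i j) = (map_mx evm N) i j by rewrite [RHS]mxE.
  rewrite map_mxM VU (_ : map_mx evm M = E); last by apply/matrixP => s t; rewrite !mxE.
  rewrite UE mxE big1// => t _; rewrite mxE ltnNge ri andbF mul0r//.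
pose N' := \matrix_(i, j) (N i j %/ dg 0 i).
have NE : N = diag_mx dg *m N'.
  rewrite mul_diag_mx; apply/matrixP => i j; rewrite [RHS]mxE [N' i j]mxE mulrC divpK// [dg _ _]mxE.
  by case: ltnP => [_|ri]; [exact: dvd1p|exact: Nq].
have detdg : \det (diag_mx dg) = q ^+ (n - r).
  have P k : \prod_(i < k) (if (i < r)%N then 1 else q) = q ^+ (k - r).
    elim: k => [|k IH]; first by rewrite big_ord0.
    rewrite big_ord_recr /= IH; case: ltnP => h; last by rewrite subSn// exprSr.
    by rewrite mulr1; congr (q ^+ _); apply/eqP; move: h; lia.
  by rewrite det_diag -P; apply: eq_bigr => i _; rewrite mxE.
have : q ^+ (n - r) %| \det V * \det M.
  by rewrite -det_mulmx -/N NE det_mulmx detdg dvdp_mulr.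
by rewrite Gauss_dvdpr// coprimep_expl.
Qed.

End Divisibility.

(** * Rank of the Fox matrix at a root of the factor *)

Section AlexanderRank.
Variables (n m : nat) (a : 'I_n.+1 -> int) (r : 'I_m -> word n.+1) (D : {poly int}).
Hypothesis D0 : D != 0.
Hypothesis D_gcd : laurent_gcd
  [set x | exists (h : 'I_n -> 'I_m) (k : 'I_n -> 'I_n.+1),
     x = \det (mxsub h k (alexander_matrix a r))] (FracField.tofrac D).
Variables (q : {poly rat}) (L : fieldExtType rat) (z : L).
Hypothesis q_irr : irreducible_poly q.
Hypothesis qD : q %| pZtoQ D.
Hypothesis z0 : z != 0.
Hypothesis qz : root (map_poly (in_alg L) q) z.
Hypothesis z_gen : <<1; z>>%VS = fullv.

Notation tf := (@FracField.tofrac {poly int}).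
Notation ev p := (map_poly (intr : int -> L) p).[z].

Definition fox_matrix : 'M[L]_(m, n.+1) := \matrix_(i, j) fox_at z a j (r i).
Notation E := fox_matrix.

Let evQ (p : {poly int}) : (map_poly (in_alg L) (pZtoQ p)).[z] = ev p.
Proof.
congr (_.[z]); rewrite -map_poly_comp; apply: eq_map_poly => t.
exact: (rmorph_int (in_alg L) t).
Qed.

Let evD : ev D = 0.
Proof. by rewrite -evQ; apply/rootP; rewrite (irreducible_root q_irr qz). Qed.

Let scaled : exists s (M : 'M[{poly int}]_(m, n.+1)),
  tvar ^+ s *: alexander_matrix a r = map_mx tf M /\ map_mx (fun p => ev p) M = z ^+ s *: E.
Proof.
by apply: laurent_value_matrix => i j; rewrite !mxE; exact: laurent_value_fox.
Qed.

Let minor s (M : 'M[{poly int}]_(m, n.+1)) (h : 'I_n -> 'I_m) (k : 'I_n -> 'I_n.+1) :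
  tvar ^+ s *: alexander_matrix a r = map_mx tf M ->
  tf (\det (mxsub h k M)) = tvar ^+ (s * n) * \det (mxsub h k (alexander_matrix a r)).
Proof.
by move=> H; rewrite -det_map_mx map_mxsub -H scale_mxsub detZ exprM.
Qed.

(** Each minor of order [n] is a Laurent multiple of D, which vanishes at [z]. *)
Lemma fox_rank_lt : (\rank E < n)%N.
Proof.
rewrite ltnNge; apply/negP => /full_rank_minor[h [k]]; apply/negP; rewrite negbK.
have [s [M [M1 M2]]] := scaled.
have [_ /(_ _ (ex_intro _ h (ex_intro _ k erefl)))[y [p [t yE]] mE] _] := D_gcd.
have tk u : tvar ^+ u != 0 by rewrite expf_neq0// tvar_neq0.
have key : 'X^t * \det (mxsub h k M) = 'X^(s * n) * (p * D).
  apply/eqP; rewrite -(tofrac_eq) !rmorphM /= (minor h k M1) mE yE -!tvarXn.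
  apply/eqP; rewrite [LHS]mulrCA; congr (_ * _).
  by rewrite mulrA mulrCA mulfV// mulr1.
have dE : ev (\det (mxsub h k M)) = 0.
  have := congr1 (fun p => ev p) key.
  rewrite !rmorphM /= !hornerM evD !mulr0 map_polyXn hornerXn => /eqP.
  by rewrite mulf_eq0 expf_eq0 (negbTE z0) andbF /= => /eqP.
have : z ^+ (s * n) * \det (mxsub h k E) = 0.
  rewrite -dE exprM -detZ -scale_mxsub -M2.
  pose evm : {rmorphism {poly int} -> L} := horner_eval z \o map_poly (intr : int -> L).
  rewrite -[RHS]/(evm _) -det_map_mx; congr (\det _).
  by apply/matrixP => i j; rewrite !mxE.
by move/eqP; rewrite mulf_eq0 expf_eq0 (negbTE z0) andbF.
Qed.

(** A minor of order [n] has corank at least [n - \rank E] at [z], so that power of q divides all of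
    them, hence also their gcd D. *)
Lemma fox_rank_degree : ((n - \rank E) * (size q).-1 <= (size D).-1)%N.
Proof.
have [s [M [M1 M2]]] := scaled; pose e := (n - \rank E)%N; rewrite -/e.
have [q1 [b b0 qE]] := rat_poly_scale q.
have q10 : q1 != 0.
  apply: contraTneq q_irr.1 => q10.
  by rewrite qE q10 rmorph0 scaler0 size_poly0.
have qe : q ^+ e %= pZtoQ (q1 ^+ e).
  by rewrite rmorphXn /= qE exprZn eqp_scale// expf_neq0// invr_eq0 intr_eq0.
(* The gcd is taken over the integers, so an integral common divisor is needed; for a primitive
   polynomial, rational divisibility of the minors is integral divisibility. *)
pose q2 := zprimitive (q1 ^+ e).
have qe2 : q ^+ e %= pZtoQ q2.
  apply: (eqp_trans qe); rewrite (zpolyEprim (q1 ^+ e)) map_polyZ /=.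
  by rewrite eqp_scale// intr_eq0 zcontents_eq0 expf_neq0.
have dvd (h : 'I_n -> 'I_m) (k : 'I_n -> 'I_n.+1) : q2 %| \det (mxsub h k M).
  rewrite -dvdp_rat_int -(eqp_dvdl _ qe2) -det_map_mx.
  have := irreducible_dvd_det q_irr qz z_gen (map_mx (map_poly (intr : int -> rat)) (mxsub h k M)).
  apply: dvdp_trans; apply: dvdp_exp2l; apply: leq_sub2l.
  rewrite (_ : map_mx _ _ = mxsub h k (z ^+ s *: E)).
    by apply: leq_trans (mxrank_mxsub _ _ _) (mxrank_scale _ _).
  by rewrite -M2; apply/matrixP => i j; rewrite !mxE evQ.
have [_ _ /(_ (tf q2))] := D_gcd.
case.
- by exists q2, 0%N; rewrite expr0 divr1.
- move=> _ [h [k ->]]; have [u uE] := dvdpP_int (dvd h k).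
  exists (tf u / tvar ^+ (s * n)); first by exists u, (s * n)%N.
  have tk : tvar ^+ (s * n) != 0 by rewrite expf_neq0// tvar_neq0.
  apply: (mulfI tk); rewrite -(minor h k M1) uE rmorphM /=.
  by rewrite /q2 zprimitive_id mulrA mulrCA mulfV// mulr1 mulrC.
move=> y [p [t ->]] DE.
have key : 'X^t * D = p * q2.
  apply/eqP; rewrite -tofrac_eq !rmorphM /= DE -tvarXn mulrA; apply/eqP; congr (_ * _).
  by rewrite mulrCA divff ?mulr1// expf_neq0// tvar_neq0.
have : q ^+ e %| pZtoQ D.
  have : q ^+ e %| 'X^t * pZtoQ D.
    have -> : 'X^t * pZtoQ D = pZtoQ p * pZtoQ q2 by rewrite -rmorphM -key rmorphM /= map_polyXn.
    by rewrite (eqp_dvdl _ qe2) dvdp_mull.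
  rewrite Gauss_dvdpr// coprimep_expl// coprimep_expr//.
  apply/coprimepP => d dq dX; rewrite -size_poly_eq1; apply/negPn/negP => d1.
  have : q %| 'X by rewrite -(eqp_dvdl _ (q_irr.2 d d1 dq)).
  by rewrite -(irreducible_root q_irr qz) map_polyX rootX (negbTE z0).
have DQ0 : pZtoQ D != 0 by rewrite map_poly_eq0_id0 ?intr_eq0 ?lead_coef_eq0.
move/(dvdp_leq DQ0); rewrite size_rat_int_poly => h.
by rewrite mulnC -size_exp -!subn1 leq_sub2r.
Qed.

End AlexanderRank.

(** * Twisted cocycles *)

Section TwistedGroup.
Variables (L : fieldType) (lam : L).
Hypothesis lam0 : lam != 0.

(* The affine maps t |-> lam ^ a * t + x: pairs of a degree and a crossed value. *)
Definition twisted_mul (x y : int * L) : int * L := (x.1 + y.1, x.2 + lam ^ x.1 * y.2).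
Definition twisted_inv (x : int * L) : int * L := (- x.1, - (lam ^ (- x.1) * x.2)).

Lemma twisted_group_laws : group_laws twisted_mul (0, 0) twisted_inv.
Proof.
split; rewrite /twisted_mul.
- by move=> [a x] [b y] [c z] /=; rewrite addrA mulrDr addrA mulrA -expfzDr.
- by move=> [a x] /=; rewrite !add0r expr0z mul1r.
- by move=> [a x] /=; rewrite mulr0 !addr0.
- by move=> [a x] /=; rewrite !addNr.
- move=> [a x] /=; rewrite subrr mulrN mulrA -expfzDr// subrr expr0z mul1r subrr //.
Qed.

(** Fox derivatives are the coefficients of crossed homomorphisms: the translation part of a word in
    the affine group depends linearly on those of the generators. *)
Lemma word_value_twisted n (a : 'I_n -> int) (xi : 'rV[L]_n) w :
  word_value twisted_mul (0, 0) twisted_inv (fun i => (a i, xi 0 i)) w =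
  (word_degree a w, \sum_j fox_at lam a j w * xi 0 j).
Proof.
have pick i : \sum_j (i == j)%:R * xi 0 j = xi 0 i.
  rewrite (bigD1 i) //= eqxx mul1r big1 ?addr0// => j ji.
  by rewrite eq_sym (negbTE ji) mul0r.
elim: w => [|[i b] w IH] /=.
  by rewrite word_degree_nil big1// => j _; rewrite mul0r.
rewrite IH /twisted_mul /word_degree big_cons /=; congr (_, _).
  by case: b.
case: b => /=.
  under [RHS]eq_bigr do rewrite mulrDl -mulrA.
  by rewrite big_split /= pick mulr_sumr.
under [RHS]eq_bigr do rewrite mulrBr mulrBl -!mulrA.
by rewrite sumrB -!mulr_sumr pick addrC.
Qed.

(** Fox's fundamental formula at [lam]. It puts the principal class in the kernel of the Fox matrix,
    and shows that it is nonzero when [lam] is not 1. *)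
Lemma fox_at_fundamental n (a : 'I_n -> int) w :
  \sum_j fox_at lam a j w * (lam ^ a j - 1) = lam ^ word_degree a w - 1.
Proof.
have pick i : \sum_j (i == j)%:R * (lam ^ a j - 1) = lam ^ a i - 1.
  rewrite (bigD1 i) //= eqxx mul1r big1 ?addr0// => j ji.
  by rewrite eq_sym (negbTE ji) mul0r.
elim: w => [|[i b] w IH] /=.
  by rewrite word_degree_nil expr0z subrr big1// => j _; rewrite mul0r.
rewrite /word_degree big_cons -/(word_degree a w) /=; case: b => /=.
  under eq_bigr do rewrite mulrDl -mulrA.
  rewrite big_split /= pick -mulr_sumr IH expfzDr//; ring.
under eq_bigr do rewrite -mulrA mulrBl.
rewrite -mulr_sumr sumrB pick IH expfzDr// opprB addrA subrK.
rewrite mulrBr -!expfzDr// addNr expr0z //.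
Qed.

End TwistedGroup.

(** * Twisted cocycles on the complement and the kernel of the Fox matrix *)

Section TwistedCocycles.
Variables (R : realType) (X : set 'rV[R]_4).
Notation V := 'rV[R]_4.
Variables (x0 : V) (n m : nat) (g : 'I_n -> R -> V) (r : 'I_m -> word n).
Hypothesis Xx0 : X x0.
Hypothesis pres : pi1_presentation X x0 g r.
Variable nu : V -> V.
Hypothesis nu_id : forall y, X y -> nu y = y.
Hypothesis nu_local : forall x, X x -> exists2 r, 0 < r &
  forall v, `|x - v| < r -> X (nu v) /\ {for v, continuous nu}.
Variable W : (R -> V) -> word n.
Hypothesis WP : forall p, path_in X x0 x0 p -> path_homotopic X x0 x0 p (word_path x0 g (W p)).
Variable P : V -> R -> V.
Hypothesis PP : forall x, X x -> path_in X x0 x (P x).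
Hypothesis P0 : P x0 = fun=> x0.
Variable a : 'I_n -> int.
Hypothesis a_r : forall j, word_degree a (r j) = 0.
Variables (L : fieldType) (lam : L).
Hypothesis lam0 : lam != 0.

Notation ac := (word_cocycle nu W P (word_degree a)).
Notation tm := (twisted_mul lam).
Notation tinv := (twisted_inv lam).
Notation one := ((0, 0) : int * L).
Let laws := twisted_group_laws lam0.
Let gl i : loop X x0 (g i). Proof. by case: pres. Qed.
Let gc i := g i \o @clamp R.
Let gcP i : path_in X x0 x0 (gc i). Proof. exact: loop_path_in. Qed.

Let acP : group_cocycle X +%R ac.
Proof.
exact: (word_cocycleP Xx0 pres nu_id nu_local WP PP (word_degree_cat a) (word_degree_pres a_r)).
Qed.

Lemma generator_degree i : path_holonomy +%R 0 ac (gc i) (a i).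
Proof.
have := word_cocycle_holonomy Xx0 pres nu_id nu_local WP PP P0 (word_degree_cat a)
  (word_degree_nil a) (word_degree_pres a_r) (gcP i).
rewrite -(rho_W Xx0 pres WP (word_degree_pres a_r) (word_path_in gl Xx0 [:: (i, true)]) (gcP i)
  (word_path1 gl i)).
rewrite (rho_W_word Xx0 pres WP (word_degree_pres a_r)).
by rewrite /word_degree big_seq1.
Qed.

Definition twisted (f : V -> V -> L) := forall x, X x -> exists2 d, 0 < d &
  forall y z w, X y -> X z -> X w -> `|x - y| < d -> `|x - z| < d -> `|x - w| < d ->
  f y z + lam ^ ac y z * f z w = f y w.

Definition twisted_coboundary (f : V -> V -> L) := exists h : V -> L, forall x, X x ->
  exists2 d, 0 < d & forall y z, X y -> X z -> `|x - y| < d -> `|x - z| < d ->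
  f y z = lam ^ ac y z * h z - h y.

Definition pair_cocycle (f : V -> V -> L) x y := (ac x y, f x y).

(** The class of [f] is the vector of values of its crossed homomorphism on the generators. *)
Definition has_class (f : V -> V -> L) (xi : 'rV[L]_n) :=
  forall i, path_holonomy tm one (pair_cocycle f) (gc i) (a i, xi 0 i).

Lemma pair_cocycleP f : twisted f -> group_cocycle X tm (pair_cocycle f).
Proof.
move=> hf x Xx; have [d1 d10 h1] := hf x Xx; have [d2 d20 h2] := acP Xx.
exists (Num.min d1 d2); first by rewrite lt_min d10.
move=> y z w Xy Xz Xw; rewrite !lt_min => /andP[y1 y2] /andP[z1 z2] /andP[w1 w2].
by rewrite /twisted_mul /pair_cocycle /= h1// (h2 y z w).
Qed.

Lemma pair_holonomy_fst f p h : path_holonomy tm one (pair_cocycle f) p h ->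
  path_holonomy +%R 0 ac p h.1.
Proof.
move=> [u [hu u0 u1]]; exists (fun s => (u s).1); rewrite u0 u1; split=> // s.
by have [d d0 hd] := hu s; exists d => // t /hd ->.
Qed.

Lemma class_exists f : twisted f -> exists xi, has_class f xi.
Proof.
move=> hf.
have H i : exists y, path_holonomy tm one (pair_cocycle f) (gc i) (a i, y).
  have [[b y] hby] := path_holonomy_exists laws (pair_cocycleP hf) (gcP i).
  exists y; have <- // : b = a i.
  exact: (path_holonomy_uniq int_group_laws (pair_holonomy_fst hby) (generator_degree i)).
have [xi xiP] := choice H; exists (\row_i xi i) => i; rewrite mxE; exact: xiP.
Qed.

Lemma class_fox f xi j : twisted f -> has_class f xi ->
  \sum_i fox_at lam a i (r j) * xi 0 i = 0.
Proof.
move=> hf hxi.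
have rj : pres_eq r (r j) [::].
  by have := pres_rel r [::] [::] j; rewrite cats0.
have := word_value_pres Xx0 pres laws (pair_cocycleP hf) hxi rj.
rewrite !word_value_twisted => -[_ ->].
by rewrite big1// => i _; rewrite mul0r.
Qed.

Lemma class_holonomy f xi w : twisted f -> has_class f xi ->
  path_holonomy tm one (pair_cocycle f) (word_path x0 g w)
    (word_degree a w, \sum_j fox_at lam a j w * xi 0 j).
Proof.
move=> hf hxi; rewrite -word_value_twisted.
exact: (path_holonomy_word gl Xx0 laws (pair_cocycleP hf) hxi).
Qed.

(** The kernel condition says that the relators become trivial in the affine group; the resulting
    homomorphism is spread over the complement by [word_cocycle]. *)
Lemma cocycle_of_class (xi : 'rV[L]_n) :
  (forall j, \sum_i fox_at lam a i (r j) * xi 0 i = 0) ->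
  exists2 f, twisted f & has_class f xi.
Proof.
move=> hxi.
pose rho := word_value tm one tinv (fun i => (a i, xi 0 i)).
have rhoM v w : rho (v ++ w) = tm (rho v) (rho w) by exact: (word_value_cat laws).
have rho_r j : rho (r j) = one by rewrite /rho word_value_twisted hxi a_r.
have [mA m1 mg mV mgV] := laws.
have rho_pres v w : pres_eq r v w -> rho v = rho w.
  elim=> // {v w} [u v w _ -> //|u v i b|u v j].
  - rewrite !rhoM; congr (tm _ _); rewrite -[RHS]m1; congr (tm _ _).
    by rewrite /rho /word_value /=; case: b; rewrite /= mg ?mgV ?mV.
  - by rewrite !rhoM rho_r m1.
pose f x y := (word_cocycle nu W P rho x y).2.
have fE x y : pair_cocycle f x y = word_cocycle nu W P rho x y.
  by rewrite /pair_cocycle /f /word_cocycle /rho !word_value_twisted.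
have hq := word_cocycleP Xx0 pres nu_id nu_local WP PP rhoM rho_pres.
exists f => [x Xx|i].
  have [d d0 h] := hq x Xx; exists d => // y z w Xy Xz Xw xy xz xw.
  have := congr1 snd (h y z w Xy Xz Xw xy xz xw).
  by rewrite -!fE.
have -> : pair_cocycle f = word_cocycle nu W P rho.
  by apply/funext => x; apply/funext => y.
have := word_cocycle_holonomy Xx0 pres nu_id nu_local WP PP P0 rhoM erefl rho_pres (gcP i).
rewrite -(rho_W Xx0 pres WP rho_pres (word_path_in gl Xx0 [:: (i, true)]) (gcP i) (word_path1 gl i)).
rewrite (rho_W_word Xx0 pres WP rho_pres).
by rewrite /rho /= mg.
Qed.

Definition principal_class : 'rV[L]_n := \row_i (lam ^ a i - 1).

Lemma twisted_lin f f' s : twisted f -> twisted f' -> twisted (fun x y => s * f x y + f' x y).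
Proof.
move=> hf hf' x Xx; have [d1 d10 h1] := hf x Xx; have [d2 d20 h2] := hf' x Xx.
exists (Num.min d1 d2); first by rewrite lt_min d10.
move=> y z w Xy Xz Xw; rewrite !lt_min => /andP[y1 y2] /andP[z1 z2] /andP[w1 w2].
by rewrite -(h1 y z w)// -(h2 y z w)//; move: (lam ^ ac y z) => A; ring.
Qed.

Lemma has_class_lin f f' s xi xi' : has_class f xi -> has_class f' xi' ->
  has_class (fun x y => s * f x y + f' x y) (s *: xi + xi').
Proof.
move=> h h' i; have [u [hu u0 u1]] := h i; have [u' [hu' u'0 u'1]] := h' i.
have E t : (u t).1 = (u' t).1.
  apply: (primitive_uniq (q := ac) (p := gc i) int_group_laws (u := fun t => (u t).1)
    (u' := fun t => (u' t).1)) => [{}t|{}t|]; last by rewrite u0 u'0.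
  - by have [d d0 hd] := hu t; exists d => // t' /hd ->.
  - by have [d d0 hd] := hu' t; exists d => // t' /hd ->.
exists (fun t => ((u t).1, s * (u t).2 + (u' t).2)); rewrite !mxE u0 u1 u'0 u'1 /= mulr0 addr0.
split=> // t; have [d1 d10 h1] := hu t; have [d2 d20 h2] := hu' t.
exists (Num.min d1 d2); first by rewrite lt_min d10.
move=> t'; rewrite lt_min => /andP[/h1 -> /h2 ->].
rewrite /twisted_mul /pair_cocycle /= -E; congr (_, _).
by move: (lam ^ _) (f _ _) (f' _ _) (u t).2 (u' t).2 => A b1 b2 b3 b4; ring.
Qed.

Lemma coboundary_lin f f' s : twisted_coboundary f -> twisted_coboundary f' ->
  twisted_coboundary (fun x y => s * f x y + f' x y).
Proof.
move=> [h H] [h' H']; exists (fun x => s * h x + h' x) => x Xx.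
have [d1 d10 h1] := H x Xx; have [d2 d20 h2] := H' x Xx.
exists (Num.min d1 d2); first by rewrite lt_min d10.
move=> y z Xy Xz; rewrite !lt_min => /andP[y1 y2] /andP[z1 z2].
by rewrite h1// h2//; move: (lam ^ _) => A; ring.
Qed.

Lemma coboundary_cst b : twisted (fun x y => b * (lam ^ ac x y - 1)) /\
  has_class (fun x y => b * (lam ^ ac x y - 1)) (b *: principal_class).
Proof.
split=> [x Xx|i].
  have [d d0 h] := acP Xx; exists d => // y z w Xy Xz Xw xy xz xw.
  by rewrite -(h y z w)// expfzDr//; move: (lam ^ ac y z) (lam ^ ac z w) => A B; ring.
have [u [hu u0 u1]] := generator_degree i.
exists (fun s => (u s, b * (lam ^ u s - 1))); rewrite u0 u1 expr0z subrr mulr0 !mxE; split=> // s.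
have [d d0 hd] := hu s; exists d => // t /hd ->.
rewrite /twisted_mul /pair_cocycle /= expfzDr//; congr (_, _).
by move: (lam ^ u s) (lam ^ ac _ _) => A B; ring.
Qed.

(** With class 0 every based loop has a holonomy without translation part, so the holonomy along the
    chosen paths, untwisted by its degree, is a global primitive. *)
Lemma class0_coboundary f : twisted f -> has_class f 0 -> twisted_coboundary f.
Proof.
move=> hf hf0.
have [U [UP hU]] := based_holonomy nu_id nu_local WP PP laws (pair_cocycleP hf).
exists (fun x => lam ^ (- (U x).1) * (U x).2) => x Xx.
have [d d0 h] := hU x Xx; exists d => // y z Xy Xz xy xz.
have [w [k [hk]]] := h y z Xy Xz xy xz.
have := path_holonomy_uniq laws hk (class_holonomy w hf hf0).
rewrite big1 => [->|j _]; last by rewrite mxE mulr0.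
rewrite /twisted_mul /pair_cocycle /= add0r => -[E1 E2].
have -> : ac y z = word_degree a w + (U z).1 - (U y).1 by rewrite -E1 addrAC subrr add0r.
rewrite -[LHS](mulKf (expfz_neq0 (U y).1 lam0)).
have -> : lam ^ (U y).1 * f y z = lam ^ word_degree a w * (U z).2 - (U y).2.
  by rewrite -E2 addrAC subrr add0r.
rewrite invr_expz mulrBr !mulrA -!expfzDr//.
congr (lam ^ _ * _ - _).
by move: (U y).1 (U z).1 (word_degree a w) => b1 b2 b3; ring.
Qed.

(** A principal class comes from a constant function; subtracting its twisted coboundary reduces to
    class 0. *)
Lemma class_principal_coboundary f b : twisted f -> has_class f (b *: principal_class) ->
  twisted_coboundary f.
Proof.
move=> hf hb; have [hc hcb] := coboundary_cst b.
have h1 := twisted_lin (-1) hc hf.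
have h2 := has_class_lin (-1) hcb hb; rewrite scaleN1r addNr in h2.
have [h H] := class0_coboundary h1 h2.
exists (fun x => h x + b) => x Xx; have [d d0 hd] := H x Xx; exists d => // y z Xy Xz xy xz.
have := hd y z Xy Xz xy xz => E.
have -> : f y z = (-1 * (b * (lam ^ ac y z - 1)) + f y z) + b * (lam ^ ac y z - 1).
  by move: (lam ^ ac y z) (f y z) => A B; ring.
by rewrite E; move: (lam ^ ac y z) => A; ring.
Qed.

Lemma coboundary_class f xi : twisted_coboundary f -> has_class f xi ->
  exists b, xi = b *: principal_class.
Proof.
move=> [h H] hxi; exists (h x0); apply/rowP => i; rewrite !mxE.
have [u [hu u0 u1]] := generator_degree i.
have [cg Xg g0 g1] := gcP i.
suff : path_holonomy tm one (pair_cocycle f) (gc i) (a i, h x0 * (lam ^ a i - 1)).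
  by move/(path_holonomy_uniq laws (hxi i)) => [].
exists (fun s => (u s, lam ^ u s * h (gc i s) - h x0)); split; last first.
- by rewrite u1 g1//; congr (_, _); move: (lam ^ a i) => A; ring.
- by rewrite u0 g0// expr0z mul1r subrr.
move=> s; have [d1 d10 h1] := hu s; have [d2 d20 h2] := H _ (Xg s).
have /cvgrPdist_lt/(_ _ d20)/nbhs_ballP[d3 /= d30 h3] := cg s.
exists (Num.min d1 d3); first by rewrite lt_min d10.
move=> t; rewrite lt_min => /andP[/h1 -> st].
have ss : `|gc i s - gc i s| < d2 by rewrite subrr normr0.
rewrite /twisted_mul /pair_cocycle /= (h2 _ _ (Xg s) (Xg t) ss (h3 _ st)).
rewrite expfzDr//; congr (_, _).
by move: (lam ^ u s) (lam ^ ac _ _) (h (gc i s)) (h (gc i t)) => A B b1 b2; ring.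
Qed.

End TwistedCocycles.

Section RationalDependence.
Import VectorInternalTheory.

(** The row space of [S] has dimension [\rank S * \dim {:L}] over Q, so one more vector than that
    forces a rational relation. *)
Lemma rat_dependent (L : fieldExtType rat) k n (S : 'M[L]_(k, n)) (v : nat -> 'rV[L]_n) :
  (forall i, (v i <= S)%MS) -> exists p : {poly rat},
  [/\ p != 0, (size p <= (\rank S * \dim {:L}).+1)%N &
      \sum_(i < size p) (p`_i)%:A *: v i = 0].
Proof.
move=> vS; set h := \rank S; set d := \dim _; pose M := (h * d).+1.
have dE : d = dim L by rewrite /d dimvf.
pose B := row_base S.
have [w wE] : exists w : nat -> 'rV[L]_h, forall i, v i = w i *m B.
  by exists (fun i => v i *m pinvmx B) => i; rewrite mulmxKpV// eq_row_base.
pose C : 'M[rat]_(M, h * dim L) := \matrix_(i < M) mxvec (\matrix_(s < h) v2r (w i 0 s)).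
have kC : kermx C != 0.
  rewrite -mxrank_eq0 mxrank_ker subn_eq0 -ltnNge.
  by apply: leq_ltn_trans (rank_leq_col _) _; rewrite /M dE ltnS.
have [c c0 cC] : exists2 c : 'rV_M, c != 0 & c *m C = 0.
  have /matrix0Pn[i0 [j0 ij]] := kC.
  exists (row i0 (kermx C)); last by apply/sub_kermxP; exact: row_sub.
  by apply: contraNneq ij => /rowP/(_ j0); rewrite mxE [RHS]mxE => ->.
have pM : (size (rVpoly c) <= M)%N by exact: size_poly.
exists (rVpoly c); split=> //.
  by apply: contraNneq c0 => p0; rewrite -[c]rVpolyK p0 linear0.
have -> : \sum_(i < size (rVpoly c)) ((rVpoly c)`_i)%:A *: v i = \sum_(i < M) (c 0 i)%:A *: v i.
  transitivity (\sum_(i < M) ((rVpoly c)`_i)%:A *: v i); last first.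
    by apply: eq_bigr => i _; rewrite coef_rVpoly_ord.
  rewrite (big_ord_widen _ (fun i : nat => ((rVpoly c)`_i)%:A *: v i) pM).
  rewrite [RHS](bigID (fun i : 'I_M => (i < size (rVpoly c))%N)) /= [X in _ + X]big1 ?addr0//.
  by move=> i; rewrite -leqNgt => hi; rewrite nth_default// scale0r scale0r.
rewrite (eq_bigr (fun i : 'I_M => ((c 0 i)%:A *: w i) *m B)); last first.
  by move=> i _; rewrite -scalemxAl -wE.
rewrite -mulmx_suml (_ : \sum_(i < M) _ = 0) ?mul0mx//.
apply/rowP => s; rewrite summxE [RHS]mxE; apply: (@v2r_inj _ L); rewrite linear0 linear_sum /=.
apply/rowP => t; rewrite summxE [RHS]mxE.
have := congr1 (fun u : 'rV_(h * dim L) => u 0 (mxvec_index s t)) cC.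
rewrite mxE [RHS]mxE => E; rewrite -[RHS]E; apply: eq_bigr => i _.
by rewrite [in LHS]mxE mulr_algl linearZ /= [in LHS]mxE [C _ _]mxE mxvecE [in RHS]mxE.
Qed.

End RationalDependence.

(** * The action of rational polynomials in the transfer operator *)

Section Module.
Variables (V : Type) (X : set V) (L : fieldExtType rat) (lam : L).
Variables (wt : V -> L) (psi : V -> V) (N : nat).
Hypothesis psiX : forall x, X x -> X (psi x).

Definition transfer (f : V -> V -> L) x y := wt x * f (psi x) (psi y).
Hypothesis transferN : forall f x y, X x -> X y -> iter N transfer f x y = lam * f x y.

Variables (n : nat) (Tw Cob : (V -> V -> L) -> Prop) (Cl : (V -> V -> L) -> 'rV[L]_n -> Prop).
Variables (m : nat) (E : 'M[L]_(m, n)) (beta : 'rV[L]_n).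
Hypothesis Tw_lin : forall f f' s, Tw f -> Tw f' -> Tw (fun x y => s * f x y + f' x y).
Hypothesis Cob_lin : forall f f' s, Cob f -> Cob f' -> Cob (fun x y => s * f x y + f' x y).
Hypothesis Cl_lin : forall f f' s xi xi', Cl f xi -> Cl f' xi' ->
  Cl (fun x y => s * f x y + f' x y) (s *: xi + xi').
Hypothesis Tw0 : Tw (fun _ _ => 0).
Hypothesis Cl0 : Cl (fun _ _ => 0) 0.
Hypothesis Cob0 : forall f, (forall x y, X x -> X y -> f x y = 0) -> Cob f.
Hypothesis Cl_exists : forall f, Tw f -> exists xi, Cl f xi.
Hypothesis Cl_fox : forall f xi, Tw f -> Cl f xi -> xi *m E^T = 0.
Hypothesis Cl_cob : forall f b, Tw f -> Cl f (b *: beta) -> Cob f.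
Hypothesis Tw_transfer : forall f, Tw f -> Tw (transfer f).
Hypothesis Cob_transfer : forall f, Cob f -> Cob (transfer f).

Definition act (p : {poly rat}) (f : V -> V -> L) x y :=
  \sum_(i < size p) (p`_i)%:A * iter i transfer f x y.

Lemma act_wide (p : {poly rat}) f M x y : (size p <= M)%N ->
  act p f x y = \sum_(i < M) (p`_i)%:A * iter i transfer f x y.
Proof.
move=> pM; rewrite /act (big_ord_widen _ (fun i => (p`_i)%:A * iter i transfer f x y) pM).
rewrite [RHS](bigID (fun i : 'I_M => (i < size p)%N)) /= [X in _ = _ + X]big1 ?addr0//.
by move=> i; rewrite -leqNgt => hi; rewrite nth_default// scale0r mul0r.
Qed.

Lemma actD p p' f x y : act (p + p') f x y = act p f x y + act p' f x y.
Proof.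
pose M := maxn (size p) (size p').
rewrite (@act_wide (p + p') f M) ?size_polyD// (@act_wide p f M) ?leq_maxl//.
rewrite (@act_wide p' f M) ?leq_maxr// -big_split; apply: eq_bigr => i _ /=.
by rewrite coefD scalerDl mulrDl.
Qed.

Lemma actZ s p f x y : act (s *: p) f x y = s%:A * act p f x y.
Proof.
rewrite (@act_wide (s *: p) f (size p)) ?size_scale_leq// /act mulr_sumr.
by apply: eq_bigr => i _; rewrite coefZ mulrA; congr (_ * _); rewrite mulr_algl scalerA.
Qed.

Lemma actX p f : act ('X * p) f = transfer (act p f).
Proof.
apply/funext => x; apply/funext => y.
rewrite (@act_wide ('X * p) f (size p).+1); last first.
  by apply: leq_trans (size_polyMleq _ _) _; rewrite size_polyX.
rewrite big_ord_recl coefXM /= scale0r mul0r add0r /transfer /act mulr_sumr.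
apply: eq_bigr => i _; rewrite ?coefXM /= ?add1n /=.
by rewrite mulrCA.
Qed.

Lemma actC s f x y : act s%:P f x y = s%:A * f x y.
Proof.
by rewrite (@act_wide s%:P f 1) ?size_polyC_leq1// big_ord1 coefC.
Qed.

Lemma act_comp p f x y : X x -> X y ->
  act (p \Po 'X^N) f x y = (map_poly (in_alg L) p).[lam] * f x y.
Proof.
move=> Xx Xy; elim/poly_ind: p => [|p s IH].
  by rewrite comp_poly0 rmorph0 horner0 mul0r /act size_poly0 big_ord0.
have pw M p' : act ('X^M * p') f = iter M transfer (act p' f).
  by elim: M => [|M IHM]; [rewrite mul1r|rewrite exprS -mulrA actX IHM].
rewrite comp_polyD comp_polyM comp_polyX comp_polyC actD mulrC pw transferN// IH actC.
rewrite rmorphD rmorphM /= map_polyX map_polyC hornerD hornerMX hornerC mulrDl.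
by rewrite mulrA (mulrC lam).
Qed.

Variable f0 : V -> V -> L.
Hypothesis f0_tw : Tw f0.
Hypothesis f0_cob : ~ Cob f0.

Definition annihilator p := Cob (act p f0).

Lemma annihilatorD p p' : annihilator p -> annihilator p' -> annihilator (p + p').
Proof.
move=> h h'; rewrite /annihilator.
have -> : act (p + p') f0 = (fun x y => 1 * act p f0 x y + act p' f0 x y).
  by apply/funext => x; apply/funext => y; rewrite actD mul1r.
exact: Cob_lin.
Qed.

Lemma annihilatorM s p : annihilator p -> annihilator (s * p).
Proof.
move=> h; elim/poly_ind: s => [|s c IH].
  rewrite mul0r /annihilator; apply: Cob0 => x y _ _.
  by rewrite /act size_poly0 big_ord0.
rewrite mulrDl -mulrA ['X * p]mulrC mulrA [_ * 'X]mulrC mul_polyC; apply: annihilatorD.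
  by rewrite /annihilator actX; exact: Cob_transfer.
rewrite /annihilator.
have -> : act (c *: p) f0 = (fun x y => c%:A * act p f0 x y + 0).
  by apply/funext => x; apply/funext => y; rewrite actZ addr0.
by apply: Cob_lin => //; apply: Cob0.
Qed.

Lemma annihilator1 : ~ annihilator 1.
Proof.
move=> h; apply: f0_cob; have <- // : act 1 f0 = f0.
by apply/funext => x; apply/funext => y; rewrite actC scale1r mul1r.
Qed.

Hypothesis beta0 : beta != 0.
Hypothesis beta_fox : beta *m E^T = 0.
Variable q : {poly rat}.
Hypothesis q_lam : root (map_poly (in_alg L) q) lam.

(** A rational relation between the classes of the iterates of [f0], modulo the principal class
    [beta]. Passing to the quotient by [beta] lowers the dimension [n - \rank E] of the kernel by
    one, whence the predecessor in the bound. *)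
Lemma annihilator_small : exists p : {poly rat}, [/\ p != 0,
  (size p <= ((n - \rank E).-1 * \dim {:L}).+1)%N & annihilator p].
Proof.
have tw i : Tw (iter i transfer f0) by elim: i => //= i; exact: Tw_transfer.
have H i : exists xi, Cl (iter i transfer f0) xi by exact: Cl_exists.
have [xi xiP] := choice H.
pose K := kermx E^T; pose S := K *m cokermx beta.
have rS : (\rank S <= (n - \rank E).-1)%N.
  have := mxrank_mul_ker K (cokermx beta); rewrite -/S mxrank_ker mxrank_tr => <-.
  have bK : (beta <= K :&: kermx (cokermx beta))%MS.
    rewrite sub_capmx; apply/andP; split; first exact/sub_kermxP.
    by apply/sub_kermxP; rewrite mulmx_coker.
  have := mxrankS bK; rewrite rank_rV beta0 => r1.
  by move: r1; case: (\rank (K :&: _)) => // t _; rewrite addnS /= leq_addr.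
have vS i : (xi i *m cokermx beta <= S)%MS.
  by apply: submxMr; apply/sub_kermxP; exact: Cl_fox (tw i) (xiP i).
have [p [p0 sp E0]] := rat_dependent vS.
exists p; split=> //.
  by apply: leq_trans sp _; rewrite ltnS leq_mul2r rS orbT.
have part k : Tw (fun x y => \sum_(i < k) (p`_i)%:A * iter i transfer f0 x y) /\
    Cl (fun x y => \sum_(i < k) (p`_i)%:A * iter i transfer f0 x y) (\sum_(i < k) (p`_i)%:A *: xi i).
  elim: k => [|k [IH1 IH2]].
    rewrite big_ord0 (_ : (fun x y => _) = (fun _ _ => 0)) //.
    by apply/funext => x; apply/funext => y; rewrite big_ord0.
  rewrite (_ : (fun x y => _) = (fun x y => (p`_k)%:A * iter k transfer f0 x y +
    \sum_(i < k) (p`_i)%:A * iter i transfer f0 x y)); last first.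
    by apply/funext => x; apply/funext => y; rewrite big_ord_recr /= addrC.
  split; first exact: Tw_lin.
  by rewrite big_ord_recr /= addrC; exact: Cl_lin.
have [tp cp] := part (size p).
have : ((\sum_(i < size p) (p`_i)%:A *: xi i)%R <= beta)%MS.
  rewrite submxE mulmx_suml -[X in _ == X]E0; apply/eqP; apply: eq_bigr => i _.
  by rewrite scalemxAl.
by move/sub_rVP => [b bE]; apply: (@Cl_cob _ b) => //; rewrite -bE.
Qed.

(** Both the small annihilator and q(X^N) send [f0] to a coboundary. If they were coprime, a Bezout
    relation would make [f0] itself a coboundary. *)
Lemma common_factor : exists p : {poly rat}, [/\ (1 < size p)%N,
  (size p <= ((n - \rank E).-1 * \dim {:L}).+1)%N & p %| q \Po 'X^N].
Proof.
have [p [p0 sp pann]] := annihilator_small.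
have qann : annihilator (q \Po 'X^N).
  apply: Cob0 => x y Xx Xy; rewrite act_comp// (rootP q_lam) mul0r//.
exists (gcdp p (q \Po 'X^N)); split; last exact: dvdp_gcdr.
  rewrite ltnNge; apply/negP => s1.
  have /Bezout_eq1_coprimepP[[u v] /= uv] : coprimep p (q \Po 'X^N).
    rewrite /coprimep eqn_leq s1 lt0n size_poly_eq0 gcdp_eq0 (negbTE p0) //.
  by apply: annihilator1; rewrite -uv; apply: annihilatorD; exact: annihilatorM.
exact: leq_trans (dvdp_leq p0 (dvdp_gcdl _ _)) sp.
Qed.

End Module.

(** * Conclusion *)

(** The coefficient of [k] must be nonnegative because it will count iterations of a map; adding a
    multiple of [N] achieves this. *)
Lemma bezout_nat (k : int) (N : nat) : (0 < N)%N -> coprimez k N ->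
  exists (u : nat) (v : int), u%:Z * k + v * N%:Z = 1.
Proof.
move=> N0 /coprimezP[[u v] /= E].
exists `|(u + N%:Z * `|u|)%R|%N, (v - k * `|u|).
rewrite gez0_abs; first by rewrite -[RHS]E; ring.
by rewrite -[u in u + _]opprK addrC subr_ge0; nia.
Qed.

(** * The factor of bounded degree for one periodic knot *)

Section PeriodicFactor.
Variable R : realType.
Notation V := 'rV[R]_4.
Variable c : R -> V.
Hypothesis c_cont : continuous c.
Hypothesis c_S3 : forall s, S3 R (c s).
Hypothesis c_eq : forall s t, c s = c t <-> exists z : int, s - t = z%:~R.
Notation X := (complement c).
Variables (f : V -> V) (n : nat).
Hypothesis n_gt0 : (0 < n)%N.
Hypothesis f_S3 : forall x, S3 R x -> S3 R (f x).
Hypothesis f_cont : forall x, S3 R x -> forall e, 0 < e -> exists2 de, 0 < de &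
  forall y, S3 R y -> `|x - y| < de -> `|f x - f y| < e.
Hypothesis f_n : forall x, S3 R x -> iter n f x = x.
Hypothesis f_free : forall x, S3 R x -> forall i, iter i f x = x -> (n %| i)%N.
Hypothesis f_K : forall x, S3 R x -> range c (f x) <-> range c x.

Variables (x0 : V) (nn mm : nat) (g : 'I_nn.+1 -> R -> V) (r : 'I_mm -> word nn.+1).
Variable a : 'I_nn.+1 -> int.
Hypothesis Xx0 : X x0.
Hypothesis pres : pi1_presentation X x0 g r.
Hypothesis a_r : forall j, word_degree a (r j) = 0.
Hypothesis a_surj : exists w, word_degree a w = 1.

Variable D : {poly int}.
Hypothesis D0 : D != 0.
Hypothesis D_gcd : laurent_gcd
  [set x | exists (h : 'I_nn -> 'I_mm) (k : 'I_nn -> 'I_nn.+1),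
     x = \det (mxsub h k (alexander_matrix a r))] (FracField.tofrac D).
Variable q : {poly rat}.
Hypothesis q_irr : irreducible_poly q.
Hypothesis qD : q %| pZtoQ D.
Variables (L : fieldExtType rat) (z : L).
Hypothesis L_dim : \dim {:L} = (size q).-1.
Hypothesis qz : root (map_poly (in_alg L) q) z.
Hypothesis z_gen : <<1; z>>%VS = fullv.
Hypothesis z0 : z != 0.
Hypothesis z1 : z != 1.
Variable N : nat.
Hypothesis N_gt0 : (0 < N)%N.
Hypothesis nN : forall i, (n %| i.*2)%N = (N %| i)%N.

Let S x : X x -> S3 R x. Proof. by case. Qed.
Let f_iterX i x : X x -> X (iter i f x).
Proof. by move=> Xx; elim: i => //= i; apply: (f_X f_S3 f_K). Qed.

Let principal_fox : principal_class a z *m (fox_matrix a r z)^T = 0.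
Proof.
apply/rowP => j; rewrite !mxE.
rewrite (eq_bigr (fun i => fox_at z a i (r j) * (z ^ a i - 1))); last first.
  by move=> i _; rewrite !mxE mulrC.
by rewrite fox_at_fundamental// a_r expr0z subrr.
Qed.

Let principal_neq0 : principal_class a z != 0.
Proof.
apply: contraNneq z1 => h; have [w w1] := a_surj.
have := fox_at_fundamental z0 a w; rewrite w1 expr1z => /esym E.
rewrite -subr_eq0 E big1// => j _.
by have /rowP/(_ j) := h; rewrite !mxE => ->; rewrite mulr0.
Qed.

(** The kernel of the Fox matrix has dimension at least 2, since its rank is below [nn] with [nn.+1]
    columns, while principal classes span a line. *)
Let nonprincipal : exists2 xi : 'rV[L]_nn.+1,
  forall j, \sum_i fox_at z a i (r j) * xi 0 i = 0 & forall b, xi <> b *: principal_class a z.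
Proof.
have rk := fox_rank_lt D_gcd q_irr qD z0 qz.
pose K := kermx (fox_matrix a r z)^T.
have : ~~ (K <= principal_class a z)%MS.
  apply/negP => /mxrankS; rewrite mxrank_ker mxrank_tr => h.
  by have := leq_trans h (rank_leq_row _); move: rk; lia.
case/row_subPn => i hi; exists (row i K) => [j|b E]; last first.
  by case/negP: hi; rewrite E scalemx_sub.
have : row i K *m (fox_matrix a r z)^T = 0 by apply/sub_kermxP; exact: row_sub.
move/rowP/(_ j); rewrite [LHS]mxE [RHS]mxE => E; rewrite -[RHS]E.
by apply: eq_bigr => t _; rewrite [_^T _ _]mxE [fox_matrix _ _ _ _ _]mxE mulrC.
Qed.

Theorem periodic_common_factor : exists p : {poly rat},
  [/\ (1 < size p)%N, (size p <= size D)%N & p %| q \Po 'X^N].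
Proof.
have conn x : X x -> exists p, path_in X x0 x p.
  by move=> Xx; exact: (complement_path_connected c_cont c_S3 c_eq n_gt0 f_S3 f_cont f_n f_free f_K).
have [W WP] := word_choice Xx0 pres.
have [P [PP P0]] := path_choice Xx0 conn.
have hac := degree_cocycleP c_cont c_eq Xx0 pres a_r WP PP.
have [J hJ J1] := degree_loop c_cont c_eq Xx0 pres a_r a_surj WP PP P0.
have [e he] := degree_shift c_cont c_S3 c_eq n_gt0 f_S3 f_cont f_n f_free f_K
  Xx0 pres a_r a_surj WP PP P0.
pose k := shift_sum f e N x0.
have kE x : X x -> shift_sum f e N x = k.
  by move=> Xx; exact: (shift_sum_cst c_cont c_S3 c_eq n_gt0 f_S3 f_cont f_n f_free f_K he nN).
have cop := shift_sum_coprime c_cont c_S3 c_eq n_gt0 f_S3 f_cont f_n f_free f_K hac hJ J1 he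
  N_gt0 nN kE.
have [u [v uv]] := bezout_nat N_gt0 cop.
have nu_id := @normalize_idX R c.
have nu_local := normalize_local c_cont c_eq.
pose ac : V -> V -> int := word_cocycle (@normalize R) W P (word_degree a).
pose psi : V -> V := iter u.*2 f.
pose E := shift_sum f e u.
(* The twist by [E] compensates the change of the degree cocycle under [psi]. Over [N] iterations
   the exponents add up to [v * N + u * k], which is 1, so the N-th iterate of the transfer is
   multiplication by [z]. *)
pose wt x : L := z ^ v * z ^ E x.
have psiX x : X x -> X (psi x) by exact: f_iterX.
have iterN j x : X x -> iter (j * N).*2 f x = x.
  move=> Xx; have /dvdnP[t ->] : (n %| (j * N).*2)%N by rewrite nN dvdn_mull.
  by elim: t => // t IH; rewrite mulSn iterD IH f_n//; exact: S.
have transfer_iter i h x y : iter i (transfer wt psi) h x y =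
    z ^ (v * i%:Z) * z ^ shift_sum f e (i * u) x * h (iter (i * u).*2 f x) (iter (i * u).*2 f y).
  elim: i x y => [|i IH] x y; first by rewrite mul0n mulr0 /shift_sum big_ord0 !expr0z !mul1r.
  rewrite iterS {1}/transfer IH mulSn shift_sumD -/psi /wt /E.
  have -> : v * i.+1%:Z = v + v * i%:Z by rewrite -addn1 PoszD mulrDr mulr1 addrC.
  rewrite !expfzDr// /psi -!iterD -!doubleD (addnC (i * u)%N).
  move: (z ^ v) (z ^ (v * i)) (z ^ shift_sum f e u x) (h _ _) => b1 b2 b3 b4.
  by move: (z ^ _) => b5; ring.
have transferN h x y : X x -> X y -> iter N (transfer wt psi) h x y = z * h x y.
  move=> Xx Xy; rewrite transfer_iter mulnC !iterN// shift_sumM.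
  rewrite (eq_bigr (fun=> k)); last first.
    by move=> j _; rewrite iterN ?kE.
  rewrite sumr_const card_ord -expfzDr// -[RHS](mulrC _ z) mulrC; congr (_ * _).
  by rewrite -[RHS]expr1z -uv; congr (z ^ _); rewrite -mulr_natl natz addrC mulrC.
have acE x : X x -> exists2 d, 0 < d & forall y w, X y -> X w -> `|x - y| < d -> `|x - w| < d ->
    ac (psi y) (psi w) = ac y w + (E w - E y).
  exact: (iter_shift f_S3 f_cont f_K he u).
have wtE x y w : ac (psi x) (psi y) = w + (E y - E x) ->
    wt x * z ^ ac (psi x) (psi y) = z ^ w * wt y.
  move=> ->; rewrite /wt -!mulrA -!expfzDr//.
  by congr (z ^ _); move: (E x) (E y) => b1 b2; ring.
have psi_near x d : X x -> 0 < d -> exists2 d', 0 < d' & forall y, X y -> `|x - y| < d' ->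
    `|psi x - psi y| < d.
  move=> Xx d0; have [d' d'0 h] := iter_cont f_S3 f_cont u.*2 (S Xx) d0.
  by exists d' => // y Xy; apply: h; exact: S.
have Tw_transfer h : twisted X (@normalize R) W P a z h ->
    twisted X (@normalize R) W P a z (transfer wt psi h).
  move=> hh x Xx; have [d1 d10 h1] := hh _ (psiX _ Xx); have [d2 d20 h2] := acE x Xx.
  have [d3 d30 h3] := psi_near x d1 Xx d10.
  exists (Num.min d2 d3); first by rewrite lt_min d20.
  move=> y t w Xy Xt Xw; rewrite !lt_min => /andP[y2 y3] /andP[t2 t3] /andP[w2 w3].
  rewrite /transfer -(h1 (psi y) (psi t) (psi w)); try by [exact: psiX|exact: h3].
  rewrite mulrDr mulrA; congr (_ + _); rewrite [RHS]mulrA; congr (_ * _).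
  by rewrite -/ac (wtE _ _ (ac y t))// h2.
have Cob_transfer h : twisted_coboundary X (@normalize R) W P a z h ->
    twisted_coboundary X (@normalize R) W P a z (transfer wt psi h).
  move=> [l hl]; exists (fun x => wt x * l (psi x)) => x Xx.
  have [d1 d10 h1] := hl _ (psiX _ Xx); have [d2 d20 h2] := acE x Xx.
  have [d3 d30 h3] := psi_near x d1 Xx d10.
  exists (Num.min d2 d3); first by rewrite lt_min d20.
  move=> y t Xy Xt; rewrite !lt_min => /andP[y2 y3] /andP[t2 t3].
  rewrite /transfer (h1 (psi y) (psi t)); try by [exact: psiX|exact: h3].
  rewrite mulrBr mulrA; congr (_ - _); rewrite [RHS]mulrA; congr (_ * _).
  by rewrite -/ac (wtE _ _ (ac y t))// h2.
have [xi xi_fox xi_np] := nonprincipal.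
have [f0 f0_tw f0_cl] := cocycle_of_class Xx0 pres nu_id nu_local WP PP P0 a_r z0 xi_fox.
have f0_cob : ~ twisted_coboundary X (@normalize R) W P a z f0.
  move=> h; have [b bE] := coboundary_class Xx0 pres nu_id nu_local WP PP P0 a_r z0 h f0_cl.
  exact: xi_np bE.
have [hc0 hcl0] := coboundary_cst Xx0 pres nu_id nu_local WP PP P0 a_r z0 0.
rewrite scale0r in hcl0.
have zeroE : (fun x y => 0 * (z ^ ac x y - 1)) = (fun _ _ => 0) :> (V -> V -> L).
  by apply/funext => x; apply/funext => y; rewrite mul0r.
rewrite zeroE in hc0 hcl0.
have Cob0 h : (forall x y, X x -> X y -> h x y = 0) ->
    twisted_coboundary X (@normalize R) W P a z h.
  move=> h0; exists (fun=> 0) => x _; exists 1 => // y w Xy Xw _ _.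
  by rewrite h0// mulr0 subr0.
have Cl_fox h xi' : twisted X (@normalize R) W P a z h -> has_class g (@normalize R) W P a z h xi' ->
    xi' *m (fox_matrix a r z)^T = 0.
  move=> hh hcl; apply/rowP => j; rewrite [LHS]mxE [RHS]mxE.
  rewrite -[RHS](class_fox Xx0 pres nu_id nu_local WP PP a_r z0 j hh hcl).
  by apply: eq_bigr => t _; rewrite [_^T _ _]mxE [fox_matrix _ _ _ _ _]mxE mulrC.
have Cl_ex h := class_exists Xx0 pres nu_id nu_local WP PP P0 a_r z0 (f := h).
have Cl_cob h b := class_principal_coboundary Xx0 pres nu_id nu_local WP PP P0 a_r z0 (f := h) (b := b).
have [p [p1 p2 p3]] := common_factor transferN
  (@twisted_lin R X _ (@normalize R) W P a L z) (@coboundary_lin R X _ (@normalize R) W P a L z)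
  (@has_class_lin R _ g (@normalize R) W P a L z) hc0 hcl0 Cob0 Cl_ex Cl_fox Cl_cob
  Tw_transfer Cob_transfer f0_tw f0_cob principal_neq0 principal_fox qz.
exists p; split=> //; apply: leq_trans p2 _.
have rk := fox_rank_lt D_gcd q_irr qD z0 qz.
have -> : (nn.+1 - \rank (fox_matrix a r z) = (nn - \rank (fox_matrix a r z)).+1)%N.
  by rewrite subSn// ltnW.
rewrite L_dim.
have := fox_rank_degree D0 D_gcd q_irr z0 qz z_gen.
have : (0 < size D)%N by rewrite size_poly_gt0.
by case: (size D) => // t _ /= h; rewrite ltnS.
Qed.

End PeriodicFactor.

(** * From smooth knots and free periods to the topological hypotheses *)

Section KnotData.
Variable R : realType.
Notation V := 'rV[R]_4.

Lemma knot_continuous (c : R -> V) : knot c -> continuous c.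
Proof.
move=> [cs _ _ _] s; apply: differentiable_continuous.
by have [h _] := cs 0%N; exact: h.
Qed.

Lemma S3_map_continuous (f : V -> V) : smooth_S3_map f -> forall x, S3 R x ->
  forall e, 0 < e -> exists2 de, 0 < de & forall y, S3 R y -> `|x - y| < de -> `|f x - f y| < e.
Proof.
move=> [_ fs] x Sx e e0; have [h _] := fs 0%N.
have E y : S3 R y -> radial_ext f y = f y.
  by move=> Sy; rewrite /radial_ext Sy scale1r invr1 scale1r.
have /differentiable_continuous/cvgrPdist_lt/(_ e e0)/nbhs_ballP[d /= d0 hd] := h x (S3_neq0 Sx).
exists d => // y Sy xy; rewrite -(E x Sx) -(E y Sy).
by apply: hd; rewrite -ball_normE.
Qed.

Lemma free_order_dvd (f : V -> V) n : (forall x, S3 R x -> S3 R (f x)) ->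
  S3_order f n -> free_on_S3 f ->
  forall x, S3 R x -> forall i, iter i f x = x -> (n %| i)%N.
Proof.
move=> fS [n0 fn fmin] free x Sx i fi.
have it j y : S3 R y -> iter (j * n) f y = y.
  by move=> Sy; elim: j => // j IH; rewrite mulSn iterD IH fn.
have rem : iter (i %% n) f x = x.
  by rewrite -[RHS]fi {2}(divn_eq i n) addnC iterD it.
rewrite /dvdn; apply/negPn/negP => k0.
have kn : (0 < i %% n < n)%N by rewrite lt0n k0 ltn_mod.
have [y Sy hy] := fmin _ kn.
by apply: (free (i %% n)%N _ x Sx) => //; exists y.
Qed.

Lemma knot_preimage (c : R -> V) (f : V -> V) n : (forall s, S3 R (c s)) ->
  (forall x, S3 R x -> S3 R (f x)) -> S3_order f n -> f @` range c = range c ->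
  forall x, S3 R x -> range c (f x) <-> range c x.
Proof.
move=> cS fS [n0 fn _] fc x Sx; split=> [|cx]; last first.
  by rewrite -fc; exists x.
rewrite -{1}fc => -[y cy fxy].
have Sy : S3 R y by case: cy => s _ <-.
by rewrite -(fn x Sx) -(prednK n0) iterSr -fxy -iterSr prednK// fn.
Qed.

(** [N] is the order of the square of an element of order [n]: [n] itself when [n] is odd and half
    of it otherwise. *)
Lemma half_order n : (0 < n)%N -> exists N, [/\ (0 < N)%N, (n <= N.*2)%N &
  forall i, (n %| i.*2)%N = (N %| i)%N].
Proof.
move=> n0; have [on|en] := boolP (odd n).
  exists n; split=> // [|i]; first by rewrite -addnn leq_addr.
  by rewrite -muln2 Gauss_dvdl// coprimen2.
exists n./2; have nE : n = n./2.*2 by rewrite -[LHS]odd_double_half (negbTE en).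
split=> [||i]; [by rewrite half_gt0; case: (n) n0 en => [|[]]|by rewrite -nE|].
by rewrite {1}nE -!muln2 dvdn_pmul2r.
Qed.

Lemma alexander_common_factor (n : nat) (c : R -> V) (D : {poly int}) (q : {poly rat})
    (L : fieldExtType rat) (z : L) :
  D != 0 -> knot c -> freely_periodic n c -> alexander_polynomial c D ->
  irreducible_poly q -> q %| pZtoQ D ->
  \dim {:L} = (size q).-1 -> root (map_poly (in_alg L) q) z -> <<1; z>>%VS = fullv ->
  z != 0 -> z != 1 ->
  exists N, [/\ (0 < N)%N, (n <= N.*2)%N & exists p : {poly rat},
    [/\ (1 < size p)%N, (size p <= size D)%N & p %| q \Po 'X^N]].
Proof.
move=> D0 hc [f [[[fsm _] _] ord fr fc _]] [x0 [nn [mm [g [r [a [Xx0 pres ar as_ dg]]]]]]].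
move=> q_irr qD Ld qz zg z0 z1.
have cc := knot_continuous hc; have [_ cS _ ceq] := hc.
have fS := fsm.1; have [n0 fn _] := ord.
have [N [N0 nN2 nN]] := half_order n0.
exists N; split=> //.
exact: (periodic_common_factor cc cS ceq n0 fS (S3_map_continuous fsm) fn
  (free_order_dvd fS ord fr) (knot_preimage cS fS ord fc) Xx0 pres ar as_ D0 dg q_irr qD
  Ld qz zg z0 z1 N0 nN).
Qed.

End KnotData.

Theorem corollary1p7 (R : realType) (D : {poly int}) (hD : D != 0)
  (hfactor : exists p : {poly rat},
    [/\ irreducible_poly p,
        p %| map_poly intr D,
        forall (k : nat) (b : rat), (0 < k)%N -> p <> b *: map_poly intr 'Phi_k
      & forall (k : nat) (b : rat), p <> b *: 'X^k]) :
  finite_set [set n : nat | exists c : R -> 'rV[R]_4,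
    [/\ knot c, freely_periodic n c & alexander_polynomial c D]].
Proof.
have [q [q_irr qD qcyc qX]] := hfactor.
(* The degree count needs a field of degree exactly deg q generated by the root, whereas the facts
   on absolute values and roots of unity live in [algC]; [transport] moves rational polynomial
   relations from [z] to a root there. *)
have [L Ld [z qz zg]] := irredp_FAdjoin q_irr.
have [q1 [b b0 qE] _] := dvdpP_rat_int qD.
have rts := irreducible_roots q_irr qcyc qX b0 qE.
have q10 : q1 != 0.
  apply: contraTneq q_irr.1 => q10; by rewrite qE q10 rmorph0 scaler0 size_poly0.
have [nu qnu] : exists nu, root (pZtoC q1) nu.
  apply/closed_rootP; rewrite size_map_inj_poly//; last exact: intr_inj.
  have := q_irr.1; rewrite qE size_scale// size_map_inj_poly//; last exact: intr_inj.
  by move/gtn_eqF; rewrite eq_sym => ->.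
have transport (p : {poly rat}) : root (map_poly (in_alg L) p) z -> root (map_poly (ratr : rat -> algC) p) nu.
  rewrite (irreducible_root q_irr qz) => /dvdpP[u ->].
  by rewrite rmorphM /= rootM qE map_polyZ /= rootZ ?fmorph_eq0// pQtoC_pZtoQ qnu orbT.
have [nu0 nu1] := rts nu qnu.
have z0 : z != 0.
  apply: contraNneq nu0 => z0; have := transport 'X.
  by rewrite !map_polyX !rootX z0 => ->.
have z1 : z != 1.
  apply: contraNneq (nu1 1%N isT) => z1; have := transport ('X - 1).
  rewrite !rmorphB /= !map_polyX !rmorph1 -!polyC1 !root_XsubC z1 eqxx => /(_ isT).
  by rewrite expr1.
have fin := finite_root_orders (size D) q10 rts.
set A := [set N | _] in fin.
apply: (@sub_finite_set _ _ (\bigcup_(N in A) `I_(N.*2).+1)); last first.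
  by apply: bigcup_finite => // N _; exact: finite_II.
move=> n [c [hc hp ha]].
have [N [N0 nN [p [p1 p2 p3]]]] := alexander_common_factor hD hc hp ha q_irr qD Ld qz zg z0 z1.
exists N; last by rewrite /= ltnS.
split=> //; exists p; split=> //; apply: (dvdp_trans p3).
by rewrite qE comp_polyZ dvdpZl// map_comp_poly map_polyXn.
Qed.
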